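(* Let $\{(W_i,M_i,N_i)\}_{i=1}^\infty$ be a collection of one-sided $h$-cobordisms such that each inclusion $M_i\hookrightarrow W_i$ is a homotopy equivalence, and suppose that for each $i\geq 1$ there is a homeomorphism $h_i:N_i\to M_{i+1}$. Then the adjunction space $$U=W_1\cup_{h_1}W_2\cup_{h_2}W_3\cup_{h_3}\cdots$$ is a pseudo-collar. Conversely, every pseudo-collar may be expressed as a countable union of one-sided $h$-cobordisms in this manner (that is, for every pseudo-collar $U$ there are one-sided $h$-cobordisms $(W_i,M_i,N_i)$ with $M_i\hookrightarrow W_i$ homotopy equivalences and homeomorphisms $h_i:N_i\to M_{i+1}$ such that $U$ is homeomorphic to $W_1\cup_{h_1}W_2\cup_{h_2}W_3\cup_{h_3}\cdots$).
   Context: Manifolds and homeomorphisms are in the PL category. A compact cobordism $(W^n,M^{n-1},N^{n-1})$ (so $\partial W^n$ is the disjoint union of $M^{n-1}$ and $N^{n-1}$) is a one-sided $h$-cobordism if one (but not necessarily both) of the inclusions $M^{n-1}\hookrightarrow W^n$, $N^{n-1}\hookrightarrow W^n$ is a homotopy equivalence. A manifold $U^n$ with compact boundary is a homotopy collar if $\partial U^n\hookrightarrow U^n$ is a homotopy equivalence. A subset $V$ of $U$ is a neighborhood of infinity if $\overline{U-V}$ is compact; neighborhoods of infinity are taken to be clean, i.e. PL submanifolds with bicollared boundary. A pseudo-collar is a homotopy collar that contains arbitrarily small homotopy collar neighborhoods of infinity (every neighborhood of infinity contains one that is a homotopy collar). *)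

(* Defs.v *)
From HB Require Import structures.
From Stdlib Require Import Relations.
From mathcomp Require Import all_boot all_order all_algebra.
From mathcomp Require Import all_classical all_reals all_analysis.
Import Order.TTheory GRing.Theory Num.Theory.
Import numFieldNormedType.Exports.

Set Implicit Arguments.
Unset Strict Implicit.
Unset Printing Implicit Defensive.

Local Open Scope classical_set_scope.
Local Open Scope ring_scope.
Local Open Scope quotient_scope.

Section PLEuclidean.
Variable R : realType.

(* Closed convex polyhedra: finite intersections of closed half-spaces. *)
Definition polyhedron k (P : set 'rV[R]_k) : Prop :=
  exists m (A : 'M[R]_(k, m)) (b : 'rV[R]_m),
    P = [set x | forall j, (x *m A) ord0 j <= b ord0 j].

Definition affine_on k l (P : set 'rV[R]_k) (g : 'rV[R]_k -> 'rV[R]_l) : Prop :=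
  exists (L : 'M[R]_(k, l)) (v : 'rV[R]_l), forall x, P x -> g x = x *m L + v.

(* [g] is PL on [S]: every point of [S] has a neighborhood in [S] that is a
   finite union of polyhedra on each of which [g] is affine.  In particular
   [S] is then locally polyhedral, and [g] is continuous on [S]. *)
Definition pl_on k l (S : set 'rV[R]_k) (g : 'rV[R]_k -> 'rV[R]_l) : Prop :=
  forall x, S x ->
  exists m (P : 'I_m -> set 'rV[R]_k),
    (forall j, [/\ polyhedron (P j), P j `<=` S & affine_on (P j) g]) /\
    (\forall y \near x, S y -> exists j, P j y).

(* Over [A], [psi] is a PL function of [phi]; when [phi] is injective on [A]
   this says that psi \o phi^-1 : phi(A) -> R^l is PL. *)
Definition pl_factor T k l (A : set T)
    (phi : T -> 'rV[R]_k) (psi : T -> 'rV[R]_l) : Prop :=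
  exists g, pl_on (phi @` A) g /\ forall x, A x -> psi x = g (phi x).

End PLEuclidean.

Section PLSpaces.
Variable R : realType.

Record chart (T : Type) (k : nat) :=
  Chart { chart_dom : set T; chart_map : T -> 'rV[R]_k }.

(* A topological embedding of an open subset of [T] into R^k. *)
Definition is_chart (T : topologicalType) k (c : chart T k) : Prop :=
  [/\ open (chart_dom c),
      forall x, chart_dom c x -> {for x, continuous (chart_map c)},
      forall x y, chart_dom c x -> chart_dom c y ->
        chart_map c x = chart_map c y -> x = y
    & forall O, open O -> O `<=` chart_dom c ->
        exists O', open O' /\
          chart_map c @` O = O' `&` (chart_map c @` chart_dom c)].

Definition chart_compat T k l (c : chart T k) (d : chart T l) : Prop :=
  pl_factor (chart_dom c `&` chart_dom d) (chart_map c) (chart_map d) /\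
  pl_factor (chart_dom c `&` chart_dom d) (chart_map d) (chart_map c).

(* Raw data only: the axioms of a PL space are collected in [is_pl_space]. *)
Record plSpace := PLSpace {
  pl_top :> topologicalType;
  pl_atlas : forall k, set (chart pl_top k) }.

(* Taking [c] and [d] equal in the compatibility condition forces the image of
   each chart to be locally polyhedral. *)
Definition is_pl_space (X : plSpace) : Prop :=
  [/\ hausdorff_space X, @second_countable X,
      forall x : X, exists k (c : chart X k), pl_atlas c /\ chart_dom c x,
      forall k (c : chart X k), pl_atlas c -> is_chart c
    & forall k l (c : chart X k) (d : chart X l),
        pl_atlas c -> pl_atlas d -> chart_compat c d].

Definition pl_map (X Y : plSpace) (f : X -> Y) : Prop :=
  continuous f /\
  forall k l (c : chart X k) (d : chart Y l), pl_atlas c -> pl_atlas d ->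
    pl_factor (chart_dom c `&` f @^-1` chart_dom d)
      (chart_map c) (chart_map d \o f).

Definition pl_homeo (X Y : plSpace) (f : X -> Y) : Prop :=
  exists g : Y -> X, [/\ cancel f g, cancel g f, pl_map f & pl_map g].

Definition restrict_chart T (A : set T) k (c : chart T k) : chart A k :=
  Chart (set_val @^-1` chart_dom c) (chart_map c \o set_val).

Definition pl_sub (X : plSpace) (A : set X) : plSpace :=
  @PLSpace (A : Type) (fun k => @restrict_chart _ A k @` @pl_atlas X k).

Inductive prod_atlas (X Y : plSpace) :
    forall k, chart (X * Y) k -> Prop :=
  ProdAtlas k l (c : chart X k) (d : chart Y l) of pl_atlas c & pl_atlas d :
    @prod_atlas X Y (k + l)%N
      (Chart (chart_dom c `*` chart_dom d)
             (fun p => row_mx (chart_map c p.1) (chart_map d p.2))).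

Definition pl_prod (X Y : plSpace) : plSpace :=
  @PLSpace (X * Y)%type (@prod_atlas X Y).

Inductive line_atlas : forall k, chart R k -> Prop :=
  LineAtlas : @line_atlas 1 (Chart setT (fun t => const_mx t)).

Definition pl_line : plSpace := @PLSpace R line_atlas.

End PLSpaces.

Arguments pl_atlas {R} X k : rename.
Arguments plSpace R : clear implicits.

Section PLManifolds.
Variables (R : realType) (n : nat).

Definition half_space : set 'rV[R]_n.+1 := [set x | 0 <= x ord0 ord0].

(* A PL coordinate chart onto a relatively open subset of the half-space. *)
Definition manifold_chart (X : plSpace R) (c : chart R X n.+1) : Prop :=
  [/\ is_chart c,
      forall k (d : chart R X k), pl_atlas X k d -> chart_compat c d
    & exists O, open O /\ chart_map c @` chart_dom c = O `&` half_space].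

(* PL manifolds (with boundary) of dimension n.+1. *)
Definition pl_manifold (X : plSpace R) : Prop :=
  is_pl_space X /\
  forall x : X, exists c : chart R X n.+1, manifold_chart c /\ chart_dom c x.

Definition boundary (X : plSpace R) : set X :=
  [set x | exists c : chart R X n.+1,
    [/\ manifold_chart c, chart_dom c x & chart_map c x ord0 ord0 = 0]].

End PLManifolds.

Section Homotopy.
Variable R : realType.

Definition homotopic (X Y : topologicalType) (f g : X -> Y) : Prop :=
  exists H : X * R -> Y,
    [/\ {within [set: X] `*` `[0, 1], continuous H},
        forall x, H (x, 0) = f x & forall x, H (x, 1) = g x].

Definition homotopy_equivalence (X Y : topologicalType) (f : X -> Y) : Prop :=
  continuous f /\
  exists g : Y -> X,
    [/\ continuous g, homotopic (g \o f) id & homotopic (f \o g) id].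

Definition inclusion_heq (X : topologicalType) (A : set X) : Prop :=
  homotopy_equivalence (set_val : A -> X).

End Homotopy.

Section PseudoCollars.
Variables (R : realType) (n : nat).

Definition cobordism (W : plSpace R) (M N : set W) : Prop :=
  [/\ pl_manifold n W, compact [set: W], closed M, closed N
    & M `&` N = set0 /\ M `|` N = boundary n (X := W)].

Definition one_sided_h_cobordism (W : plSpace R) (M N : set W) : Prop :=
  cobordism M N /\ (inclusion_heq R M \/ inclusion_heq R N).

Definition homotopy_collar (U : plSpace R) : Prop :=
  [/\ pl_manifold n U, compact (boundary n (X := U))
    & inclusion_heq R (boundary n (X := U))].

(* [B] has a neighborhood PL homeomorphic to B x ]-1, 1[. *)
Definition bicollared (U : plSpace R) (B : set U) : Prop :=
  exists c : pl_prod (pl_sub B) (pl_sub (X := pl_line R) `]-1, 1[) -> U,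
    [/\ pl_map c, injective c, forall O, open O -> open (c @` O)
      & forall b t, set_val t = 0 -> c (b, t) = set_val b].

(* An arbitrary subset with relatively compact complement; cleanness is a
   separate predicate. *)
Definition neighborhood_of_infinity (U : plSpace R) (V : set U) : Prop :=
  compact (closure (~` V)).

(* The boundary of [V] is its boundary as a manifold in its own right; being
   bicollared in [U], it is disjoint from the boundary of [U]. *)
Definition clean (U : plSpace R) (V : set U) : Prop :=
  [/\ closed V, pl_manifold n (pl_sub V)
    & bicollared (set_val @` boundary n (X := pl_sub V))].

Definition pseudo_collar (U : plSpace R) : Prop :=
  homotopy_collar U /\
  forall V : set U, neighborhood_of_infinity V ->
    exists V' : set U, [/\ V' `<=` V, neighborhood_of_infinity V', clean V'
                         & homotopy_collar (pl_sub V')].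

End PseudoCollars.

Section Adjunction.
Variables (R : realType) (W : nat -> plSpace R) (M N : forall i, set (W i)).
Variable h : forall i, pl_sub (@N i) -> pl_sub (@M i.+1).

Inductive adj_step : {i & W i} -> {i & W i} -> Prop :=
  AdjStep i (x : pl_sub (@N i)) :
    adj_step (existT (fun i => W i : Type) i (set_val x))
             (existT (fun i => W i : Type) i.+1 (set_val (h x))).

Definition adj_rel : rel {i & W i} :=
  fun x y => `[< clos_refl_sym_trans _ adj_step x y >].

Lemma adj_rel_refl : reflexive adj_rel.
Proof. by move=> x; apply/asboolP; exact: rst_refl. Qed.

Lemma adj_rel_sym : symmetric adj_rel.
Proof. by move=> x y; apply/asboolP/asboolP => ?; exact: rst_sym. Qed.

Lemma adj_rel_trans : transitive adj_rel.
Proof.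
by move=> y x z /asboolP xy /asboolP yz; apply/asboolP; exact: rst_trans xy yz.
Qed.

Definition adj_equiv : equiv_rel {i & W i} :=
  EquivRel adj_rel adj_rel_refl adj_rel_sym adj_rel_trans.

Definition adj_space : topologicalType :=
  quotient_topology {eq_quot adj_equiv}.

Definition adj_lift i (x : W i) : adj_space :=
  \pi_{eq_quot adj_equiv} (existT (fun i => W i : Type) i x).

(* The PL structure of the adjunction space: its charts are the open
   topological embeddings that are PL on each piece [W i]. *)
Definition adjunction : plSpace R :=
  @PLSpace R adj_space (fun k => [set c | is_chart c /\
    forall i l (d : chart R (W i) l), pl_atlas (W i) l d ->
      pl_factor (chart_dom d `&` @adj_lift i @^-1` chart_dom c)
        (chart_map d) (chart_map c \o @adj_lift i)]).

End Adjunction.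

(* Main.v *)
(* Direct part.  Collars of the boundaries, glued along the homeomorphisms h_i, bicollar the
   seams; this gives charts of the adjunction space U along the seams and shows that each
   tail V_k = W_k u W_(k+1) u ... is a clean manifold with boundary M_k.  A homotopy
   equivalence M_i -> W_i improves, by means of a collar, to a strong deformation
   retraction; run in the time intervals [1 / 2^(i+1), 1 / 2^i], these assemble to a strong
   deformation retraction of V_k onto M_k.
   Converse.  Choose homotopy collar neighbourhoods of infinity V_0 = U, V_1, V_2, ... such
   that V_(i+1) misses the frontier and the boundary of V_i and the i-th set of a compact
   exhaustion.  As the boundary B_(i+1) of V_(i+1) is bicollared and, by invariance of
   domain, V_(i+1) lies locally on exactly one side of it, W_i = V_i n cl(U - V_(i+1)) is a
   compact manifold with boundary B_i + B_(i+1).  Retracting V_(i+1) onto B_(i+1) retracts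
   V_i onto W_i, hence the inclusion of B_i in W_i inherits being a homotopy equivalence
   from the inclusion of B_i in V_i. *)
From Stdlib Require Import Relations Eqdep_dec.
Require Import Defs.
From mathcomp Require Import all_boot all_order all_algebra.
From mathcomp Require Import all_classical all_reals all_analysis.
From mathcomp Require Import ring lra zify.
Import Order.TTheory GRing.Theory Num.Theory.
Import numFieldNormedType.Exports.

Set Implicit Arguments.
Unset Strict Implicit.
Unset Printing Implicit Defensive.

Local Open Scope classical_set_scope.
Local Open Scope ring_scope.
Local Open Scope quotient_scope.

(** * Affine maps and polyhedra *)

Section Polyhedra.
Variable R : realType.

(** A PL function on a set is handled through germs: finitely many polyhedra with an affine map on
    each. Tails, boundaries and seams are not open, so germs are taken relative to subsets; they
    compose, invert and restrict without triangulations. Inversion works because an injective affine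
    map sends polyhedra to polyhedra. The engine is an elementary invariance of domain for piecewise
    affine injections. Beyond its use in the converse, it shows that the boundary does not depend on
    the chart and that a collar, built only as an injective PL map, is open. The obstacle in the
    direct part is that the adjunction space has a priori no chart at a seam: coordinates on the two
    sides are unrelated away from it. A chart along [N i] is therefore carried to [M i.+1] by [h i]
    and spread to both sides by collars, with the seam at height 2; heights stay in ]1, 3[, so the
    image is open, inside the half-space and free of boundary points. In the converse the charts are
    those of the given manifold. *)

Definition affine k l (g : 'rV[R]_k -> 'rV[R]_l) : Prop :=
  exists (L : 'M[R]_(k, l)) (v : 'rV[R]_l), forall x, g x = x *m L + v.

Definition affine_fun k (f : 'rV[R]_k -> R) : Prop :=
  exists (u : 'cV[R]_k) (b : R), forall x, f x = (x *m u) ord0 ord0 + b.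

Lemma affine_id k : affine (@id 'rV[R]_k).
Proof. by exists 1%:M, 0 => x; rewrite mulmx1 addr0. Qed.

Lemma affine_cst k l (v : 'rV[R]_l) : affine (fun _ : 'rV[R]_k => v).
Proof. by exists 0, v => x; rewrite mulmx0 add0r. Qed.

Lemma affine_comp k l p (g : 'rV[R]_k -> 'rV[R]_l) (h : 'rV[R]_l -> 'rV[R]_p) :
  affine g -> affine h -> affine (h \o g).
Proof.
move=> [L [v gE]] [M [w hE]]; exists (L *m M), (v *m M + w) => x /=.
by rewrite hE gE mulmxDl mulmxA addrA.
Qed.

Lemma affine_fun_comp k l (g : 'rV[R]_k -> 'rV[R]_l) (f : 'rV[R]_l -> R) :
  affine g -> affine_fun f -> affine_fun (f \o g).
Proof.
move=> [L [v gE]] [u [b fE]]; exists (L *m u), ((v *m u) ord0 ord0 + b) => x /=.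
by rewrite fE gE mulmxDl mulmxA mxE addrA.
Qed.

Lemma affine_funD k (f g : 'rV[R]_k -> R) :
  affine_fun f -> affine_fun g -> affine_fun (fun x => f x + g x).
Proof.
move=> [u [b fE]] [v [c gE]]; exists (u + v), (b + c) => x.
by rewrite fE gE mulmxDr [in RHS]mxE; ring.
Qed.

Lemma affine_funZ k (f : 'rV[R]_k -> R) a :
  affine_fun f -> affine_fun (fun x => a * f x).
Proof.
move=> [u [b fE]]; exists (a *: u), (a * b) => x.
by rewrite fE -scalemxAr [in RHS]mxE; ring.
Qed.

Lemma affine_fun_cst k (a : R) : affine_fun (fun _ : 'rV[R]_k => a).
Proof. by exists 0, a => x; rewrite mulmx0 mxE add0r. Qed.

Lemma affine_funN k (f : 'rV[R]_k -> R) :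
  affine_fun f -> affine_fun (fun x => - f x).
Proof.
move=> /(affine_funZ (-1)) [u [b H]]; exists u, b => x.
by rewrite -H mulN1r.
Qed.

Lemma affine_fun_coord k (i : 'I_k) : affine_fun (fun x : 'rV[R]_k => x ord0 i).
Proof.
exists (delta_mx i ord0), 0 => x; rewrite addr0 mxE (bigD1 i) //= mxE !eqxx mulr1.
by rewrite big1 ?addr0 // => j /negbTE ji; rewrite mxE ji mulr0.
Qed.

Lemma affine_coord k l (g : 'rV[R]_k -> 'rV[R]_l) :
  affine g <-> forall i, affine_fun (fun x => g x ord0 i).
Proof.
split=> [ag i|H].
  exact: (affine_fun_comp ag (affine_fun_coord i)).
have /choice [u Hu] : forall i, exists ub : 'cV[R]_k * R,
    forall x, g x ord0 i = (x *m ub.1) ord0 ord0 + ub.2.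
  by move=> i; have [u [b ?]] := H i; exists (u, b).
exists (\matrix_(a, i) (u i).1 a ord0), (\row_i (u i).2) => x.
apply/rowP => i; rewrite Hu !mxE; congr (_ + _).
by apply: eq_bigr => a _; rewrite !mxE.
Qed.

Lemma affine_on_affine k l (P : set 'rV[R]_k) (g : 'rV[R]_k -> 'rV[R]_l) :
  affine_on P g <-> exists2 a, affine a & forall x, P x -> g x = a x.
Proof.
split=> [[L [v H]]|[a [L [v aE]] H]].
  by exists (fun x => x *m L + v) => //; exists L, v.
by exists L, v => x Px; rewrite H // aE.
Qed.

Lemma polyhedronP k (P : set 'rV[R]_k) :
  polyhedron P <-> exists m (f : 'I_m -> 'rV[R]_k -> R),
    (forall j, affine_fun (f j)) /\ P = [set x | forall j, f j x <= 0].
Proof.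
split=> [[m [A [b ->]]]|[m [f [af ->]]]].
  exists m, (fun j x => (x *m A) ord0 j - b ord0 j); split.
    move=> j; exists (col j A), (- b ord0 j) => x; congr (_ + _).
    by rewrite !mxE; apply: eq_bigr => a _; rewrite mxE.
  by apply/seteqP; split=> x /= H j; have := H j; rewrite subr_le0.
have /choice [u Hu] : forall i, exists ub : 'cV[R]_k * R,
    forall x, f i x = (x *m ub.1) ord0 ord0 + ub.2.
  by move=> i; have [u [b ?]] := af i; exists (u, b).
exists m, (\matrix_(a, i) (u i).1 a ord0), (\row_i - (u i).2).
suff E x j : (f j x <= 0) = ((x *m \matrix_(a, i) (u i).1 a ord0) ord0 j
    <= (\row_i - (u i).2) ord0 j).
  by apply/seteqP; split=> x /= H j; have := H j; rewrite E.
rewrite Hu -[in RHS]subr_le0 !mxE opprK; congr (_ + _ <= _).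
by apply: eq_bigr => a _; rewrite mxE.
Qed.

Lemma polyhedron_le0 k (f : 'rV[R]_k -> R) :
  affine_fun f -> polyhedron [set x | f x <= 0].
Proof.
move=> af; apply/polyhedronP; exists 1%N, (fun _ => f); split=> //.
by apply/seteqP; split=> x //= H; exact: (H ord0).
Qed.

Lemma polyhedronT k : polyhedron (@setT 'rV[R]_k).
Proof.
apply/polyhedronP; exists 0%N, (fun _ _ => 0); split; first by case.
by apply/seteqP; split=> x //= _ [].
Qed.

Lemma polyhedronI k (P Q : set 'rV[R]_k) :
  polyhedron P -> polyhedron Q -> polyhedron (P `&` Q).
Proof.
move=> /polyhedronP [m [f [af ->]]] /polyhedronP [p [g [ag ->]]].
apply/polyhedronP; exists (m + p)%N,
  (fun j : 'I_(m + p) => match fintype.split j with inl a => f a | inr b => g b end); split.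
  by move=> j; case: (fintype.split j).
apply/seteqP; split=> x /=.
  by move=> [Hf Hg] j; case: (fintype.split j).
move=> H; split=> j.
  by have := H (lshift p j); rewrite (unsplitK (inl j)).
by have := H (rshift m j); rewrite (unsplitK (inr j)).
Qed.

Lemma polyhedron_preimage k l (g : 'rV[R]_k -> 'rV[R]_l) (Q : set 'rV[R]_l) :
  affine g -> polyhedron Q -> polyhedron (g @^-1` Q).
Proof.
move=> ag /polyhedronP [p [f [af ->]]]; apply/polyhedronP.
exists p, (fun j => f j \o g); split=> // j; exact: affine_fun_comp.
Qed.

Lemma polyhedron_bigcap k m (P : 'I_m -> set 'rV[R]_k) :
  (forall j, polyhedron (P j)) -> polyhedron [set x | forall j, P j x].
Proof.
elim: m P => [|m IH] P H.
  by rewrite (_ : mkset _ = setT); [exact: polyhedronT|apply/seteqP; split=> x //= _ []].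
have -> : [set x | forall j, P j x] =
    P ord0 `&` [set x | forall j : 'I_m, P (lift ord0 j) x].
  apply/seteqP; split=> x /= => [Hx|[H0 Hx] j]; first by split.
  by case: (unliftP ord0 j) => [i ->|->].
by apply: polyhedronI => //; apply: IH.
Qed.

Lemma contD (T : topologicalType) (f g : T -> R) x :
  continuous_at x f -> continuous_at x g -> continuous_at x (fun y => f y + g y).
Proof. by move=> cf cg; exact: (cvgD cf cg). Qed.

Lemma contM (T : topologicalType) (f g : T -> R) x :
  continuous_at x f -> continuous_at x g -> continuous_at x (fun y => f y * g y).
Proof. by move=> cf cg; exact: (cvgM cf cg). Qed.

Lemma affine_fun_continuous k (f : 'rV[R]_k -> R) : affine_fun f -> continuous f.
Proof.
move=> [u [b fE]].
have cs (r : seq 'I_k) :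
    continuous (fun x : 'rV[R]_k => \sum_(j <- r) x ord0 j * u j ord0 : R).
  elim: r => [|j r IH] x.
    rewrite (_ : (fun _ => _) = (fun _ => 0)); last by apply: funext => y; rewrite big_nil.
    exact: cst_continuous.
  rewrite (_ : (fun _ => _) =
      (fun y : 'rV[R]_k => y ord0 j * u j ord0 + \sum_(j <- r) y ord0 j * u j ord0)).
    by apply: contD => //; apply: contM; [exact: coord_continuous|exact: cst_continuous].
  by apply: funext => y; rewrite big_cons.
rewrite (_ : f = (fun x => (\sum_(j <- index_enum 'I_k) x ord0 j * u j ord0) + b)).
  by move=> x; apply: contD; [exact: cs|exact: cst_continuous].
by apply: funext => x; rewrite fE !mxE.
Qed.

Lemma mx_continuous (T : Type) k (F : set_system T) (FF : Filter F)
    (g : T -> 'rV[R]_k) (a : 'rV[R]_k) :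
  (forall i, (fun x => g x ord0 i) @ F --> a ord0 i) -> g @ F --> a.
Proof.
move=> H V; rewrite nbhs_simpl => -[P HP PV].
have HF : F [set x | forall i, P ord0 i (g x ord0 i)].
  apply: (@filter_forall _ _ (fun i x => P ord0 i (g x ord0 i))) => i.
  exact: (H i _ (HP ord0 i)).
by apply: (@filterS _ F _ _ _ _ HF) => x Hx; apply: PV => i j; rewrite (ord1 i); exact: Hx.
Qed.

Lemma affine_continuous k l (g : 'rV[R]_k -> 'rV[R]_l) : affine g -> continuous g.
Proof.
move=> /affine_coord H x; apply: (mx_continuous (nbhs_filter x)) => i.
exact: affine_fun_continuous.
Qed.

Lemma polyhedron_closed k (P : set 'rV[R]_k) : polyhedron P -> closed P.
Proof.
move=> /polyhedronP [m [f [af ->]]].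
have -> : [set x | forall j, f j x <= 0] =
    \bigcap_j (f j @^-1` [set y | y <= 0]).
  by apply/seteqP; split=> x /= H j //; have := H j; exact.
apply: closed_bigI => j _; apply: preimage_closed; last exact: closed_le.
by move=> x _; exact: affine_fun_continuous.
Qed.

(** Closed balls of the maximum norm, chosen because they are at once neighbourhoods and
    polyhedra. *)
Definition cube k (a : 'rV[R]_k) (r : R) : set 'rV[R]_k :=
  [set x | forall i, `|x ord0 i - a ord0 i| <= r].

Lemma cube_polyhedron k (a : 'rV[R]_k) (r : R) : polyhedron (cube a r).
Proof.
apply: (@polyhedron_bigcap _ _ (fun i x => `|x ord0 i - a ord0 i| <= r)) => i.
have p1 : polyhedron [set x : 'rV[R]_k | x ord0 i + (- a ord0 i - r) <= 0].
  apply: polyhedron_le0; apply: affine_funD; last exact: affine_fun_cst.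
  exact: affine_fun_coord.
have p2 : polyhedron [set x : 'rV[R]_k | - x ord0 i + (a ord0 i - r) <= 0].
  apply: polyhedron_le0; apply: affine_funD; last exact: affine_fun_cst.
  by apply: affine_funN; exact: affine_fun_coord.
set Q := (X in polyhedron X).
suff -> : Q = [set x : 'rV[R]_k | x ord0 i + (- a ord0 i - r) <= 0] `&`
    [set x : 'rV[R]_k | - x ord0 i + (a ord0 i - r) <= 0] by exact: polyhedronI.
apply/seteqP; rewrite /Q; split=> x /=; rewrite ler_norml.
  by move=> /andP[? ?]; split; lra.
by move=> [? ?]; apply/andP; split; lra.
Qed.

Lemma cube_nbhs k (a : 'rV[R]_k) (r : R) : 0 < r -> nbhs a (cube a r).
Proof.
move=> r0; exists (fun _ i => [set t | `|t - a ord0 i| <= r]).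
  move=> i j; rewrite (ord1 i); apply/nbhs_ballP; exists r => //= t.
  by rewrite /ball /= distrC => /ltW.
by move=> x Hx i; exact: Hx.
Qed.

Lemma nbhs_cube k (a : 'rV[R]_k) (V : set 'rV[R]_k) :
  nbhs a V -> exists2 r, 0 < r & cube a r `<=` V.
Proof.
move=> /nbhs_ballP [e /= e0 eV]; exists (e / 2); first by rewrite divr_gt0.
move=> x Hx; apply: eV; split=> // i j; rewrite (ord1 i) /ball /= distrC.
by apply: le_lt_trans (Hx j) _; rewrite ltr_pdivrMr // mulr2n mulrDr mulr1 ltrDl.
Qed.

End Polyhedra.

Definition inj_on T U (A : set T) (f : T -> U) : Prop :=
  forall x y, A x -> A y -> f x = f y -> x = y.

(** * Images of polyhedra under injective affine maps *)

Section PolyhedronImage.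
Variable R : realType.

Lemma polyhedron_eq0 k l (g : 'rV[R]_k -> 'rV[R]_l) :
  affine g -> polyhedron [set x | g x = 0].
Proof.
move=> /affine_coord ag.
have H i : polyhedron [set x | g x ord0 i = 0].
  rewrite (_ : mkset _ = [set x | g x ord0 i <= 0] `&` [set x | - g x ord0 i <= 0]).
    by apply: polyhedronI; apply: polyhedron_le0 => //; exact: affine_funN.
  apply/seteqP; split=> x /= => [->|[? ?]]; first by rewrite oppr0.
  by apply/eqP; rewrite eq_le; apply/andP; split; lra.
rewrite (_ : mkset _ = [set x | forall i, g x ord0 i = 0]).
  exact: (polyhedron_bigcap H).
apply/seteqP; split=> x /= => [-> i|Hx]; first by rewrite mxE.
by apply/rowP => i; rewrite Hx mxE.
Qed.

Lemma polyhedron_simplex k (P : set 'rV[R]_k) (p0 : 'rV[R]_k) r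
    (T : 'M[R]_(r, k)) (c : 'rV[R]_r) :
  polyhedron P -> P p0 -> (forall i, P (p0 + row i T)) ->
  (forall i, 0 <= c ord0 i) -> \sum_i c ord0 i <= 1 -> P (p0 + c *m T).
Proof.
move=> /polyhedronP [m [f [af ->]]] /= Hp0 Hr c0 c1 j.
have [u [b fE]] := af j.
have lin x : f j (p0 + x) = f j p0 + (x *m u) ord0 ord0.
  by rewrite !fE mulmxDl [in LHS]mxE; ring.
have -> : f j (p0 + c *m T) = (1 - \sum_i c ord0 i) * f j p0
    + \sum_i c ord0 i * f j (p0 + row i T).
  rewrite lin; transitivity (f j p0 + \sum_i c ord0 i * (row i T *m u) ord0 ord0).
    congr (_ + _); rewrite -mulmxA [LHS]mxE; apply: eq_bigr => i _.
    by congr (_ * _); rewrite !mxE; apply: eq_bigr => a _; rewrite mxE.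
  have -> : \sum_i c ord0 i * f j (p0 + row i T) = \sum_i (c ord0 i * f j p0 +
      c ord0 i * (row i T *m u) ord0 ord0).
    by apply: eq_bigr => i _; rewrite lin mulrDr.
  by rewrite big_split /= -mulr_suml; ring.
have H1 : (1 - \sum_i c ord0 i) * f j p0 <= 0.
  by rewrite mulr_ge0_le0 // subr_ge0.
have H2 : \sum_i c ord0 i * f j (p0 + row i T) <= 0.
  by apply: sumr_le0 => i _; rewrite mulr_ge0_le0 //; exact: Hr.
lra.
Qed.

(** A free family of differences of maximal size spans: a difference outside its row space could be
    added as a further free row. The rows are realised by points of [P] because the map in
    [affine_inverse] is injective on [P] only. *)
Lemma polyhedron_span k (P : set 'rV[R]_k) (p0 : 'rV[R]_k) :
  exists r (T : 'M[R]_(r, k)), [/\ row_free T, forall i, P (p0 + row i T) &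
    forall p, P p -> (p - p0 <= T)%MS].
Proof.
pose Q r := `[< exists T : 'M[R]_(r, k), row_free T /\ forall i, P (p0 + row i T) >].
have Q0 : exists r, Q r.
  exists 0%N; apply/asboolP; exists 0; split; last by case.
  by rewrite /row_free mxrank0.
have Qk r : Q r -> (r <= k)%N.
  by move=> /asboolP [T [/eqP rT _]]; have := rank_leq_col T; rewrite rT.
case: (ex_maxnP Q0 Qk) => r /asboolP [T [fT PT]] rmax.
exists r, T; split=> // p Pp; apply/negPn/negP => nT.
suff /rmax : Q (r + 1)%N by rewrite addn1 ltnn.
apply/asboolP; exists (col_mx T (p - p0)); split; last first.
  move=> i; case: (fintype.splitP i) => j ij.
    rewrite (_ : i = lshift 1 j); last exact: val_inj.
    by rewrite rowKu.
  rewrite (_ : i = rshift r j); last exact: val_inj.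
  by rewrite rowKd [j]ord1 row_id addrC subrK.
apply: inj_row_free => v; rewrite -[v]hsubmxK mul_row_col => H.
have v20 : rsubmx v = 0.
  apply/eqP/negPn/negP => v2; apply/negP: nT; rewrite negbK.
  have e0 : rsubmx v ord0 ord0 != 0.
    apply: contra v2 => /eqP e0; apply/eqP/matrixP => i j.
    by rewrite (ord1 i) (ord1 j) e0 mxE.
  have vE : rsubmx v = (rsubmx v ord0 ord0)%:M by rewrite -mx11_scalar.
  move: H; rewrite vE mul_scalar_mx => H.
  have -> : p - p0 = (- (rsubmx v ord0 ord0)^-1 *: lsubmx v) *m T.
    rewrite -scalemxAl (_ : lsubmx v *m T = - (rsubmx v ord0 ord0 *: (p - p0))).
      by rewrite scalerN scaleNr opprK scalerA mulVf // scale1r.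
    by apply/eqP; rewrite -addr_eq0; apply/eqP.
  exact: submxMl.
move: H; rewrite v20 mul0mx addr0 => H.
have [B TB] := row_freeP fT.
have -> : lsubmx v = 0 by rewrite -[lsubmx v]mulmx1 -TB mulmxA H mul0mx.
exact: row_mx0.
Qed.

(** Injectivity on [P] makes the linear part injective on the directions of [P]: these are the
    directions of a simplex contained in [P], and a kernel vector would move its barycentre inside
    it without changing the image. A left inverse of the linear part on these directions gives [b],
    affine on the whole space although [a] need not be injective there. *)
Lemma affine_inverse k l (P : set 'rV[R]_k) (a : 'rV[R]_k -> 'rV[R]_l) :
  polyhedron P -> affine a -> inj_on P a ->
  exists2 b, affine b & forall x, P x -> b (a x) = x.
Proof.
move=> pP aa injP.
have [[p0 Pp0]|/set0P/negP/negPn/eqP P0] := pselect (P !=set0); last first.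
  by exists (fun=> 0); [exact: affine_cst|move=> x; rewrite P0].
have [L [v aE]] := aa.
have [r [T [fT PT PS]]] := polyhedron_span P p0.
have [B TLB] : exists B, (T *m L) *m B = 1%:M.
  apply/row_freeP; apply: inj_row_free => w; rewrite mulmxA => wTL.
  (* The coefficients [d] are those of the barycentre of the simplex on [p0] and the [p0 + row i T];
     with [e = d / (1 + s)] the displacement [e * w] changes each of them, and their sum, by at most
     [d]. *)
  pose d : R := r.+1%:R^-1; pose s := \sum_i `|w ord0 i|.
  have s0 : 0 <= s by apply: sumr_ge0.
  have d0 : 0 < d by rewrite invr_gt0 ltr0n.
  have dr : d * r%:R = 1 - d.
    have : d * r.+1%:R = 1 by rewrite mulVf // pnatr_eq0.
    by rewrite -natr1 mulrDr mulr1; lra.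
  pose e := d / (1 + s).
  have s1 : 0 < 1 + s by lra.
  have e0 : 0 < e by rewrite divr_gt0.
  have es : e * s <= d.
    rewrite /e mulrAC ler_pdivrMr // ler_pM2l //; lra.
  have ew i : `|e * w ord0 i| <= d.
    rewrite normrM (gtr0_norm e0); apply: le_trans es; rewrite ler_pM2l //.
    by rewrite /s (bigD1 i) //= lerDl sumr_ge0.
  have Pt t : 0 <= t <= 1 -> P (p0 + (\row_i (d + t * (e * w ord0 i))) *m T).
    move=> /andP[t0 t1]; apply: polyhedron_simplex => // [i|].
      rewrite mxE; have := ew i; rewrite ler_norml => /andP[h1 h2].
      have := ler_norm (- (t * (e * w ord0 i))); rewrite normrN normrM ger0_norm //.
      have : t * `|e * w ord0 i| <= `|e * w ord0 i| by rewrite ler_piMl.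
      have := ew i; lra.
    under eq_bigr do rewrite mxE.
    rewrite big_split /= sumr_const card_ord -mulr_natr dr -mulr_sumr -mulr_sumr.
    have : \sum_i w ord0 i <= s by apply: ler_sum => i _; exact: ler_norm.
    move=> ws; have : e * \sum_i w ord0 i <= d.
      by apply: le_trans es; rewrite ler_pM2l.
    move=> h; have : t * (e * \sum_i w ord0 i) <= d.
      have [h1|/ltW h1] := leP 0 (e * \sum_i w ord0 i).
        by apply: le_trans h; rewrite ler_piMl.
      by apply: le_trans (ltW d0); rewrite mulr_ge0_le0.
    lra.
  have E t : (\row_i (d + t * (e * w ord0 i))) = const_mx d + (t * e) *: w :> 'rV_r.
    by apply/rowP => i; rewrite !mxE mulrA.
  have : p0 + (\row_i (d + 1 * (e * w ord0 i))) *m T =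
         p0 + (\row_i (d + 0 * (e * w ord0 i))) *m T.
    apply: injP; [apply: Pt; lra|apply: Pt; lra|].
    rewrite !aE !E mul0r scale0r addr0 mul1r !mulmxDl -scalemxAl -scalemxAl wTL.
    by rewrite scaler0 addr0.
  rewrite !E mul0r scale0r addr0 mul1r => /addrI; rewrite mulmxDl -[RHS]addr0.
  move=> /addrI /eqP; rewrite -scalemxAl scaler_eq0 (gt_eqF e0) /= => /eqP wT.
  by have [C TC] := row_freeP fT; rewrite -[w]mulmx1 -TC mulmxA wT mul0mx.
pose M := B *m T.
have TLM u : (u <= T)%MS -> u *m L *m M = u.
  move=> /submxP [w ->]; rewrite /M.
  by rewrite -!mulmxA (mulmxA T) (mulmxA (T *m L)) TLB mul1mx.
exists (fun y => p0 + (y - a p0) *m M).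
  by exists M, (p0 - a p0 *m M) => y; rewrite mulmxBl addrC addrAC addrA.
move=> p Pp; have -> : a p - a p0 = (p - p0) *m L.
  by rewrite !aE mulmxBl opprD addrACA subrr addr0.
by rewrite TLM ?PS // addrC subrK.
Qed.

(** With an affine left inverse [b] of [a] on [P], the image is cut out by the polyhedral conditions
    that [b y] lies in [P] and [a (b y) = y], so no variable has to be eliminated. *)
Lemma polyhedron_image k l (P : set 'rV[R]_k) (a : 'rV[R]_k -> 'rV[R]_l) :
  polyhedron P -> affine a -> inj_on P a -> polyhedron (a @` P).
Proof.
move=> pP aa injP; have [b ab bK] := affine_inverse pP aa injP.
have -> : a @` P = b @^-1` P `&` [set y | a (b y) - y = 0].
  apply/seteqP; split=> [y [p Pp <-]|y /= [Py yE]] /=; first by rewrite bK ?subrr.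
  by exists (b y) => //; apply/eqP; rewrite -subr_eq0 yE.
apply: polyhedronI; first exact: polyhedron_preimage.
apply: (@polyhedron_eq0 _ _ (fun y => a (b y) - y)).
have [L [v LE]] := affine_comp ab aa.
by exists (L - 1%:M), v => y; rewrite [a _]LE mulmxBr mulmx1 addrAC.
Qed.

End PolyhedronImage.

(** * Germs of PL maps *)

Section Germs.
Variable R : realType.

(* Germ at [x] of the statement that [psi] is a PL function of [phi] on [A]. *)
Definition plg (T : topologicalType) k l (A : set T)
    (phi : T -> 'rV[R]_k) (psi : T -> 'rV[R]_l) (x : T) : Prop :=
  exists m (P : 'I_m -> set 'rV[R]_k),
    (forall j, [/\ polyhedron (P j), P j `<=` phi @` A &
      exists2 a, affine a & forall z, A z -> P j (phi z) -> psi z = a (phi z)]) /\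
    \forall z \near x, A z -> exists j, P j (phi z).

Definition cont_at (T Y : topologicalType) (A : set T) (f : T -> Y) (x : T) : Prop :=
  forall V, nbhs (f x) V -> \forall z \near x, A z -> V (f z).

Definition cont_on (T Y : topologicalType) (A : set T) (f : T -> Y) : Prop :=
  forall x, A x -> cont_at A f x.

(* Continuity at [f x] of the inverse of [f] restricted to [A]. *)
Definition inv_at (T Y : topologicalType) (A : set T) (f : T -> Y) (x : T) : Prop :=
  forall V, nbhs x V -> \forall y \near f x, forall z, A z -> f z = y -> V z.

Definition emb_on (T Y : topologicalType) (A : set T) (f : T -> Y) : Prop :=
  [/\ cont_on A f, inj_on A f & forall x, A x -> inv_at A f x].

Section Basic.
Variables (T : topologicalType).
Implicit Types (A B : set T) (x : T).

Lemma plg_fin k l (I : finType) (P : I -> set 'rV[R]_k) A phi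
    (psi : T -> 'rV[R]_l) x :
  (forall j, [/\ polyhedron (P j), P j `<=` phi @` A &
    exists2 a, affine a & forall z, A z -> P j (phi z) -> psi z = a (phi z)]) ->
  (\forall z \near x, A z -> exists j, P j (phi z)) -> plg A phi psi x.
Proof.
move=> HP Hx; exists #|I|, (fun j => P (enum_val j)); split=> [j|]; first exact: HP.
apply: filterS Hx => z Hz Az; have [j Pj] := Hz Az.
by exists (enum_rank j); rewrite enum_rankK.
Qed.

Lemma plg_ext k l A (phi phi' : T -> 'rV[R]_k) (psi psi' : T -> 'rV[R]_l) x :
  (forall z, A z -> phi z = phi' z) -> (forall z, A z -> psi z = psi' z) ->
  plg A phi psi x -> plg A phi' psi' x.
Proof.
move=> E E' [m [P [HP Hx]]]; exists m, P; split=> [j|].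
  have [pP PA [a aa aE]] := HP j; split=> //.
    by move=> y /PA [z Az <-]; exists z; rewrite ?E.
  by exists a => // z Az; rewrite -E // -E' //; exact: aE.
by apply: filterS Hx => z Hz Az; rewrite -E //; exact: Hz.
Qed.

Lemma plg_comp k l p A B phi psi chi x :
  plg A phi (psi : T -> 'rV[R]_l) x -> A `<=` B ->
  plg B psi (chi : T -> 'rV[R]_p) x -> plg A (phi : T -> 'rV[R]_k) chi x.
Proof.
move=> [m [P [HP Hx]]] AB [q [Q [HQ Hx']]].
have /choice [a Ha] : forall j, exists a, affine a /\
    forall z, A z -> P j (phi z) -> psi z = a (phi z).
  by move=> j; have [_ _ [a ? ?]] := HP j; exists a.
apply: (@plg_fin _ _ ('I_m * 'I_q)%type
  (fun ij => P ij.1 `&` a ij.1 @^-1` Q ij.2)).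
  move=> [i j] /=; have [pP PA _] := HP i; have [pQ QB [b ab bE]] := HQ j.
  have [ai aE] := Ha i; split.
  - by apply: polyhedronI => //; exact: polyhedron_preimage.
  - by move=> y [] /PA.
  exists (b \o a i); first exact: affine_comp.
  move=> z Az [Pz /= Qz]; rewrite -aE //; apply: bE; first exact: AB.
  by rewrite aE.
apply: filterS2 Hx Hx' => z Hz Hz' Az.
have [i Pi] := Hz Az; have [j Qj] := Hz' (AB _ Az).
by exists (i, j); split=> //=; have [_ <-] := Ha i.
Qed.

Lemma plg_post k l p A phi (psi : T -> 'rV[R]_l) (g : 'rV[R]_l -> 'rV[R]_p) x :
  affine g -> plg A (phi : T -> 'rV[R]_k) psi x -> plg A phi (g \o psi) x.
Proof.
move=> ag [m [P [HP Hx]]]; exists m, P; split=> // j.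
have [pP PA [a aa aE]] := HP j; split=> //.
by exists (g \o a); [exact: affine_comp|move=> z Az Pz /=; rewrite aE].
Qed.

(** Since a piece [P j] lies in the image of [A] under [phi] and [psi] is injective on [A], the
    affine map on [P j] is injective there; hence the image of [P j] is a polyhedron carrying an
    affine inverse. This is why the definition of [plg] asks the pieces to lie in that image. *)
Lemma plg_inv k l A (phi : T -> 'rV[R]_k) (psi : T -> 'rV[R]_l) x :
  inj_on A psi -> plg A phi psi x -> plg A psi phi x.
Proof.
move=> ipsi [m [P [HP Hx]]].
have /choice [a Ha] : forall j, exists a, affine a /\
    forall z, A z -> P j (phi z) -> psi z = a (phi z).
  by move=> j; have [_ _ [a ? ?]] := HP j; exists a.
have injP j : inj_on (P j) (a j).
  have [_ PA _] := HP j; have [_ aE] := Ha j.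
  move=> y y' Py Py'; have [z Az zy] := PA _ Py; have [z' Az' zy'] := PA _ Py'.
  move: Py Py'; rewrite -{}zy -{}zy' => Py Py'; rewrite -!aE //.
  by move=> /ipsi ->.
exists m, (fun j => a j @` P j); split=> [j|].
  have [pP PA _] := HP j; have [aa aE] := Ha j; split.
  - exact: polyhedron_image.
  - move=> _ [y Py <-]; have [z Az zy] := PA _ Py.
    by exists z => //; rewrite -zy -aE // zy.
  have [pP' _ [b ab bE]] : [/\ polyhedron (a j @` P j), True & exists2 b,
      affine b & forall y, P j y -> b (a j y) = y].
    by split=> //; [exact: polyhedron_image|exact: affine_inverse].
  exists b => // z Az [y Py yz]; have [w Aw wy] := PA _ Py.
  rewrite -yz bE // -wy; congr phi; apply: ipsi => //.
  by rewrite -yz aE // wy.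
apply: filterS Hx => z Hz Az; have [j Pj] := Hz Az; exists j, (phi z) => //.
by have [_ ->] := Ha j.
Qed.

Lemma plg_inter k l A B (phi : T -> 'rV[R]_k) (psi : T -> 'rV[R]_l) x :
  inj_on (A `|` B) phi -> plg A phi psi x -> plg B phi phi x ->
  plg (A `&` B) phi psi x.
Proof.
move=> iphi [m [P [HP Hx]]] [q [Q [HQ Hx']]].
apply: (@plg_fin _ _ ('I_m * 'I_q)%type (fun ij => P ij.1 `&` Q ij.2)).
  move=> [i j] /=; have [pP PA [a aa aE]] := HP i; have [pQ QB _] := HQ j; split.
  - exact: polyhedronI.
  - move=> y [/PA [z Az zy] /QB [z' Bz' zy']]; exists z => //; split=> //.
    by rewrite (iphi z z') //; [left|right|rewrite zy zy'].
  by exists a => // z [Az _] [Pz _]; exact: aE.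
apply: filterS2 Hx Hx' => z Hz Hz' [Az Bz].
by have [i Pi] := Hz Az; have [j Qj] := Hz' Bz; exists (i, j).
Qed.

Lemma plg_pair k l p A (phi : T -> 'rV[R]_k) (psi : T -> 'rV[R]_l)
    (chi : T -> 'rV[R]_p) x :
  plg A phi psi x -> plg A phi chi x ->
  plg A phi (fun z => row_mx (psi z) (chi z)) x.
Proof.
move=> [m [P [HP Hx]]] [q [Q [HQ Hx']]].
apply: (@plg_fin _ _ ('I_m * 'I_q)%type (fun ij => P ij.1 `&` Q ij.2)).
  move=> [i j] /=; have [pP PA [a aa aE]] := HP i; have [pQ QB [b ab bE]] := HQ j.
  split; first exact: polyhedronI.
    by move=> y [/PA].
  exists (fun y => row_mx (a y) (b y)).
    have [L [v LE]] := aa; have [M [w ME]] := ab.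
    exists (row_mx L M), (row_mx v w) => y.
    by rewrite mul_mx_row add_row_mx LE ME.
  by move=> z Az [Pz Qz]; rewrite -aE // -bE.
apply: filterS2 Hx Hx' => z Hz Hz' Az.
by have [i Pi] := Hz Az; have [j Qj] := Hz' Az; exists (i, j).
Qed.

Lemma plg_union k l A B (phi : T -> 'rV[R]_k) (psi : T -> 'rV[R]_l) x :
  inj_on (A `|` B) phi -> plg A phi psi x -> plg B phi psi x ->
  plg (A `|` B) phi psi x.
Proof.
move=> iphi [m [P [HP Hx]]] [q [Q [HQ Hx']]].
apply: (@plg_fin _ _ ('I_m + 'I_q)%type
   (fun ij => match ij with inl i => P i | inr j => Q j end)).
  move=> [i|j].
    have [pP PA [a aa aE]] := HP i; split=> //.
      by move=> y /PA [z Az zy]; exists z => //; left.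
    exists a => // z ABz Pz; apply: aE => //; have [z' Az' zz'] := PA _ Pz.
    by rewrite (iphi z z') //; left.
  have [pP PA [a aa aE]] := HQ j; split=> //.
    by move=> y /PA [z Az zy]; exists z => //; right.
  exists a => // z ABz Pz; apply: aE => //; have [z' Az' zz'] := PA _ Pz.
  by rewrite (iphi z z') //; right.
apply: filterS2 Hx Hx' => z Hz Hz' [Az|Bz].
  by have [i Pi] := Hz Az; exists (inl i).
by have [i Pi] := Hz' Bz; exists (inr i).
Qed.

Lemma plg_out k l A (phi : T -> 'rV[R]_k) (psi : T -> 'rV[R]_l) x :
  (\forall z \near x, ~ A z) -> plg A phi psi x.
Proof.
move=> H; exists 0%N, (fun=> set0); split; first by case.
by apply: filterS H => z nA Az.
Qed.

Lemma plg_enlarge k l A B (phi : T -> 'rV[R]_k) (psi : T -> 'rV[R]_l) x :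
  inj_on B phi -> A `<=` B -> (\forall z \near x, B z -> A z) ->
  plg A phi psi x -> plg B phi psi x.
Proof.
move=> iphi AB BA [m [P [HP Hx]]]; exists m, P; split=> [j|].
  have [pP PA [a aa aE]] := HP j; split=> //.
    by move=> y /PA [z Az zy]; exists z => //; exact: AB.
  exists a => // z Bz Pz; apply: aE => //; have [z' Az' zz'] := PA _ Pz.
  by rewrite (iphi z z') //; exact: AB.
by apply: filterS2 BA Hx => z Hz Hz' Bz; exact: Hz' (Hz Bz).
Qed.

(** The pieces may leave the image of [B], so they are cut by a cube around [phi x] that is small
    enough, by continuity of the inverse, for its points in the image of [A] to come from [B]. *)
Lemma plg_shrink k l A B (phi : T -> 'rV[R]_k) (psi : T -> 'rV[R]_l) x :
  cont_at A phi x -> inv_at A phi x -> B `<=` A ->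
  (\forall z \near x, A z -> B z) -> plg A phi psi x -> plg B phi psi x.
Proof.
move=> cphi vphi BA AB [m [P [HP Hx]]].
have [r r0 Hr] := nbhs_cube (vphi _ AB).
exists m, (fun j => P j `&` cube (phi x) r); split=> [j|].
  have [pP PA [a aa aE]] := HP j; split=> //.
  - by apply: polyhedronI => //; exact: cube_polyhedron.
  - move=> y [/PA [z Az zy] cy]; exists z => //.
    exact: (Hr _ cy z Az zy Az).
  by exists a => // z Bz [Pz _]; apply: aE => //; exact: BA.
apply: filterS2 Hx (cphi _ (cube_nbhs (phi x) r0)) => z Hz Hz' Bz.
by have [j Pj] := Hz (BA _ Bz); exists j; split=> //; exact: Hz' (BA _ Bz).
Qed.

(** Pieces cut by a polyhedral condition on a PL function remain polyhedral. Boundaries, seams and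
    halves of collars are recognised as polyhedral in this way. *)
Lemma plg_level k l p A (phi : T -> 'rV[R]_k) (psi : T -> 'rV[R]_l)
    (chi : T -> 'rV[R]_p) Q x :
  polyhedron Q -> plg A phi chi x -> plg A phi psi x ->
  plg (A `&` chi @^-1` Q) phi psi x.
Proof.
move=> pQ [m [P [HP Hx]]] [q [P' [HP' Hx']]].
have /choice [a Ha] : forall j, exists a, affine a /\
    forall z, A z -> P j (phi z) -> chi z = a (phi z).
  by move=> j; have [_ _ [a ? ?]] := HP j; exists a.
apply: (@plg_fin _ _ ('I_m * 'I_q)%type
   (fun ij => (P ij.1 `&` a ij.1 @^-1` Q) `&` P' ij.2)).
  move=> [i j] /=; have [pP PA _] := HP i; have [pP' _ [b ab bE]] := HP' j.
  have [aa aE] := Ha i; split.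
  - by apply: polyhedronI => //; apply: polyhedronI => //; exact: polyhedron_preimage.
  - move=> y [[Py Qy] _]; have [z Az zy] := PA _ Py; exists z => //.
    by split=> //=; rewrite aE // zy.
  by exists b => // z [Az _] [_ Pz]; exact: bE.
apply: filterS2 Hx Hx' => z Hz Hz' [Az Qz].
have [i Pi] := Hz Az; have [j Pj] := Hz' Az; exists (i, j); split=> //; split=> //=.
by have [_ <-] := Ha i.
Qed.

Lemma plg_refl k l A (phi : T -> 'rV[R]_k) (psi : T -> 'rV[R]_l) x :
  plg A phi psi x -> plg A phi phi x.
Proof.
move=> [m [P [HP Hx]]]; exists m, P; split=> // j; have [? ? _] := HP j.
by split=> //; exists id => //; exact: affine_id.
Qed.

End Basic.

(** Together with [plg_push] this transports germs along an embedding: pulling back uses continuity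
    of [j], pushing forward continuity of its inverse. *)
Lemma plg_pull (S T : topologicalType) k l (j : S -> T) (A : set T) (B : set S)
    (phi : T -> 'rV[R]_k) (psi : T -> 'rV[R]_l) s :
  continuous_at s j -> (forall z, B z -> A (j z)) -> A `<=` j @` B ->
  plg A phi psi (j s) -> plg B (phi \o j) (psi \o j) s.
Proof.
move=> cj BA AB [m [P [HP Hx]]]; exists m, P; split=> [i|].
  have [pP PA [a aa aE]] := HP i; split=> //.
    by move=> y /PA [z /AB [w Bw <-] <-]; exists w.
  by exists a => // z Bz; apply: aE; exact: BA.
by apply: (@filterS _ (nbhs s) _ _ _ _ (cj _ Hx)) => z Hz /BA; exact: Hz.
Qed.

Lemma plg_push (S T : topologicalType) k l (j : S -> T) (A : set T) (B : set S)
    (phi : T -> 'rV[R]_k) (psi : T -> 'rV[R]_l) s :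
  inv_at B j s -> (forall z, B z -> A (j z)) -> A `<=` j @` B ->
  plg B (phi \o j) (psi \o j) s -> plg A phi psi (j s).
Proof.
move=> vj BA AB [m [P [HP Hx]]]; exists m, P; split=> [i|].
  have [pP PA [a aa aE]] := HP i; split=> //.
    by move=> y /PA [z Bz <-]; exists (j z) => //; exact: BA.
  by exists a => // z /AB [w Bw <-]; exact: aE.
apply: filterS (vj _ Hx) => z Hz /AB [w Bw wz]; rewrite -wz.
by have := Hz _ Bw wz Bw.
Qed.

Lemma pl_factor_plg (T : topologicalType) k l (A : set T)
    (phi : T -> 'rV[R]_k) (psi : T -> 'rV[R]_l) x :
  cont_at A phi x -> A x -> pl_factor A phi psi -> plg A phi psi x.
Proof.
move=> cphi Ax [g [pg E]].
have [m [P [HP Hx]]] := pg (phi x) (imageP _ Ax).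
exists m, P; split=> [j|].
  have [pP PA /affine_on_affine [a aa aE]] := HP j; split=> //.
  by exists a => // z Az Pz; rewrite E // aE.
by apply: filterS (cphi _ Hx) => z Hz Az; apply: Hz => //; exists z.
Qed.

(** With [pl_factor_plg], this makes the global notion of PL function of an embedding [phi]
    equivalent to its germs. The factor [g] is the composite of [psi] with the inverse of [phi],
    chosen pointwise, and [inv_at] turns neighbourhoods of [x] into neighbourhoods of [phi x]. *)
Lemma plg_pl_factor (T : topologicalType) k l (A : set T)
    (phi : T -> 'rV[R]_k) (psi : T -> 'rV[R]_l) :
  inj_on A phi -> (forall x, A x -> inv_at A phi x) ->
  (forall x, A x -> plg A phi psi x) -> pl_factor A phi psi.
Proof.
move=> iphi vphi H.
pose g y := xget 0 [set w | exists2 z, A z & phi z = y /\ psi z = w].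
have gE z : A z -> g (phi z) = psi z.
  move=> Az; rewrite /g; case: xgetP => [w _ [z' Az' [zz' <-]]|].
    by rewrite (iphi z' z).
  by move=> /(_ (psi z)) []; exists z.
exists g; split=> [_ [x Ax <-]|x Ax]; last by rewrite gE.
have [m [P [HP Hx]]] := H x Ax; exists m, P; split=> [j|].
  have [pP PA [a aa aE]] := HP j; split=> //; apply/affine_on_affine.
  exists a => // y Py; have [z Az zy] := PA _ Py.
  by rewrite -zy gE // aE // zy.
by apply: (@filterS _ (nbhs (phi x)) _ _ _ _ (vphi x Ax _ Hx)) => y Hy [z Az zy];
  rewrite -zy; exact: (Hy z Az zy Az).
Qed.

End Germs.

(** * PL invariance of domain *)

Section InvarianceOfDomain.
Variable R : realType.

Lemma near_cont (T Y : topologicalType) (f : T -> Y) x (V : set Y) (W : set T) :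
  continuous_at x f -> nbhs (f x) V -> (forall y, V (f y) -> W y) -> nbhs x W.
Proof. by move=> cf Vfx VW; exact: (@filterS _ (nbhs x) _ _ _ VW (cf _ Vfx)). Qed.

Lemma affine_fun_line k (f : 'rV[R]_k -> R) x w t :
  affine_fun f -> f (x + t *: (w - x)) = (1 - t) * f x + t * f w.
Proof.
move=> [u [b fE]]; rewrite !fE mulmxDl -scalemxAl mulmxBl.
have E (M N : 'M[R]_(1, 1)) : (M + t *: (N - M)) ord0 ord0 =
  M ord0 ord0 + t * (N ord0 ord0 - M ord0 ord0) by rewrite !mxE.
by rewrite E; ring.
Qed.

Lemma line_continuous k (x w : 'rV[R]_k) : continuous (fun t : R => x + t *: (w - x)).
Proof.
move=> t; apply: (mx_continuous (nbhs_filter t)) => i.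
have -> : (x + t *: (w - x)) ord0 i = x ord0 i + t * (w ord0 i - x ord0 i).
  by rewrite !mxE.
rewrite (_ : (fun s : R => (x + s *: (w - x)) ord0 i) =
  (fun s => x ord0 i + s * (w ord0 i - x ord0 i))); last first.
  by apply: funext => s; rewrite !mxE.
have c : continuous_at t (fun s : R => x ord0 i + s * (w ord0 i - x ord0 i)).
  apply: contD; first exact: cst_continuous.
  by apply: contM; [exact: cvg_id|exact: cst_continuous].
exact: c.
Qed.

Lemma near_line k (x w : 'rV[R]_k) (V : set 'rV[R]_k) : nbhs x V ->
  exists2 e, 0 < e & forall t, `|t| <= e -> V (x + t *: (w - x)).
Proof.
move=> Vx; have V0 : nbhs (x + 0 *: (w - x)) V by rewrite scale0r addr0.
have : nbhs (0 : R) (fun t => V (x + t *: (w - x))).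
  by apply: (near_cont (@line_continuous k x w 0) V0).
move=> /nbhs_ballP [e /= e0 He]; exists (e / 2); first by rewrite divr_gt0.
move=> t te; apply: He; rewrite /ball /= sub0r normrN.
by apply: le_lt_trans te _; rewrite ltr_pdivrMr // mulr2n mulrDr mulr1 ltrDl.
Qed.

Definition trivial_fun k (f : 'rV[R]_k -> R) := forall x, f x = 0.

(** The functionals are treated one at a time: if [F j] vanishes at [x] but not identically, a small
    move towards a point [w] with [F j w <> 0] makes it nonzero, and is too small to spoil those
    that are nonzero already. *)
Lemma avoid_zeros k (I : finType) (F : I -> 'rV[R]_k -> R) (V : set 'rV[R]_k)
    (x0 : 'rV[R]_k) :
  (forall i, affine_fun (F i)) -> nbhs x0 V ->
  exists x, nbhs x V /\ forall i, trivial_fun (F i) \/ F i x <> 0.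
Proof.
move=> aF Vx0.
suff [x [Vx H]] : exists x, nbhs x V /\
    forall i, i \in enum I -> trivial_fun (F i) \/ F i x <> 0.
  by exists x; split=> // i; apply: H; rewrite mem_enum.
elim: (enum I) => [|j s [x [Vx IH]]]; first by exists x0.
have [tj|/existsNP[w Fw]] := pselect (trivial_fun (F j)).
  exists x; split=> // i; rewrite inE => /orP[/eqP ->|]; first by left.
  exact: IH.
have [Fx|Fx] := eqVneq (F j x) 0; last first.
  exists x; split=> // i; rewrite inE => /orP[/eqP ->|]; first by right; exact/eqP.
  exact: IH.
have nz : \forall y \near x, forall i, F i x <> 0 -> F i y <> 0.
  apply: (@filter_forall _ _ (fun i y => F i x <> 0 -> F i y <> 0) _ (nbhs_filter x)) => i.
  have [F0|F0] := eqVneq (F i x) 0; first by apply: nearW => y; rewrite F0.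
  apply: (near_cont (affine_fun_continuous (aF i) (x := x))
    (V := [set y | y != 0])) => [|y /= /eqP //].
  by apply: open_nbhs_nbhs; split=> //; exact: open_neq.
have [e e0 He] := near_line w (filterI (nbhs_interior Vx) nz).
have [/= Vt nzt] := He e (ltac:(by rewrite gtr0_norm)).
exists (x + e *: (w - x)); split=> // i.
rewrite inE => /orP[/eqP ->|/IH [ti|/nzt]]; [right|by left|by right].
rewrite affine_fun_line // Fx mulr0 add0r; apply/eqP; rewrite mulf_neq0 //.
  by rewrite gt_eqF.
exact/eqP.
Qed.

Lemma affine_open k (a : 'rV[R]_k -> 'rV[R]_k) (N : set 'rV[R]_k)
    (p : 'rV[R]_k) :
  affine a -> nbhs p N -> inj_on N a ->
  exists b, [/\ affine b, cancel a b & cancel b a].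
Proof.
move=> [L [v aE]] Np injN.
have uL : L \in unitmx.
  rewrite -row_free_unit; apply: inj_row_free => w wL.
  have [e e0 He] := near_line (p + w) Np.
  have := He e (ltac:(by rewrite gtr0_norm)); rewrite addrAC subrr add0r => Nw.
  have /(injN _ _ Nw (nbhs_singleton Np)) : a (p + e *: w) = a p.
    by rewrite !aE mulmxDl -scalemxAl wL scaler0 addr0.
  move=> /eqP; rewrite -subr_eq0 addrAC subrr add0r scaler_eq0 => /orP[|/eqP //].
  by rewrite gt_eqF.
exists (fun y => (y - v) *m invmx L); split.
- by exists (invmx L), (- (v *m invmx L)) => y; rewrite mulmxBl.
- by move=> x; rewrite aE addrK mulmxK.
- by move=> y; rewrite aE mulmxKV // subrK.
Qed.

Lemma affine_image_nbhs k (a : 'rV[R]_k -> 'rV[R]_k) (N : set 'rV[R]_k)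
    (p : 'rV[R]_k) :
  affine a -> nbhs p N -> inj_on N a -> nbhs (a p) (a @` N).
Proof.
move=> aa Np injN; have [b [ab aK bK]] := affine_open aa Np injN.
have : nbhs (b (a p)) N by rewrite aK.
move=> H; apply: (near_cont (affine_continuous ab (x := a p)) H) => y Ny.
by exists (b y).
Qed.

(** The number [N] is common to all pieces; missing functionals are filled in by the zero function,
    which is one reason why genericity is stated up to [trivial_fun]. *)
Lemma polyhedra_functionals k m (P : 'I_m -> set 'rV[R]_k) :
  (forall j, polyhedron (P j)) -> exists N (f : 'I_m -> 'I_N -> 'rV[R]_k -> R),
    (forall j i, affine_fun (f j i)) /\
    forall j x, P j x <-> forall i, f j i x <= 0.
Proof.
move=> H; have /choice [F HF] : forall j, exists F : {n & 'I_n -> 'rV[R]_k -> R},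
    (forall i, affine_fun (projT2 F i)) /\ P j = [set x | forall i, projT2 F i x <= 0].
  by move=> j; have /polyhedronP [n [f Hf]] := H j; exists (existT _ n f).
pose N := (\max_j projT1 (F j))%N.
exists N, (fun j i => if insub (i : nat) is Some i' then projT2 (F j) i' else fun=> 0).
split=> [j i|j x].
  case: insubP => [i' _ _|_]; last exact: affine_fun_cst.
  by have [] := HF j.
have [_ ->] := HF j; split=> /= Hx i; first by case: insubP => [i' _ _|_].
have iN : (i < N)%N.
  by apply: leq_trans (ltn_ord i) _; exact: (@leq_bigmax _ (fun j => projT1 (F j))).
have := Hx (Ordinal iN); case: insubP => [i' _ /= ii'|/=]; last by rewrite ltn_ord.
by rewrite (_ : i' = i) //; exact: val_inj.
Qed.

Lemma polyhedron_nbhs k N (f : 'I_N -> 'rV[R]_k -> R) x :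
  (forall i, affine_fun (f i)) -> (forall i, trivial_fun (f i) \/ f i x < 0) ->
  nbhs x [set y | forall i, f i y <= 0].
Proof.
move=> af H; apply: (@filter_forall _ _ (fun i y => f i y <= 0) _ (nbhs_filter x)) => i.
have [ti|fi] := H i; first by apply: nearW => y; rewrite ti.
have : nbhs (f i x) [set y | y < 0] by apply: open_nbhs_nbhs; split=> //; exact: open_lt.
move=> {}H; apply: (near_cont (affine_fun_continuous (af i) (x := x)) H) => y /=.
exact: ltW.
Qed.

Lemma closed_finU (T : topologicalType) (I : finType) (F : I -> set T) :
  (forall i, closed (F i)) -> closed [set x | exists i, F i x].
Proof.
move=> H; rewrite (_ : mkset _ = \bigcup_(i in setT) F i).
  by apply: closed_bigcup => [|i _]; [exact: finite_finset|exact: H].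
by apply/seteqP; split=> x /= => [[i Fi]|[i _ Fi]]; exists i.
Qed.

(* If [g x0] were not interior to the image, then a segment from a point [z] inside
   the image to a point [w] outside of it, chosen generic, leaves the image through
   a single wall [Phi = 0].  Near the exit point the image is the half-space
   [0 <= Phi] and [g] is a single affine injection, which is open. *)
Lemma inv_domain_raw k m (g : 'rV[R]_k -> 'rV[R]_k) (x0 : 'rV[R]_k) (r : R)
    (P : 'I_m -> set 'rV[R]_k) (a : 'I_m -> 'rV[R]_k -> 'rV[R]_k) :
  0 < r -> (forall j, polyhedron (P j)) -> (forall j, affine (a j)) ->
  (forall z, cube x0 r z -> exists j, P j z) ->
  (forall j z, cube x0 r z -> P j z -> g z = a j z) ->
  inj_on (cube x0 r) g -> nbhs (g x0) (g @` cube x0 r).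
Proof.
move=> r0 pP aa cov gE injg; set K := cube x0 r.
pose P' j := P j `&` K.
have pP' j : polyhedron (P' j) by apply: polyhedronI => //; exact: cube_polyhedron.
have injP j : inj_on (P' j) (a j).
  by move=> y z [Py Ky] [Pz Kz] ayz; apply: injg => //; rewrite !(gE j).
have imP j (S : set 'rV[R]_k) : polyhedron S -> polyhedron (a j @` (P' j `&` S)).
  move=> pS; apply: polyhedron_image => //; first exact: polyhedronI.
  by move=> y z [P'y _] [P'z _]; exact: injP.
pose Q j := a j @` P' j.
have pQ j : polyhedron (Q j) by exact: polyhedron_image.
have QE y : (g @` K) y <-> exists j, Q j y.
  split=> [[x Kx <-]|[j [x [Px Kx] <-]]]; last by exists x; rewrite ?(gE j).
  by have [j Pj] := cov _ Kx; exists j, x => //; rewrite (gE j).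
pose face (bi : bool * 'I_k) :=
  [set z : 'rV[R]_k | z ord0 bi.2 - x0 ord0 bi.2 = if bi.1 then r else - r].
have pface bi : polyhedron (face bi).
  pose c := x0 ord0 bi.2 + if bi.1 then r else - r.
  rewrite (_ : face bi = [set z : 'rV[R]_k | (\row_(i < 1) (z ord0 bi.2 - c) : 'rV_1) = 0]).
    apply: (@polyhedron_eq0 _ _ 1 (fun z => \row_(i < 1) (z ord0 bi.2 - c))).
    apply/affine_coord => i.
    have : affine_fun (fun z : 'rV[R]_k => z ord0 bi.2 + (- c)).
      by apply: affine_funD; [exact: affine_fun_coord|exact: affine_fun_cst].
    by move=> [u [b H]]; exists u, b => z; rewrite mxE H.
  apply/seteqP; split=> z; rewrite /face /c /=.
    by move=> H; apply/rowP => i; rewrite !mxE -H; ring.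
  by move=> /rowP /(_ ord0); rewrite !mxE => H; lra.
(* The image of the frontier of the cube. It is closed and misses [g x0] by injectivity, so that
   near [g x0] all preimages are interior to [K]. *)
pose D := [set y | exists jb : 'I_m * (bool * 'I_k),
  (a jb.1 @` (P' jb.1 `&` face jb.2)) y].
have cD : closed D.
  by apply: closed_finU => jb; apply: polyhedron_closed; exact: imP.
have x0K : K x0 by move=> i; rewrite subrr normr0 ltW.
have nD : ~ D (g x0).
  move=> [[j [b i]] [x [[Px Kx] fx] /=]]; rewrite -gE // => /injg xx0.
  by move: fx; rewrite xx0 // /face /= subrr; case: ifP => _ ?; lra.
have intK x : K x -> ~ D (g x) -> nbhs x K.
  move=> Kx nDx; apply: (@filter_forall _ _
    (fun i (z : 'rV[R]_k) => `|z ord0 i - x0 ord0 i| <= r) _ (nbhs_filter x)) => i.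
  have xi : `|x ord0 i - x0 ord0 i| < r.
    rewrite lt_neqAle Kx andbT; apply/negP => /eqP xi; apply: nDx.
    have [j Pj] := cov _ Kx.
    have [h|h] := leP 0 (x ord0 i - x0 ord0 i).
      exists (j, (true, i)), x; last by rewrite (gE j).
      by split=> //; rewrite /face /= -xi ger0_norm.
    exists (j, (false, i)), x; last by rewrite (gE j).
    by split=> //; rewrite /face /= -xi ltr0_norm // opprK.
  have af : affine_fun (fun z : 'rV[R]_k => z ord0 i + (- x0 ord0 i)).
    by apply: affine_funD; [exact: affine_fun_coord|exact: affine_fun_cst].
  apply: (near_cont (affine_fun_continuous af (x := x))
     (V := [set t | `|t| < r])) => [|y /= /ltW //].
  apply: open_nbhs_nbhs; split => //.
  apply: (@open_comp _ _ (@Num.norm R R) [set t | t < r]); last exact: open_lt.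
  by move=> y _; exact: norm_continuous.
have gcont x V : nbhs x K -> nbhs (g x) V -> nbhs x (fun z => V (g z)).
  move=> Kx Vg; have : nbhs x (fun z => forall j, P j z -> V (a j z)).
    apply: (@filter_forall _ _ (fun j z => P j z -> V (a j z)) _ (nbhs_filter x)) => j.
    have [Px|nPx] := pselect (P j x).
      have Va : nbhs (a j x) V by rewrite -gE //; exact: nbhs_singleton.
      by apply: (near_cont (affine_continuous (aa j) (x := x)) Va).
    have : nbhs x (~` P j).
      by apply: open_nbhs_nbhs; split=> //; apply: closed_openC; exact: polyhedron_closed.
    by apply: filterS.
  apply: filterS2 Kx => z Kz Hz; have [j Pj] := cov _ Kz.
  by rewrite (gE j) //; exact: Hz.
have cQ : closed (g @` K).
  rewrite (_ : g @` K = [set y | exists j, Q j y]); last by apply/seteqP; split=> y /QE.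
  by apply: closed_finU => j; exact: polyhedron_closed.
have nKx0 : nbhs x0 K by exact: cube_nbhs.
have [rho rho0 Hrho] : exists2 rho, 0 < rho & cube (g x0) rho `<=` ~` D.
  by apply: nbhs_cube; apply: open_nbhs_nbhs; split=> //; exact: closed_openC.
set C := cube (g x0) rho.
have convC y z t : C y -> C z -> 0 <= t <= 1 -> C (y + t *: (z - y)).
  move=> Cy Cz /andP[t0 t1] i; have := Cy i; have := Cz i; rewrite !mxE !ler_norml.
  by move=> /andP[? ?] /andP[? ?]; apply/andP; split; nra.
have Cx0 : nbhs (g x0) C by exact: cube_nbhs.
apply: contrapT => nQ.
have [N [h [ah hE]]] := polyhedra_functionals pP'.
have [N' [f [af fE]]] := polyhedra_functionals pQ.
have nCx0 : nbhs (g x0) C° by exact: nbhs_interior.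
(* A generic [p] near [x0] lies on no wall of the pieces, hence is interior to one of them, and an
   affine injection carries that interior into the interior of the image. The point [z] is then
   taken generic in this open part of the image. *)
have [p [np nzp]] := avoid_zeros (I := ('I_m * 'I_N)%type)
  (F := fun ji => h ji.1 ji.2) (fun ji => ah ji.1 ji.2)
  (filterI nKx0 (gcont _ _ nKx0 nCx0)).
have [Kp Cgp] := nbhs_singleton np.
have [j Pjp] := cov _ Kp.
have nP'p : nbhs p (P' j).
  have H : nbhs p [set y | forall i, h j i y <= 0].
    apply: polyhedron_nbhs => // i; have [?|nz] := nzp (j, i); [by left|right].
    rewrite lt_neqAle; apply/andP; split; first exact/eqP.
    by move: i {nz}; apply/hE.
  by apply: (@filterS _ (nbhs p) _ _ _ _ H) => y /hE.
have nQgp : nbhs (g p) (Q j).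
  by rewrite (gE j) //; apply: affine_image_nbhs => //; exact: injP.
pose II : finType := ('I_m * 'I_N')%type.
pose F (e : II) := f e.1 e.2.
have aF e : affine_fun (F e) by exact: af.
have [z [nz nzz]] := avoid_zeros (F := F) aF (filterI nQgp Cgp).
have [Qjz Cz] := nbhs_singleton nz.
have [w0 [Cw0 nQw0]] : exists w0, C° w0 /\ ~ (g @` K) w0.
  apply: contrapT => H; apply: nQ.
  apply: (@filterS _ (nbhs (g x0)) _ _ _ _ nCx0) => y Cy; apply: contrapT => nQy.
  by apply: H; exists y.
have nw0 : nbhs w0 (C `&` ~` (g @` K)).
  apply: filterI => //; apply: open_nbhs_nbhs; split=> //; exact: closed_openC.
(* The second kind of functional vanishes at [z]. When [w] is not a zero of it, unless it is
   trivial, two walls met by the segment at the same point must have proportional functionals. *)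
pose G (e : II + II * II) (y : 'rV[R]_k) := match e with
  | inl e => F e y
  | inr (e, e') => F e y * F e' z - F e' y * F e z end.
have aG e : affine_fun (G e).
  case: e => [e|[e e']] /=; first exact: aF.
  have h1 := affine_funZ (F e' z) (aF e); have h2 := affine_funZ (- F e z) (aF e').
  have [u [b H]] := affine_funD h1 h2; exists u, b => y /=; rewrite -H /=; ring.
have [w [nw nzw]] := avoid_zeros (F := G) aG nw0.
have [Cw nQw] := nbhs_singleton nw.
pose y t := z + t *: (w - z).
have Cy t : 0 <= t <= 1 -> C (y t) by exact: convC.
have Fy e t : F e (y t) = (1 - t) * F e z + t * F e w by exact: affine_fun_line.
pose E := [set t : R | 0 <= t <= 1 /\ ~ (g @` K) (y t)].
have E1 : E 1.
  by split; [rewrite ler01 lexx|rewrite /y scale1r addrC subrK].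
have infE : has_inf E by split; [exists 1|exists 0 => t [/andP[]]].
(* The exit time: the image is closed, so [y ts] still belongs to it, while points outside the image
   occur at arbitrarily close later times. *)
set ts := inf E.
have ts_le t : E t -> ts <= t by move=> Et; apply: ge_inf => //; case: infE.
have ts1 : ts <= 1 by exact: ts_le.
have before s : 0 <= s < ts -> (g @` K) (y s).
  move=> /andP[s0 sts]; apply: contrapT => nQs.
  suff /ts_le : E s by rewrite leNgt sts.
  by split=> //; rewrite s0 (le_trans (ltW sts)).
have yt_shift s t : y (s + t) = y s + t *: ((y s + (w - z)) - y s).
  by rewrite /y (addrC (z + _) (w - z)) addrK scalerDl addrA.
have near_y s (V : set 'rV[R]_k) : nbhs (y s) V ->
    exists2 e, 0 < e & forall t, `|t| <= e -> V (y (s + t)).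
  move=> /(near_line (y s + (w - z))) [e e0 He]; exists e => // t te.
  by rewrite yt_shift; exact: He.
have Qz : nbhs z (g @` K).
  have : nbhs z [set y | forall i, f j i y <= 0].
    apply: polyhedron_nbhs => // i; have [?|nz0] := nzz (j, i); [by left|right].
    rewrite lt_neqAle; apply/andP; split; first exact/eqP.
    by move: i {nz0}; apply/fE.
  by move=> H; apply: (@filterS _ (nbhs z) _ _ _ _ H) => v /fE Qv; apply/QE; exists j.
have ts0 : 0 < ts.
  have y0 : y 0 = z by rewrite /y scale0r addr0.
  have [e e0 He] : exists2 e, 0 < e & forall t, `|t| <= e -> (g @` K) (y (0 + t)).
    by apply: near_y; rewrite y0.
  apply: lt_le_trans e0 _; apply: lb_le_inf; first by case: infE.
  move=> t [/andP[t0 t1] nQt]; rewrite leNgt; apply/negP => te; apply: nQt.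
  by rewrite -(add0r t); apply: He; rewrite ger0_norm // ltW.
have Qs : (g @` K) (y ts).
  apply: contrapT => nQs.
  have : nbhs (y ts) (~` (g @` K)) by apply: open_nbhs_nbhs; split=> //; exact: closed_openC.
  move=> /near_y [e e0 He].
  pose d := Num.min e ts.
  have d0 : 0 < d by rewrite lt_min e0.
  have dts : d <= ts by rewrite ge_min lexx orbT.
  have de : d <= e by rewrite ge_min lexx.
  apply: (He (- d)); first by rewrite normrN gtr0_norm.
  by apply: before; apply/andP; split; lra.
have after e : 0 < e -> exists2 t, 0 < t <= e & ~ (g @` K) (y (ts + t)).
  move=> e0; have [t Et tlt] := inf_adherent e0 infE.
  have tts := ts_le _ Et; case: Et => t01 nQt.
  exists (t - ts); last by rewrite addrC subrK.
  have : t != ts by apply/eqP => tE; apply: nQt; rewrite tE.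
  by move: tlt; rewrite -/ts => ? /eqP ?; apply/andP; split; lra.
have Cs : C (y ts) by apply: Cy; rewrite (ltW ts0).
have [xs Kxs gxs] := Qs.
have nKxs : nbhs xs K by apply: intK => //; rewrite gxs; exact: Hrho.
have [j0 Qj0] : exists j0, Q j0 (y ts) by exact/QE.
have [e0 [ne0 Fe0]] : exists e0, ~ trivial_fun (F e0) /\ F e0 (y ts) = 0.
  apply: contrapT => H.
  have : nbhs (y ts) [set v | forall i, f j0 i v <= 0].
    apply: polyhedron_nbhs => // i; have [?|ntr] := pselect (trivial_fun (f j0 i)).
      by left.
    right; rewrite lt_neqAle; apply/andP; split; last by move: i {ntr}; apply/fE.
    by apply/eqP => fi; apply: H; exists (j0, i).
  move=> /near_y [e eg He]; have [t /andP[t0 te] nQt] := after e eg.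
  apply: nQt; apply/QE; exists j0; apply/fE; apply: He.
  by rewrite gtr0_norm.
have Fe0z : F e0 z <> 0 by case: (nzz e0).
pose Phi v := F e0 v / F e0 z.
have aPhi : affine_fun Phi.
  have [u [b H]] := affine_funZ (F e0 z)^-1 (aF e0).
  by exists u, b => v; rewrite -H mulrC.
have Phiz : Phi z = 1 by rewrite /Phi divff //; exact/eqP.
have Phiy s : Phi (y s) = 1 - s / ts.
  have := Fy e0 ts; rewrite Fe0 => H.
  have HH : Phi w = 1 - ts^-1.
    apply: (mulfI (x := ts * F e0 z)); first by apply: mulf_neq0; [rewrite gt_eqF|exact/eqP].
    rewrite /Phi mulrCA -!mulrA divff ?mulr1; last exact/eqP.
    have E2 : ts * (F e0 z * (1 - ts^-1)) = F e0 z * (ts - ts / ts) by ring.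
    by rewrite E2 divff ?gt_eqF //; lra.
  rewrite (affine_fun_line z w s aPhi) Phiz HH; ring.
have prop e : ~ trivial_fun (F e) -> F e (y ts) = 0 -> forall v, F e v = F e z * Phi v.
  move=> nte Fe v; have tr : trivial_fun (G (inr (e, e0))).
    case: (nzw (inr (e, e0))) => // /eqP nzG; exfalso.
    have := affine_fun_line z w ts (aG (inr (e, e0))).
    rewrite -/(y ts) {1 2}/G Fe Fe0 !mul0r subrr (mulrC (F e z)) subrr mulr0 add0r.
    move/eqP; rewrite eq_sym mulf_eq0 (negbTE nzG) orbF gt_eqF //.
  have := tr v; rewrite /= /Phi => /eqP; rewrite subr_eq0 => /eqP H.
  apply: (mulIf (x := F e0 z)); first exact/eqP.
  by rewrite H mulrA mulfVK 1?mulrC //; exact/eqP.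
(* On [N0] the functionals that are nonzero at the exit point keep their signs, and the others are
   multiples of [Phi]; so the sign of [Phi] decides membership in each [Q j]. *)
pose NP (e : II) (v : 'rV[R]_k) : Prop :=
  (F e (y ts) < 0 -> F e v < 0) /\ (0 < F e (y ts) -> 0 < F e v).
pose N0 := [set v | forall e : II, NP e v].
have nN0 : nbhs (y ts) N0.
  apply: (@filter_forall _ _ NP _ (nbhs_filter (y ts))) => e.
  have cF := affine_fun_continuous (aF e) (x := y ts).
  have [hh|hh] := ltP (F e (y ts)) 0.
    have h1 : nbhs (F e (y ts)) [set v | v < 0] by apply: open_nbhs_nbhs; split=> //; exact: open_lt.
    by apply: (near_cont cF h1) => v /= Fv; split=> // ?; lra.
  have [hh'|hh'] := ltP 0 (F e (y ts)).
    have h1 : nbhs (F e (y ts)) [set v | 0 < v] by apply: open_nbhs_nbhs; split=> //; exact: open_gt.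
    by apply: (near_cont cF h1) => v /= Fv; split=> // ?; lra.
  by apply: nearW => v; split=> ?; lra.
have [eN eN0 HeN] := near_y _ _ nN0.
(* The piece met just before the exit contains the whole half [0 <= Phi] of [N0]. A piece reaching
   the other half would also contain points of the segment after the exit. *)
have [j1 Hj1] : exists j1, forall v, N0 v -> 0 <= Phi v -> Q j1 v.
  pose d := Num.min eN (ts / 2).
  have d0 : 0 < d by rewrite lt_min eN0 divr_gt0.
  have dts : d <= ts / 2 by rewrite ge_min lexx orbT.
  have de : d <= eN by rewrite ge_min lexx.
  have [|j1 Qj1] := (iffLR (QE (y (ts + - d)))).
    by apply: before; apply/andP; split; lra.
  have Nd : N0 (y (ts + - d)) by apply: HeN; rewrite normrN gtr0_norm.
  have Pd : 0 < Phi (y (ts + - d)).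
    rewrite Phiy mulrDl divff ?gt_eqF // mulNr; have : 0 < d / ts by rewrite divr_gt0.
    lra.
  exists j1 => v Nv Pv; apply/fE => i; pose e : II := (j1, i).
  change (F e v <= 0).
  have Fed : F e (y (ts + - d)) <= 0 by move/fE: Qj1 => /(_ i).
  have [tr|ntr] := pselect (trivial_fun (F e)); first by rewrite tr.
  have [Nv1 _] := Nv e; have [_ Nd2] := Nd e.
  have [hh|hh|hh] := ltgtP (F e (y ts)) 0; first by apply: ltW; exact: Nv1.
    by have := Nd2 hh; lra.
  rewrite (prop e ntr hh) mulr_le0_ge0 //.
  have := Fed; rewrite (prop e ntr hh) pmulr_lle0 //.
have Hneg v : N0 v -> (g @` K) v -> 0 <= Phi v.
  move=> Nv /QE [j2 Qv]; rewrite leNgt; apply/negP => Pv.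
  have [t /andP[t0 te] nQt] := after _ eN0.
  apply: nQt; apply/QE; exists j2; apply/fE => i; pose e : II := (j2, i).
  have Nt : N0 (y (ts + t)) by apply: HeN; rewrite gtr0_norm.
  change (F e (y (ts + t)) <= 0).
  have Fev : F e v <= 0 by move/fE: Qv => /(_ i).
  have Pt : Phi (y (ts + t)) <= 0.
    rewrite Phiy mulrDl divff ?gt_eqF //; have : 0 < t / ts by rewrite divr_gt0.
    lra.
  have [tr|ntr] := pselect (trivial_fun (F e)); first by rewrite tr.
  have [Nt1 _] := Nt e; have [_ Nv2] := Nv e.
  have [hh|hh|hh] := ltgtP (F e (y ts)) 0; first by apply: ltW; exact: Nt1.
    by have := Nv2 hh; lra.
  rewrite (prop e ntr hh) mulr_ge0_le0 //.
  by move: Fev; rewrite (prop e ntr hh) nmulr_lle0.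
(* Near [xs] everything is sent into [0 <= Phi], hence into [Q j1], and injectivity of [g] puts it
   in [P' j1]. There [g] is the affine bijection [a j1], along which [Phi] changes sign at [xs]:
   this is the contradiction. *)
have nP1 : nbhs xs (P' j1 `&` [set v | 0 <= Phi (a j1 v)]).
  have nN0' : nbhs (g xs) N0 by rewrite gxs.
  apply: (@filterS2 _ (nbhs xs) _ _ _ _ _ nKxs (gcont _ _ nKxs nN0')) => v Kv Nv.
  have Pv : 0 <= Phi (g v) by apply: Hneg => //; exists v.
  have [v' [P1v' Kv'] v'E] := Hj1 _ Nv Pv.
  have vv : v' = v by apply: injg => //; rewrite (gE j1).
  by subst v'; split=> //=; rewrite v'E.
have [P1xs _] := nbhs_singleton nP1.
have axs : a j1 xs = y ts by case: P1xs => ? ?; rewrite -(gE j1).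
have Phixs : Phi (a j1 xs) = 0 by rewrite axs Phiy divff ?gt_eqF // subrr.
have aPa := affine_fun_comp (aa j1) aPhi.
have P1n : nbhs xs (P' j1) by apply: filterS nP1 => v [].
have [b [ab aK bK]] := affine_open (aa j1) P1n (injP j1).
have [e eg He] := near_line (b (y ts + (w - z))) nP1.
have [_ /=] := He e (ltac:(by rewrite gtr0_norm)).
have [_ /=] := He (- e) (ltac:(by rewrite normrN gtr0_norm)).
have L t : Phi (a j1 (xs + t *: (b (y ts + (w - z)) - xs))) = - (t / ts).
  rewrite (affine_fun_line _ _ t aPa : Phi (a j1 _) = _) /= bK Phixs.
  have -> : y ts + (w - z) = y (ts + 1) by rewrite /y -addrA scalerDl scale1r.
  have E3 : (ts + 1) / ts = 1 + ts^-1 by rewrite mulrDl divff ?gt_eqF // mul1r.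
  rewrite Phiy E3; ring.
rewrite !L mulNr opprK; have : 0 < e / ts by rewrite divr_gt0.
lra.
Qed.

End InvarianceOfDomain.

(** * Openness of injective PL germs, in the interior and at the boundary *)

Section OpenGerms.
Variable R : realType.

Definition c0 n (z : 'rV[R]_n.+1) : R := z ord0 ord0.

Definition setc n (s : R) (z : 'rV[R]_n.+1) : 'rV[R]_n.+1 :=
  \row_j (if j == ord0 then s else z ord0 j).

Lemma c0_setc n s (z : 'rV[R]_n.+1) : c0 (setc s z) = s.
Proof. by rewrite /c0 mxE eqxx. Qed.

Lemma setc_id n (z : 'rV[R]_n.+1) : setc (c0 z) z = z.
Proof. by apply/rowP => j; rewrite mxE; case: eqP => [->|]. Qed.

Lemma setc_setc n s t (z : 'rV[R]_n.+1) : setc s (setc t z) = setc s z.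
Proof. by apply/rowP => j; rewrite !mxE; case: eqP. Qed.

Lemma setc_inj n s (z z' : 'rV[R]_n.+1) : setc s z = setc s z' -> c0 z = c0 z' -> z = z'.
Proof.
move=> /rowP H H0; apply/rowP => j; have [->|j0] := eqVneq j ord0; first exact: H0.
by have := H j; rewrite !mxE (negbTE j0).
Qed.

Lemma affine_fun_c0 n : affine_fun (@c0 n).
Proof. exact: affine_fun_coord. Qed.

Lemma affine_setc k n (s : 'rV[R]_k -> R) (z : 'rV[R]_k -> 'rV[R]_n.+1) :
  affine_fun s -> affine z -> affine (fun y => setc (s y) (z y)).
Proof.
move=> as_ az; apply/affine_coord => j; have [->|j0] := eqVneq j ord0.
  by have [u [b H]] := as_; exists u, b => y; rewrite -H mxE eqxx.
have [u [b H]] := (affine_coord z).1 az j.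
by exists u, b => y; rewrite -H mxE (negbTE j0).
Qed.

Lemma inv_domain_fin k (I : finType) (g : 'rV[R]_k -> 'rV[R]_k) (x0 : 'rV[R]_k) (r : R)
    (P : I -> set 'rV[R]_k) (a : I -> 'rV[R]_k -> 'rV[R]_k) :
  0 < r -> (forall j, polyhedron (P j)) -> (forall j, affine (a j)) ->
  (forall z, cube x0 r z -> exists j, P j z) ->
  (forall j z, cube x0 r z -> P j z -> g z = a j z) ->
  inj_on (cube x0 r) g -> nbhs (g x0) (g @` cube x0 r).
Proof.
move=> r0 pP aa cov gE; apply: (inv_domain_raw (m := #|I|)
  (P := fun j => P (enum_val j)) (a := fun j => a (enum_val j))) => // z.
  by move=> /cov [j Pj]; exists (enum_rank j); rewrite enum_rankK.
by move=> ?; exact: gE.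
Qed.

Lemma cube_sub k (x y : 'rV[R]_k) r s : cube x r y -> cube y s `<=` cube x (r + s).
Proof.
move=> xy z yz i; have -> : z ord0 i - x ord0 i =
  (y ord0 i - x ord0 i) + (z ord0 i - y ord0 i) by ring.
by apply: le_trans (ler_normD _ _) _; apply: lerD; [exact: xy|exact: yz].
Qed.

Lemma cubeS k (x : 'rV[R]_k) r s : r <= s -> cube x r `<=` cube x s.
Proof. by move=> rs z xz i; exact: le_trans (xz i) rs. Qed.

Definition refl n (z : 'rV[R]_n.+1) := setc (- c0 z) z.

Lemma reflK n : involutive (@refl n).
Proof. by move=> z; rewrite /refl c0_setc opprK setc_setc setc_id. Qed.

Lemma c0_refl n (z : 'rV[R]_n.+1) : c0 (refl z) = - c0 z.
Proof. exact: c0_setc. Qed.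

Lemma refl_id n (z : 'rV[R]_n.+1) : c0 z = 0 -> refl z = z.
Proof. by move=> z0; rewrite /refl z0 oppr0 -z0 setc_id. Qed.

Lemma affine_refl n : affine (@refl n).
Proof.
apply: affine_setc; last exact: affine_id.
by apply: affine_funN; exact: affine_fun_c0.
Qed.

Lemma nbhs_c0_gt0 n (y : 'rV[R]_n.+1) (V : set 'rV[R]_n.+1) :
  nbhs y V -> (forall z, V z -> 0 <= c0 z) -> 0 < c0 y.
Proof.
move=> Vy H; have [e e0 He] := near_line (setc (c0 y - 1) y) Vy.
have := H _ (He e (ltac:(by rewrite gtr0_norm))).
rewrite affine_fun_line; last exact: affine_fun_c0.
by rewrite c0_setc; lra.
Qed.

(* Doubling along the wall [c0 = 0] reduces this to [inv_domain_fin]. *)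
Lemma inv_domain_half n (I : finType) (g : 'rV[R]_n.+1 -> 'rV[R]_n.+1)
    (x0 : 'rV[R]_n.+1) (r : R)
    (P : I -> set 'rV[R]_n.+1) (a : I -> 'rV[R]_n.+1 -> 'rV[R]_n.+1) :
  let K := cube x0 r `&` [set z | 0 <= c0 z] in
  0 < r -> c0 x0 = 0 -> (forall j, polyhedron (P j)) -> (forall j, affine (a j)) ->
  (forall z, K z -> exists j, P j z) ->
  (forall j z, K z -> P j z -> g z = a j z) ->
  (forall z, K z -> 0 <= c0 (g z)) -> (forall z, K z -> c0 z = 0 -> c0 (g z) = 0) ->
  inj_on K g -> \forall y \near g x0, 0 <= c0 y -> (g @` K) y.
Proof.
move=> K r0 x00 pP aa cov gE g_ge0 g_eq0 injg.
(* Invariance of domain on a cube inside the open half-space. It shows that [g] keeps [c0] positive,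
   without which the double [H] of [g] could fail to be injective. *)
have g_gt0 z : cube x0 (r / 2) z -> 0 < c0 z -> 0 < c0 (g z).
  move=> Kz z0; pose s := Num.min (r / 2) (c0 z).
  have s0 : 0 < s by rewrite lt_min divr_gt0.
  have sK : cube z s `<=` K.
    move=> w zw; split.
      have [sr1 sr2] : s <= r / 2 /\ s <= c0 z by rewrite !ge_min !lexx orbT.
      by apply: (cubeS (_ : r / 2 + s <= r)); [lra|exact: cube_sub zw].
    have [sr1 sr2] : s <= r / 2 /\ s <= c0 z by rewrite !ge_min !lexx orbT.
    by have := zw ord0; rewrite -/(c0 w) -/(c0 z) ler_norml /= => /andP[? ?]; lra.
  have /nbhs_c0_gt0 : nbhs (g z) (g @` cube z s).
    apply: (inv_domain_fin (P := P) (a := a)) => //.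
    - by move=> w /sK /cov.
    - by move=> j w /sK; exact: gE.
    - by move=> w w' /sK Kw /sK; exact: injg.
  by apply => _ [w /sK Kw <-]; exact: g_ge0.
pose H z := if 0 <= c0 z then g z else refl (g (refl z)).
have cr z s : cube x0 s z -> cube x0 s (refl z).
  move=> Kz j; have := Kz j; rewrite mxE; case: eqP => [->|//].
  by rewrite -/(c0 x0) -/(c0 z) x00 !subr0 normrN.
have r2 : 0 < r / 2 by rewrite divr_gt0.
have rr2 : r / 2 <= r by lra.
have KK z : cube x0 (r / 2) z -> 0 <= c0 z -> K z.
  by move=> /(cubeS rr2).
have KK' z : cube x0 (r / 2) z -> c0 z < 0 -> K (refl z).
  by move=> Kz z0; apply: KK; [exact: cr|rewrite c0_refl; lra].
have HP z : cube x0 (r / 2) z -> (0 <= c0 (H z)) = (0 <= c0 z).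
  move=> Kz; rewrite /H; have [h|h] := leP 0 (c0 z); first by rewrite g_ge0 //; exact: KK.
  rewrite c0_refl oppr_ge0; apply/negbTE; rewrite -ltNge.
  by apply: g_gt0; [exact: cr|rewrite c0_refl; lra].
have nH : nbhs (H x0) (H @` cube x0 (r / 2)).
  apply: (inv_domain_fin (I := (I + I)%type)
    (P := fun j => match j with inl j => P j `&` [set z | 0 <= c0 z]
        | inr j => @refl n @^-1` (P j `&` [set z | 0 <= c0 z]) end)
    (a := fun j => match j with inl j => a j | inr j => @refl n \o (a j \o @refl n) end)) => //.
  - have ph : polyhedron [set z : 'rV[R]_n.+1 | 0 <= c0 z].
      rewrite (_ : mkset _ = [set z | - c0 z <= 0]).
        by apply: polyhedron_le0; apply: affine_funN; exact: affine_fun_c0.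
      by apply/seteqP; split=> z /=; rewrite oppr_le0.
    case=> j; first exact: polyhedronI.
    by apply: polyhedron_preimage; [exact: affine_refl|exact: polyhedronI].
  - case=> j //; apply: affine_comp; last exact: affine_refl.
    by apply: affine_comp => //; exact: affine_refl.
  - move=> z Kz; have [h|h] := leP 0 (c0 z).
      by have [j Pj] := cov _ (KK _ Kz h); exists (inl j).
    have [j Pj] := cov _ (KK' _ Kz h); exists (inr j); split=> //=.
    by rewrite c0_refl; lra.
  - case=> j z Kz [Pj h]; rewrite /H.
      by rewrite h; apply: gE => //; exact: KK.
    have rh : 0 <= c0 (refl z) := h.
    have Krz : K (refl z) by apply: KK => //; exact: cr.
    have [h'|h'] := leP 0 (c0 z); last by rewrite (gE j).
    have z0 : c0 z = 0 by move: rh; rewrite c0_refl; lra.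
    rewrite /= -(gE j) // (refl_id z0) refl_id //.
    by apply: g_eq0 => //; exact: KK.
  - move=> z w Kz Kw HE; have := HP _ Kz; rewrite HE HP // => S.
    move: HE; rewrite /H -S; case: ifP => [h|/negbT]; last first.
      rewrite -ltNge => h; have zh : c0 z < 0 by rewrite ltNge -S -ltNge.
      move=> /(can_inj (@reflK n)) /injg HE.
      by apply: (can_inj (@reflK n)); apply: HE; exact: KK'.
    by apply: injg; [apply: KK => //; rewrite -S|exact: KK].
have Hx0 : H x0 = g x0 by rewrite /H x00 lexx.
rewrite -Hx0; apply: (@filterS _ (nbhs (H x0)) _ _ _ _ nH) => _ [z Kz <-].
rewrite HP // /H => h; rewrite h; exists z => //; exact: KK.
Qed.

Section Plg.
Variable T : topologicalType.

(** Converts a germ into the data of the two invariance theorems: [g] is [q] composed with the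
    inverse of [p], affine on finitely many polyhedra that cover the part of a cube in [H]. Here [H]
    is the local model, the whole space or a half-space. *)
Lemma plg_cube k l (A : set T) (p : T -> 'rV[R]_k) (q : T -> 'rV[R]_l) x O
    (H : set 'rV[R]_k) :
  A x -> inj_on A p -> inv_at A p x -> nbhs x O ->
  (\forall y \near p x, H y -> (p @` A) y) -> plg A p q x ->
  exists r, 0 < r /\ exists g m (P : 'I_m -> set 'rV[R]_k) a,
  [/\ forall j, polyhedron (P j) /\ affine (a j),
      forall z, cube (p x) r z -> H z ->
        (exists j, P j z) /\ exists2 w, (A `&` O) w & p w = z,
      forall j z, cube (p x) r z -> H z -> P j z -> g z = a j z
    & forall w, A w -> g (p w) = q w].
Proof.
move=> Ax injp vp Ox pA [m [P [HP Hx]]].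
have /choice [a Ha] : forall j, exists a, affine a /\
    forall z, A z -> P j (p z) -> q z = a (p z).
  by move=> j; have [_ _ [a ? ?]] := HP j; exists a.
have [r r0 Hr] := nbhs_cube (filterI pA (vp _ (filterI Ox Hx))).
pose g y := xget 0 [set w | exists2 z, A z & p z = y /\ q z = w].
have gE z : A z -> g (p z) = q z.
  move=> Az; rewrite /g; case: xgetP => [w _ [z' Az' [zz' <-]]|].
    by rewrite (injp z' z).
  by move=> /(_ (q z)) []; exists z.
exists r; split=> //; exists g, m, P, a; split=> //.
- by move=> j; split; [case: (HP j)|case: (Ha j)].
- move=> z cz Hz; have [/(_ Hz) [w Aw wz] /(_ w Aw wz) [Ow Hw]] := Hr _ cz.
  by split; [rewrite -wz; exact: Hw|exists w].
move=> j z cz Hz Pz; have [/(_ Hz) [w Aw wz] _] := Hr _ cz.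
by rewrite -wz gE // (proj2 (Ha j)) // wz.
Qed.

Lemma plg_open k (A : set T) (p q : T -> 'rV[R]_k) x O :
  A x -> inj_on A p -> inv_at A p x -> inj_on A q -> nbhs (p x) (p @` A) ->
  plg A p q x -> nbhs x O -> nbhs (q x) (q @` (A `&` O)).
Proof.
move=> Ax injp vp injq pA Hpl Ox.
have [|r [r0 [g [m [P [a [H1 H2 H3 gE]]]]]]] :=
  plg_cube (H := setT) Ax injp vp Ox _ Hpl; first by apply: filterS pA => y.
have : nbhs (g (p x)) (g @` cube (p x) r).
  apply: (inv_domain_fin (P := P) (a := a)) => //; try by move=> j; case: (H1 j).
  - by move=> z cz; case: (H2 z cz).
  - by move=> j z cz; exact: H3.
  - move=> y z cy cz; have [_ [w [Aw _] <-]] := H2 y cy I.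
    by have [_ [w' [Aw' _] <-]] := H2 z cz I; rewrite !gE // => /injq ->.
rewrite gE // => N; apply: (@filterS _ (nbhs (q x)) _ _ _ _ N) => _ [z cz <-].
by have [_ [w AOw <-]] := H2 z cz I; exists w => //; rewrite gE //; case: AOw.
Qed.

Lemma plg_open_half n (A : set T) (p q : T -> 'rV[R]_n.+1) x O :
  A x -> inj_on A p -> inv_at A p x -> inj_on A q -> c0 (p x) = 0 ->
  (\forall y \near p x, 0 <= c0 y -> (p @` A) y) ->
  (forall z, A z -> 0 <= c0 (q z)) -> (forall z, A z -> c0 (p z) = 0 -> c0 (q z) = 0) ->
  plg A p q x -> nbhs x O -> \forall y \near q x, 0 <= c0 y -> (q @` (A `&` O)) y.
Proof.
move=> Ax injp vp injq px0 pA q_ge0 q_eq0 Hpl Ox.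
have [r [r0 [g [m [P [a [H1 H2 H3 gE]]]]]]] :=
  plg_cube (H := [set y | 0 <= c0 y]) Ax injp vp Ox pA Hpl.
have : \forall y \near g (p x), 0 <= c0 y ->
    (g @` (cube (p x) r `&` [set z | 0 <= c0 z])) y.
  apply: (inv_domain_half (P := P) (a := a)) => //; try by move=> j; case: (H1 j).
  - by move=> z [cz hz]; case: (H2 z cz hz).
  - by move=> j z [cz hz]; exact: H3.
  - by move=> z [cz hz]; have [_ [w [Aw _] <-]] := H2 z cz hz; rewrite gE //; exact: q_ge0.
  - by move=> z [cz hz]; have [_ [w [Aw _] <-]] := H2 z cz hz; rewrite gE //; exact: q_eq0.
  - move=> y z [cy hy] [cz hz]; have [_ [w [Aw _] <-]] := H2 y cy hy.
    by have [_ [w' [Aw' _] <-]] := H2 z cz hz; rewrite !gE // => /injq ->.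
rewrite gE // => N; apply: (@filterS _ (nbhs (q x)) _ _ _ _ N) => y Hy /Hy [z [cz hz] <-].
by have [_ [w AOw <-]] := H2 z cz hz; exists w => //; rewrite gE //; case: AOw.
Qed.

End Plg.
End OpenGerms.

(** * Charts and submanifolds *)

Section Charts.
Variable R : realType.

Lemma open_near (T : topologicalType) (O : set T) (x : T) : open O -> O x -> \forall z \near x, O z.
Proof. by move=> oO Ox; apply: open_nbhs_nbhs. Qed.

Lemma cont_at_sub (T Y : topologicalType) (A B : set T) (f : T -> Y) x :
  B `<=` A -> cont_at A f x -> cont_at B f x.
Proof. by move=> BA H V /H; apply: filterS => z Hz /BA. Qed.

Lemma inv_at_sub (T Y : topologicalType) (A B : set T) (f : T -> Y) x :
  B `<=` A -> inv_at A f x -> inv_at B f x.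
Proof. by move=> BA H V /H; apply: filterS => y Hy z /BA; exact: Hy. Qed.

Lemma inj_on_sub T Y (A B : set T) (f : T -> Y) : B `<=` A -> inj_on A f -> inj_on B f.
Proof. by move=> BA H x y /BA ? /BA; exact: H. Qed.

Lemma emb_on_sub (T Y : topologicalType) (A B : set T) (f : T -> Y) :
  B `<=` A -> emb_on A f -> emb_on B f.
Proof.
move=> BA [c i v]; split; [move=> x /BA /c|exact: inj_on_sub i|move=> x /BA /v].
  exact: cont_at_sub.
exact: inv_at_sub.
Qed.

Lemma cont_at_near (T Y : topologicalType) (A B : set T) (f g : T -> Y) x :
  (\forall z \near x, B z -> A z /\ f z = g z) -> f x = g x ->
  cont_at A f x -> cont_at B g x.
Proof.
move=> H fgx cf V; rewrite -fgx => /cf Vf.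
by apply: filterS2 H Vf => z Hz Vz /Hz [/Vz + <-].
Qed.

Lemma cont_at_ext (T Y : topologicalType) (A : set T) (f g : T -> Y) x :
  (forall z, A z -> f z = g z) -> A x -> cont_at A f x -> cont_at A g x.
Proof.
by move=> fg Ax; apply: cont_at_near; [apply: nearW => z Az; split=> //; exact: fg|exact: fg].
Qed.

Lemma cont_at_comp (S T Y : topologicalType) (A : set S) (B : set T)
    (f : S -> T) (g : T -> Y) x :
  cont_at A f x -> (forall z, A z -> B (f z)) -> cont_at B g (f x) ->
  cont_at A (g \o f) x.
Proof.
move=> cf AB cg V /cg /cf; apply: filterS => z H Az; apply: H => //.
exact: AB.
Qed.

Lemma cont_on_comp (S T Y : topologicalType) (A : set S) (B : set T)
    (f : S -> T) (g : T -> Y) :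
  cont_on A f -> (forall z, A z -> B (f z)) -> cont_on B g -> cont_on A (g \o f).
Proof.
by move=> cf AB cg x Ax; apply: (cont_at_comp (cf _ Ax) AB); apply: cg; exact: AB.
Qed.

Lemma cont_on_sub (T Y : topologicalType) (A B : set T) (f : T -> Y) :
  B `<=` A -> cont_on A f -> cont_on B f.
Proof. by move=> BA H x /BA /H; exact: cont_at_sub. Qed.

Lemma cont_on_ext (T Y : topologicalType) (A : set T) (f g : T -> Y) :
  (forall z, A z -> f z = g z) -> cont_on A f -> cont_on A g.
Proof. by move=> fg H x Ax; apply: (cont_at_ext fg) => //; exact: H. Qed.

Lemma continuous_cont_on (T Y : topologicalType) (A : set T) (f : T -> Y) :
  continuous f -> cont_on A f.
Proof. by move=> cf x _ V Vf; apply: (near_cont (cf x) Vf). Qed.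

Lemma cont_onT (T Y : topologicalType) (f : T -> Y) : cont_on setT f <-> continuous f.
Proof.
split; last exact: continuous_cont_on.
by move=> cf x V /(cf x I); apply: filterS => z; exact.
Qed.

(** Injectivity of [d] on the image of [A] and [D] together identifies [f z] with the point of [D]
    provided by a piece of the second germ; so the composite pieces stay in the required image. *)
Lemma plg_comp_map (S T : topologicalType) k l p (f : S -> T) (A : set S) (D : set T)
    (phi : S -> 'rV[R]_k) (d : T -> 'rV[R]_l) (psi : T -> 'rV[R]_p) x :
  cont_at A f x -> inj_on (f @` A `|` D) d ->
  plg A phi (d \o f) x -> plg D d psi (f x) ->
  plg (A `&` f @^-1` D) phi (psi \o f) x.
Proof.
move=> cf injd [m [P [HP Hx]]] [q [Q [HQ Hx']]].
have /choice [a Ha] : forall j, exists a, affine a /\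
    forall z, A z -> P j (phi z) -> d (f z) = a (phi z).
  by move=> j; have [_ _ [a ? ?]] := HP j; exists a.
apply: (@plg_fin _ _ _ _ ('I_m * 'I_q)%type
  (fun ij => P ij.1 `&` a ij.1 @^-1` Q ij.2)).
  move=> [i j] /=; have [pP PA _] := HP i; have [pQ QD [b ab bE]] := HQ j.
  have [ai aE] := Ha i; split.
  - by apply: polyhedronI => //; exact: polyhedron_preimage.
  - move=> y [Py /= Qy]; have [z Az zy] := PA _ Py; exists z => //; split=> //=.
    have [w Dw wE] := QD _ Qy.
    rewrite (_ : f z = w) //; apply: injd; [by left; exists z|by right|].
    by rewrite wE -zy aE // zy.
  exists (b \o a i); first exact: affine_comp.
  move=> z [Az Dz] [Pz /= Qz]; rewrite -aE //; apply: bE => //.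
  by rewrite aE.
apply: filterS2 Hx (cf _ Hx') => z Hz Hz' [Az Dz].
have [i Pi] := Hz Az; have [j Qj] := Hz' Az Dz.
by exists (i, j); split=> //=; have [_ <-] := Ha i.
Qed.

Lemma is_chart_emb (T : topologicalType) k (c : chart R T k) :
  is_chart c -> open (chart_dom c) /\ emb_on (chart_dom c) (chart_map c).
Proof.
move=> [oc cc ic ec]; split=> //; split=> //.
  by move=> x /cc H V Vf; apply: (near_cont H Vf).
move=> x cx V Vx.
have [W [oO' E]] := ec (V° `&` chart_dom c) (openI (open_interior V) oc) (@subIsetr _ _ _).
have : W (chart_map c x).
  have : (chart_map c @` (V° `&` chart_dom c)) (chart_map c x).
    by exists x => //; split=> //; exact: nbhs_interior.
  by rewrite E => -[].
move=> /(open_near oO'); apply: filterS => y Oy z cz zy.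
have : (chart_map c @` (V° `&` chart_dom c)) y by rewrite E; split=> //; exists z.
move=> [w [Vw cw] wy]; rewrite (ic z w) ?zy ?wy //.
exact: interior_subset.
Qed.

Lemma emb_is_chart (T : topologicalType) k (c : chart R T k) :
  open (chart_dom c) -> emb_on (chart_dom c) (chart_map c) -> is_chart c.
Proof.
move=> oc [cc ic vc]; split=> //.
  move=> x cx V Vf; apply: filterS2 (open_near oc cx) (cc x cx _ Vf) => z cz.
  exact.
move=> O oO Oc; exists ([set y | forall z, chart_dom c z -> chart_map c z = y -> O z]°).
split; first exact: open_interior.
apply/seteqP; split=> [_ [x Ox <-]|y [/interior_subset /= Hy [x cx xy]]].
  split; last by exists x => //; exact: Oc.
  by apply: vc; [exact: Oc|exact: open_near].
by exists x => //; exact: Hy xy.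
Qed.

(* [is_pl_space] without the Hausdorff and countability axioms. *)
Definition pl_axioms (X : plSpace R) : Prop :=
  [/\ forall x : X, exists k (c : chart R X k), pl_atlas X k c /\ chart_dom c x,
      forall k (c : chart R X k), pl_atlas X k c -> is_chart c
    & forall k l (c : chart R X k) (d : chart R X l),
        pl_atlas X k c -> pl_atlas X l d -> chart_compat c d].

Lemma is_pl_space_axioms (X : plSpace R) : is_pl_space X -> pl_axioms X.
Proof. by case. Qed.

Coercion is_pl_space_axioms : is_pl_space >-> pl_axioms.

Section Space.
Variable X : plSpace R.
Hypothesis X_pl : pl_axioms X.

(* [phi] is a chart of the subset [A], compatible with the atlas. *)
Definition rchart k (A : set X) (phi : X -> 'rV[R]_k) : Prop :=
  emb_on A phi /\ forall l (c : chart R X l), pl_atlas X l c ->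
    forall x, A x -> chart_dom c x ->
      plg (A `&` chart_dom c) (chart_map c) phi x /\
      plg (A `&` chart_dom c) phi (chart_map c) x.

Lemma atlas_emb k (c : chart R X k) : pl_atlas X k c ->
  open (chart_dom c) /\ emb_on (chart_dom c) (chart_map c).
Proof. by case: X_pl => _ H _ /H /is_chart_emb. Qed.

Lemma atlas_cover x : exists k (c : chart R X k), pl_atlas X k c /\ chart_dom c x.
Proof. by case: X_pl. Qed.

Lemma chart_compat_plg (T : topologicalType) k l (c : chart R T k) (d : chart R T l) x :
  is_chart c -> is_chart d -> chart_dom c x -> chart_dom d x ->
  chart_compat c d ->
  plg (chart_dom c `&` chart_dom d) (chart_map c) (chart_map d) x /\
  plg (chart_dom c `&` chart_dom d) (chart_map d) (chart_map c) x.
Proof.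
move=> /is_chart_emb [_ [cc _ _]] /is_chart_emb [_ [cd _ _]] cx dx [h1 h2].
split; (apply: pl_factor_plg => //; apply: cont_at_sub;
  [|by [exact: cc|exact: cd]] => z []) => //.
Qed.

Lemma compat_rchart k (c : chart R X k) : is_chart c ->
  (forall l (d : chart R X l), pl_atlas X l d -> chart_compat c d) ->
  rchart (chart_dom c) (chart_map c).
Proof.
move=> hc H; have [_ ec] := is_chart_emb hc; split=> // l d ad x cx dx.
have hd : is_chart d by case: X_pl => _ + _; exact.
by have [h1 h2] := chart_compat_plg hc hd cx dx (H _ _ ad).
Qed.

Lemma atlas_rchart k (c : chart R X k) : pl_atlas X k c ->
  rchart (chart_dom c) (chart_map c).
Proof.
move=> ac; apply: compat_rchart => [|l d ad]; case: X_pl => _ h1 h2.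
  exact: h1.
exact: h2.
Qed.

Lemma manifold_chart_rchart n (c : chart R X n.+1) : manifold_chart c ->
  rchart (chart_dom c) (chart_map c).
Proof. by move=> [h1 h2 _]; apply: compat_rchart. Qed.

(** Both maps are PL against one chart of the atlas around [x], and the germs compose through it.
    The restriction to the domain of that chart is then removed by [plg_enlarge]. *)
Lemma rchart_plg k l (A B : set X) (phi : X -> 'rV[R]_k) (psi : X -> 'rV[R]_l) x :
  rchart A phi -> rchart B psi -> A x -> B x -> plg (A `&` B) phi psi x.
Proof.
move=> [eA HA] [eB HB] Ax Bx; have [p [c [ac cx]]] := atlas_cover x.
have [oc [_ ic _]] := atlas_emb ac.
have [h1 h2] := HA _ c ac x Ax cx; have [h3 h4] := HB _ c ac x Bx cx.
have h : plg ((A `&` chart_dom c) `&` id @^-1` (B `&` chart_dom c)) phi (psi \o id) x.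
  apply: (plg_comp_map (d := chart_map c)) => //.
  - by apply: (continuous_cont_on (A := A `&` chart_dom c)) => // y; exact: cvg_id.
  - by apply: inj_on_sub ic => y [[z [_ ?] <-]|[]].
apply: plg_enlarge h.
- by case: eA => _ i _; apply: inj_on_sub i => y [].
- by move=> y [[? ?] [? ?]].
- by apply: filterS (open_near oc cx) => y cy [? ?]; split.
Qed.

Lemma rchart_self k (A : set X) (phi : X -> 'rV[R]_k) x :
  rchart A phi -> A x -> plg A phi phi x.
Proof. by move=> H Ax; have := rchart_plg H H Ax Ax; rewrite setIid. Qed.

(** A subset can only lose local polyhedrality of its image, which is what the germ of [phi] over
    itself on [B] records. *)
Lemma rchart_sub k (A B : set X) (phi : X -> 'rV[R]_k) :
  rchart A phi -> B `<=` A -> (forall x, B x -> plg B phi phi x) -> rchart B phi.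
Proof.
move=> [eA HA] BA HB; split=> [|l c ac x Bx cx]; first exact: emb_on_sub eA.
have [h1 h2] := HA _ c ac x (BA _ Bx) cx.
have [oc [_ ic _]] := atlas_emb ac; have [_ iA _] := eA.
have h3 : plg (B `&` chart_dom c) phi (chart_map c) x.
  have -> : B `&` chart_dom c = (A `&` chart_dom c) `&` B.
    apply/seteqP; split=> z; first by move=> [? ?]; split=> //; split=> //; exact: BA.
    by move=> [[? ?] ?].
  apply: plg_inter => //; last exact: HB.
  by apply: inj_on_sub iA => z [[]|/BA].
split=> //; apply: plg_inv => //.
by apply: inj_on_sub ic => z [].
Qed.

Lemma rchart_open k (A O : set X) (phi : X -> 'rV[R]_k) :
  rchart A phi -> open O -> rchart (A `&` O) phi.
Proof.
move=> H oO; have [[cA iA vA] _] := H.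
apply: (rchart_sub H) => [z []//|x [Ax Ox]].
apply: (plg_shrink (A := A)); [exact: cA|exact: vA|by move=> z []| |].
  by apply: filterS (open_near oO Ox) => z; split.
exact: rchart_self.
Qed.

End Space.
End Charts.

(** * PL embeddings, submanifolds and subspaces *)

Section Embeddings.
Variable R : realType.

Lemma cont_atT (T Y : topologicalType) (f : T -> Y) x :
  cont_at setT f x -> continuous_at x f.
Proof.
move=> H V Vf; apply: (@filterS _ (nbhs x) _ _ _ _ (H V Vf)) => z; exact.
Qed.

Lemma set_valE' T (A : set T) (x : A) : A (set_val x).
Proof. by case: x => x xA; rewrite set_valE /=; exact: set_mem. Qed.

Definition toset T (A : set T) (x : T) (Ax : A x) : A := exist _ x (mem_set Ax).

Lemma set_val_toset T (A : set T) (x : T) (Ax : A x) : set_val (toset Ax) = x.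
Proof. by rewrite set_valE. Qed.

Lemma set_val_inj T (A : set T) : injective (set_val : A -> T).
Proof. by move=> x y; rewrite set_valE => /val_inj. Qed.

Lemma set_val_image T (A : set T) : set_val @` [set: A] = A.
Proof.
apply/seteqP; split=> [_ [x _ <-]|x Ax]; first exact: set_valE'.
by exists (toset Ax); rewrite ?set_val_toset.
Qed.

Lemma set_val_emb (T : topologicalType) (A : set T) :
  emb_on [set: A] (set_val : A -> T).
Proof.
split.
- by apply/cont_onT; exact: initial_continuous.
- by move=> x y _ _; exact: set_val_inj.
move=> x _ V; rewrite nbhsE => -[W [[ O oO <-] /= Ox] WV].
apply: filterS (open_near oO Ox) => y Oy z _ zy; apply: WV => /=.
by rewrite zy.
Qed.

(* [f \o j^-1], with junk values outside of [j @` B]. *)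
Definition transp S T k (B : set S) (j : S -> T) (f : S -> 'rV[R]_k) (y : T) : 'rV[R]_k :=
  xget 0 [set w | exists x, [/\ B x, j x = y & f x = w]].

Lemma transpE S T k (B : set S) (j : S -> T) (f : S -> 'rV[R]_k) x :
  inj_on B j -> B x -> transp B j f (j x) = f x.
Proof.
move=> ij Bx; rewrite /transp; case: xgetP => [w _ [x' [Bx' xx' <-]]|].
  by rewrite (ij x' x).
by move=> /(_ (f x)) []; exists x.
Qed.

(** The PL condition is put on [j]; [plg_inv] yields it for the inverse on the image. *)
Definition pl_emb (X T : plSpace R) (j : X -> T) : Prop :=
  emb_on setT j /\ forall k l (c : chart R X k) (d : chart R T l),
    pl_atlas X k c -> pl_atlas T l d -> forall x, chart_dom c x -> chart_dom d (j x) ->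
    plg (chart_dom c `&` j @^-1` chart_dom d) (chart_map c) (chart_map d \o j) x.

Section PushPull.
Variables (X T : plSpace R).
Hypotheses (X_pl : pl_axioms X) (T_pl : pl_axioms T).

Lemma emb_push (S S' : topologicalType) k (B : set S) (j : S -> S')
    (f : S -> 'rV[R]_k) (f' : S' -> 'rV[R]_k) :
  emb_on B j -> emb_on B f -> (forall x, B x -> f' (j x) = f x) -> emb_on (j @` B) f'.
Proof.
move=> [cj ij vj] [cf i_f vf] E; split.
- move=> _ [x Bx <-] V; rewrite E // => Vf.
  apply: filterS (vj _ Bx _ (cf _ Bx _ Vf)) => y Hy [z Bz zy].
  by rewrite -zy E //; exact: (Hy z Bz zy Bz).
- by move=> _ _ [x Bx <-] [y By <-]; rewrite !E // => /i_f ->.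
move=> _ [x Bx <-] V Vj; rewrite E //.
have := vf _ Bx _ (cj _ Bx _ Vj).
apply: (@filterS _ (nbhs (f x))) => y Hy _ [z Bz <-]; rewrite E // => zy.
exact: (Hy z Bz zy Bz).
Qed.

Lemma emb_comp (S S' S'' : topologicalType) (A : set S) (B : set S')
    (j : S -> S') (f : S' -> S'') :
  emb_on A j -> (forall x, A x -> B (j x)) -> emb_on B f -> emb_on A (f \o j).
Proof.
move=> [cj ij vj] AB [cf i_f vf]; split.
- exact: (cont_on_comp cj AB).
- by move=> x y Ax Ay /= /i_f /ij; apply=> //; exact: AB.
move=> x Ax V /(vj _ Ax) /(vf _ (AB _ Ax)).
apply: filterS => y Hy z Az zy; exact: (Hy (j z) (AB _ Az) zy z Az).
Qed.

Lemma rchart_push (j : X -> T) k (B : set X) (phi : X -> 'rV[R]_k) (phi' : T -> 'rV[R]_k) :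
  pl_emb j -> rchart B phi -> (forall x, B x -> phi' (j x) = phi x) ->
  rchart (j @` B) phi'.
Proof.
move=> [ej pj] [eB HB] E; have ejB := emb_on_sub (@subsetT _ B) ej.
have e' : emb_on (j @` B) phi' by exact: emb_push E.
split=> // l d ad _ [x Bx <-] dx.
have [k' [c [ac cx]]] := atlas_cover X_pl x.
have [oc [_ ic _]] := atlas_emb X_pl ac; have [od [_ jd vd]] := atlas_emb T_pl ad.
have [h1 h2] := HB _ c ac x Bx cx.
have h3 := pj _ _ c d ac ad x cx dx.
have [[cj ij vj] [cB iB vB]] := (ej, eB).
have h : plg (B `&` j @^-1` chart_dom d) phi (chart_map d \o j) x.
  have : plg ((B `&` chart_dom c) `&` (@id X) @^-1` (chart_dom c `&` j @^-1` chart_dom d))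
      phi ((chart_map d \o j) \o id) x.
    apply: (plg_comp_map (d := chart_map c)) => //.
      by apply: (continuous_cont_on (A := B `&` chart_dom c)) => // y; exact: cvg_id.
    by apply: inj_on_sub ic => y [[z [_ ?] <-]|[]].
  apply: plg_enlarge.
  - by apply: inj_on_sub iB => y [].
  - by move=> y [[? ?] [? ?]].
  - by apply: filterS (open_near oc cx) => y cy [? ?]; split.
have i' : inj_on (B `&` j @^-1` chart_dom d) (chart_map d \o j).
  by move=> y z [_ dy] [_ dz] /= /jd => /(_ dy dz) /ij; apply.
have vjB : inv_at (B `&` j @^-1` chart_dom d) j x.
  by apply: inv_at_sub (vj x I).
have P k1 k2 (f : T -> 'rV[R]_k1) (g : T -> 'rV[R]_k2) :
    plg (B `&` j @^-1` chart_dom d) (f \o j) (g \o j) x ->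
    plg (j @` B `&` chart_dom d) f g (j x).
  apply: plg_push => //; first by move=> y [By dy]; split=> //; exists y.
  by move=> _ [[y By <-] dy]; exists y.
by split; apply: P; [apply: plg_inv => //|]; apply: plg_ext h => // y [By _] /=;
  rewrite E.
Qed.

Lemma rchart_pull (j : X -> T) k (B : set T) (phi : T -> 'rV[R]_k) :
  pl_emb j -> rchart B phi -> B `<=` range j -> rchart (j @^-1` B) (phi \o j).
Proof.
move=> [ej pj] [eB HB] Bj; have [cj ij vj] := ej; have [cB iB vB] := eB.
have e' : emb_on (j @^-1` B) (phi \o j).
  by apply: (emb_comp _ _ eB) => //; exact: emb_on_sub ej.
split=> // l c ac x Bx cx.
have [k' [d [ad dx]]] := atlas_cover T_pl (j x).
have [oc [cc ic vc]] := atlas_emb X_pl ac; have [od [_ jd vd]] := atlas_emb T_pl ad.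
have [h1 h2] := HB _ d ad (j x) Bx dx.
have h3 := pj _ _ c d ac ad x cx dx.
have h4 : plg (j @^-1` B `&` j @^-1` chart_dom d) (phi \o j) (chart_map d \o j) x.
  apply: plg_pull h2 => //.
    by apply: cont_atT; exact: cj.
  by move=> y [/[dup] By /Bj [z _ zy] dy]; exists z => //; rewrite /= zy.
have nd : \forall z \near x, chart_dom d (j z).
  by apply: filterS (cj x I _ (open_near od dx)) => z; exact.
have i3 : inj_on (chart_dom c `&` j @^-1` chart_dom d) (chart_map d \o j).
  by move=> y z [_ dy] [_ dz] /= /jd => /(_ dy dz) /ij; apply.
have h : plg (j @^-1` B `&` chart_dom c) (phi \o j) (chart_map c) x.
  have : plg ((j @^-1` B `&` j @^-1` chart_dom d) `&`
      (@id X) @^-1` (chart_dom c `&` j @^-1` chart_dom d))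
      (phi \o j) (chart_map c \o (@id X)) x.
    apply: (plg_comp_map (d := chart_map d \o j)) => //.
    - by apply: (continuous_cont_on (A := j @^-1` B `&` j @^-1` chart_dom d)) => // y; exact: cvg_id.
    - move=> y z hy hz /= E; apply: ij => //; apply: jd => //.
        by case: hy => [[w [_ ?] <-]|[]].
      by case: hz => [[w [_ ?] <-]|[]].
    - exact: plg_inv.
  apply: plg_enlarge.
  - by case: e' => _ i' _; apply: inj_on_sub i' => y [].
  - by move=> y [[? ?] [? ?]].
  - by apply: filterS nd => y dy [? ?]; split.
split=> //; apply: plg_inv => //.
by apply: inj_on_sub ic => y [].
Qed.

End PushPull.

Lemma pl_emb_id (X : plSpace R) : is_pl_space X -> pl_emb (@id X).
Proof.
move=> X_pl; split.
  split=> //; first by apply/cont_onT => x; exact: cvg_id.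
  by move=> x _ V Vx; apply: filterS Vx => y Vy z _ ->.
move=> k l c d ac ad x cx dx.
exact: (rchart_plg X_pl (atlas_rchart X_pl ac) (atlas_rchart X_pl ad) cx dx).
Qed.

(* [V] is a manifold in [T] with boundary [B]. *)
Definition smf n (T : plSpace R) (V B : set T) : Prop :=
  forall x, V x -> exists D (phi : T -> 'rV[R]_n.+1),
    [/\ open D /\ D x, rchart (V `&` D) phi,
        exists2 O, open O & phi @` (V `&` D) = O `&` @half_space R n
      & forall z, V z -> D z -> (B z <-> c0 (phi z) = 0)].

(** Otherwise [psi] would map a neighbourhood of [x] onto a neighbourhood of [psi x], and invariance
    of domain would make [phi] open at [x], against [0 <= c0] with equality at [phi x]. Hence the
    boundary does not depend on the chart. *)
Lemma half_chart_boundary n (X : plSpace R) (A B : set X) (phi psi : X -> 'rV[R]_n.+1) x :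
  is_pl_space X -> rchart A phi -> rchart B psi -> nbhs x A -> nbhs x B ->
  (forall z, A z -> 0 <= c0 (phi z)) ->
  (exists2 O, open O & psi @` B = O `&` @half_space R n) ->
  c0 (phi x) = 0 -> c0 (psi x) = 0.
Proof.
move=> X_pl rA rB nA nB phi0 [ O oO BE] px0.
have [Ax Bx] := (nbhs_singleton nA, nbhs_singleton nB).
have [[cA iA vA] _] := rA; have [[cB iB vB] _] := rB.
have : (O `&` @half_space R n) (psi x) by rewrite -BE; exists x.
move=> [Ox px]; apply/eqP; rewrite -[_ == _]negbK; apply/negP => nx.
have px1 : 0 < c0 (psi x) by rewrite lt_neqAle eq_sym nx.
have nO : nbhs (psi x) (psi @` (B `&` A)).
  have h : nbhs (psi x) (psi @` B).
    rewrite BE; apply: (@filterI _ (nbhs (psi x))); first exact: (open_near oO Ox).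
    have : nbhs (c0 (psi x)) [set t | 0 < t] by apply: open_nbhs_nbhs; split=> //; exact: open_gt.
    move=> h; apply: (near_cont (affine_fun_continuous (affine_fun_c0 R n) (x := psi x)) h).
    by move=> y /ltW.
  apply: (@filterS2 _ (nbhs (psi x)) _ _ _ _ _ h (vB _ Bx _ nA)) => _ [y By <-] /(_ y By erefl) Ay.
  by exists y.
have pl : plg (B `&` A) psi phi x by exact: (rchart_plg X_pl rB rA).
have BAx : (B `&` A) x by [].
have nT : nbhs x setT by exact: filterT.
have := plg_open BAx (inj_on_sub (@subIsetl _ B A) iB)
  (inv_at_sub (@subIsetl _ B A) (vB _ Bx)) (inj_on_sub (@subIsetr _ B A) iA) nO pl nT.
move=> /nbhs_c0_gt0; rewrite px0 ltxx => H.
have // : false by apply: H => _ [z [[_ Az] _] <-]; exact: phi0.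
Qed.

Lemma manifold_chart_half n (X : plSpace R) (c : chart R X n.+1) : manifold_chart c ->
  (forall z, chart_dom c z -> 0 <= c0 (chart_map c z)).
Proof.
move=> [_ _ [ O [_ E]]] z cz.
have [_ h] : (O `&` @half_space R n) (chart_map c z) by rewrite -E; exists z.
exact: h.
Qed.

Lemma boundary_c0 n (X : plSpace R) (c : chart R X n.+1) x : is_pl_space X ->
  manifold_chart c -> chart_dom c x ->
  (boundary n x <-> c0 (chart_map c x) = 0).
Proof.
move=> X_pl mc cx; split=> [[d [md dx d0]]|c0x]; last by exists c.
have [oc _] := is_chart_emb (let: And3 h _ _ := mc in h).
have [od _] := is_chart_emb (let: And3 h _ _ := md in h).
apply: (half_chart_boundary X_pl (manifold_chart_rchart X_pl md)
  (manifold_chart_rchart X_pl mc)) d0.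
- exact: open_near.
- exact: open_near.
- exact: manifold_chart_half.
by case: mc => _ _ [ O [oO E]]; exists O.
Qed.

Section Smf.
Variables (n : nat) (X T : plSpace R) (j : X -> T).
Hypotheses (X_pl : is_pl_space X) (T_pl : is_pl_space T) (j_emb : pl_emb j).

Lemma rchart_compat k l (c : chart R X k) (d : chart R X l) :
  rchart (chart_dom c) (chart_map c) -> rchart (chart_dom d) (chart_map d) ->
  chart_compat c d.
Proof.
move=> rc rd; have [[_ ic vc] _] := rc; have [[_ jd vd] _] := rd.
split; apply: plg_pl_factor.
- by apply: inj_on_sub ic => z [].
- by move=> x [cx _]; apply: inv_at_sub (vc _ cx) => z [].
- by move=> x [cx dx]; exact: (rchart_plg X_pl).
- by apply: inj_on_sub jd => z [].
- by move=> x [_ dx]; apply: inv_at_sub (vd _ dx) => z [].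
by move=> x [cx dx]; rewrite setIC; exact: (rchart_plg X_pl).
Qed.

(** With [manifold_smf], this is the dictionary between intrinsic manifolds and subsets of an
    ambient space with half-space charts; by [boundary_c0] any chart tells the boundary. *)
Lemma smf_manifold (B : set T) : smf n (range j) B ->
  pl_manifold n X /\ boundary n (X := X) = j @^-1` B.
Proof.
move=> H; have [cj ij vj] := proj1 j_emb.
have mch x : exists c : chart R X n.+1, [/\ manifold_chart c, chart_dom c x
    & B (j x) <-> c0 (chart_map c x) = 0].
  have [D [phi [[oD Dx] rD [ O oO OE] BE]]] := H (j x) (imageP _ I).
  have jD : j @^-1` (range j `&` D) = j @^-1` D.
    by apply/seteqP; split=> y; [case|split=> //; exists y].
  pose c := Chart (j @^-1` D) (phi \o j).
  have rc : rchart (chart_dom c) (chart_map c).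
    by rewrite /= -jD; apply: (rchart_pull X_pl T_pl) => // y [].
  exists c; split=> //; last by apply: BE => //; exists x.
  split.
  - apply: emb_is_chart; last by case: rc.
    rewrite openE => y Dy; apply: filterS (cj y I _ (open_near oD Dy)) => z; exact.
  - by move=> k d ad; apply: rchart_compat => //; exact: (atlas_rchart X_pl ad).
  exists O; split=> //; rewrite -OE /=; apply/seteqP; split=> [_ [y Dy <-]|].
    by exists (j y) => //; split=> //; exists y.
  by move=> _ [_ [[y _ <-] Dy] <-]; exists y.
split; first by split=> // x; have [c [mc cx _]] := mch x; exists c.
apply/seteqP; split=> x /=; have [c [mc cx E]] := mch x.
  by move=> bx; apply/E; apply/(boundary_c0 X_pl mc cx).
by move=> /E bx; apply/(boundary_c0 X_pl mc cx).
Qed.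

Lemma manifold_smf : pl_manifold n X -> smf n (range j) (j @` boundary n (X := X)).
Proof.
move=> [_ HX] _ [x _ <-]; have [cj ij vj] := proj1 j_emb.
have [c [mc cx]] := HX x.
have rc := manifold_chart_rchart X_pl mc; have [ec _] := rc.
have [oc _] := is_chart_emb (let: And3 h _ _ := mc in h).
pose D := [set y | forall z, [set: X] z -> j z = y -> chart_dom c z]°.
have DE z : D (j z) <-> chart_dom c z.
  split=> [/interior_subset /(_ z I erefl) //|cz].
  by apply: vj => //; exact: open_near.
have jD : range j `&` D = j @` chart_dom c.
  apply/seteqP; split=> [_ [[y _ <-] /DE cy]|_ [y cy <-]]; first by exists y.
  by split; [exists y|apply/DE].
have ijc : inj_on (chart_dom c) j by apply: inj_on_sub ij.
pose phi := transp (chart_dom c) j (chart_map c).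
have phiE y : chart_dom c y -> phi (j y) = chart_map c y by move=> cy; rewrite /phi transpE.
exists D, phi; split.
- by split; [exact: open_interior|apply/DE].
- by rewrite jD; exact: (rchart_push X_pl T_pl j_emb rc).
- case: mc => _ _ [ O [oO OE]]; exists O => //; rewrite -OE jD; apply/seteqP; split.
    by move=> _ [_ [y cy <-] <-]; exists y => //; rewrite phiE.
  by move=> _ [y cy <-]; exists (j y); [exists y|rewrite phiE].
move=> _ [y _ <-] /DE cy; rewrite phiE //.
split=> [[z bz /ij zy]|/(boundary_c0 X_pl mc cy) by_]; last by exists y.
by apply/(boundary_c0 X_pl mc cy); rewrite -zy.
Qed.

End Smf.

Section Sub.
Variables (T : plSpace R) (V : set T).
Hypothesis T_pl : pl_axioms T.

Lemma sub_hausdorff : hausdorff_space T -> hausdorff_space (V : Type).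
Proof.
move=> hT x y xy; apply: set_val_inj; apply: hT => A B Ax By.
have [c _ _] := set_val_emb V.
have [z [Az Bz]] := xy _ _ (c x I _ Ax) (c y I _ By).
by exists (set_val z); split; [exact: Az|exact: Bz].
Qed.

Lemma sub_second_countable : @second_countable T -> @second_countable (V : Type).
Proof.
move=> [B cB [oB bB]]; exists ((fun A => set_val @^-1` A) @` B).
  exact: card_le_trans (card_image_le _ _) cB.
have [c i v] := set_val_emb V; split.
  move=> _ [A BA <-]; rewrite openE => x Ax.
  by apply: filterS (c x I _ (open_near (oB _ BA) Ax)) => z; exact.
move=> x W Wx; have [A [BA Ax] AW] := bB _ _ (v x I _ Wx).
exists (set_val @^-1` A); first by split=> //; exists A.
by move=> y Ay; exact: (AW _ Ay y I erefl).
Qed.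

Hypothesis V_poly : forall k (c : chart R T k), pl_atlas T k c ->
  forall x, V x -> chart_dom c x -> plg (V `&` chart_dom c) (chart_map c) (chart_map c) x.

Lemma restrict_chart_emb k (c : chart R T k) : pl_atlas T k c ->
  open (chart_dom (@restrict_chart R T V k c)) /\
  emb_on (chart_dom (@restrict_chart R T V k c)) (chart_map (@restrict_chart R T V k c)).
Proof.
move=> ac; have [oc ec] := atlas_emb T_pl ac; have eV := set_val_emb V.
split; last by apply: (emb_comp _ _ ec) => //; exact: emb_on_sub eV.
have [cV _ _] := eV; rewrite openE => x cx.
by apply: filterS (cV x I _ (open_near oc cx)) => z; exact.
Qed.

Lemma sub_plg k l (c : chart R T k) (d : chart R T l) (x : V) :
  pl_atlas T k c -> pl_atlas T l d -> chart_dom c (set_val x) -> chart_dom d (set_val x) ->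
  plg (V `&` chart_dom c `&` chart_dom d) (chart_map c) (chart_map d) (set_val x).
Proof.
move=> ac ad cx dx; have [_ [_ ic _]] := atlas_emb T_pl ac.
have h := rchart_plg T_pl (atlas_rchart T_pl ac) (atlas_rchart T_pl ad) cx dx.
have -> : V `&` chart_dom c `&` chart_dom d =
    (chart_dom c `&` chart_dom d) `&` (V `&` chart_dom c).
  by apply/seteqP; split=> y; [case=> [[? ?] ?]|case=> [[? ?] [? ?]]].
apply: plg_inter => //; first by apply: inj_on_sub ic => z [[]|[]].
exact: V_poly (set_valE' x) cx.
Qed.

(** Restricted charts are compatible, already with themselves, only when the subset is locally
    polyhedral in the charts of [T]; this is what [V_poly] provides. *)
Lemma sub_axioms : pl_axioms (pl_sub V).
Proof.
split.
- move=> x; have [k [c [ac cx]]] := atlas_cover T_pl (set_val x).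
  by exists k, (@restrict_chart R T V k c); split=> //; exists c.
- by move=> k _ [c ac <-]; have [oc ec] := restrict_chart_emb ac; exact: emb_is_chart.
move=> k l _ _ [c ac <-] [d ad <-].
have P k' l' (e : chart R T k') (f : chart R T l') : pl_atlas T k' e -> pl_atlas T l' f ->
    pl_factor (chart_dom (@restrict_chart R T V _ e) `&` chart_dom (@restrict_chart R T V _ f))
      (chart_map (@restrict_chart R T V _ e)) (chart_map (@restrict_chart R T V _ f)).
  move=> ae af; have [oe [_ ie ve]] := restrict_chart_emb ae.
  apply: plg_pl_factor; first by apply: inj_on_sub ie => z [].
    by move=> x [cx _]; apply: inv_at_sub (ve _ cx) => z [].
  move=> x [cx dx]; have [cV iV vV] := set_val_emb V.
  apply: plg_pull (sub_plg ae af cx dx).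
  - by move=> W Wx; apply: filterS (cV x I _ Wx) => z; exact.
  - by move=> z [? ?]; split=> //; split=> //; exact: set_valE'.
  by move=> z [[Vz ?] ?]; exists (toset Vz); rewrite ?set_val_toset //; split; rewrite /= set_val_toset.
by split; [exact: P|rewrite setIC; exact: P].
Qed.

End Sub.

Lemma sub_is_pl_space (T : plSpace R) (V : set T) : is_pl_space T ->
  (forall k (c : chart R T k), pl_atlas T k c ->
    forall x, V x -> chart_dom c x -> plg (V `&` chart_dom c) (chart_map c) (chart_map c) x) ->
  is_pl_space (pl_sub V).
Proof.
move=> T_pl V_poly; have [h1 h2 h3] := sub_axioms T_pl V_poly.
by split=> //; [apply: sub_hausdorff|apply: sub_second_countable]; case: T_pl.
Qed.

Lemma sub_pl_emb (T : plSpace R) (V : set T) : pl_axioms T ->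
  pl_axioms (pl_sub V) -> pl_emb (set_val : pl_sub V -> T).
Proof.
move=> T_pl V_pl; split; first exact: set_val_emb.
move=> k l c d [c' ac' <-] ad x cx dx.
exact: (rchart_plg V_pl (atlas_rchart V_pl (imageP _ ac'))
  (atlas_rchart V_pl (imageP _ ad)) cx dx).
Qed.

Lemma smf_poly n (T : plSpace R) (V B : set T) : pl_axioms T -> smf n V B ->
  forall k (c : chart R T k), pl_atlas T k c ->
  forall x, V x -> chart_dom c x -> plg (V `&` chart_dom c) (chart_map c) (chart_map c) x.
Proof.
move=> T_pl H k c ac x Vx cx.
have [D [phi [[oD Dx] rD _ _]]] := H _ Vx; have [_ HD] := rD.
have [h1 h2] := HD _ _ ac _ (conj Vx Dx) cx.
have [_ [_ ic _]] := atlas_emb T_pl ac.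
apply: plg_enlarge (plg_refl h1).
- by apply: inj_on_sub ic => z [].
- by move=> z [[? ?] ?].
by apply: filterS (open_near oD Dx) => z Dz [? ?].
Qed.

End Embeddings.

(** * PL maps near a point of a subset *)

Section PLat.
Variable R : realType.

(** Pieces not containing [phi x] are closed, hence avoided near [x]; on each of the others [q] is
    given by an affine map with value [q x] at [phi x]. *)
Lemma plg_cont (T : topologicalType) k l (A : set T) (phi : T -> 'rV[R]_k)
    (q : T -> 'rV[R]_l) x : A x -> cont_at A phi x -> plg A phi q x -> cont_at A q x.
Proof.
move=> Ax cphi [m [P [HP Hx]]] V Vq.
have : \forall z \near x, forall j, A z -> P j (phi z) -> V (q z).
  apply: (@filter_forall _ _ (fun j z => A z -> P j (phi z) -> V (q z)) _ (nbhs_filter x)) => j.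
  have [pP PA [a aa aE]] := HP j.
  have [Pj|nPj] := pselect (P j (phi x)).
    have Va : nbhs (phi x) (a @^-1` V).
      by apply: (near_cont (V := V) (affine_continuous aa (x := phi x))) => //; rewrite -aE.
    by apply: filterS (cphi _ Va) => z Hz Az Pz; rewrite aE //; exact: Hz.
  have : nbhs (phi x) (~` P j).
    by apply: open_nbhs_nbhs; split=> //; apply: closed_openC; exact: polyhedron_closed.
  by move=> /cphi; apply: filterS => z Hz Az /(Hz Az).
apply: filterS2 Hx => z Hz Hz' Az; have [j Pj] := Hz Az; exact: Hz' j Az Pj.
Qed.

Lemma plg_near_eq (T : topologicalType) k l (A B : set T) (phi : T -> 'rV[R]_k)
    (psi psi' : T -> 'rV[R]_l) x :
  A x -> cont_at A phi x -> inv_at A phi x -> inj_on B phi ->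
  (\forall z \near x, (A z <-> B z) /\ (A z -> psi z = psi' z)) ->
  plg A phi psi x -> plg B phi psi' x.
Proof.
move=> Ax cA vA iB H h; pose C := [set z | A z /\ B z /\ psi z = psi' z].
have h1 : plg C phi psi x.
  apply: plg_shrink h => //; first by move=> z [].
  by apply: filterS H => z [AB E] Az; split=> //; split; [exact/AB|exact: E].
have h2 : plg C phi psi' x by apply: plg_ext h1 => // z [_ []].
apply: plg_enlarge h2 => //; first by move=> z [_ []].
apply: filterS H => z [AB E] Bz; have Az := AB.2 Bz.
by split=> //; split=> //; exact: E.
Qed.

(* [f] is PL on [A] near [x]. *)
Definition plat (X Y : plSpace R) (A : set X) (f : X -> Y) (x : X) : Prop :=
  cont_at A f x /\ forall k l (c : chart R X k) (d : chart R Y l),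
    pl_atlas X k c -> pl_atlas Y l d -> chart_dom c x -> chart_dom d (f x) ->
    plg (A `&` chart_dom c `&` f @^-1` chart_dom d) (chart_map c) (chart_map d \o f) x.

Section Two.
Variables (X Y : plSpace R).
Hypotheses (X_pl : pl_axioms X) (Y_pl : pl_axioms Y).

Lemma plg_id_comp (T : topologicalType) k l p (A B : set T) (phi : T -> 'rV[R]_k)
    (d : T -> 'rV[R]_l) (psi : T -> 'rV[R]_p) x :
  inj_on (A `|` B) d -> plg A phi d x -> plg B d psi x -> plg (A `&` B) phi psi x.
Proof.
move=> jd h1 h2; apply: (plg_comp_map (f := @id T) (d := d)) => //.
  by move=> V; apply: filterS => z Vz.
by apply: inj_on_sub jd => z [[w Aw <-]|]; [left|right].
Qed.

Lemma plat_rchart k l (A : set X) (f : X -> Y) (A' : set X) (D : set Y)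
    (phi : X -> 'rV[R]_k) (psi : Y -> 'rV[R]_l) x :
  plat A f x -> rchart A' phi -> rchart D psi -> A x -> A' x -> D (f x) ->
  plg (A `&` A' `&` f @^-1` D) phi (psi \o f) x.
Proof.
move=> [cf pf] [eA HA] [eD HD] Ax A'x Dfx.
have [k' [c [ac cx]]] := atlas_cover X_pl x.
have [l' [d [ad dx]]] := atlas_cover Y_pl (f x).
have [oc [cc ic vc]] := atlas_emb X_pl ac; have [od [cd jd vd]] := atlas_emb Y_pl ad.
have [h1 h2] := HA _ c ac x A'x cx; have [h3 h4] := HD _ d ad _ Dfx dx.
have h := pf _ _ c d ac ad cx dx.
have h5 := plg_id_comp (inj_on_sub _ ic) h2 h.
have {}h5 := h5 (ltac:(by move=> z [[]|[[]]])).
have cf' : cont_at ((A' `&` chart_dom c) `&` (A `&` chart_dom c `&` f @^-1` chart_dom d)) f x.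
  by apply: cont_at_sub cf => z [_ [[]]].
have h6 := plg_comp_map (D := D `&` chart_dom d) cf' _ h5 h3.
have {}h6 := h6 (ltac:(by apply: inj_on_sub jd => z [[w [_ [_ ?]] <-]|[]])).
apply: plg_enlarge h6.
- by case: eA => _ i _; apply: inj_on_sub i => z [[]].
- by move=> z [[[? ?] [[? ?] ?]] [? ?]].
have nd := cf _ (open_near od dx).
apply: filterS2 nd (open_near oc cx) => z dz cz [[Az A'z] Dz].
have := dz Az; by [].
Qed.

(** Chart changes are PL, so a single pair of charts suffices to prove a map PL near [x]; conversely
    [plat_rchart] gives all pairs. *)
Lemma plat_intro k l (A : set X) (f : X -> Y) (A' : set X) (D : set Y)
    (phi : X -> 'rV[R]_k) (psi : Y -> 'rV[R]_l) x :
  rchart A' phi -> rchart D psi -> A x -> nbhs x A' -> nbhs (f x) D ->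
  (\forall z \near x, A z -> D (f z)) ->
  plg (A `&` A' `&` f @^-1` D) phi (psi \o f) x -> plat A f x.
Proof.
move=> [eA HA] [eD HD] Ax nA' nD AD h.
have [A'x Dfx] := (nbhs_singleton nA', nbhs_singleton nD).
have [cA iA vA] := eA; have [cD iD vD] := eD.
have cf : cont_at A f x.
  move=> V Vf; have := plg_cont _ (cont_at_sub _ (cA _ A'x)) h.
  move=> /(_ _ _ _ (vD _ Dfx _ Vf)) H.
  have {}H := H (conj (conj Ax A'x) Dfx) (ltac:(by move=> z [[]])).
  near=> z => Az; apply: (near H z) => //.
  - split; first by split=> //; near: z.
    by move: Az; near: z.
  - by move: Az; near: z.
split=> // k' l' c d ac ad cx dx.
have [oc [cc ic vc]] := atlas_emb X_pl ac; have [od [cd jd vd]] := atlas_emb Y_pl ad.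
have [h1 h2] := HA _ c ac x A'x cx; have [h3 h4] := HD _ d ad _ Dfx dx.
have h5 := plg_id_comp (inj_on_sub _ iA) h1 h.
have {}h5 := h5 (ltac:(by move=> z [[]|[[]]])).
have cf' : cont_at ((A' `&` chart_dom c) `&` (A `&` A' `&` f @^-1` D)) f x.
  by apply: cont_at_sub cf => z [_ [[]]].
have h6 := plg_comp_map (D := D `&` chart_dom d) cf' _ h5 h4.
have {}h6 := h6 (ltac:(by apply: inj_on_sub iD => z [[w [_ [_ ?]] <-]|[]])).
apply: plg_enlarge h6.
- by apply: inj_on_sub ic => z [[]].
- by move=> z [[[? ?] [[? ?] ?]] [? ?]].
by apply: filterS2 nA' AD => z A'z Dz [[Az cz] dz]; have Dfz := Dz Az.
Unshelve. all: by end_near.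
Qed.

Lemma plat_near (A B : set X) (f g : X -> Y) x : A x -> f x = g x ->
  (\forall z \near x, (A z <-> B z) /\ (A z -> f z = g z)) -> plat A f x -> plat B g x.
Proof.
move=> Ax fg H [cf pf]; split.
  apply: cont_at_near cf => //; apply: filterS H => z [AB E] Bz.
  by split; [exact/AB|apply: E; exact/AB].
move=> k l c d ac ad cx dx; rewrite -fg in dx.
have [oc [cc ic vc]] := atlas_emb X_pl ac.
have h := pf _ _ c d ac ad cx dx.
apply: plg_near_eq h => //.
- by apply: cont_at_sub (cc _ cx) => z [[]].
- by apply: inv_at_sub (vc _ cx) => z [[]].
- by apply: inj_on_sub ic => z [[]].
apply: filterS H => z [AB E]; split=> [|[[Az _] _] /=]; last by rewrite E.
split=> [[[Az cz] dz]|[[Bz cz] dz]].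
  by split; [split=> //; exact/AB|rewrite /= -E].
have Az := AB.2 Bz.
by split=> //; rewrite /= E.
Qed.

Lemma plat_ext (A : set X) (f g : X -> Y) x : A x -> (forall z, A z -> f z = g z) ->
  plat A f x -> plat A g x.
Proof.
by move=> Ax E; apply: plat_near => //; [exact: E|apply: nearW => z; split=> //; exact: E].
Qed.

Lemma plat_union (A B : set X) (f : X -> Y) x : plat A f x -> plat B f x ->
  plat (A `|` B) f x.
Proof.
move=> [cA pA] [cB pB]; split.
  by move=> V Vf; apply: filterS2 (cA _ Vf) (cB _ Vf) => z h1 h2 [].
move=> k l c d ac ad cx dx; have [_ [_ ic _]] := atlas_emb X_pl ac.
rewrite !setIUl; apply: plg_union; first by apply: inj_on_sub ic => z [[[]]|[[]]].
  exact: pA.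
exact: pB.
Qed.

Lemma plat_out (A : set X) (f : X -> Y) x : (\forall z \near x, ~ A z) -> plat A f x.
Proof.
move=> H; split; first by move=> V _; apply: filterS H => z nA.
by move=> *; apply: plg_out; apply: filterS H => z nA [[]].
Qed.

Lemma plat_inter (A B : set X) (f : X -> Y) x :
  plat A f x -> plat B id x -> plat (A `&` B) f x.
Proof.
move=> [cA pA] [cB pB]; split; first by apply: cont_at_sub cA => z [].
move=> k l c d ac ad cx dx; have [_ [_ ic _]] := atlas_emb X_pl ac.
have -> : A `&` B `&` chart_dom c `&` f @^-1` chart_dom d =
  (A `&` chart_dom c `&` f @^-1` chart_dom d) `&` (B `&` chart_dom c `&` id @^-1` chart_dom c).
  by apply/seteqP; split=> z; [move=> [[[? ?] ?] ?]|move=> [[[? ?] ?] [[? ?] ?]]].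
apply: plg_inter; first by apply: inj_on_sub ic => z [[[]]|[[]]].
  exact: pA.
exact: (pB _ _ c c ac ac cx cx).
Qed.

Lemma plat_open (A O : set X) (f : X -> Y) x : A x -> open O -> O x ->
  plat A f x -> plat (A `&` O) f x.
Proof.
move=> Ax oO Ox; apply: plat_near => //; apply: filterS (open_near oO Ox) => z Oz.
by split=> //; split=> [|[]].
Qed.

End Two.

Lemma plat_id (X : plSpace R) (x : X) : pl_axioms X -> plat setT id x.
Proof.
move=> X_pl; split; first by move=> V; apply: filterS => z Vz.
move=> k l c d ac ad cx dx; rewrite setTI.
exact: (rchart_plg X_pl (atlas_rchart X_pl ac) (atlas_rchart X_pl ad)).
Qed.

Lemma rchart_plat (X : plSpace R) k (A : set X) (phi : X -> 'rV[R]_k) x :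
  pl_axioms X -> rchart A phi -> A x -> plat A id x.
Proof.
move=> X_pl rA Ax; split; first by move=> V; apply: filterS => z Vz.
move=> l l' c d ac ad cx dx; have [_ HA] := rA; have [[cA iA _] _] := rA.
have [oc [cc ic vc]] := atlas_emb X_pl ac; have [od _] := atlas_emb X_pl ad.
have [h1 _] := HA _ _ ac _ Ax cx.
have h2 := rchart_plg X_pl (atlas_rchart X_pl ac) (atlas_rchart X_pl ad) cx dx.
have h := plg_id_comp (inj_on_sub _ ic) (plg_refl h1) h2.
have {}h := h (ltac:(by move=> z [[]|[]])).
apply: plg_enlarge h.
- by apply: inj_on_sub ic => z [[]].
- by move=> z [[? ?] [? ?]].
by apply: nearW => z [[? ?] ?].
Qed.

Lemma plat_comp (X Y Z : plSpace R) (A : set X) (B : set Y) (f : X -> Y) (g : Y -> Z) x :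
  pl_axioms X -> pl_axioms Y -> pl_axioms Z -> A x ->
  plat A f x -> (forall z, A z -> B (f z)) -> plat B g (f x) -> plat A (g \o f) x.
Proof.
move=> X_pl Y_pl Z_pl Ax [cf pf] AB [cg pg]; split; first exact: cont_at_comp cg.
move=> k l c e ac ae cx ex; have [l' [d [ad dx]]] := atlas_cover Y_pl (f x).
have [oc [cc ic vc]] := atlas_emb X_pl ac; have [od [cd jd vd]] := atlas_emb Y_pl ad.
have cf' : cont_at (A `&` chart_dom c `&` f @^-1` chart_dom d) f x.
  by apply: cont_at_sub cf => z [[]].
have h := plg_comp_map cf' _ (pf _ _ c d ac ad cx dx) (pg _ _ d e ad ae dx ex).
have {}h := h (ltac:(by apply: inj_on_sub jd => z [[w [_ ?] <-]|[[]]])).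
apply: plg_enlarge h.
- by apply: inj_on_sub ic => z [[]].
- by move=> z [[[? ?] ?] [[? ?] ?]].
apply: filterS (cf _ (open_near od dx)) => z Hz [[Az cz] ez].
by have dz := Hz Az; have Bz := AB _ Az.
Qed.

End PLat.

(** * Real-valued PL germs *)

Section RealGerms.
Variable R : realType.

Section Raw.
Variables (T : topologicalType) (k : nat) (phi : T -> 'rV[R]_k).
Implicit Types (A : set T) (f g : T -> R).

(** A real is encoded as a row vector of length one, so that the calculus of germs applies. *)
Definition rg A f x := plg A phi (fun z => const_mx (f z) : 'rV[R]_1) x.

Lemma rg_of_plg l A (psi : T -> 'rV[R]_l) (h : 'rV[R]_l -> R) f x :
  affine_fun h -> (forall z, A z -> f z = h (psi z)) -> plg A phi psi x -> rg A f x.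
Proof.
move=> ah E H; have a1 : affine (fun y => const_mx (h y) : 'rV[R]_1).
  by apply/affine_coord => i; have [u [b hE]] := ah; exists u, b => y; rewrite mxE hE.
by apply: plg_ext (plg_post a1 H) => // z Az; rewrite /= E.
Qed.

Lemma rg_ext A f g x : (forall z, A z -> f z = g z) -> rg A f x -> rg A g x.
Proof. by move=> E; apply: plg_ext => // z Az; rewrite E. Qed.

Lemma rg_cst A t x : plg A phi phi x -> rg A (fun=> t) x.
Proof. by apply: (rg_of_plg (h := fun=> t)) => //; exact: affine_fun_cst. Qed.

Lemma rg_coord l A (psi : T -> 'rV[R]_l) i x : plg A phi psi x -> rg A (fun z => psi z ord0 i) x.
Proof. by apply: (rg_of_plg (h := fun y => y ord0 i)) => //; exact: affine_fun_coord. Qed.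

Lemma rg_add A f g x : rg A f x -> rg A g x -> rg A (fun z => f z + g z) x.
Proof.
move=> hf hg; apply: (rg_of_plg (h := fun y : 'rV[R]_(1 + 1) => y ord0 (lshift 1 ord0) +
   y ord0 (rshift 1 ord0))) (plg_pair hf hg).
  by apply: affine_funD; exact: affine_fun_coord.
by move=> z Az; rewrite row_mxEl row_mxEr !mxE.
Qed.

Lemma rg_scale A f a x : rg A f x -> rg A (fun z => a * f z) x.
Proof.
move=> hf; apply: (rg_of_plg (h := fun y : 'rV[R]_1 => a * y ord0 ord0)) hf.
  by apply: affine_funZ; exact: affine_fun_coord.
by move=> z Az; rewrite mxE.
Qed.

Lemma rg_sub A f g x : rg A f x -> rg A g x -> rg A (fun z => f z - g z) x.
Proof.
move=> hf /(rg_scale (-1)) hg; apply: rg_ext (rg_add hf hg) => z _.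
by rewrite mulN1r.
Qed.

Lemma rg_level l A (psi : T -> 'rV[R]_l) f g x :
  rg A f x -> rg A g x -> plg A phi psi x ->
  plg (A `&` [set z | f z <= g z]) phi psi x.
Proof.
move=> hf hg hpsi; have h := rg_sub hf hg.
have p : polyhedron [set y : 'rV[R]_1 | y ord0 ord0 <= 0].
  by apply: polyhedron_le0; exact: affine_fun_coord.
suff -> : A `&` [set z | f z <= g z] = A `&` (fun z => const_mx (f z - g z)) @^-1`
    [set y : 'rV[R]_1 | y ord0 ord0 <= 0] by exact: plg_level.
by apply/seteqP; split=> z [Az /= H]; split=> //=; move: H; rewrite mxE subr_le0.
Qed.

Lemma rg_min A f g x : inj_on A phi -> rg A f x -> rg A g x ->
  rg A (fun z => Num.min (f z) (g z)) x.
Proof.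
move=> iphi hf hg.
have AE : A = (A `&` [set z | f z <= g z]) `|` (A `&` [set z | g z <= f z]).
  rewrite -setIUr; apply/seteqP; split=> z; last by case.
  by move=> Az; split=> //; case: (leP (f z) (g z)) => [|/ltW]; [left|right].
rewrite /rg AE; apply: plg_union; first by rewrite -AE.
  by apply: plg_ext (rg_level hf hg hf) => // z [_ /= h]; rewrite min_l.
by apply: plg_ext (rg_level hg hf hg) => // z [_ /= h]; rewrite min_r.
Qed.

Lemma rg_max A f g x : inj_on A phi -> rg A f x -> rg A g x ->
  rg A (fun z => Num.max (f z) (g z)) x.
Proof.
move=> iphi /(rg_scale (-1)) hf /(rg_scale (-1)) hg.
apply: rg_ext (rg_scale (-1) (rg_min iphi hf hg)) => z _ /=.
by rewrite !mulN1r oppr_min !opprK.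
Qed.

Lemma rg_abs A f x : inj_on A phi -> rg A f x -> rg A (fun z => `|f z|) x.
Proof.
move=> iphi hf; apply: rg_ext (rg_max iphi hf (rg_scale (-1) hf)) => z _.
by rewrite mulN1r -[in RHS]maxrN.
Qed.

Lemma rg_bigmin A (I : Type) (s : seq I) (f : I -> T -> R) t x :
  inj_on A phi -> plg A phi phi x -> (forall i, rg A (f i) x) ->
  rg A (fun z => \big[Num.min/t]_(i <- s) f i z) x.
Proof.
move=> iphi h hf; elim: s => [|i s IH].
  by apply: rg_ext (rg_cst t h) => z _; rewrite big_nil.
by apply: rg_ext (rg_min iphi (hf i) IH) => z _; rewrite big_cons.
Qed.

Lemma rg_setc n A (psi : T -> 'rV[R]_n.+1) f x :
  rg A f x -> plg A phi psi x -> plg A phi (fun z => setc (f z) (psi z)) x.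
Proof.
move=> hf hpsi.
pose F (y : 'rV[R]_(1 + n.+1)) := setc (lsubmx y ord0 ord0) (rsubmx y).
have aF : affine F.
  apply: affine_setc.
    have : affine_fun (fun y : 'rV[R]_(1 + n.+1) => y ord0 (lshift n.+1 ord0)) by exact: affine_fun_coord.
    by move=> [u [b H]]; exists u, b => y; rewrite -H mxE.
  apply/affine_coord => i.
  have : affine_fun (fun y : 'rV[R]_(1 + n.+1) => y ord0 (rshift 1 i)) by exact: affine_fun_coord.
  by move=> [u [b H]]; exists u, b => y; rewrite -H mxE.
apply: plg_ext (plg_post aF (plg_pair hf hpsi)) => // z Az.
by rewrite /F /= row_mxKl row_mxKr mxE.
Qed.

End Raw.
End RealGerms.

(** * Products of PL spaces and the line *)

Section Products.
Variable R : realType.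

Lemma line_axioms : pl_axioms (pl_line R).
Proof.
have ec : emb_on [set: R] (fun t : R => const_mx t : 'rV[R]_1).
  split.
  - move=> t _ V Vt; suff : nbhs t (fun s => V (const_mx s)) by apply: filterS.
    have [P HP PV] : nbhs (const_mx t : 'rV[R]_1) V := Vt.
    have h := HP ord0 ord0; rewrite mxE in h.
    apply: filterS h => s Ps; apply: PV => i j; by rewrite mxE !ord1.
  - by move=> s t _ _ /matrixP /(_ ord0 ord0); rewrite !mxE.
  move=> t _ V Vt; exists (fun _ _ => V) => [i j|y Hy s _ sy]; first by rewrite mxE.
  by have := Hy ord0 ord0; rewrite -sy mxE.
have oT : open (chart_dom (Chart [set: R] (fun t : R => const_mx t : 'rV[R]_1))) by exact: openT.
split.
- by move=> t; exists 1%N, (Chart setT (fun t => const_mx t)); split.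
- by move=> k c [] ; exact: emb_is_chart.
have [cc ic vc] := ec.
move=> k l c d [] [] /=.
have : pl_factor [set: R] (fun t : R => const_mx t : 'rV[R]_1) (fun t : R => const_mx t : 'rV[R]_1).
  apply: plg_pl_factor => // x _; exists 1%N, (fun=> setT); split=> [j|].
    split; [exact: polyhedronT| |by exists id => //; exact: affine_id].
    by move=> y _; exists (y ord0 ord0) => //; apply/rowP => i; rewrite mxE (ord1 i).
  by apply: (@filterS _ (nbhs (x : R)) (nbhs_filter x) setT) => [z _ _|]; [exists ord0|exact: filterT].
by rewrite /chart_compat /= setIT.
Qed.

Lemma emb_prod (X Y : topologicalType) k l (A : set X) (B : set Y)
    (f : X -> 'rV[R]_k) (g : Y -> 'rV[R]_l) :
  emb_on A f -> emb_on B g ->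
  emb_on (A `*` B) (fun p : X * Y => row_mx (f p.1) (g p.2)).
Proof.
move=> [cf jf vf] [cg jg vg]; split.
- move=> [x y] [/= Ax By] V /nbhs_cube [r r0 rV].
  have h1 := cf x Ax _ (cube_nbhs _ r0); have h2 := cg y By _ (cube_nbhs _ r0).
  exists ([set z | A z -> cube (f x) r (f z)], [set z | B z -> cube (g y) r (g z)]) => //=.
  move=> [u v] /= [Hu Hv] [/= Au Bv]; apply: rV => i.
  case: (fintype.splitP i) => j ij.
    by rewrite (_ : i = lshift l j); [rewrite !row_mxEl; exact: Hu|exact: val_inj].
  by rewrite (_ : i = rshift k j); [rewrite !row_mxEr; exact: Hv|exact: val_inj].
- move=> [x y] [x' y'] [/= Ax By] [/= Ax' By'] /eq_row_mx [E E'].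
  by rewrite (jf x x') // (jg y y').
move=> [x y] [/= Ax By] V [[V1 V2] /= [nV1 nV2] HV].
have [r r0 rV] := nbhs_cube (vf x Ax _ nV1); have [s s0 sV] := nbhs_cube (vg y By _ nV2).
have t0 : 0 < Num.min r s by rewrite lt_min r0.
apply: (@filterS _ (nbhs (row_mx (f x) (g y))) _ _ _ _ (cube_nbhs _ t0)).
move=> w Hw [u v] [/= Au Bv] wE; apply: HV; split=> /=.
  apply: (rV (f u)) => // i; have := Hw (lshift l i); rewrite -wE !row_mxEl.
  by rewrite le_min => /andP[].
apply: (sV (g v)) => // i; have := Hw (rshift k i); rewrite -wE !row_mxEr.
by rewrite le_min => /andP[].
Qed.

Lemma plg_prod (X Y : topologicalType) k l k' l' (A : set X) (B : set Y)
    (f : X -> 'rV[R]_k) (f' : X -> 'rV[R]_k') (g : Y -> 'rV[R]_l) (g' : Y -> 'rV[R]_l') x y :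
  plg A f f' x -> plg B g g' y ->
  plg (A `*` B) (fun p : X * Y => row_mx (f p.1) (g p.2))
     (fun p => row_mx (f' p.1) (g' p.2)) (x, y).
Proof.
move=> [m [P [HP Hx]]] [q [Q [HQ Hy]]].
pose L (z : 'rV[R]_(k + l)) : 'rV[R]_k := lsubmx z.
pose L' (z : 'rV[R]_(k + l)) : 'rV[R]_l := rsubmx z.
have aL : affine L.
  apply/affine_coord => i.
  have : affine_fun (fun y : 'rV[R]_(k + l) => y ord0 (lshift l i)) by exact: affine_fun_coord.
  by move=> [u [b H]]; exists u, b => z; rewrite -H mxE.
have aL' : affine L'.
  apply/affine_coord => i.
  have : affine_fun (fun y : 'rV[R]_(k + l) => y ord0 (rshift k i)) by exact: affine_fun_coord.
  by move=> [u [b H]]; exists u, b => z; rewrite -H mxE.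
apply: (@plg_fin _ _ _ _ ('I_m * 'I_q)%type (fun ij => L @^-1` P ij.1 `&` L' @^-1` Q ij.2)).
  move=> [i j] /=; have [pP PA [a aa aE]] := HP i; have [pQ QB [b ab bE]] := HQ j; split.
  - by apply: polyhedronI; exact: polyhedron_preimage.
  - move=> z [/= /PA [u Au uz] /QB [v Bv vz]]; exists (u, v) => //=.
    by rewrite uz vz hsubmxK.
  exists (fun z => row_mx (a (L z)) (b (L' z))).
    have [M [u ME]] := affine_comp aL aa; have [M' [u' ME']] := affine_comp aL' ab.
    exists (row_mx M M'), (row_mx u u') => z.
    by rewrite mul_mx_row add_row_mx -ME -ME'.
  move=> [u v] [/= Au Bv]; rewrite /L /L' row_mxKl row_mxKr => -[Pu Qv].
  by rewrite aE // bE.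
exists ([set z | A z -> exists j, P j (f z)], [set z | B z -> exists j, Q j (g z)]) => //=.
move=> [u v] [/= Hu Hv] [/= Au Bv]; have [i Pi] := Hu Au; have [j Qj] := Hv Bv.
by exists (i, j); rewrite /= /L /L' row_mxKl row_mxKr.
Qed.

Lemma open_prod (X Y : topologicalType) (A : set X) (B : set Y) :
  open A -> open B -> open (A `*` B).
Proof.
move=> oA oB; rewrite openE => -[x y] [/= Ax By].
by exists (A, B) => //=; split; exact: open_near.
Qed.

Section Prod.
Variables X Y : plSpace R.
Hypotheses (X_pl : pl_axioms X) (Y_pl : pl_axioms Y).

Lemma prod_axioms : pl_axioms (pl_prod X Y).
Proof.
have emb k l (c : chart R X k) (d : chart R Y l) : pl_atlas X k c -> pl_atlas Y l d ->
    let e := Chart (chart_dom c `*` chart_dom d)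
             (fun p : X * Y => row_mx (chart_map c p.1) (chart_map d p.2)) in
    open (chart_dom e) /\ emb_on (chart_dom e) (chart_map e).
  move=> ac ad; have [oc ec] := atlas_emb X_pl ac; have [od ed] := atlas_emb Y_pl ad.
  by split; [exact: open_prod|exact: emb_prod].
split.
- move=> [x y]; have [k [c [ac cx]]] := atlas_cover X_pl x.
  have [l [d [ad dy]]] := atlas_cover Y_pl y.
  by do 2 eexists; split; [exact: (ProdAtlas ac ad)|split].
- by move=> _ _ [k l c d ac ad]; have [oe ee] := emb _ _ c d ac ad; exact: emb_is_chart.
move=> _ _ _ _ [k l c d ac ad] [k' l' c' d' ac' ad'].
have P k1 l1 k2 l2 (c1 : chart R X k1) (d1 : chart R Y l1) (c2 : chart R X k2) (d2 : chart R Y l2) :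
    pl_atlas X k1 c1 -> pl_atlas Y l1 d1 -> pl_atlas X k2 c2 -> pl_atlas Y l2 d2 ->
    pl_factor (chart_dom c1 `*` chart_dom d1 `&` chart_dom c2 `*` chart_dom d2)
      (fun p : X * Y => row_mx (chart_map c1 p.1) (chart_map d1 p.2))
      (fun p => row_mx (chart_map c2 p.1) (chart_map d2 p.2)).
  move=> a1 b1 a2 b2; have [ o1 [cc1 i1 v1]] := emb _ _ c1 d1 a1 b1.
  apply: plg_pl_factor; first by apply: inj_on_sub i1 => z [].
    by move=> x [cx _]; apply: inv_at_sub (v1 _ cx) => z [].
  move=> [x y] [[/= c1x d1y] [/= c2x d2y]].
  have -> : chart_dom c1 `*` chart_dom d1 `&` chart_dom c2 `*` chart_dom d2 =
      (chart_dom c1 `&` chart_dom c2) `*` (chart_dom d1 `&` chart_dom d2).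
    by apply/seteqP; split=> -[u v]; [move=> [[? ?] [? ?]]|move=> [[? ?] [? ?]]].
  by apply: plg_prod; [apply: (rchart_plg X_pl)|apply: (rchart_plg Y_pl)] => //;
    exact: atlas_rchart.
by split; [exact: P|rewrite setIC; exact: P].
Qed.

Lemma rchart_prod k l (A : set X) (B : set Y) (phi : X -> 'rV[R]_k) (psi : Y -> 'rV[R]_l) :
  rchart A phi -> rchart B psi ->
  @rchart R (pl_prod X Y) _ (A `*` B) (fun p => row_mx (phi p.1) (psi p.2)).
Proof.
move=> [eA HA] [eB HB]; split; first exact: emb_prod.
move=> _ _ [k' l' c d ac ad] [x y] [/= Ax By] [/= cx dy].
have -> : A `*` B `&` chart_dom c `*` chart_dom d =
    (A `&` chart_dom c) `*` (B `&` chart_dom d).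
  by apply/seteqP; split=> -[u v]; [move=> [[? ?] [? ?]]|move=> [[? ?] [? ?]]].
have [h1 h2] := HA _ _ ac _ Ax cx; have [h3 h4] := HB _ _ ad _ By dy.
by split; exact: plg_prod.
Qed.

Lemma plat_pair (Z : plSpace R) (A : set Z) (f : Z -> X) (g : Z -> Y) z :
  pl_axioms Z -> plat A f z -> plat A g z ->
  @plat R Z (pl_prod X Y) A (fun w => (f w, g w)) z.
Proof.
move=> Z_pl [cf pf] [cg pg]; split.
  move=> V [[V1 V2] /= [nV1 nV2] HV].
  apply: filterS2 (cf _ nV1) (cg _ nV2) => w h1 h2 Aw.
  by apply: HV; split; [exact: h1|exact: h2].
move=> k _ c _ ac [k' l' d e ad ae] cz [/= dz ez].
have h1 := pf _ _ c d ac ad cz dz; have h2 := pg _ _ c e ac ae cz ez.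
have [oc [_ ic _]] := atlas_emb Z_pl ac.
have -> : A `&` chart_dom c `&` (fun w => (f w, g w)) @^-1` (chart_dom d `*` chart_dom e) =
   (A `&` chart_dom c `&` f @^-1` chart_dom d) `&` (A `&` chart_dom c `&` g @^-1` chart_dom e).
  by apply/seteqP; split=> w; [move=> [[? ?] [? ?]]|move=> [[[? ?] ?] [[? ?] ?]]].
apply: (plg_pair (psi := chart_map d \o f) (chi := chart_map e \o g)).
  by apply: plg_inter => //; [apply: inj_on_sub ic => w [[[]]|[[]]]|exact: plg_refl h2].
rewrite setIC; apply: plg_inter => //; [by apply: inj_on_sub ic => w [[[]]|[[]]]|exact: plg_refl h1].
Qed.

Lemma plat_fst (p : pl_prod X Y) : @plat R (pl_prod X Y) X setT fst p.
Proof.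
case: p => x y; have [k [c [ac cx]]] := atlas_cover X_pl x.
have [l [d [ad dy]]] := atlas_cover Y_pl y.
have [oc [cc ic vc]] := atlas_emb X_pl ac; have [od [cd jd vd]] := atlas_emb Y_pl ad.
have rp := rchart_prod (atlas_rchart X_pl ac) (atlas_rchart Y_pl ad).
apply: (plat_intro prod_axioms X_pl rp (atlas_rchart X_pl ac)) => //.
- by exact: (open_near (open_prod oc od) (conj cx dy : (chart_dom c `*` chart_dom d) (x, y))).
- exact: open_near.
- have h : nbhs (x, y) (chart_dom c `*` chart_dom d) by exact: (open_near (open_prod oc od) (conj cx dy : (chart_dom c `*` chart_dom d) (x, y))).
  by apply: filterS h => -[u v] [].
have -> : setT `&` chart_dom c `*` chart_dom d `&` fst @^-1` chart_dom c =
    chart_dom c `*` chart_dom d.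
  by apply/seteqP; split=> -[u v]; [move=> [[_ ?] ?]|move=> [? ?]].
have h : plg (chart_dom c `*` chart_dom d)
    (fun p : X * Y => row_mx (chart_map c p.1) (chart_map d p.2))
    (fun p => row_mx (chart_map c p.1) (chart_map d p.2)) (x, y).
  by apply: plg_prod; [exact: (rchart_self X_pl (atlas_rchart X_pl ac))|
    exact: (rchart_self Y_pl (atlas_rchart Y_pl ad))].
have aL : affine (fun z : 'rV[R]_(k + l) => lsubmx z).
  apply/affine_coord => i.
  have : affine_fun (fun y : 'rV[R]_(k + l) => y ord0 (lshift l i)) by exact: affine_fun_coord.
  by move=> [u [b H]]; exists u, b => z; rewrite -H mxE.
by apply: plg_ext (plg_post aL h) => // z _ /=; rewrite row_mxKl.
Qed.

End Prod.

Lemma rchart_line : @rchart R (pl_line R) 1 setT (fun t : R => const_mx t).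
Proof. exact: (atlas_rchart line_axioms (LineAtlas R)). Qed.

Lemma rg_plat (X : plSpace R) k (A A' : set X) (phi : X -> 'rV[R]_k) (f : X -> R) x :
  pl_axioms X -> rchart A' phi -> A x -> nbhs x A' ->
  rg phi (A `&` A') f x -> @plat R X (pl_line R) A f x.
Proof.
move=> X_pl rA Ax nA h; apply: (plat_intro X_pl line_axioms rA rchart_line) => //.
- exact: filterT.
- by apply: nearW.
by rewrite preimage_setT setIT.
Qed.

End Products.

(** * Collars *)

Section Compactness.

Lemma nbhs_all (T : topologicalType) (x : T) (P : set T) : (forall y, P y) -> nbhs x P.
Proof. by move=> H; apply: filterS (@filterT _ (nbhs x) _) => y _. Qed.

(** If no finite subfamily covers [A], the sets outside which [A] is finitely covered form a proper
    filter containing [A]. It contains the complement of [N x] for every [x] in [A], which is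
    impossible when [x] is a cluster point. *)
Lemma compact_finite_cover (T : topologicalType) (A : set T) (N : T -> set T) :
  compact A -> (forall x, A x -> nbhs x (N x)) ->
  exists s : seq T, (forall x, x \in s -> A x) /\
    forall y, A y -> exists2 x, x \in s & N x y.
Proof.
move=> cA HN; apply: contrapT => nA.
pose Q (S : set T) := exists s : seq T, (forall x, x \in s -> A x) /\
    forall y, A y -> ~ S y -> exists2 x, x \in s & N x y.
have FQ : ProperFilter Q.
  apply: Build_ProperFilter_ex.
    move=> S [s [sA H]]; apply: contrapT => nS; apply: nA; exists s; split=> // y Ay.
    by apply: H => // Sy; apply: nS; exists y.
  split.
  - by exists [::]; split=> // y _ [].
  - move=> S S' [s [sA H]] [s' [sA' H']]; exists (s ++ s'); split.
      by move=> x; rewrite mem_cat => /orP[/sA|/sA'].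
    move=> y Ay nSS'; have [Sy|nSy] := pselect (S y).
      have [|x xs Nx] := H' y Ay; first by move=> S'y; apply: nSS'.
      by exists x => //; rewrite mem_cat xs orbT.
    by have [x xs Nx] := H y Ay nSy; exists x => //; rewrite mem_cat xs.
  - by move=> S S' SS' [s [sA H]]; exists s; split=> // y Ay nS'; apply: H => // /SS'.
have QA : Q A by exists [::]; split=> // y ? [].
have [x [Ax clx]] := cA _ FQ QA.
have Qx : Q (~` N x).
  exists [:: x]; split=> [y|y Ay /contrapT Ny]; first by rewrite inE => /eqP ->.
  by exists x; rewrite ?inE.
by have [y []] := clx _ _ Qx (HN _ Ax).
Qed.

Lemma cont_on_within (T Y : topologicalType) (A : set T) (f : T -> Y) :
  cont_on A f <-> {within A, continuous f}.
Proof.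
split=> [H|/subspace_continuousP H x Ax V Vf].
  by apply/subspace_continuousP => x Ax V Vf; apply: filterS (H x Ax V Vf) => z; exact.
by apply: filterS (H x Ax V Vf) => z.
Qed.

Lemma cont_on_compact (T Y : topologicalType) (A : set T) (f : T -> Y) :
  cont_on A f -> compact A -> compact (f @` A).
Proof. by move=> /cont_on_within; exact: continuous_compact. Qed.

Lemma compact_cube_half (R : realType) n (a : 'rV[R]_n.+1) r :
  compact (cube a r `&` [set z | 0 <= c0 z]).
Proof.
apply: compact_closedI.
  rewrite (_ : cube a r = [set v | forall i, `[a ord0 i - r, a ord0 i + r]%classic (v ord0 i)]).
    apply: (@rV_compact R _ (fun i => `[a ord0 i - r, a ord0 i + r]%classic)) => i.
    exact: segment_compact.
  apply/seteqP; split=> v /= H i; have := H i; rewrite /= in_itv /= ler_norml;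
    by move=> /andP[h1 h2]; apply/andP; split; lra.
rewrite (_ : mkset _ = @c0 R n @^-1` [set t : R | 0 <= t]) //.
apply: (@preimage_closed _ _ (@c0 R n) [set t : R | 0 <= t]); last exact: closed_ge.
by move=> z _; exact: (affine_fun_continuous (affine_fun_c0 R n)).
Qed.

End Compactness.

Section Collar.
Variables (R : realType) (n : nat) (W : plSpace R).
Hypothesis W_man : pl_manifold n W.
Let W_pl : is_pl_space W := proj1 W_man.
Let B : set W := boundary n (X := W).
Let WR := pl_prod W (pl_line R).
Let WR_pl : pl_axioms WR := prod_axioms W_pl (line_axioms R).

Definition cyl (A : set W) (e : R) : set WR := [set p | A p.1 /\ 0 <= p.2 < e].

(** Openness is not part of the notion: it is recovered once the whole boundary is covered, by
    [collar_open], and so does not have to be carried through the induction over patches. *)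
Definition partial_collar (N : set W) (e : R) (c : WR -> W) : Prop :=
  [/\ forall y, (B `&` N) y -> c (y, 0) = y, inj_on (cyl (B `&` N) e) c &
      forall p, cyl (B `&` N) e p -> plat (cyl (B `&` N) e) c p].

Section Patch.
Variables (x0 : W) (c : chart R W n.+1) (r : R).
Let A := chart_dom c.
Let phi := chart_map c.
Let a := phi x0.
Hypotheses (mc : manifold_chart c) (Ax0 : A x0) (a0 : c0 a = 0) (r0 : 0 < r)
  (cube_img : cube a r `&` [set z | 0 <= c0 z] `<=` phi @` A).

(** A tent around [a] in the coordinates along the boundary. Leaving out [c0] makes it constant on
    the fibres of the straight collar of the chart. *)
Definition bump (z : 'rV[R]_n.+1) : R :=
  \big[Num.min/r]_(i < n) (r - `|z ord0 (lift ord0 i) - a ord0 (lift ord0 i)|).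

Definition core : set W := [set w | A w /\ r / 2 < bump (phi w)].

Let rA : rchart A phi := manifold_chart_rchart W_pl mc.
Let oA : open A := proj1 (is_chart_emb (let: And3 h _ _ := mc in h)).

Lemma bump_setc s z : bump (setc s z) = bump z.
Proof. by rewrite /bump; apply: eq_bigr => i _; rewrite mxE. Qed.

Lemma rg_bump (T : topologicalType) k (S : set T) (u : T -> 'rV[R]_k) (v : T -> 'rV[R]_n.+1) p :
  inj_on S u -> plg S u v p -> rg u S (fun q => bump (v q)) p.
Proof.
move=> iu huv; have huu := plg_refl huv; apply: rg_bigmin => // i.
apply: rg_sub; first exact: rg_cst.
by apply: rg_abs => //; apply: rg_sub; [exact: rg_coord|exact: rg_cst].
Qed.

Lemma bump_continuous : continuous bump.
Proof.
move=> z; have h : plg [set: 'rV[R]_n.+1] id id z.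
  exists 1%N, (fun=> setT); split=> [j|]; last by apply: nbhs_all => y _; exists ord0.
  split; [exact: polyhedronT|by move=> y _; exists y|by exists id => //; exact: affine_id].
have hb := rg_bump (fun x y _ _ => id) h.
have c1 : cont_at [set: 'rV[R]_n.+1] (fun q => const_mx (bump q) : 'rV[R]_1) z.
  by apply: plg_cont hb => // V; apply: filterS.
apply: cont_atT => V Vz.
have V' : nbhs (const_mx (bump z) : 'rV[R]_1) [set u | V (u ord0 ord0)].
  by exists (fun _ _ => V) => [i j|u Hu]; [rewrite mxE|exact: Hu].
by apply: filterS (c1 _ V') => q Hq _; have := Hq I; rewrite /= mxE.
Qed.

Lemma core_open : open core.
Proof.
rewrite openE => w [Aw bw]; have [[cA _ _] _] := rA.
have h : nbhs (bump (phi w)) [set t | r / 2 < t] by apply: open_nbhs_nbhs; split=> //; exact: open_gt.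
have h' : nbhs (phi w) [set z | r / 2 < bump z] := near_cont (bump_continuous (x := phi w)) h (fun y hy => hy).
apply: filterS2 (open_near oA Aw) (cA _ Aw _ h') => z Az bz; split=> //; exact: bz.
Qed.

Lemma core_center : core x0.
Proof.
split=> //; apply/bigmin_gtP; split=> [|i _]; first by rewrite ltr_pdivrMr // mulr2n mulrDr mulr1 ltrDl.
by rewrite subrr normr0 subr0 ltr_pdivrMr // mulr2n mulrDr mulr1 ltrDl.
Qed.

Lemma bump_gt0 z : 0 < bump z -> 0 <= c0 z <= r -> cube a r z.
Proof.
move=> /bigmin_gtP [_ H] /andP[z0 zr] i; have [j ->|->] := unliftP ord0 i.
  by have := H j isT; rewrite subr_gt0 => /ltW.
by rewrite -/(c0 a) -/(c0 z) a0 subr0 ger0_norm.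
Qed.

Variable e : R.
Hypotheses (e0 : 0 < e) (er : e <= r / 2).

(** The height up to which the new collar follows the chart: [e] on the core, where the tent exceeds
    [r / 2 >= e], and 0 where the tent is not positive. *)
Definition lam (z : 'rV[R]_n.+1) : R := Num.max 0 (Num.min e (bump z)).

Lemma lam_ge0 z : 0 <= lam z. Proof. by rewrite le_max lexx. Qed.

Lemma lam_le z : lam z <= e.
Proof. by rewrite ge_max (ltW e0) ge_min lexx. Qed.

Lemma lam_gt0 z : 0 < lam z -> 0 < bump z.
Proof. by rewrite lt_max ltxx /= lt_min => /andP[]. Qed.

Lemma lam_setc s z : lam (setc s z) = lam z.
Proof. by rewrite /lam bump_setc. Qed.

Lemma lam_core w : core w -> lam (phi w) = e.
Proof.
move=> [_ bw]; rewrite /lam min_l; last by apply: le_trans er (ltW bw).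
by rewrite max_r // ltW.
Qed.

Lemma rg_lam (T : topologicalType) k (S : set T) (u : T -> 'rV[R]_k) (v : T -> 'rV[R]_n.+1) p :
  inj_on S u -> plg S u v p -> rg u S (fun q => lam (v q)) p.
Proof.
move=> iu huv; have huu := plg_refl huv; apply: rg_max => //; first exact: rg_cst.
by apply: rg_min => //; [exact: rg_cst|exact: rg_bump].
Qed.

Definition phi_inv (z : 'rV[R]_n.+1) : W := xget x0 [set w | A w /\ phi w = z].

Lemma phi_invK z : (phi @` A) z -> A (phi_inv z) /\ phi (phi_inv z) = z.
Proof.
move=> [w Aw wz]; rewrite /phi_inv; case: xgetP => [y _ //|].
by move=> /(_ w) [].
Qed.

Lemma phiK w : A w -> phi_inv (phi w) = w.
Proof.
move=> Aw; have [h1 h2] := phi_invK (imageP _ Aw); have [[_ iA _] _] := rA.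
exact: iA.
Qed.

Lemma phi_ge0 w : A w -> 0 <= c0 (phi w).
Proof. exact: manifold_chart_half. Qed.

Lemma B_c0 w : A w -> (B w <-> c0 (phi w) = 0).
Proof. exact: boundary_c0. Qed.

Lemma setc_img z s : (phi @` A) z -> 0 <= s <= r -> 0 < lam z \/ s = c0 z ->
  (phi @` A) (setc s z).
Proof.
move=> Az sr [lz|->]; last by rewrite setc_id.
apply: cube_img; split; last by rewrite /= c0_setc; case/andP: sr.
apply: bump_gt0; last by rewrite c0_setc.
by rewrite bump_setc; exact: lam_gt0.
Qed.

(** For [0 <= c0 z] this compresses the heights from 0 to [2 * lam z] onto those from [lam z] to
    [2 * lam z] and fixes larger ones. As [2 * lam z <= r], moved points stay in the cube. *)
Definition theta (z : 'rV[R]_n.+1) : R := Num.max (c0 z) (c0 z / 2 + lam z).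

Lemma theta_img w : A w -> (phi @` A) (setc (theta (phi w)) (phi w)).
Proof.
move=> Aw; have z0 := phi_ge0 Aw; have l0 := lam_ge0 (phi w); have le_ := lam_le (phi w).
have [h|h] := leP (2 * lam (phi w)) (c0 (phi w)).
  rewrite /theta max_l; last by lra.
  by rewrite setc_id; exists w.
apply: setc_img; first by exists w.
  rewrite /theta; apply/andP; split; first by rewrite le_max z0.
  by rewrite ge_max; move: (r0) (er) => ? ?; apply/andP; split; lra.
by left; rewrite -(pmulr_rgt0 _ (ltr0Sn R 1)); lra.
Qed.

(* Pushes [W] inwards by [lam], leaving room for the first half of the new collar. *)
Definition push (w : W) : W :=
  if `[< A w >] then phi_inv (setc (theta (phi w)) (phi w)) else w.

Lemma push_in w : A w -> A (push w) /\ phi (push w) = setc (theta (phi w)) (phi w).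
Proof. by move=> Aw; rewrite /push asboolT //; apply: phi_invK; exact: theta_img. Qed.

Lemma push_out w : ~ A w -> push w = w.
Proof. by move=> nAw; rewrite /push asboolF. Qed.

Lemma push_A w : A (push w) -> A w.
Proof. by have [//|nA] := pselect (A w); rewrite push_out. Qed.

Lemma theta_inj z z' : lam z = lam z' -> theta z = theta z' -> c0 z = c0 z'.
Proof.
rewrite /theta => <-.
by case: (leP (c0 z) (c0 z / 2 + lam z)); case: (leP (c0 z') (c0 z' / 2 + lam z)); lra.
Qed.

Lemma push_inj w w' : push w = push w' -> w = w'.
Proof.
have [[_ iA _] _] := rA.
have [Aw|nAw] := pselect (A w); last first.
  rewrite push_out // => E; have [Aw'|nAw'] := pselect (A w'); last by rewrite E push_out.
  by exfalso; apply: nAw; rewrite E; case: (push_in Aw').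
have [Aw'|nAw'] := pselect (A w'); last first.
  by move=> E; exfalso; apply: (nAw'); rewrite -(push_out nAw') -E; case: (push_in Aw).
have [_ h] := push_in Aw; have [_ h'] := push_in Aw' => E.
have Es : setc (theta (phi w)) (phi w) = setc (theta (phi w')) (phi w') by rewrite -h -h' E.
have Et : theta (phi w) = theta (phi w') by rewrite -(c0_setc (theta (phi w)) (phi w)) Es c0_setc.
have El : lam (phi w) = lam (phi w') by rewrite -(lam_setc (theta (phi w))) Es lam_setc.
apply: iA => //; apply: (setc_inj (s := 0)); last exact: theta_inj.
by rewrite -(setc_setc 0 (theta (phi w))) Es setc_setc.
Qed.

(** A compact, hence closed, set off which [push] is the identity; this settles the points at the
    frontier of the chart domain. *)
Definition supp : set W := phi_inv @` (cube a r `&` [set z | 0 <= c0 z]).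

Lemma suppP w : A w -> cube a r (phi w) -> supp w.
Proof. by move=> Aw cw; exists (phi w); [split=> //; exact: phi_ge0|exact: phiK]. Qed.

Lemma supp_A w : supp w -> A w.
Proof. by move=> [z /cube_img /phi_invK [h _] <-]. Qed.

Lemma supp_closed : closed supp.
Proof.
apply: compact_closed; first by case: W_pl.
apply: cont_on_compact; last exact: compact_cube_half.
move=> z /cube_img Az V Vz; have [Aw wz] := phi_invK Az.
have [[_ _ vA] _] := rA; have := vA _ Aw _ Vz; rewrite -/phi wz.
apply: (@filterS _ (nbhs z)) => y Hy /cube_img /phi_invK [Ay yz]; exact: Hy.
Qed.

Lemma lam_out w : A w -> B w -> ~ supp w -> lam (phi w) = 0.
Proof.
move=> Aw /(B_c0 Aw) w0 nsw; apply/eqP; rewrite -[_ == _]negbK; apply/negP => l0.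
apply: nsw; apply: suppP => //; apply: bump_gt0; last by rewrite w0 lexx ltW.
by apply: lam_gt0; rewrite lt_neqAle eq_sym l0 lam_ge0.
Qed.

Lemma push_nsupp w : ~ supp w -> push w = w.
Proof.
move=> nsw; have [Aw|/push_out //] := pselect (A w); rewrite /push asboolT //.
have z0 := phi_ge0 Aw; have l0 := lam_ge0 (phi w); have le_ := lam_le (phi w).
have [h|h] := leP (2 * lam (phi w)) (c0 (phi w)).
  by rewrite /theta max_l ?setc_id ?phiK //; lra.
exfalso; apply: nsw; apply: suppP => //; apply: bump_gt0; last first.
  by move: (r0) (er) => ? ?; apply/andP; split; lra.
by apply: lam_gt0; lra.
Qed.

Lemma plat_push w : plat setT push w.
Proof.
have [Aw|nAw] := pselect (A w); last first.
  have nsw : ~ supp w by move=> /supp_A.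
  apply: (plat_near (A := setT) (f := id) W_pl) => //; first by rewrite push_out.
    have := open_near (closed_openC supp_closed) nsw.
    by apply: filterS => z nsz; split=> // _; rewrite push_nsupp.
  by apply: plat_id; exact: W_pl.
apply: (plat_intro W_pl W_pl rA rA) => //.
- exact: open_near.
- by apply: open_near => //; case: (push_in Aw).
- by apply: filterS (open_near oA Aw) => z Az _; case: (push_in Az).
have -> : setT `&` A `&` push @^-1` A = A.
  apply/seteqP; split=> z; first by move=> [[_ ?] _].
  by move=> Az; split=> //; case: (push_in Az).
have h := rchart_self W_pl rA Aw; have [[_ iA _] _] := rA.
apply: (plg_ext (psi := fun z => setc (theta (phi z)) (phi z))) => //.
  by move=> z Az; case: (push_in Az).
have h0 : rg phi A (fun z => c0 (phi z)) w by apply: rg_coord.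
apply: rg_setc => //; apply: rg_max => //; apply: rg_add; last exact: rg_lam.
by apply: rg_ext (rg_scale 2^-1 h0) => z _; rewrite mulrC.
Qed.

Variables (N : set W) (eB : R) (cB : WR -> W).
Hypotheses (oN : open N) (hB : partial_collar N eB cB) (e_eB : e <= eB).

Definition lamW (w : W) : R := if `[< A w >] then lam (phi w) else 0.

Definition low (p : WR) : W := phi_inv (setc p.2 (phi p.1)).

Definition high (p : WR) : W := push (cB (p.1, p.2 - lamW p.1)).

(** Up to time [lam] the collar rises straight in the chart; afterwards it follows the old collar,
    delayed by [lam] and pushed inwards. At time [lam] over [N] both descriptions give [push] of the
    base point. *)
Definition merge (p : WR) : W := if p.2 < lamW p.1 then low p else high p.

Definition E1 : set WR := [set p | [/\ A p.1, B p.1 & 0 <= p.2 <= lam (phi p.1)]].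

Definition E2 : set WR := [set p | [/\ A p.1, B p.1 & lam (phi p.1) <= p.2]].

Let F2 : set WR := E2 `&` (N `*` [set t | t < e]).

Let Phi (p : WR) := row_mx (phi p.1) (const_mx p.2 : 'rV[R]_1).

Let P0 : set WR := A `*` setT.

Let rP : @rchart R WR _ P0 Phi := rchart_prod rA (rchart_line R).

Let oP : open P0 := open_prod oA (@openT R).

Let iP : inj_on P0 Phi.
Proof. by have [[_ i _] _] := rP. Qed.

Lemma lamW_A w : A w -> lamW w = lam (phi w).
Proof. by move=> Aw; rewrite /lamW asboolT. Qed.

Lemma lamW_ge0 w : 0 <= lamW w.
Proof. by rewrite /lamW; case: asboolP => // _; exact: lam_ge0. Qed.

Lemma lamW_gt0 w : 0 < lamW w -> A w.
Proof. by rewrite /lamW; case: asboolP => //; rewrite ltxx. Qed.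

Lemma lowP p : E1 p -> A (low p) /\ phi (low p) = setc p.2 (phi p.1).
Proof.
case: p => y s [/= Ay By /andP[s0 sl]]; apply: phi_invK.
have le_ := lam_le (phi y).
apply: setc_img; first by exists y.
  by rewrite /=; move: (r0) (er) => ? ?; apply/andP; split; lra.
have [l0|l0] := ltP 0 (lam (phi y)); [by left|right].
by rewrite (proj1 (B_c0 Ay) By) /=; lra.
Qed.

Lemma push_bd y : A y -> B y -> push y = low (y, lam (phi y)).
Proof.
move=> Ay By; rewrite /push asboolT // /low /= /theta (proj1 (B_c0 Ay) By) mul0r add0r.
by rewrite max_r // lam_ge0.
Qed.

Lemma merge_base y : B y -> (N `|` core) y -> merge (y, 0) = y.
Proof.
move=> By NCy; rewrite /merge /=; case: ltP => h.
  have Ay := lamW_gt0 h; rewrite /low /= -(proj1 (B_c0 Ay) By) setc_id.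
  exact: phiK.
have l0 : lamW y = 0 by apply/eqP; rewrite eq_le h lamW_ge0.
have Ny : N y.
  case: NCy => // Cy; move: l0; rewrite lamW_A; last by case: Cy.
  by rewrite lam_core // => e00; move: (e0); rewrite e00 ltxx.
have [h1 _ _] := hB; rewrite /high /= l0 subr0 h1 //.
have [Ay|nAy] := pselect (A y); last exact: push_out.
rewrite push_bd // -(lamW_A Ay) l0 /low /= -(proj1 (B_c0 Ay) By) setc_id.
exact: phiK.
Qed.

Lemma high_cyl p : B p.1 -> N p.1 -> lamW p.1 <= p.2 < e ->
  cyl (B `&` N) eB (p.1, p.2 - lamW p.1).
Proof.
case: p => y s /= By Ny /andP[ls se]; split=> //=.
by have := lamW_ge0 y; move: (e_eB) => ? ?; apply/andP; split; lra.
Qed.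

Lemma merge_lt p : cyl (B `&` (N `|` core)) e p -> p.2 < lamW p.1 -> E1 p.
Proof.
move=> [[By _] /andP[s0 _]] h; have Ay := lamW_gt0 (le_lt_trans s0 h).
by split=> //; rewrite s0 -lamW_A // ltW.
Qed.

Lemma merge_ge p : cyl (B `&` (N `|` core)) e p -> lamW p.1 <= p.2 -> N p.1.
Proof.
move=> [[By [//|Cy]] /andP[s0 se]]; rewrite lamW_A; last by case: Cy.
by rewrite lam_core // leNgt se.
Qed.

(** In the chart a pushed point has height [theta >= lam] and a point of the low part a height below
    [lam], while [lam] depends on the fibre only. *)
Lemma low_high p w : E1 p -> p.2 < lam (phi p.1) -> low p = push w -> False.
Proof.
move=> Ep slt E; have [Al hl] := lowP Ep.
have Aw : A w by apply: push_A; rewrite -E.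
have [_ hw] := push_in Aw.
have Es : setc p.2 (phi p.1) = setc (theta (phi w)) (phi w) by rewrite -hl E.
have Et : p.2 = theta (phi w) by rewrite -(c0_setc p.2 (phi p.1)) Es c0_setc.
have El : lam (phi p.1) = lam (phi w) by rewrite -(lam_setc p.2) Es lam_setc.
have z0 := phi_ge0 Aw.
have : lam (phi w) <= theta (phi w) by rewrite /theta le_max; apply/orP; right; lra.
by lra.
Qed.

Lemma merge_inj : inj_on (cyl (B `&` (N `|` core)) e) merge.
Proof.
have [_ iB _] := hB; have [[_ iA _] _] := rA.
move=> p q Sp Sq; rewrite /merge.
case: (ltP p.2 (lamW p.1)) => hp; case: (ltP q.2 (lamW q.1)) => hq.
- have Ep := merge_lt Sp hp; have Eq := merge_lt Sq hq.
  have [_ h1] := lowP Ep; have [_ h2] := lowP Eq => E.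
  have Es : setc p.2 (phi p.1) = setc q.2 (phi q.1) by rewrite -h1 E.
  have Et : p.2 = q.2 by rewrite -(c0_setc p.2 (phi p.1)) Es c0_setc.
  have [Ap Bp _] := Ep; have [Aq Bq _] := Eq.
  have Ey : p.1 = q.1.
    apply: iA => //; apply: (setc_inj (s := p.2)); first by rewrite {2}Et.
    by rewrite (proj1 (B_c0 Ap) Bp) (proj1 (B_c0 Aq) Bq).
  by case: p q Et Ey {Sp Sq hp hq Ep Eq h1 h2 E Es Ap Bp Aq Bq} => y s [y' s'] /= -> ->.
- move=> E; exfalso; have Ep := merge_lt Sp hp; apply: (low_high Ep) E.
  by rewrite -lamW_A //; case: Ep.
- move=> /esym E; exfalso; have Eq := merge_lt Sq hq; apply: (low_high Eq) E.
  by rewrite -lamW_A //; case: Eq.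
move=> /push_inj /iB E.
have Np := merge_ge Sp hp; have Nq := merge_ge Sq hq.
have [[Bp _] /andP[_ pe]] := Sp; have [[Bq _] /andP[_ qe]] := Sq.
have [] := E (high_cyl Bp Np (ltac:(by rewrite hp))) (high_cyl Bq Nq (ltac:(by rewrite hq))).
by case: p q {Sp Sq hp hq E Np Nq Bp pe Bq qe} => y s [y' s'] /= -> /addIr ->.
Qed.

Section Coord.
Variable p : WR.
Hypothesis P0p : P0 p.

Let hPhi : plg P0 Phi Phi p := rchart_self WR_pl rP P0p.

Lemma plg_phi1 : plg P0 Phi (fun q : WR => phi q.1) p.
Proof.
have aL : affine (fun z : 'rV[R]_(n.+1 + 1) => lsubmx z).
  apply/affine_coord => i.
  have : affine_fun (fun y : 'rV[R]_(n.+1 + 1) => y ord0 (lshift 1 i)) by exact: affine_fun_coord.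
  by move=> [u [b H]]; exists u, b => z; rewrite -H mxE.
by apply: plg_ext (plg_post aL hPhi) => // z _; rewrite /= /Phi row_mxKl.
Qed.

Lemma rg_snd : rg Phi P0 (fun q : WR => q.2) p.
Proof.
by apply: rg_ext (rg_coord (rshift n.+1 ord0) hPhi) => z _; rewrite /Phi row_mxEr mxE.
Qed.

Lemma rg_c01 : rg Phi P0 (fun q : WR => c0 (phi q.1)) p.
Proof. exact: rg_coord plg_phi1. Qed.

Lemma rg_lam1 : rg Phi P0 (fun q : WR => lam (phi q.1)) p.
Proof. by apply: rg_lam => //; exact: plg_phi1. Qed.

Lemma plg_low : plg E1 Phi (fun q : WR => setc q.2 (phi q.1)) p.
Proof.
have -> : E1 = P0 `&` [set q | Num.max (c0 (phi q.1))
    (Num.max (-1 * q.2) (q.2 - lam (phi q.1))) <= 0].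
  apply/seteqP; split=> -[y s]; rewrite /P0 /= !ge_max.
    move=> [/= Ay By /andP[s0 sl]]; split=> //=; rewrite (proj1 (B_c0 Ay) By) lexx /=.
    by apply/andP; split; lra.
  move=> [[/= Ay _]] /and3P[h1 h2 h3]; split=> //=; last by apply/andP; split; lra.
  by apply/(B_c0 Ay)/eqP; rewrite eq_le h1 phi_ge0.
apply: rg_level.
- apply: rg_max => //; first exact: rg_c01.
  by apply: rg_max => //; [apply: rg_scale; exact: rg_snd|apply: rg_sub; [exact: rg_snd|exact: rg_lam1]].
- exact: rg_cst.
- by apply: rg_setc; [exact: rg_snd|exact: plg_phi1].
Qed.

Lemma plg_E2 : plg E2 Phi Phi p.
Proof.
have -> : E2 = P0 `&` [set q | Num.max (c0 (phi q.1)) (lam (phi q.1) - q.2) <= 0].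
  apply/seteqP; split=> -[y s]; rewrite /P0 /= ?ge_max.
    move=> [/= Ay By sl]; split=> //=; rewrite (proj1 (B_c0 Ay) By) lexx /=.
    by lra.
  move=> [[/= Ay _]] /andP[h1 h2]; split=> //=; last by lra.
  by apply/(B_c0 Ay)/eqP; rewrite eq_le h1 phi_ge0.
apply: rg_level => //; last exact: rg_cst.
apply: rg_max => //; first exact: rg_c01.
by apply: rg_sub; [exact: rg_lam1|exact: rg_snd].
Qed.

Lemma plat_shift_real : @plat R WR (pl_line R) P0 (fun q : WR => q.2 - lam (phi q.1)) p.
Proof.
apply: (rg_plat WR_pl rP) => //; first exact: (open_near oP P0p).
by rewrite setIid; apply: rg_sub; [exact: rg_snd|exact: rg_lam1].
Qed.

End Coord.

Lemma plat_low p : E1 p -> plat E1 low p.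
Proof.
move=> Ep; have [Al hl] := lowP Ep; have [Ap Bp _] := Ep.
have P0p : P0 p by [].
apply: (plat_intro WR_pl W_pl rP rA) => //;
    [exact: (open_near oP P0p)|exact: (open_near oA Al)| |].
  by apply: nbhs_all => q /lowP [].
have -> : E1 `&` P0 `&` low @^-1` A = E1.
  apply/seteqP; split=> q; first by move=> [[]].
  by move=> Eq; have [Alq _] := lowP Eq; have [Aq _ _] := Eq; split.
by apply: plg_ext (plg_low P0p) => // q /lowP [_ h]; rewrite /= h.
Qed.

Lemma plat_high p : F2 p -> plat F2 high p.
Proof.
move=> Fp; have [[Ap Bp lp] [Np pe]] := Fp; have P0p : P0 p by [].
have oNe : open (N `*` [set t : R | t < e]) by apply: open_prod => //; exact: open_lt.
have E2id : @plat R WR WR E2 id p.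
  have h := plg_E2 P0p.
  have P0E2 : E2 `<=` P0 by move=> q [].
  apply: (plat_intro WR_pl WR_pl rP rP) => //;
    [exact: (open_near oP P0p)|exact: (open_near oP P0p)| |].
    by apply: nbhs_all => q /P0E2.
  rewrite (_ : _ `&` _ = E2) //.
  by apply/seteqP; split=> q; [move=> [[]]|move=> Eq; have := P0E2 _ Eq].
have F2id : @plat R WR WR F2 id p by apply: plat_open.
have sh : @plat R WR WR F2 (fun q : WR => (q.1, q.2 - lam (phi q.1))) p.
  apply: plat_pair WR_pl _ _.
    have := plat_inter WR_pl (plat_fst W_pl (line_axioms R) p) F2id.
    by rewrite setTI.
  have := plat_inter WR_pl (plat_shift_real P0p) F2id.
  rewrite (_ : P0 `&` F2 = F2) //; apply/seteqP; split=> q; first by case.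
  by move=> Fq; split=> //; case: Fq => [[]].
have [_ _ pB] := hB.
have cylF q : F2 q -> cyl (B `&` N) eB (q.1, q.2 - lam (phi q.1)).
  move=> [[Aq Bq lq] [Nq qe]]; rewrite -lamW_A //; apply: high_cyl => //.
  by rewrite lamW_A // lq.
have h1 := plat_comp WR_pl WR_pl W_pl Fp sh cylF (pB _ (cylF _ Fp)).
have h2 := plat_comp WR_pl W_pl W_pl Fp h1 (fun q _ => I) (plat_push _).
apply: (plat_ext WR_pl Fp _ h2) => q [[Aq _ _] _].
by rewrite /high lamW_A.
Qed.

Lemma merge_low p : E1 p -> N p.1 \/ p.2 < lam (phi p.1) -> merge p = low p.
Proof.
move=> [Ap Bp /andP[s0 sl]] Np; rewrite /merge lamW_A //; case: ltP => // ls.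
case: Np => [Np|]; last by rewrite ltNge ls.
have sE : p.2 = lam (phi p.1) by apply/eqP; rewrite eq_le sl.
have [h1 _ _] := hB; rewrite /high lamW_A // sE subrr h1 // push_bd // /low /= -sE //.
Qed.

Lemma merge_high p : E2 p -> merge p = high p.
Proof. by move=> [Ap Bp lp]; rewrite /merge lamW_A // ltNge lp. Qed.

Lemma near_lam p : P0 p -> (p.2 < lam (phi p.1) -> \forall q \near p, A q.1 /\ q.2 < lam (phi q.1)) /\
  (lam (phi p.1) < p.2 -> \forall q \near p, A q.1 /\ lam (phi q.1) < q.2).
Proof.
move=> P0p; have [cg _] := plat_shift_real P0p; have nP := open_near oP P0p.
split=> h.
  have h' : nbhs (p.2 - lam (phi p.1)) [set t : R | t < 0].
    by apply: open_nbhs_nbhs; split; [exact: open_lt|rewrite /= subr_lt0].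
  apply: (@filterS2 _ (nbhs p) _ _ _ _ _ nP (cg _ h')) => q [Aq _] Hq.
  by split=> //; rewrite -subr_lt0; apply: Hq.
have h' : nbhs (p.2 - lam (phi p.1)) [set t : R | 0 < t].
  by apply: open_nbhs_nbhs; split; [exact: open_gt|rewrite /= subr_gt0].
apply: (@filterS2 _ (nbhs p) _ _ _ _ _ nP (cg _ h')) => q [Aq _] Hq.
by split=> //; rewrite -subr_gt0; apply: Hq.
Qed.

Lemma plat_merge p : cyl (B `&` (N `|` core)) e p ->
  plat (cyl (B `&` (N `|` core)) e) merge p.
Proof.
move=> Sp; have [[Bp NCp] /andP[p0 pe]] := Sp.
have ne (O : set W) : open O -> O p.1 -> nbhs p (O `*` [set t : R | t < e]).
  move=> oO Op; apply: (open_near (open_prod oO (@open_lt R e))).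
  by split.
(* Three regions. Over the core [lam] equals [e], so the collar is low throughout; outside [supp] it
   vanishes on the boundary and the collar is the pushed old one; in between, the low and high parts
   are polyhedral and their germs are united. *)
have [Cp|nCp] := pselect (core p.1).
  have [Ap _] := Cp.
  have Ep : E1 p by split=> //; rewrite p0 lam_core // ltW.
  apply: (plat_near WR_pl Ep _ _ (plat_low Ep)).
    by rewrite merge_low //; right; rewrite lam_core.
  apply: (@filterS _ (nbhs p) _ _ _ _ (ne _ core_open Cp)) => q [Cq qe]; have [Aq _] := Cq.
  split=> [|Eq]; last by rewrite merge_low //; right; rewrite lam_core.
  split=> [[_ Bq /andP[q0 _]]|[[Bq _] /andP[q0 _]]].
    by split; [split=> //; right|rewrite q0].
  by split=> //; rewrite q0 lam_core // ltW.
have Np : N p.1 by case: NCp.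
have [sp|nsp] := pselect (supp p.1); last first.
  have Cyp : cyl (B `&` N) eB p.
    by split=> //; rewrite p0 (lt_le_trans pe).
  have lW0 q : B q.1 -> ~ supp q.1 -> lamW q.1 = 0.
    move=> Bq nsq; rewrite /lamW; case: asboolP => // Aq; exact: lam_out.
  have E q : B q.1 -> ~ supp q.1 -> 0 <= q.2 -> merge q = push (cB q).
    move=> Bq nsq q0; rewrite /merge lW0 // ltNge q0 /= /high lW0 // subr0.
    by case: q {Bq nsq q0}.
  have [_ _ pB] := hB.
  have h2 := plat_comp WR_pl W_pl W_pl Cyp (pB _ Cyp) (fun q _ => I) (plat_push _).
  apply: (plat_near WR_pl Cyp _ _ h2); first by rewrite E.
  have oO : open (N `&` ~` supp) by apply: openI => //; exact: closed_openC supp_closed.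
  apply: (@filterS _ (nbhs p) _ _ _ _ (ne _ oO (conj Np nsp))) => q [[Nq nsq] qe].
  split=> [|[[Bq _] /andP[q0 _]]]; last by rewrite E.
  split=> [[[Bq _] /andP[q0 _]]|[[Bq _] /andP[q0 _]]].
    by split; [split=> //; left|rewrite q0].
  by split=> //; rewrite q0 (lt_le_trans qe).
have Ap : A p.1 by exact: supp_A.
have P0p : P0 p by [].
pose G1 := E1 `&` (N `*` setT).
have pE : plat (G1 `|` F2) merge p.
  apply: (plat_union WR_pl).
    have [lp|lp] := leP p.2 (lam (phi p.1)).
      have Ep : E1 p by split=> //; rewrite p0.
      have h : plat G1 low p by apply: plat_open => //; [exact: open_prod oN (@openT R)|exact: plat_low].
      apply: (plat_ext WR_pl _ _ h) => // q [Eq [Nq _]].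
      by rewrite merge_low //; left.
    apply: plat_out; apply: (@filterS _ (nbhs p) _ _ _ _ ((near_lam P0p).2 lp)) => q [Aq lq].
    by move=> [[_ _ /andP[_]]]; rewrite leNgt lq.
  have [lp|lp] := leP (lam (phi p.1)) p.2.
    have Fp : F2 p by [].
    apply: (plat_ext WR_pl _ _ (plat_high Fp)) => // q [Eq _].
    by rewrite merge_high.
  apply: plat_out; apply: (@filterS _ (nbhs p) _ _ _ _ ((near_lam P0p).1 lp)) => q [Aq lq].
  by move=> [[_ _ h] _]; move: h; rewrite leNgt lq.
have Hp : (G1 `|` F2) p.
  by case: (leP p.2 (lam (phi p.1))) => h; [left; split=> //; split=> //; rewrite p0|
    right; split=> //; split=> //; exact: ltW].
apply: (plat_near WR_pl Hp _ _ pE) => //.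
have oO : open (N `&` A) by exact: openI.
apply: (@filterS _ (nbhs p) _ _ _ _ (ne _ oO (conj Np Ap))) => q [[Nq Aq] qe].
split=> //; split.
  move=> [[[_ Bq /andP[q0 _]] _]|[[_ Bq lq] _]].
    by split; [split=> //; left|rewrite q0].
  by split; [split=> //; left|rewrite (le_trans (lam_ge0 _) lq)].
move=> [[Bq _] /andP[q0 _]].
by case: (leP q.2 (lam (phi q.1))) => h; [left; split=> //; split=> //; rewrite q0|
  right; split=> //; split=> //; exact: ltW].
Qed.

Lemma merge_collar : partial_collar (N `|` core) e merge.
Proof.
by split=> [y [By NCy]||]; [exact: merge_base|exact: merge_inj|exact: plat_merge].
Qed.

End Patch.

Lemma chart_cube x : B x -> exists (c : chart R W n.+1) (r : R),
  [/\ manifold_chart c, chart_dom c x, c0 (chart_map c x) = 0, 0 < r &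
   cube (chart_map c x) r `&` [set z | 0 <= c0 z] `<=` chart_map c @` chart_dom c].
Proof.
move=> [c [mc cx x0]]; have [_ _ [ O [oO OE]]] := mc.
have Ox : O (chart_map c x).
  have : (O `&` @half_space R n) (chart_map c x) by rewrite -OE; exists x.
  by case.
have [r r0 rO] := nbhs_cube (open_near oO Ox).
by exists c, r; split=> // z [/rO Oz z0]; rewrite OE.
Qed.

Hypothesis cB : compact B.

(** Starting from the empty set, cores of finitely many patches are added until they cover the
    compact boundary; each patch lowers the height to at most half the size of its cube, as [lam]
    requires. *)
Lemma partial_collar_exists : exists e (c : WR -> W), 0 < e /\ partial_collar setT e c.
Proof.
have /choice [cr Hcr] : forall x, exists cr : chart R W n.+1 * R, B x ->
  [/\ manifold_chart cr.1, chart_dom cr.1 x, c0 (chart_map cr.1 x) = 0, 0 < cr.2 &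
   cube (chart_map cr.1 x) cr.2 `&` [set z | 0 <= c0 z] `<=` chart_map cr.1 @` chart_dom cr.1].
  move=> x; have [Bx|nBx] := pselect (B x); last first.
    have c : chart R W n.+1 by split; [exact: set0|exact: (fun=> 0)].
    by exists (c, 0).
  by have [c [r H]] := chart_cube Bx; exists (c, r).
pose N x := core x (cr x).1 (cr x).2.
have HN x : B x -> nbhs x (N x).
  move=> Bx; have [h1 h2 h3 h4 h5] := Hcr x Bx.
  by apply: open_near; [exact: core_open|exact: core_center].
have [s [sB Bs]] := compact_finite_cover cB HN.
suff [e [c [e0 oN [h1 h2 h3]]]] : exists e c, [/\ 0 < e,
    open [set y | exists2 x, x \in s & N x y] &
    partial_collar [set y | exists2 x, x \in s & N x y] e c].
  have BE : B `&` [set y | exists2 x, x \in s & N x y] = B `&` setT.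
    by apply/seteqP; split=> y [By _]; split=> //; exact: Bs.
  by exists e, c; split=> //; rewrite /partial_collar -BE.
elim: s sB {Bs} => [|x s IH] sB.
  exists 1, fst; split=> //.
    by rewrite (_ : mkset _ = set0); [exact: open0|apply/seteqP; split=> y // [x]].
  have BE : B `&` [set y | exists2 x, x \in [::] & N x y] = set0.
    by apply/seteqP; split=> y // [_ [x]].
  by rewrite /partial_collar BE; split=> // [p q []|p []] //= [].
have [y ys|e [c [e0 oN hc]]] := IH; first by apply: sB; rewrite inE ys orbT.
have Bx : B x by apply: sB; rewrite inE eqxx.
have [mc cx x0 r0 himg] := Hcr x Bx.
pose e' := Num.min e ((cr x).2 / 2).
have e'0 : 0 < e' by rewrite lt_min e0 divr_gt0.
have e'r : e' <= (cr x).2 / 2 by rewrite ge_min lexx orbT.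
have e'e : e' <= e by rewrite ge_min lexx.
have NE : [set y | exists2 z, z \in x :: s & N z y] =
    [set y | exists2 x, x \in s & N x y] `|` N x.
  apply/seteqP; split=> y.
    by move=> [z]; rewrite inE => /orP[/eqP ->|zs Nz]; [right|left; exists z].
  by move=> [[z zs Nz]|Nx]; [exists z; rewrite ?inE ?zs ?orbT|exists x; rewrite ?inE ?eqxx].
exists e'; eexists; split=> //.
  by rewrite NE; apply: openU => //; exact: core_open.
by rewrite NE; apply: merge_collar himg _ e'0 e'r _ _ _ _ hc e'e.
Qed.

End Collar.

(** * Openness of collars *)

Section OpenCollar.
Variables (R : realType) (n : nat) (W : plSpace R).
Hypothesis W_man : pl_manifold n W.
Let W_pl : is_pl_space W := proj1 W_man.
Let B : set W := boundary n (X := W).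
Let WR := pl_prod W (pl_line R).
Let WR_pl : pl_axioms WR := prod_axioms W_pl (line_axioms R).

Lemma plg_nbhs (T : topologicalType) k (X G : set T) (p : T -> 'rV[R]_k) (H : set 'rV[R]_k) x :
  X x -> inv_at X p x -> (\forall y \near p x, H y -> (p @` X) y) -> nbhs x G ->
  \forall y \near p x, H y -> (p @` (X `&` G)) y.
Proof.
move=> Xx vp pX Gx; apply: (@filterS2 _ (nbhs (p x)) _ _ _ _ _ pX (vp _ Gx)) => y h1 h2 Hy.
by have [z Xz zy] := h1 Hy; exists z => //; split=> //; exact: (h2 z Xz zy).
Qed.

Variables (e : R) (c : WR -> W).
Let S : set WR := [set p | B p.1 /\ 0 <= p.2 < e].
Hypotheses (c_base : forall y, B y -> c (y, 0) = y) (c_inj : inj_on S c)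
  (c_pl : forall p, S p -> plat S c p) (e0 : 0 < e).

(** The first coordinate of a boundary chart vanishes on [B], so [pi] can store the collar parameter
    there. In these coordinates the domain is an open part of a half-space of the same dimension as
    [W], and invariance of domain applies, in its half-space form when the parameter is 0. *)
Lemma collar_open (O : set WR) : open O -> open (c @` (O `&` S)).
Proof.
move=> oO; rewrite openE => _ [[y s] [Op Sp] <-].
have [By /andP[/= s0 se]] := Sp; have [cc _] := c_pl Sp.
have [d [md dy]] := proj2 W_man y; set q := c (y, s).
have [f [mf fq]] := proj2 W_man q.
pose A := chart_dom d; pose phi := chart_map d.
pose D := chart_dom f; pose psi := chart_map f.
have rA : rchart A phi := manifold_chart_rchart W_pl md.
have rD : rchart D psi := manifold_chart_rchart W_pl mf.
have [[cA iA vA] _] := rA; have [[cD iD vD] _] := rD.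
have oA : open A := proj1 (is_chart_emb (let: And3 h _ _ := md in h)).
have oD : open D := proj1 (is_chart_emb (let: And3 h _ _ := mf in h)).
pose P0 : set WR := A `*` setT.
pose Phi (p : WR) := row_mx (phi p.1) (const_mx p.2 : 'rV[R]_1).
have rP : @rchart R WR _ P0 Phi := rchart_prod rA (rchart_line R).
have P0p : P0 (y, s) by [].
have [[cP iP vP] _] := rP.
pose pi (p : WR) := setc p.2 (phi p.1).
have phiB w : A w -> (B w <-> c0 (phi w) = 0) by move=> ?; exact: boundary_c0.
pose X := S `&` P0.
have Xp : X (y, s) by [].
have iX : inj_on X pi.
  move=> [w t] [w' t'] [[/= Bw _] [/= Aw _]] [[/= Bw' _] [/= Aw' _]] E.
  have tt : t = t' by rewrite -(c0_setc t (phi w)) -(c0_setc t' (phi w')) -/(pi (w, t)) E.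
  have := E; rewrite tt => /setc_inj Es; congr (_, _); apply: iA => //; apply: Es.
  by rewrite (proj1 (phiB _ Aw) Bw) (proj1 (phiB _ Aw') Bw').
(* An affine map recovering the product chart [Phi] from [pi]; with it continuity of the inverse of
   [pi] reduces to that of [Phi]. *)
pose F (u : 'rV[R]_n.+1) := row_mx (setc 0 u) (const_mx (c0 u) : 'rV[R]_1).
have aF : affine F.
  have [L [v LE]] : affine (fun u : 'rV[R]_n.+1 => setc 0 u).
    by apply: affine_setc; [exact: affine_fun_cst|exact: affine_id].
  have [M [w ME]] : affine (fun u : 'rV[R]_n.+1 => const_mx (c0 u) : 'rV[R]_1).
    apply/affine_coord => i; have [u [b H]] := affine_fun_c0 R n.
    by exists u, b => z; rewrite mxE H.
  by exists (row_mx L M), (row_mx v w) => u; rewrite mul_mx_row add_row_mx -LE -ME.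
have FE p : X p -> F (pi p) = Phi p.
  move=> [[Bp _] [Ap _]]; rewrite /F /pi /Phi c0_setc setc_setc.
  by rewrite -(proj1 (phiB _ Ap) Bp) setc_id.
have vX : inv_at X pi (y, s).
  move=> V Vp; have := vP _ P0p _ Vp; rewrite -(FE _ Xp) => h.
  apply: (near_cont (affine_continuous aF (x := pi (y, s))) h) => u Hu z Xz zu.
  by apply: (Hu z); [case: Xz|rewrite -FE // zu].
pose G := [set p | S p -> D (c p)].
have nG : nbhs (y, s) G := cc _ (open_near oD fq).
pose A0 := X `&` G.
have A0E : A0 = S `&` P0 `&` c @^-1` D.
  apply/seteqP; split=> p; first by move=> [[Sp' Pp] Gp]; split=> //; exact: Gp.
  by move=> [[Sp' Pp] Dp]; split.
have A0p : A0 (y, s) by split=> //; exact: nbhs_singleton.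
have plPsi : plg A0 pi (psi \o c) (y, s).
  have h1 : plg A0 Phi (psi \o c) (y, s).
    by rewrite A0E; exact: (plat_rchart WR_pl W_pl (c_pl Sp) rP rD).
  have h0 := plg_refl h1.
  have iA0 : inj_on A0 pi by apply: inj_on_sub iX => z [].
  have a1 : affine (fun z : 'rV[R]_(n.+1 + 1) => setc (z ord0 (rshift n.+1 ord0)) (lsubmx z)).
    apply: affine_setc; first exact: affine_fun_coord.
    apply/affine_coord => i.
    have : affine_fun (fun y : 'rV[R]_(n.+1 + 1) => y ord0 (lshift 1 i)) by exact: affine_fun_coord.
    by move=> [u [b H]]; exists u, b => z; rewrite -H mxE.
  have h2 : plg A0 Phi pi (y, s).
    by apply: plg_ext (plg_post a1 h0) => // z _; rewrite /= /Phi row_mxEr mxE row_mxKl.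
  by apply: plg_comp (plg_inv iA0 h2) _ h1.
have iPsi : inj_on A0 (psi \o c).
  move=> z z'; rewrite A0E => -[[Sz _] Dz] [[Sz' _] Dz'] /= /iD E.
  by apply: c_inj => //; exact: E.
have piX : \forall u \near pi (y, s), 0 <= c0 u -> (pi @` X) u.
  have [_ _ [OA [oOA EA]]] := md.
  have h : nbhs (pi (y, s)) [set u | OA (setc 0 u) /\ c0 u < e].
    have c1 : continuous (fun u : 'rV[R]_n.+1 => setc 0 u).
      by apply: affine_continuous; apply: affine_setc; [exact: affine_fun_cst|exact: affine_id].
    have y1 : OA (setc 0 (pi (y, s))).
      rewrite /pi setc_setc -(proj1 (phiB _ dy) By) setc_id.
      have : (OA `&` @half_space R n) (phi y) by rewrite -EA; exists y.
      by case.
    have h1 := near_cont (c1 (pi (y, s))) (open_near oOA y1) (fun _ h => h).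
    have h2 : nbhs (c0 (pi (y, s))) [set t | t < e].
      by apply: open_nbhs_nbhs; split; [exact: open_lt|rewrite /pi c0_setc].
    have h3 := near_cont (affine_fun_continuous (affine_fun_c0 R n) (x := pi (y, s))) h2 (fun _ h => h).
    exact: (@filterI _ (nbhs (pi (y, s))) _ _ _ h1 h3).
  apply: (@filterS _ (nbhs (pi (y, s))) _ _ _ _ h) => u [Ou ue] u0.
  have : (OA `&` @half_space R n) (setc 0 u) by split=> //; rewrite /half_space /= -/(c0 _) c0_setc.
  rewrite -EA => -[w Aw wu]; exists (w, c0 u); last by rewrite /pi /phi /= wu setc_setc setc_id.
  split=> //; split=> /=; last by rewrite u0.
  by apply/(phiB _ Aw); rewrite /phi wu c0_setc.
have piA0 := plg_nbhs Xp vX piX nG.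
have Oq : nbhs (y, s) O by exact: (open_near oO Op).
have vA0 : inv_at A0 pi (y, s) by apply: inv_at_sub vX => z [].
have iA0 : inj_on A0 pi by apply: inj_on_sub iX => z [].
have fin : (\forall u \near psi q, 0 <= c0 u -> ((psi \o c) @` (A0 `&` O)) u) ->
    nbhs q (c @` (O `&` S)).
  move=> h; apply: filterS2 (open_near oD fq) (cD _ fq _ h) => w Dw Hw.
  have [p [A0p' Op'] pw] := Hw Dw (manifold_chart_half mf Dw).
  have [[Sp' _] Gp'] := A0p'.
  by exists p => //; apply: iD => //; exact: Gp'.
apply: fin; have [s00|s1] := eqVneq s 0.
  have q_y : q = y by rewrite /q s00 c_base.
  apply: (plg_open_half (p := pi) (q := psi \o c)) => //.
  - by rewrite /pi c0_setc s00.
  - by move=> z; rewrite A0E => -[[Sz _] Dz]; exact: (manifold_chart_half mf).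
  move=> [w t]; rewrite A0E => -[[Sz _] Dz]; rewrite /pi c0_setc /= => t0.
  have [/= Bw _] := Sz; move: Dz; rewrite /= t0 c_base // => Dw.
  by apply/(boundary_c0 W_pl mf Dw).
have sgt : 0 < s by rewrite lt_neqAle eq_sym s1.
have nA : nbhs (pi (y, s)) (pi @` A0).
  have h : nbhs (c0 (pi (y, s))) [set t | 0 < t].
    by apply: open_nbhs_nbhs; split; [exact: open_gt|rewrite /pi c0_setc].
  have h3 := near_cont (affine_fun_continuous (affine_fun_c0 R n) (x := pi (y, s))) h (fun _ h => h).
  by apply: (@filterS2 _ (nbhs (pi (y, s))) _ _ _ _ _ piA0 h3) => u Hu /ltW; exact: Hu.
have := plg_open A0p iA0 vA0 iPsi nA plPsi Oq.
by apply: (@filterS _ (nbhs (psi q))) => u Hu _.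
Qed.

End OpenCollar.

Lemma plat_prod_id (R : realType) (X Y : plSpace R) (A : set X) (I : set Y) x t :
  pl_axioms X -> pl_axioms Y -> plat A id x -> plat I id t -> A x -> I t ->
  @plat R (pl_prod X Y) (pl_prod X Y) (A `*` I) id (x, t).
Proof.
move=> X_pl Y_pl [_ pA] [_ pI] Ax It; have Z_pl := prod_axioms X_pl Y_pl.
have [k [c [ac cx]]] := atlas_cover X_pl x; have [l [d [ad dt]]] := atlas_cover Y_pl t.
have [oc _] := atlas_emb X_pl ac; have [od _] := atlas_emb Y_pl ad.
have rP := rchart_prod (atlas_rchart X_pl ac) (atlas_rchart Y_pl ad).
have cdx : (chart_dom c `*` chart_dom d) (x, t) by [].
have nP := open_near (open_prod oc od) cdx.
apply: (plat_intro Z_pl Z_pl rP rP) => //; first by apply: filterS nP.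
have -> : A `*` I `&` chart_dom c `*` chart_dom d `&` id @^-1` (chart_dom c `*` chart_dom d)
  = (A `&` chart_dom c `&` id @^-1` chart_dom c) `*` (I `&` chart_dom d `&` id @^-1` chart_dom d).
  by apply/seteqP; split=> -[u v] /=; [move=> [[[? ?] [? ?]] _]|move=> [[[? ?] ?] [[? ?] ?]]].
by apply: plg_prod; [exact: (pA _ _ c c)|exact: (pI _ _ d d)].
Qed.

Lemma plat_ge0 (R : realType) (t : R) : 0 <= t ->
  @plat R (pl_line R) (pl_line R) [set s | 0 <= s] id t.
Proof.
move=> t0; have rl := rchart_line R.
apply: (plat_intro (line_axioms R) (line_axioms R) rl rl) => //; try exact: filterT.
  exact: nbhs_all.
have h := rchart_self (line_axioms R) rl (I : [set: R] t).
have rs : rg (fun t : R => const_mx t : 'rV[R]_1) [set: R] (fun s => s) t.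
  by apply: rg_ext (rg_coord ord0 h) => z _; rewrite mxE.
have := rg_level (rg_cst 0 h) rs h.
by congr (plg _ _ _ _); apply/seteqP; split=> s /=; [move=> []|move=> [[]]].
Qed.

Lemma plat_boundary (R : realType) n (W : plSpace R) (y : W) : pl_manifold n W ->
  boundary n y -> plat (boundary n (X := W)) id y.
Proof.
move=> W_man By; have W_pl : is_pl_space W := proj1 W_man.
have [c [mc cy]] := proj2 W_man y; have rc := manifold_chart_rchart W_pl mc.
have oc := proj1 (is_chart_emb (let: And3 h _ _ := mc in h)).
apply: (plat_intro W_pl W_pl rc rc) => //; try exact: open_near.
  by apply: filterS (open_near oc cy).
have h := rchart_self W_pl rc cy.
have -> : boundary n (X := W) `&` chart_dom c `&` id @^-1` chart_dom c =
    chart_dom c `&` [set z | c0 (chart_map c z) <= 0].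
  apply/seteqP; split=> z /=.
    by move=> [[Bz cz] _]; split=> //=; rewrite (proj1 (boundary_c0 W_pl mc cz) Bz).
  move=> [cz z0]; split=> //; split=> //; apply/(boundary_c0 W_pl mc cz)/eqP.
  by rewrite eq_le z0 (manifold_chart_half mc cz).
by apply: rg_level => //; [exact: rg_coord|exact: rg_cst].
Qed.

Definition half_open (R : realType) (T : Type) (B : set T) : set (T * R) :=
  B `*` [set t | 0 <= t < 1].

Arguments half_open R [T] B _.

Lemma plat_scale (R : realType) (W : plSpace R) (a : R) p : pl_axioms W ->
  @plat R (pl_prod W (pl_line R)) (pl_line R) setT (fun q => a * q.2) p.
Proof.
move=> W_pl; have WR_pl := prod_axioms W_pl (line_axioms R).
case: p => y s; have [k [d [ad dy]]] := atlas_cover W_pl y.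
have rP := rchart_prod (atlas_rchart W_pl ad) (rchart_line R).
have [od _] := atlas_emb W_pl ad.
have dp : (chart_dom d `*` setT) (y, s) by [].
apply: (rg_plat WR_pl rP) => //; first exact: (open_near (open_prod od (@openT R)) dp).
rewrite setTI; apply: rg_scale.
apply: rg_ext (rg_coord (rshift k ord0) (rchart_self WR_pl rP dp)) => z _.
by rewrite row_mxEr mxE.
Qed.

Lemma plat_half_open (R : realType) n (W : plSpace R) p : pl_manifold n W ->
  half_open R (boundary n (X := W)) p ->
  @plat R (pl_prod W (pl_line R)) (pl_prod W (pl_line R)) (half_open R (boundary n (X := W))) id p.
Proof.
move=> W_man; case: p => y s [By /andP[s0 s1]]; have W_pl : is_pl_space W := proj1 W_man.
apply: plat_prod_id => //; [exact: W_pl|exact: line_axioms|exact: plat_boundary| |by apply/andP].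
have o1 : open [set t : R | t < 1] by exact: open_lt.
have := plat_open (line_axioms R) (s0 : [set t : R | 0 <= t] s) o1 s1 (plat_ge0 s0).
by congr plat; apply/seteqP; split=> t /=; [move=> [-> ->]|move=> /andP[]].
Qed.

Lemma collar_theorem (R : realType) n (W : plSpace R) :
  pl_manifold n W -> compact (boundary n (X := W)) ->
  let S : set (pl_prod W (pl_line R)) := half_open R (boundary n (X := W)) in
  exists c : pl_prod W (pl_line R) -> W,
  [/\ forall y, boundary n y -> c (y, 0) = y, inj_on S c,
      forall p, S p -> plat S c p &
      forall O, open O -> open (c @` (O `&` S))].
Proof.
move=> W_man cB S; have W_pl : is_pl_space W := proj1 W_man.
have WR_pl : pl_axioms (pl_prod W (pl_line R)) := prod_axioms W_pl (line_axioms R).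
have [e [c [e0 [h1 h2 h3]]]] := partial_collar_exists W_man cB.
rewrite setIT in h1 h2 h3; set S' := cyl _ _ in h2 h3.
pose m (p : pl_prod W (pl_line R)) : pl_prod W (pl_line R) := (p.1, e * p.2).
have mS p : S p -> S' (m p).
  by move=> [Bp /andP[p0 p1]]; split=> //=; rewrite mulr_ge0 ?(ltW e0) //= gtr_pMr.
have base y : boundary n y -> (c \o m) (y, 0) = y.
  by move=> By; rewrite /m /= mulr0 h1.
have inj : inj_on S (c \o m).
  move=> [y s] [y' s'] Sp Sq /= /h2 E; have [-> /eqP] := E (mS _ Sp) (mS _ Sq).
  by rewrite -subr_eq0 -mulrBr mulf_eq0 gt_eqF //= subr_eq0 => /eqP ->.
have pl p : S p -> plat S (c \o m) p.
  move=> Sp; apply: (plat_comp WR_pl WR_pl W_pl Sp _ mS); last by apply: h3; exact: mS.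
  have mm : @plat R _ _ setT m p.
    by apply: (plat_pair WR_pl (plat_fst W_pl (line_axioms R) p)); exact: (plat_scale e p (is_pl_space_axioms W_pl)).
  by have := plat_inter WR_pl mm (plat_half_open W_man Sp); rewrite setTI.
exists (c \o m); split=> //.
by move=> O; apply: (collar_open W_man (e := 1)) => //; exact: ltr01.
Qed.

(** * Homotopy equivalences and deformation retractions *)

Section SubsetHomotopy.
Variable R : realType.

Definition I01 : set R := [set t | 0 <= t <= 1].

Lemma I01E : I01 = `[0, 1]%classic.
Proof. by apply/seteqP; split=> t; rewrite /I01 /= in_itv. Qed.

Lemma cont_paste (T Y : topologicalType) (S C1 C2 : set T) (f : T -> Y) :
  closed C1 -> closed C2 -> S `<=` C1 `|` C2 ->
  cont_on (S `&` C1) f -> cont_on (S `&` C2) f -> cont_on S f.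
Proof.
move=> k1 k2 SC h1 h2 x Sx V Vf.
have P (C : set T) : closed C -> cont_on (S `&` C) f -> \forall z \near x, S z -> C z -> V (f z).
  move=> kC h; have [Cx|nCx] := pselect (C x).
    by apply: filterS (h x (conj Sx Cx) V Vf) => z Hz Sz Cz; exact: Hz.
  by apply: filterS (open_near (closed_openC kC) nCx) => z nCz _ /nCz.
apply: filterS2 (P C1 k1 h1) (P C2 k2 h2) => z H1 H2 Sz.
by case: (SC _ Sz) => Cz; [exact: H1|exact: H2].
Qed.

Lemma cont_on_pair (T Y Z : topologicalType) (A : set T) (f : T -> Y) (g : T -> Z) :
  cont_on A f -> cont_on A g -> cont_on A (fun x => (f x, g x)).
Proof.
move=> cf cg x Ax V [[V1 V2] /= [n1 n2] HV].
apply: filterS2 (cf x Ax _ n1) (cg x Ax _ n2) => z h1 h2 Az.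
by apply: HV; split; [exact: h1|exact: h2].
Qed.

Lemma cont_on_fst (T Y : topologicalType) (A : set (T * Y)) : cont_on A fst.
Proof. by apply: continuous_cont_on => x; exact: cvg_fst. Qed.

Lemma cont_on_snd (T Y : topologicalType) (A : set (T * Y)) : cont_on A snd.
Proof. by apply: continuous_cont_on => x; exact: cvg_snd. Qed.

Lemma cont_on_cst (T Y : topologicalType) (A : set T) (y : Y) : cont_on A (fun=> y).
Proof. by apply: continuous_cont_on => x; exact: cst_continuous. Qed.

Lemma cont_on_id (T : topologicalType) (A : set T) : cont_on A id.
Proof. by move=> x _ V Vx; apply: filterS Vx => z. Qed.

Lemma cont_onP (T Y : topologicalType) (A : set T) (f : T -> Y) x : 
  cont_at A f x <-> f @ within A (nbhs x) --> f x.
Proof. by split=> H V /H; apply: filterS => z. Qed.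

Section Real.
Variables (T : topologicalType) (A : set T).

Lemma cont_on_add (f g : T -> R) : cont_on A f -> cont_on A g -> cont_on A (fun x => f x + g x).
Proof.
move=> cf cg x Ax; apply/cont_onP.
exact: (cvgD ((cont_onP A f x).1 (cf x Ax)) ((cont_onP A g x).1 (cg x Ax))).
Qed.

Lemma cont_on_mul (f g : T -> R) : cont_on A f -> cont_on A g -> cont_on A (fun x => f x * g x).
Proof.
move=> cf cg x Ax; apply/cont_onP.
exact: (cvgM ((cont_onP A f x).1 (cf x Ax)) ((cont_onP A g x).1 (cg x Ax))).
Qed.

Lemma cont_on_opp (f : T -> R) : cont_on A f -> cont_on A (fun x => - f x).
Proof.
move=> cf; apply: (cont_on_ext (f := fun x => (-1) * f x)); first by move=> x _; rewrite mulN1r.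
by apply: cont_on_mul => //; exact: cont_on_cst.
Qed.

Lemma closed_le_on (f g : T -> R) : continuous f -> continuous g -> closed [set x | f x <= g x].
Proof.
move=> cf cg; rewrite (_ : mkset _ = (fun x => f x + - g x) @^-1` [set t | t <= 0]).
  apply: preimage_closed; last exact: closed_le.
  by move=> x _; apply: contD; [exact: cf|apply: cvgN; exact: cg].
by apply/seteqP; split=> x /=; rewrite subr_le0.
Qed.

Lemma cont_on_min (f g : T -> R) : cont_on A f -> cont_on A g ->
  cont_on A (fun x => Num.min (f x) (g x)).
Proof.
move=> cf cg x Ax V Vm.
have P (h h' : T -> R) : cont_on A h -> cont_on A h' -> h x < h' x ->
    \forall z \near x, A z -> h z < h' z.
  move=> ch ch' hx.
  have ck : cont_on A (fun z => h' z + - h z) by apply: cont_on_add => //; exact: cont_on_opp.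
  have h0 : nbhs (h' x + - h x) [set t : R | 0 < t].
    by apply: open_nbhs_nbhs; split; [exact: open_gt|rewrite /= subr_gt0].
  by apply: filterS (ck x Ax _ h0) => z H Az; rewrite -subr_gt0; exact: H.
have [fg|gf|E] := ltgtP (f x) (g x).
- have Vf : nbhs (f x) V by rewrite min_l // in Vm; exact: ltW.
  apply: filterS2 (P _ _ cf cg fg) (cf x Ax _ Vf) => z h1 h2 Az.
  by rewrite min_l ?(ltW (h1 Az)) //; exact: h2.
- have Vg : nbhs (g x) V by rewrite min_r // in Vm; exact: ltW.
  apply: filterS2 (P _ _ cg cf gf) (cg x Ax _ Vg) => z h1 h2 Az.
  by rewrite min_r ?(ltW (h1 Az)) //; exact: h2.
have Vf : nbhs (f x) V by rewrite min_l // E in Vm *.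
have Vg : nbhs (g x) V by rewrite -E.
apply: filterS2 (cf x Ax _ Vf) (cg x Ax _ Vg) => z h1 h2 Az.
by rewrite /Num.min; case: ifP => _; [exact: h1|exact: h2].
Qed.

Lemma cont_on_max (f g : T -> R) : cont_on A f -> cont_on A g ->
  cont_on A (fun x => Num.max (f x) (g x)).
Proof.
move=> cf cg; apply: (cont_on_ext (f := fun x => - Num.min (- f x) (- g x))).
  by move=> x _; rewrite oppr_min !opprK.
by apply: cont_on_opp; apply: cont_on_min; exact: cont_on_opp.
Qed.

End Real.

(** As [transp], for arbitrary targets: values off the image of [B] come from the default [d]. *)
Definition extend S T (Y : choiceType) (B : set S) (j : S -> T) (f : S -> Y) (d : T -> Y) (y : T) : Y :=
  xget (d y) [set w | exists x, [/\ B x, j x = y & f x = w]].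

Lemma extendE S T (Y : choiceType) (B : set S) (j : S -> T) (f : S -> Y) (d : T -> Y) x :
  inj_on B j -> B x -> extend B j f d (j x) = f x.
Proof.
move=> ij Bx; rewrite /extend; case: xgetP => [w _ [x' [Bx' xx' <-]]|].
  by rewrite (ij x' x).
by move=> /(_ (f x)) []; exists x.
Qed.

Lemma extend_cont (S T Y : topologicalType) (B : set S) (j : S -> T) (f : S -> Y) (d : T -> Y) :
  emb_on B j -> cont_on B f -> cont_on (j @` B) (extend B j f d).
Proof.
move=> [cj ij vj] cf _ [x Bx <-] V; rewrite extendE // => Vf.
apply: filterS (vj x Bx _ (cf x Bx _ Vf)) => y Hy [z Bz zy].
by rewrite -zy extendE //; exact: (Hy z Bz zy Bz).
Qed.

Lemma emb_prodR (S T : topologicalType) (B : set S) (I : set R) (j : S -> T) :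
  emb_on B j -> emb_on (B `*` I) (fun p : S * R => (j p.1, p.2)).
Proof.
move=> [cj ij vj]; split.
- apply: cont_on_pair; last exact: cont_on_snd.
  by apply: (cont_on_comp (B := B)) => //; [exact: cont_on_fst|move=> p []].
- by move=> [x s] [y t] [/= Bx _] [/= By _] [/ij -> // ->].
move=> [x s] [/= Bx Is] V [[V1 V2] /= [n1 n2] HV].
exists ([set y | forall z, B z -> j z = y -> V1 z], V2) => /=.
  by split=> //; exact: vj.
by move=> [y t] /= [H1 H2] [z r] [/= Bz _] [zy rt]; apply: HV; split; [exact: H1|rewrite /= rt].
Qed.

(* Subset version of: the inclusion of [B] in [V] is a homotopy equivalence. *)
Definition sheq (T : topologicalType) (V B : set T) : Prop :=
  exists (g : T -> T) (G F : T * R -> T),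
  [/\ cont_on V g /\ (forall x, V x -> B (g x)),
      cont_on (B `*` I01) G /\ (forall p, (B `*` I01) p -> B (G p)),
      forall b, B b -> G (b, 0) = g b /\ G (b, 1) = b,
      cont_on (V `*` I01) F /\ (forall p, (V `*` I01) p -> V (F p))
    & forall x, V x -> F (x, 0) = g x /\ F (x, 1) = x].

(** Homotopy data are moved to subsets of an ambient space, where they can be restricted and pasted
    freely; [sheq_inclusion_heq] leads back to subspaces. *)
Lemma inclusion_heq_sheq (X T : topologicalType) (j : X -> T) (A : set X) :
  emb_on setT j -> inclusion_heq R A -> sheq (range j) (j @` A).
Proof.
move=> ej [cA [g [cg [H1 [cH1 H10 H11]] [H2 [cH2 H20 H21]]]]].
have eA := set_val_emb A.
have eJ : emb_on setT (j \o set_val : A -> T) by apply: (emb_comp eA _ ej).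
have eJI := emb_prodR I01 eJ; have ejI := emb_prodR I01 ej.
have [cj ij vj] := ej; have [cJ iJ vJ] := eJ.
have [_ iJI _] := eJI; have [_ ijI _] := ejI.
have imJ : (fun p : A * R => ((j \o set_val) p.1, p.2)) @` (setT `*` I01) = (j @` A) `*` I01.
  apply/seteqP; split=> [y [[a t] [_ It] ye]|[y t] [/= [x Ax xy] It]]; first subst y.
    by split=> //; exists (set_val a) => //; exact: set_valE'.
  by exists (toset Ax, t) => //=; rewrite set_val_toset xy.
have imj : (fun p : X * R => (j p.1, p.2)) @` (setT `*` I01) = range j `*` I01.
  apply/seteqP; split=> [y [[a t] [_ It] ye]|[y t] [/= [x _ xy] It]]; first subst y.
    by split=> //; exists a.
  by exists (x, t) => //=; rewrite xy.
exists (extend setT j (j \o (set_val \o g)) id),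
  (extend (setT `*` I01) (fun p : A * R => ((j \o set_val) p.1, p.2)) ((j \o set_val) \o H1) fst),
  (extend (setT `*` I01) (fun p : X * R => (j p.1, p.2)) (j \o H2) fst); split.
- split; last first.
    by move=> _ [x _ <-]; rewrite extendE //; exists (set_val (g x)) => //; exact: set_valE'.
  apply: extend_cont => //; apply: (cont_on_comp (B := setT)) => //.
  apply/cont_onT => x; apply: continuous_comp; first exact: cg.
  exact: cA.
- rewrite -imJ; split.
    apply: extend_cont => //; apply: (cont_on_comp (B := setT)) => //.
    by apply/cont_on_within; rewrite I01E.
  move=> _ [p Ip <-]; rewrite extendE //; exists (set_val (H1 p)) => //.
  exact: set_valE'.
- move=> _ [x Ax <-]; rewrite extendE //.
  have E t : I01 t -> extend (setT `*` I01) (fun p : A * R => ((j \o set_val) p.1, p.2))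
      ((j \o set_val) \o H1) fst (j x, t) = j (set_val (H1 (toset Ax, t))).
    move=> It; have -> : (j x, t) = (fun p : A * R => ((j \o set_val) p.1, p.2)) (toset Ax, t).
      by rewrite /= set_val_toset.
    by rewrite extendE.
  rewrite (E 0) ?(E 1); try by rewrite /I01 /= lexx ler01.
  by rewrite H10 H11 /= set_val_toset.
- rewrite -imj; split.
    apply: extend_cont => //; apply: (cont_on_comp (B := setT)) => //.
    by apply/cont_on_within; rewrite I01E.
  by move=> _ [p Ip <-]; rewrite extendE.
move=> _ [x _ <-]; rewrite extendE //.
have E t : I01 t -> extend (setT `*` I01) (fun p : X * R => (j p.1, p.2)) (j \o H2) fst (j x, t) =
    j (H2 (x, t)).
  move=> It; have -> : (j x, t) = (fun p : X * R => (j p.1, p.2)) (x, t) by [].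
  by rewrite extendE.
rewrite (E 0) ?(E 1); try by rewrite /I01 /= lexx ler01.
by rewrite H20 H21.
Qed.

Lemma lift_cont (S X T : topologicalType) (D : set S) (J : X -> T) (f : S -> X) (h : S -> T) :
  emb_on setT J -> (forall s, D s -> J (f s) = h s) -> cont_on D h -> cont_on D f.
Proof.
move=> [cJ iJ vJ] E ch s Ds V Vf.
have := vJ (f s) I _ Vf; rewrite E // => H.
by apply: filterS (ch s Ds _ H) => z Hz Dz; apply: (Hz Dz (f z)) => //; exact: E.
Qed.

Lemma sheq_inclusion_heq (X T : topologicalType) (j : X -> T) (B : set T) :
  emb_on setT j -> B `<=` range j -> sheq (range j) B -> inclusion_heq R (j @^-1` B).
Proof.
move=> ej BV [g [G [F [[cg gB] [cG GB] GE [cF FV] FE]]]].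
set A := j @^-1` B; have eA := set_val_emb A.
have eJ : emb_on setT (j \o set_val : A -> T) by apply: (emb_comp eA _ ej).
have [cj ij vj] := ej; have [cJ iJ vJ] := eJ.
have AB (y : T) : B y -> exists a : A, j (set_val a) = y.
  by move=> By; have [x _ xy] := BV _ By; subst y; exists (toset (By : A x)); rewrite set_val_toset.
have jA (a : A) : B (j (set_val a)) by exact: (set_valE' a).
have /choice [g0 Hg0] : forall x, exists a : A, j (set_val a) = g (j x).
  by move=> x; apply: AB; apply: gB; exists x.
have /choice [G0 HG0] : forall p : A * R, exists a : A, I01 p.2 -> j (set_val a) = G (j (set_val p.1), p.2).
  move=> [a t]; have [It|nIt] := pselect (I01 t); last by exists a.
  by have [b Hb] := AB _ (GB (j (set_val a), t) (conj (jA a) It)); exists b.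
have /choice [F0 HF0] : forall p : X * R, exists x : X, I01 p.2 -> j x = F (j p.1, p.2).
  move=> [x t]; have [It|nIt] := pselect (I01 t); last by exists x.
  have jx : range j (j x) by exists x.
  by have [y _ Hy] := FV (j x, t) (conj jx It); exists y.
have I0 : I01 0 by rewrite /I01 /= lexx ler01.
have I1 : I01 1 by rewrite /I01 /= lexx ler01.
split; first by apply/cont_onT; case: eA.
exists g0; split.
- apply/cont_onT; apply: (lift_cont eJ (h := g \o j)) => [x _|]; first exact: Hg0.
  by apply: (cont_on_comp (B := range j)) => // x _; exists x.
- exists G0; split.
  + rewrite -I01E; apply/cont_on_within.
    apply: (lift_cont eJ (h := G \o (fun p : A * R => (j (set_val p.1), p.2)))).
      by move=> p [_ Ip]; exact: HG0.
    apply: (cont_on_comp (B := B `*` I01)) => //; last by move=> p [_ ?]; split=> //; exact: jA.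
    by case: (emb_prodR I01 eJ).
  + move=> a; apply: iJ => //=; rewrite HG0 // Hg0.
    by case: (GE _ (jA a)).
  + move=> a; apply: iJ => //=; rewrite HG0 //.
    by case: (GE _ (jA a)).
exists F0; split.
+ rewrite -I01E; apply/cont_on_within.
  apply: (lift_cont ej (h := F \o (fun p : X * R => (j p.1, p.2)))).
    by move=> p [_ Ip]; exact: HF0.
  apply: (cont_on_comp (B := range j `*` I01)) => //; last by move=> p [_ ?]; split=> //; exists p.1.
  by case: (emb_prodR I01 ej).
+ move=> x; apply: ij => //=; rewrite HF0 // Hg0.
  by have [|-> _] := FE (j x); first by exists x.
+ move=> x; apply: ij => //=; rewrite HF0 //.
  by have [|_ ->] := FE (j x); first by exists x.
Qed.

End SubsetHomotopy.

(** * From homotopy equivalences to strong deformation retractions *)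

Section Deformation.
Variable R : realType.
Local Notation I01 := (@I01 R).

Lemma I01_0 : I01 0. Proof. by rewrite /I01 /= lexx ler01. Qed.
Lemma I01_1 : I01 1. Proof. by rewrite /I01 /= lexx ler01. Qed.

Definition sdr (T : topologicalType) (V B : set T) : Prop :=
  exists Q : T * R -> T,
  [/\ cont_on (V `*` I01) Q, forall p, (V `*` I01) p -> V (Q p),
      forall x, V x -> Q (x, 0) = x /\ B (Q (x, 1))
    & forall b t, B b -> I01 t -> Q (b, t) = b].

(* A neighbourhood [tau <= 1/2] of [A] is deformed into [A] by [D], rel [A]. *)
Definition ndr (X : topologicalType) (A : set X) : Prop :=
  exists (tau : X -> R) (D : X * R -> X),
  [/\ continuous tau /\ (forall x, 0 <= tau x),
      cont_on (setT `*` I01) D /\ (forall x, D (x, 0) = x),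
      forall a, A a -> tau a = 0, forall a t, A a -> I01 t -> D (a, t) = a
    & forall x, tau x <= 1 / 2 -> A (D (x, 1))].

(** At time 1 this sends [0, 1/2] to 0, stretches [1/2, 3/4] onto [0, 3/4] and fixes the rest of [0,
    1[; so a deformation of the collar by it is stationary above 3/4. *)
Definition shrink (u t : R) : R := (1 - t) * u + t * Num.min u (Num.max 0 (3 * u - 3 / 2)).

Lemma shrink_bound u t : 0 <= u < 1 -> I01 t -> 0 <= shrink u t < 1.
Proof.
move=> /andP[u0 u1] /andP[t0 t1]; rewrite /shrink; set m := Num.min _ _.
have m0 : 0 <= m by rewrite le_min u0 le_max lexx.
have mu : m <= u by rewrite ge_min lexx.
by apply/andP; split; nra.
Qed.

Lemma shrink_id u t : 3 / 4 <= u -> shrink u t = u.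
Proof.
move=> h; have E : Num.max 0 (3 * u - 3 / 2) = 3 * u - 3 / 2 by rewrite max_r //; lra.
by rewrite /shrink E min_l; [ring|lra].
Qed.

Lemma collar_ndr (X : topologicalType) (A : set X) (c : X * R -> X) :
  hausdorff_space X -> compact A -> (forall y, A y -> c (y, 0) = y) ->
  inj_on (half_open R A) c -> cont_on (half_open R A) c ->
  (forall O, open O -> open (c @` (O `&` half_open R A))) -> ndr A.
Proof.
move=> hX cA c_base c_inj c_cont c_open; set S := half_open R A in c_inj c_cont c_open *.
pose Nb := c @` S.
have oNb : open Nb by have := c_open _ (@openT _); rewrite setTI.
(* Off this compact, hence closed, set [tau] is 3/4 and [D] is stationary. This gives continuity at
   the points outside the open collar. *)
pose K := c @` (A `*` [set t | 0 <= t <= 3 / 4]).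
have KS : A `*` [set t : R | 0 <= t <= 3 / 4] `<=` S.
  by move=> [y t] [/= Ay /andP[t0 t1]]; split=> //=; apply/andP; split; lra.
have kK : closed K.
  apply: compact_closed => //; apply: cont_on_compact; first exact: cont_on_sub c_cont.
  apply: compact_setX => //.
  rewrite (_ : mkset _ = `[0, 3 / 4]%classic); first exact: segment_compact.
  by apply/seteqP; split=> t; rewrite /= in_itv.
pose inv x := xget (x, 0 : R) [set q | S q /\ c q = x].
have invE q : S q -> inv (c q) = q.
  move=> Sq; rewrite /inv; case: xgetP => [q' _ [Sq' /c_inj]|/(_ q) []//]; exact.
have inv_cont : cont_on Nb inv.
  move=> _ [q Sq <-] V; rewrite invE // => Vq.
  have cq : (c @` (V° `&` S)) (c q) by exists q => //; split=> //; exact: nbhs_interior.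
  apply: filterS (open_near (c_open _ (open_interior V)) cq) => _ [q' [Vq' Sq'] <-] _.
  by rewrite invE //; exact: interior_subset.
have invS x : Nb x -> S (inv x) by move=> [q Sq <-]; rewrite invE.
have cinv x : Nb x -> c (inv x) = x by move=> [q Sq <-]; rewrite invE.
pose tau x := if `[< Nb x >] then Num.min (inv x).2 (3 / 4) else 3 / 4.
pose D (p : X * R) := if `[< Nb p.1 >] then c ((inv p.1).1, shrink (inv p.1).2 p.2) else p.1.
have notK x : ~ K x -> Nb x -> 3 / 4 <= (inv x).2.
  move=> nKx Nx; rewrite leNgt; apply/negP => h; apply: nKx; rewrite -(cinv _ Nx).
  exists (inv x) => //; have [Ai /andP[i0 i1]] := invS _ Nx.
  by split=> //=; apply/andP; split=> //; exact: ltW.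
have tau_out x : ~ K x -> tau x = 3 / 4.
  by move=> nKx; rewrite /tau; case: asboolP => // Nx; rewrite min_r // notK.
have D_out x t : ~ K x -> D (x, t) = x.
  move=> nKx; rewrite /D; case: asboolP => //= Nx.
  by rewrite shrink_id ?notK // -surjective_pairing cinv.
have invA a : A a -> Nb a /\ inv a = (a, 0).
  move=> Aa; have Sa : S (a, 0) by split=> //=; rewrite lexx ltr01.
  by rewrite -{1 2}(c_base _ Aa) invE //; split=> //; exists (a, 0).
have inv1 : cont_on Nb (fun x => (inv x).1) by apply: (cont_on_comp inv_cont (B := setT)) => //; exact: cont_on_fst.
have inv2 : cont_on Nb (fun x => (inv x).2) by apply: (cont_on_comp inv_cont (B := setT)) => //; exact: cont_on_snd.
exists tau, D; split.
- split; last first.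
    move=> x; rewrite /tau; case: asboolP => [Nx|_]; last by lra.
    by rewrite le_min; have [_ /andP[-> _]] := invS _ Nx; lra.
  apply/cont_onT => x _; have [Nx|nNx] := pselect (Nb x).
    have h : cont_on Nb (fun x => Num.min (inv x).2 (3 / 4)).
      by apply: cont_on_min => //; exact: cont_on_cst.
    apply: cont_at_near (h x Nx); last by rewrite /tau asboolT.
    by apply: filterS (open_near oNb Nx) => z Nz _; rewrite /tau asboolT.
  have nKx : ~ K x by move=> [q /KS Sq qx]; apply: nNx; exists q.
  apply: cont_at_near (@cont_on_cst _ _ setT (3 / 4 : R) x I); last by rewrite tau_out.
  by apply: filterS (open_near (closed_openC kK) nKx) => z nKz _; rewrite tau_out.
- split; last first.
    move=> x; rewrite /D; case: asboolP => //= Nx.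
    by rewrite /shrink subr0 mul1r mul0r addr0 -surjective_pairing cinv.
  move=> [x t] [_ It]; have [Nx|nNx] := pselect (Nb x).
    have h : cont_on (Nb `*` I01) (fun p => c ((inv p.1).1, shrink (inv p.1).2 p.2)).
      have f1 : cont_on (Nb `*` I01) (fun p => (inv p.1).1).
        by apply: (cont_on_comp (B := Nb) (f := fst) (g := fun x => (inv x).1)) => // [|p []] //; exact: cont_on_fst.
      have f2 : cont_on (Nb `*` I01) (fun p => (inv p.1).2).
        by apply: (cont_on_comp (B := Nb) (f := fst) (g := fun x => (inv x).2)) => // [|p []] //; exact: cont_on_fst.
      apply: (cont_on_comp (B := S) (f := fun p : X * R => ((inv p.1).1, shrink (inv p.1).2 p.2))) => //.
        apply: cont_on_pair => //; apply: cont_on_add; apply: cont_on_mul => //.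
        + apply: cont_on_add; first exact: cont_on_cst.
          by apply: cont_on_opp; exact: cont_on_snd.
        + exact: cont_on_snd.
        apply: cont_on_min => //; apply: cont_on_max; first exact: cont_on_cst.
        apply: cont_on_add; last exact: cont_on_cst.
        by apply: cont_on_mul => //; exact: cont_on_cst.
      move=> [y s] [/= Ny Is]; have [Ay y01] := invS _ Ny; split=> //=.
      exact: shrink_bound.
    have oN : open (Nb `*` [set: R]) by exact: (open_prod oNb (@openT R)).
    apply: cont_at_near (h (x, t) (conj Nx It)); last by rewrite /D asboolT.
    apply: filterS (open_near oN (conj Nx I : (Nb `*` [set: R]) (x, t))) => -[z s] [/= Nz _] [_ Is].
    by rewrite /D asboolT.
  have nKx : ~ K x by move=> [q /KS Sq qx]; apply: nNx; exists q.
  have oN : open (~` K `*` [set: R]) by exact: (open_prod (closed_openC kK) (@openT R)).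
  apply: cont_at_near (@cont_on_fst _ _ (setT `*` I01) (x, t) (conj I It)); last by rewrite D_out.
  by apply: filterS (open_near oN (conj nKx I : (~` K `*` [set: R]) (x, t))) => -[z s] [/= nKz _] Hz; rewrite D_out.
- move=> a Aa; have [Na ia] := invA _ Aa; rewrite /tau asboolT // ia min_l //=; lra.
- move=> a t Aa It; have [Na ia] := invA _ Aa; rewrite /D asboolT //= ia /=.
  have -> : shrink 0 t = 0.
    by rewrite /shrink mulr0 add0r min_l ?mulr0 // le_max lexx.
  exact: c_base.
move=> x; rewrite /tau /D; case: asboolP => [Nx h|_]; last by lra.
have [Ay /andP[y0 _]] := invS _ Nx.
have h' : (inv x).2 <= 1 / 2 by move: h; rewrite ge_min => /orP[//|]; lra.
rewrite /=; have -> : shrink (inv x).2 1 = 0.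
  by rewrite /shrink subrr mul0r add0r mul1r max_l ?min_r //; lra.
by rewrite c_base.
Qed.

Section HeqNdr.
Variables (X : topologicalType) (A : set X).
Hypotheses (A_ndr : ndr A) (A_heq : sheq R setT A).

Let half0 : closed [set t : R | t <= 1 / 2]. Proof. exact: closed_le. Qed.
Let half1 : closed [set t : R | 1 / 2 <= t]. Proof. exact: closed_ge. Qed.

Lemma paste_real (T Y : topologicalType) (S : set T) (s : T -> R) (f g h : T -> Y) :
  continuous s -> cont_on (S `&` [set x | s x <= 1 / 2]) f ->
  cont_on (S `&` [set x | 1 / 2 <= s x]) g ->
  (forall x, S x -> s x <= 1 / 2 -> h x = f x) ->
  (forall x, S x -> 1 / 2 <= s x -> h x = g x) -> cont_on S h.
Proof.
move=> cs cf cg hf hg.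
have k1 : closed [set x | s x <= 1 / 2].
  by apply: (preimage_closed (D := [set t : R | t <= 1 / 2])) => // x _; exact: cs.
have k2 : closed [set x | 1 / 2 <= s x].
  by apply: (preimage_closed (D := [set t : R | 1 / 2 <= t])) => // x _; exact: cs.
apply: (cont_paste k1 k2).
- by move=> x Sx; case: (leP (s x) (1 / 2)) => [|/ltW]; [left|right].
- by apply: cont_on_ext cf => x [Sx sx]; rewrite hf.
- by apply: cont_on_ext cg => x [Sx sx]; rewrite hg.
Qed.

Lemma snd_continuous (T : topologicalType) : continuous (@snd T R).
Proof. by move=> x; exact: cvg_snd. Qed.

Definition hcat (T Y : Type) (H K : T * R -> Y) (p : T * R) : Y :=
  if p.2 <= 1 / 2 then H (p.1, 2 * p.2) else K (p.1, 2 * p.2 - 1).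

Lemma hcat_cont (T Y : topologicalType) (V : set T) (H K : T * R -> Y) :
  cont_on (V `*` I01) H -> cont_on (V `*` I01) K ->
  (forall x, V x -> H (x, 1) = K (x, 0)) -> cont_on (V `*` I01) (hcat H K).
Proof.
move=> cH cK HK.
apply: (paste_real (s := snd) (f := fun p => H (p.1, 2 * p.2)) (g := fun p => K (p.1, 2 * p.2 - 1))).
- exact: snd_continuous.
- apply: (cont_on_comp (B := V `*` I01) (f := fun p : T * R => (p.1, 2 * p.2))) => //.
    apply: cont_on_pair; first exact: cont_on_fst.
    by apply: cont_on_mul; [exact: cont_on_cst|exact: cont_on_snd].
  move=> [x t] [[/= Vx /andP[t0 t1]] th]; split=> //=; apply/andP; split; lra.
- apply: (cont_on_comp (B := V `*` I01) (f := fun p : T * R => (p.1, 2 * p.2 - 1))) => //.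
    apply: cont_on_pair; first exact: cont_on_fst.
    apply: cont_on_add; last exact: cont_on_cst.
    by apply: cont_on_mul; [exact: cont_on_cst|exact: cont_on_snd].
  move=> [x t] [[/= Vx /andP[t0 t1]] th]; split=> //=; apply/andP; split; lra.
- by move=> [x t] _ /= h; rewrite /hcat /= h.
move=> [x t] [/= Vx _] h; rewrite /hcat /=; case: leP => // h'.
have -> : t = 1 / 2 by lra.
have -> : 2 * (1 / 2) = 1 :> R by lra.
by rewrite subrr HK.
Qed.

Lemma hcat0 (T Y : Type) (H K : T * R -> Y) x : hcat H K (x, 0) = H (x, 0).
Proof. by rewrite /hcat /= mulr0 ifT //; lra. Qed.

Lemma hcat1 (T Y : Type) (H K : T * R -> Y) x : hcat H K (x, 1) = K (x, 1).
Proof. by rewrite /hcat /= mulr1 ifF; [congr (K (x, _)); ring|apply/negbTE; rewrite -ltNge; lra]. Qed.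

(* The homotopy [G] on [A], run along the collar parameter [tau], turns the
   homotopy inverse [g] into a strict retraction. *)
Lemma heq_retraction : exists (r : X -> X) (K : X * R -> X),
  [/\ continuous r, forall x, A (r x), forall a, A a -> r a = a,
      cont_on (setT `*` I01) K & forall x, K (x, 0) = x /\ K (x, 1) = r x].
Proof.
have [tau [D [[ctau tau0] [cD D0] tauA DA DN]]] := A_ndr.
have [g [G [F [[cg gA] [cG GA] GE [cF _] FE]]]] := A_heq.
pose rho x := D (x, 1).
have crho : continuous rho.
  apply/cont_onT; apply: (cont_on_comp (B := setT `*` I01) (f := fun x : X => (x, 1 : R))) => //.
    by apply: cont_on_pair; [exact: cont_on_id|exact: cont_on_cst].
  by move=> x _; split=> //; exact: I01_1.
have ctau' (S : set X) : cont_on S tau by exact: continuous_cont_on.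
have crho' (S : set X) : cont_on S rho by exact: continuous_cont_on.
have cgrho (S : set X) : cont_on S (g \o rho).
  by apply: (cont_on_comp (B := setT)) => //.
(* Near [A] the homotopy [G] completes [g]: at [tau = 0] it has brought [g a] back to [a], and at
   [tau = 1 / 2] it has not started, so the two formulas agree. *)
pose r x := if tau x <= 1 / 2 then G (rho x, 1 - 2 * tau x) else g (rho x).
have rE x : 1 / 2 <= tau x -> r x = g (rho x).
  move=> h'; rewrite /r; case: leP => // h; have -> : tau x = 1 / 2 by lra.
  have -> : 1 - 2 * (1 / 2) = 0 :> R by lra.
  by have [-> _] := GE (rho x) (DN _ h).
have cr : continuous r.
  apply/cont_onT; apply: (paste_real (s := tau) (f := fun x => G (rho x, 1 - 2 * tau x)) (g := g \o rho)) => //.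
  - apply: (cont_on_comp (B := A `*` I01) (f := fun x => (rho x, 1 - 2 * tau x))) => //.
      apply: cont_on_pair => //; apply: cont_on_add; first exact: cont_on_cst.
      by apply: cont_on_opp; apply: cont_on_mul => //; exact: cont_on_cst.
    move=> x [_ h]; split=> /=; first exact: DN.
    by have := tau0 x; rewrite /= in h => ?; apply/andP; split; lra.
  - by move=> x _ h; rewrite /r h.
  - by move=> x _; exact: rE.
have rA x : A (r x).
  rewrite /r; case: leP => h; last exact: gA.
  apply: GA; split=> /=; first exact: DN.
  by have := tau0 x => ?; apply/andP; split; lra.
have r_id a : A a -> r a = a.
  move=> Aa; rewrite /r tauA // mulr0 subr0 ifT; last by lra.
  by rewrite /rho DA //; [case: (GE a Aa)|exact: I01_1].
(* Three homotopies in a row: [F] reversed, from the identity to [g]; then [g] along [D], to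
   [g \o rho]; then the part of [G] that enters [r]. *)
pose K1 (p : X * R) := F (p.1, 1 - p.2).
pose K2 (p : X * R) := g (D p).
pose K3 (p : X * R) := if tau p.1 <= 1 / 2 then G (rho p.1, p.2 * (1 - 2 * tau p.1)) else g (rho p.1).
have cK1 : cont_on (setT `*` I01) K1.
  apply: (cont_on_comp (B := setT `*` I01) (f := fun p : X * R => (p.1, 1 - p.2))) => //.
    apply: cont_on_pair; first exact: cont_on_fst.
    by apply: cont_on_add; [exact: cont_on_cst|apply: cont_on_opp; exact: cont_on_snd].
  by move=> p [_ /andP[? ?]]; split=> //=; apply/andP; split; lra.
have cK2 : cont_on (setT `*` I01) K2 by apply: (cont_on_comp (B := setT)) => //.
have ct1 : continuous (fun p : X * R => tau p.1).
  by move=> p; apply: continuous_comp; [exact: cvg_fst|exact: ctau].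
have cr1 (S : set (X * R)) : cont_on S (fun p : X * R => rho p.1).
  by apply: continuous_cont_on => p; apply: continuous_comp; [exact: cvg_fst|exact: crho].
have cK3 : cont_on (setT `*` I01) K3.
  apply: (paste_real (s := fun p : X * R => tau p.1)
    (f := fun p : X * R => G (rho p.1, p.2 * (1 - 2 * tau p.1))) (g := fun p : X * R => g (rho p.1))) => //.
  - apply: (cont_on_comp (B := A `*` I01) (f := fun p : X * R => (rho p.1, p.2 * (1 - 2 * tau p.1)))) => //.
      apply: cont_on_pair => //; apply: cont_on_mul; first exact: cont_on_snd.
      apply: cont_on_add; first exact: cont_on_cst.
      by apply: cont_on_opp; apply: cont_on_mul; [exact: cont_on_cst|exact: continuous_cont_on].
    move=> [x t] [[_ /andP[t0 t1]] h]; rewrite /= in t0 t1 h; split=> /=; first exact: DN.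
    by have := tau0 x => ?; apply/andP; split; nra.
  - exact: (cont_on_comp (B := setT) (cr1 _)).
  - by move=> [x t] _ h; rewrite /K3 h.
  - move=> [x t] _ /= h; rewrite /K3 /=; case: leP => // h'.
    have -> : tau x = 1 / 2 by lra.
    have -> : 1 - 2 * (1 / 2) = 0 :> R by lra.
    by rewrite mulr0; have [-> _] := GE (rho x) (DN _ h').
exists r, (hcat K1 (hcat K2 K3)); split=> //.
  apply: hcat_cont => // [|x _].
    apply: hcat_cont => // x _; rewrite /K2 /K3 /= mul0r; case: leP => // h.
    by have [-> _] := GE (rho x) (DN _ h).
  rewrite hcat0 /K1 /K2 /= subrr D0.
  by have [-> _] := FE x I.
move=> x; rewrite hcat0 hcat1 hcat1 /K1 /K3 /= subr0 mul1r; split=> //.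
- by have [_ ->] := FE x I.
- by rewrite mul1r /r mul1r.
Qed.

(** For [a] in [A] the path [K (a, _)] is a loop, and [Q], which is [K] followed by the reverse of
    [K] after [r], runs through it forth and back. Such a path contracts by turning round earlier,
    and [tau] serves as the turning parameter: [Q'] is constant over [A] and is [Q] after [rho]
    where [tau] is at least 1/2. *)
Lemma heq_sdr : sdr setT A.
Proof.
have [tau [D [[ctau tau0] [cD D0] tauA DA DN]]] := A_ndr.
have [r [K [cr rA r_id cK KE]]] := heq_retraction.
pose rho x := D (x, 1).
have crho : continuous rho.
  apply/cont_onT; apply: (cont_on_comp (B := setT `*` I01) (f := fun x : X => (x, 1 : R))) => //.
    by apply: cont_on_pair; [exact: cont_on_id|exact: cont_on_cst].
  by move=> x _; split=> //; exact: I01_1.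
pose Q := hcat K (fun p : X * R => K (r p.1, 1 - p.2)).
have cr1 (S : set (X * R)) : cont_on S (fun p : X * R => r p.1).
  by apply: continuous_cont_on => p; apply: continuous_comp; [exact: cvg_fst|exact: cr].
have cQ : cont_on (setT `*` I01) Q.
  apply: hcat_cont => // [|x _]; last first.
    by have [_ ->] := KE x; rewrite /= subr0; have [_ ->] := KE (r x); rewrite (r_id _ (rA x)).
  apply: (cont_on_comp (B := setT `*` I01) (f := fun p : X * R => (r p.1, 1 - p.2))) => //.
    apply: cont_on_pair => //.
    by apply: cont_on_add; [exact: cont_on_cst|apply: cont_on_opp; exact: cont_on_snd].
  by move=> p [_ /andP[? ?]]; split=> //=; apply/andP; split; lra.
(* The tent with value 0 at both ends and 1 in the middle: the time at which [K] is read on the way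
   forth and back. *)
pose s (t : R) := Num.min (2 * t) (2 - 2 * t).
have sI t : I01 t -> I01 (s t).
  move=> /andP[t0 t1]; rewrite /I01 /s /= le_min ge_min; apply/andP; split; first by apply/andP; split; lra.
  by case: (leP t (1 / 2)) => ?; apply/orP; [left|right]; lra.
have cs (S : set (X * R)) : cont_on S (fun p : X * R => s p.2).
  apply: cont_on_min; first by apply: cont_on_mul; [exact: cont_on_cst|exact: cont_on_snd].
  apply: cont_on_add; first exact: cont_on_cst.
  by apply: cont_on_opp; apply: cont_on_mul; [exact: cont_on_cst|exact: cont_on_snd].
have QA a t : A a -> I01 t -> Q (a, t) = K (a, s t).
  move=> Aa It; rewrite /Q /hcat /= r_id // /s; case: leP => h.
    by rewrite min_l //; lra.
  rewrite min_r; last by lra.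
  by congr (K (a, _)); ring.
have ct1 : continuous (fun p : X * R => tau p.1).
  by move=> p; apply: continuous_comp; [exact: cvg_fst|exact: ctau].
have crho1 (S : set (X * R)) : cont_on S (fun p : X * R => rho p.1).
  by apply: continuous_cont_on => p; apply: continuous_comp; [exact: cvg_fst|exact: crho].
pose Q' (p : X * R) := if tau p.1 <= 1 / 2 then K (rho p.1, 2 * tau p.1 * s p.2) else Q (rho p.1, p.2).
have cQ' : cont_on (setT `*` I01) Q'.
  apply: (paste_real (s := fun p : X * R => tau p.1)
    (f := fun p : X * R => K (rho p.1, 2 * tau p.1 * s p.2)) (g := fun p : X * R => Q (rho p.1, p.2))) => //.
  - apply: (cont_on_comp (B := setT `*` I01) (f := fun p : X * R => (rho p.1, 2 * tau p.1 * s p.2))) => //.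
      apply: cont_on_pair => //; apply: cont_on_mul => //.
      by apply: cont_on_mul; [exact: cont_on_cst|exact: continuous_cont_on].
    move=> [x t] [[_ /sI /andP[t0 t1]] h]; rewrite /= in t0 t1 h; split=> //=.
    by have := tau0 x => ?; apply/andP; split; nra.
  - apply: (cont_on_comp (B := setT `*` I01) (f := fun p : X * R => (rho p.1, p.2))) => //.
      by apply: cont_on_pair => //; exact: cont_on_snd.
    by move=> p [[_ ?] _].
  - by move=> [x t] _ h; rewrite /Q' h.
  move=> [x t] [_ /= It] /= h; rewrite /Q' /=; case: leP => // h'.
  have -> : tau x = 1 / 2 by lra.
  have -> : 2 * (1 / 2) = 1 :> R by lra.
  by rewrite mul1r QA //; exact: DN.
have s0 : s 0 = 0 by rewrite /s mulr0 min_l //; lra.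
have s1 : s 1 = 0 by rewrite /s min_r; lra.
have Q'0 x : Q' (x, 0) = rho x.
  rewrite /Q' /= s0 mulr0 /Q hcat0; case: ifP => _; by have [-> _] := KE (rho x).
exists (hcat D Q'); split=> //.
- by apply: hcat_cont => // x _; rewrite Q'0.
- move=> x _; rewrite hcat0 hcat1; split; first exact: D0.
  rewrite /Q' /= s1 mulr0; case: leP => h; first by have [-> _] := KE (rho x); exact: DN.
  by rewrite /Q hcat1 /= subrr; have [-> _] := KE (r (rho x)).
move=> a t Aa It; rewrite /hcat /=; case: leP => h.
  by rewrite DA //; case/andP: It => ? ?; apply/andP; split; lra.
rewrite /Q' /= tauA // mulr0 mul0r ifT; last by lra.
by rewrite /rho DA //; [have [-> _] := KE a|exact: I01_1].
Qed.

End HeqNdr.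
End Deformation.

(** * Infinite concatenation of deformation retractions *)

Section Telescope.
Variable R : realType.
Local Notation I01 := (@I01 R).

Lemma sdr_sheq (T : topologicalType) (V B : set T) : B `<=` V -> sdr R V B -> sheq R V B.
Proof.
move=> BV [Q [cQ QV QE QB]].
exists (fun x => Q (x, 1)), (fun p => p.1), (fun p : T * R => Q (p.1, 1 - p.2)); split.
- split; last by move=> x /QE[].
  apply: (cont_on_comp (B := V `*` I01) (f := fun x : T => (x, 1 : R))) => //.
    by apply: cont_on_pair; [exact: cont_on_id|exact: cont_on_cst].
  by move=> x Vx; split=> //; exact: I01_1.
- by split; [exact: cont_on_fst|move=> p []].
- by move=> b Bb; rewrite QB //; exact: I01_1.
- have H p : (V `*` I01) p -> (V `*` I01) (p.1, 1 - p.2).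
    by move=> [? /andP[? ?]]; split=> //=; apply/andP; split; lra.
  split; last by move=> p /H; exact: QV.
  apply: (cont_on_comp (B := V `*` I01) (f := fun p : T * R => (p.1, 1 - p.2))) => //.
  apply: cont_on_pair; first exact: cont_on_fst.
  by apply: cont_on_add; [exact: cont_on_cst|apply: cont_on_opp; exact: cont_on_snd].
by move=> x Vx /=; rewrite subr0 subrr; split=> //; case: (QE x Vx).
Qed.

Variables (T : topologicalType) (Z B : nat -> set T) (D : nat -> T * R -> T).
Hypothesis Zc : forall i, closed (Z i).
Hypothesis D_cont : forall i, cont_on (Z i `*` I01) (D i).
Hypothesis D_in : forall i p, (Z i `*` I01) p -> Z i (D i p).
Hypothesis D_ends : forall i x, Z i x -> D i (x, 0) = x /\ B i (D i (x, 1)).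
Hypothesis D_rel : forall i b t, B i b -> I01 t -> D i (b, t) = b.

Let E k : set T := [set x | exists2 i, (i <= k)%N & Z i x].
Hypothesis ZE : forall k, Z k.+1 `&` E k `<=` B k.+1.
Hypothesis BZ0 : B 0 `<=` Z 0.
Hypothesis BZ : forall k, B k.+1 `<=` Z k.

Let X : set T := [set x | exists i, Z i x].
Hypothesis X_fin : forall x, X x -> exists O k, [/\ open O, O x & O `&` X `<=` E k].

Let pow (k : nat) : R := 2 ^+ k.

Let clip (k : nat) (t : R) : R := Num.max 0 (4 * (pow k * t) - 1).

(* [D k.+1] is run during the time interval from [1 / 2 ^ k.+2] to [1 / 2 ^ k.+1]. *)
Fixpoint tele (k : nat) (p : T * R) : T :=
  if k is m.+1 then
    if `[< Z k p.1 >] then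
      if pow m * p.2 <= 1 / 2 then D k (p.1, clip m p.2) else tele m (D k (p.1, 1), p.2)
    else tele m p
  else D 0 (p.1, Num.max 0 (2 * p.2 - 1)).

Let E_mono k m : (k <= m)%N -> E k `<=` E m.
Proof. by move=> km x [i ik Zx]; exists i => //; exact: leq_trans km. Qed.

Let E_closed k : closed (E k).
Proof.
rewrite (_ : E k = \bigcup_(i in `I_k.+1) Z i).
  by apply: closed_bigcup => // i _; exact: Zc.
by apply/seteqP; split=> x [i ik Zx]; exists i.
Qed.

Let ES k x : E k.+1 x -> E k x \/ Z k.+1 x.
Proof. by move=> [i]; rewrite leq_eqVlt => /orP[/eqP->|h]; [right|left; exists i]. Qed.

(** The pieces up to the [k]-th rest until time 1 / 2^(k+1). This lets infinitely many deformations
    fit into [0, 1] without spoiling continuity at time 0. *)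
Lemma tele_start k x t : E k x -> 0 <= t -> pow k * t <= 1 / 2 -> tele k (x, t) = x.
Proof.
elim: k x t => [|k IH] x t Ex t0 h /=.
  have Zx : Z 0 x by case: Ex => i; rewrite leqn0 => /eqP->.
  rewrite /pow expr0 mul1r in h; rewrite max_l; last by lra.
  by case: (D_ends Zx).
have h' : pow k * t <= 1 / 4 by move: h; rewrite /pow exprS -mulrA; lra.
case: asboolP => [Zx|nZ].
  rewrite ifT; last by lra.
  rewrite /clip max_l; last by lra.
  by case: (D_ends Zx).
by apply: IH => //; [case: (ES Ex)|lra].
Qed.

(** A point common to the new piece and an earlier one lies in [B k.+1], which [D k.+1] fixes; so a
    further piece changes nothing on the earlier ones. *)
Lemma tele_succ k x t : E k x -> I01 t -> tele k.+1 (x, t) = tele k (x, t).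
Proof.
move=> Ex It /=; case: asboolP => // Zx; have Bx : B k.+1 x by apply: ZE.
have /andP[t0 t1] := It.
rewrite (D_rel Bx (I01_1 R)); case: leP => // h; rewrite tele_start // D_rel // /clip.
apply/andP; split; first by rewrite le_max lexx.
by rewrite ge_max ler01 /=; lra.
Qed.

Lemma tele_stable k m x t : (k <= m)%N -> E k x -> I01 t -> tele m (x, t) = tele k (x, t).
Proof.
move=> /subnK <-; elim: (m - k)%N => // j IH Ex It; rewrite addSn tele_succ ?IH //.
by apply: E_mono Ex; exact: leq_addl.
Qed.

Lemma tele_cont k : cont_on (E k `*` I01) (tele k).
Proof.
have clI m (t : R) : I01 t -> pow m * t <= 1 / 2 -> I01 (clip m t).
  move=> It h; apply/andP; split; first by rewrite le_max lexx.
  by rewrite ge_max ler01 /=; lra.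
elim: k => [|k IH].
  apply: (cont_on_comp (B := Z 0 `*` I01) (f := fun p : T * R => (p.1, Num.max 0 (2 * p.2 - 1)))) => //.
    apply: cont_on_pair; first exact: cont_on_fst.
    apply: cont_on_max; first exact: cont_on_cst.
    apply: cont_on_add; last exact: cont_on_cst.
    by apply: cont_on_mul; [exact: cont_on_cst|exact: cont_on_snd].
  move=> [x t] [[i i0 Zx] /andP[/= t0 t1]]; move: i0 Zx; rewrite leqn0 => /eqP-> Zx; split=> //=.
  apply/andP; split; first by rewrite le_max lexx.
  by rewrite ge_max ler01 /=; lra.
have cl (C : set T) : closed C -> closed (C `*` [set: R]).
  move=> kC; rewrite (_ : C `*` _ = (@fst T R) @^-1` C); last by apply/seteqP; split=> p // -[].
  by apply: (preimage_closed (D := C)) => // p _; exact: cvg_fst.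
apply: (cont_paste (cl _ (E_closed (k := k))) (cl _ (Zc (i := k.+1)))).
- by move=> [x t] [/= /ES[]]; [left|right].
- apply: (@cont_on_ext _ _ _ (tele k)); last by apply: cont_on_sub IH => -[x t] [[_ /= ?] [/= ? _]].
  by move=> [x t] [[_ It] [Ex _]]; symmetry; exact: tele_succ.
apply: (@cont_on_sub _ _ (Z k.+1 `*` I01)); first by move=> [x t] [[_ It] [Zx _]].
apply: (paste_real (s := fun p : T * R => pow k * p.2)
  (f := fun p : T * R => D k.+1 (p.1, clip k p.2)) (g := fun p : T * R => tele k (D k.+1 (p.1, 1), p.2))).
- by apply/cont_onT; apply: cont_on_mul; [exact: cont_on_cst|exact: cont_on_snd].
- apply: (cont_on_comp (B := Z k.+1 `*` I01) (f := fun p : T * R => (p.1, clip k p.2))) => //.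
    apply: cont_on_pair; first exact: cont_on_fst.
    apply: cont_on_max; first exact: cont_on_cst.
    apply: cont_on_add; last exact: cont_on_cst.
    apply: cont_on_mul; first exact: cont_on_cst.
    by apply: cont_on_mul; [exact: cont_on_cst|exact: cont_on_snd].
  by move=> [x t] [[/= Zx It] h]; split=> //; exact: clI.
- apply: (cont_on_comp (B := E k `*` I01) (f := fun p : T * R => (D k.+1 (p.1, 1), p.2))) => //.
    apply: cont_on_pair; last exact: cont_on_snd.
    apply: (cont_on_comp (B := Z k.+1 `*` I01) (f := fun p : T * R => (p.1, 1))) => //.
      by apply: cont_on_pair; [exact: cont_on_fst|exact: cont_on_cst].
    by move=> p [[Zx _] _]; split=> //; exact: I01_1.
  move=> [x t] [[/= Zx It] _]; split=> //=; exists k => //; apply: BZ.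
  by case: (D_ends Zx).
- by move=> [x t] [/= Zx _] h; rewrite asboolT // h.
move=> [x t] [/= Zx /andP[/= t0 t1]] h; rewrite asboolT //; case: leP => // h'.
have e : pow k * t = 1 / 2 by lra.
have -> : clip k t = 1 by rewrite /clip e max_r; lra.
rewrite tele_start //; exists k => //; apply: BZ.
by case: (D_ends Zx).
Qed.

Lemma tele_in k x t : E k x -> I01 t -> E k (tele k (x, t)).
Proof.
have cl (u : R) : u <= 1 -> I01 (Num.max 0 u).
  by move=> ?; apply/andP; split; [rewrite le_max lexx|rewrite ge_max ler01].
elim: k x => [|k IH] x Ex /[dup] It /andP[t0 t1] /=.
  exists 0%N => //; apply: D_in; split=> /=; last by apply: cl; lra.
  by case: Ex => i; rewrite leqn0 => /eqP->.
case: asboolP => [Zx|nZ].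
  case: leP => h.
    by exists k.+1 => //; apply: D_in; split=> //=; apply: cl; lra.
  apply: (E_mono (leqnSn k)); apply: IH => //; exists k => //; apply: BZ.
  by case: (D_ends Zx).
by apply: (E_mono (leqnSn k)); apply: IH => //; case: (ES Ex).
Qed.

Lemma tele_end k x : E k x -> B 0 (tele k (x, 1)).
Proof.
elim: k x => [|k IH] x Ex /=.
  have Zx : Z 0 x by case: Ex => i; rewrite leqn0 => /eqP->.
  have -> : Num.max 0 (2 * 1 - 1) = 1 :> R by rewrite max_r; lra.
  by case: (D_ends Zx).
case: asboolP => [Zx|nZ]; last by apply: IH; case: (ES Ex).
rewrite ifF; first by apply: IH; exists k => //; apply: BZ; case: (D_ends Zx).
have : 1 <= pow k by apply: exprn_ege1; lra.
by rewrite mulr1; case: leP => //; lra.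
Qed.

Lemma tele_rel k b t : B 0 b -> I01 t -> tele k (b, t) = b.
Proof.
move=> Bb It; have Eb : E 0 b by exists 0%N => //; exact: BZ0.
rewrite (tele_stable (leq0n k) Eb It) /= D_rel //; case/andP: It => ? ?.
by apply/andP; split; [rewrite le_max lexx|rewrite ge_max ler01 /=; lra].
Qed.

(** The level is chosen pointwise and is immaterial by [tele_stable]. By [X_fin] it is bounded near
    each point, where continuity becomes that of a single [tele k]. *)
Lemma tele_sdr : sdr R X (B 0).
Proof.
pose lvl x := xget 0%N [set k | E k x].
have lvlE x : X x -> E (lvl x) x.
  by move=> [i Zx]; rewrite /lvl; case: xgetP => // /(_ i) []; exists i.
have EX k : E k `<=` X by move=> x [i _ Zx]; exists i.
have telE k x t : E k x -> I01 t -> tele (lvl x) (x, t) = tele k (x, t).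
  move=> Ex It; have El := lvlE _ (EX _ _ Ex).
  by case/orP: (leq_total k (lvl x)) => h; [|symmetry]; apply: tele_stable.
exists (fun p => tele (lvl p.1) p); split.
- move=> [x t] [/= Xx It]; have [ O [k [ oO Ox OE]]] := X_fin Xx.
  have Ex : E k x by apply: OE.
  have oN : open (O `*` [set: R]) by exact: (open_prod oO (@openT R)).
  have := @tele_cont k (x, t) (conj Ex It).
  move=> H V /=; rewrite (telE k) // => /H.
  apply: filterS2 (open_near oN (conj Ox I : (O `*` [set: R]) (x, t))) => -[y s] [/= Oy _] HV [/= Xy Is].
  have Ey : E k y by apply: OE.
  by rewrite (telE k) //; apply: HV.
- by move=> [x t] [/= Xx It]; apply: (EX (lvl x)); apply: tele_in => //; exact: lvlE.
- move=> x Xx /=; split; last by apply: tele_end; exact: lvlE.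
  by apply: tele_start => //; [exact: lvlE|rewrite mulr0; lra].
by move=> b t Bb It /=; exact: tele_rel.
Qed.

End Telescope.

(** * Adjunction spaces *)

Lemma existT_inj (W : nat -> Type) i (x y : W i) : existT W i x = existT W i y -> x = y.
Proof. by move=> e; apply: (Eqdep_dec.inj_pair2_eq_dec _ PeanoNat.Nat.eq_dec _ _ _ _ e). Qed.

Section AdjSpace.
Variables (R : realType) (W : nat -> plSpace R) (M N : forall i, set (W i)).
Variable h : forall i, pl_sub (@N i) -> pl_sub (@M i.+1).
Hypothesis MN0 : forall i, @M i `&` @N i = set0.
Hypothesis h_homeo : forall i, pl_homeo (@h i).

Local Notation L := (@adj_lift R W M N h).
Local Notation T := (adj_space h).
Local Notation WT := (fun i => W i : Type).

Let hinv i : pl_sub (@M i.+1) -> pl_sub (@N i) := sval (cid (h_homeo i)).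
Let hinvK i : cancel (@h i) (@hinv i). Proof. by rewrite /hinv; case: cid => g []. Qed.
Let hK i : cancel (@hinv i) (@h i). Proof. by rewrite /hinv; case: cid => g []. Qed.

(* The representative, in the piece of smallest index, of a point of the adjunction space. *)
Definition lowest i : W i -> {i & W i} :=
  match i return W i -> {i & W i} with
  | 0 => fun x => existT WT 0 x
  | j.+1 => fun x =>
    match pselect (M x) with
    | left Mx => existT WT j (set_val (hinv (toset Mx : pl_sub (@M j.+1))))
    | right _ => existT WT j.+1 x
    end
  end.
Arguments lowest : simpl never.

Let lowestM j (x : pl_sub (@M j.+1)) : lowest (set_val x : W j.+1) = existT WT j (set_val (hinv x)).
Proof.
rewrite /lowest; case: pselect => [Mx|]; last by case; exact: set_valE'.
by congr (existT WT j (set_val (hinv _))); apply: set_val_inj; rewrite set_val_toset.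
Qed.

Let lowestN j (x : W j) : ~ M x -> lowest x = existT WT j x.
Proof. by case: j x => // j x nM; rewrite /lowest; case: pselect. Qed.

Let N_notM i (x : W i) : N x -> ~ M x.
Proof. by move=> Nx Mx; have : (@M i `&` @N i) x by []; rewrite MN0. Qed.

Let lowest_cases j (x : W j) :
  lowest x = existT WT j x \/
  exists k (e : j = k.+1) (y : pl_sub (@M k.+1)),
    lowest x = existT WT k (set_val (hinv y)) /\ existT WT j x = existT WT k.+1 (set_val y).
Proof.
case: j x => [|j] x; first by left.
have [Mx|nMx] := pselect (M x); last by left; rewrite lowestN.
right; exists j, erefl, (toset Mx); split; last by rewrite set_val_toset.
by rewrite -(lowestM (toset Mx)) set_val_toset.
Qed.

(** It is enough to look at a generating pair: a point of [N] is its own lowest representative,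
    since [N] and [M] are disjoint, and its image under [h] is sent back to it. *)
Let lowest_eq i j (x : W i) (y : W j) : L x = L y -> lowest x = lowest y.
Proof.
move=> /eqmodP /asboolP.
suff H p q : clos_refl_sym_trans _ (adj_step h) p q -> lowest (projT2 p) = lowest (projT2 q).
  by move=> /H.
elim=> {p q} [_ _ [k a]|p|p q _ ->|p q r _ -> _ ->] //=.
rewrite lowestM hinvK lowestN //; apply: N_notM; exact: (set_valE' a).
Qed.

Lemma adj_surj (z : T) : exists i (x : W i), L x = z.
Proof.
by exists (projT1 (repr z)), (projT2 (repr z)); rewrite /adj_lift -sigT_eta reprK.
Qed.

Lemma adj_step_eq i (x : pl_sub (@N i)) : L (set_val x : W i) = L (set_val (h x) : W i.+1).
Proof. by apply/eqmodP/asboolP; apply: rst_step; exact: (AdjStep h x). Qed.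

Lemma adj_lift_inj i : injective (@adj_lift R W M N h i).
Proof.
move=> x y /lowest_eq.
have [->|[k [e [a [-> xa]]]]] := lowest_cases x; have [->|[l [e' [b [-> yb]]]]] := lowest_cases y.
- exact: existT_inj.
- by move=> /(congr1 (@projT1 _ _)) /= E; exfalso; lia.
- by move=> /(congr1 (@projT1 _ _)) /= E; exfalso; lia.
move=> E; have kl := congr1 (@projT1 _ _) E; rewrite /= in kl; subst l.
have /set_val_inj/(can_inj (@hK k)) ab := existT_inj E; subst b.
by subst i; rewrite (existT_inj xa) (existT_inj yb).
Qed.

Lemma adj_meet i (x : W i) (y : W i.+1) : L x = L y ->
  exists a : pl_sub (@N i), x = set_val a /\ y = set_val (h a).
Proof.
move=> /lowest_eq.
have [->|[k [e [a [-> xa]]]]] := lowest_cases x; have [->|[l [[e'] [b [-> yb]]]]] := lowest_cases y.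
- by move=> /(congr1 (@projT1 _ _)) /= E; exfalso; lia.
- move=> E; have ll := congr1 (@projT1 _ _) E; rewrite /= in ll; subst l.
  by exists (hinv b); rewrite hK (existT_inj E) (existT_inj yb).
- move=> /(congr1 (@projT1 _ _)) /= E; exfalso; lia.
move=> /(congr1 (@projT1 _ _)) /= E; exfalso; lia.
Qed.

(** The lowest representative of a point of the [j]-th piece has index [j] or one less, so only
    neighbouring pieces meet. *)
Lemma adj_next i j (x : W i) (y : W j) : L x = L y -> (i < j)%N -> j = i.+1.
Proof.
move=> /lowest_eq.
have [->|[k [e [a [-> xa]]]]] := lowest_cases x; have [->|[l [e' [b [-> yb]]]]] := lowest_cases y;
 move=> /(congr1 (@projT1 _ _)) /=; lia.
Qed.

Lemma adj_openP (O : set T) : open O <-> forall i, open (@adj_lift R W M N h i @^-1` O).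
Proof. exact: (@sigT_openP _ WT). Qed.

Lemma adj_lift_continuous i : continuous (@adj_lift R W M N h i).
Proof. by apply/continuousP => O /adj_openP. Qed.

Hypotheses (M_closed : forall i, closed (@M i)) (N_closed : forall i, closed (@N i)).

Lemma closed_set_val (X : topologicalType) (A : set X) (S : set A) :
  closed A -> closed S -> closed (set_val @` S).
Proof.
move=> cA cS; have [_ _ iv] := set_val_emb A.
rewrite -[X in closed X]setCK; apply: open_closedC; rewrite openE => x nx; rewrite /interior.
have [Ax|nAx] := pselect (A x); last first.
  by apply: filterS (open_near (closed_openC cA) nAx) => y nAy [a _ ay]; apply: nAy; rewrite -ay; exact: set_valE'.
have nS : ~ S (toset Ax) by move=> Sx; apply: nx; exists (toset Ax) => //; exact: set_val_toset.
have := iv (toset Ax) I _ (open_near (closed_openC cS) nS); rewrite set_val_toset.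
by apply: filterS => y Hy [a Sa ay]; exact: (Hy a I ay Sa).
Qed.

(* The union needs no local finiteness assumption, since a piece meets only its
   two neighbours. *)
Lemma adj_closed (F : forall i, set (W i)) : (forall i, closed (F i)) ->
  closed [set y | exists i x, L x = y /\ @F i x].
Proof.
move=> cF; rewrite -[X in closed X]setCK; apply: open_closedC; apply/adj_openP => i.
rewrite preimage_setC; apply: closed_openC.
have hc : continuous (@h i) by case: (h_homeo i) => g [_ _ []].
have sc (j : nat) (A : set (W j)) : continuous (set_val : A -> W j).
  by apply/cont_onT; case: (set_val_emb A).
have c1 : closed (set_val @` [set a : pl_sub (@N i) | @F i.+1 (set_val (h a))]).
  apply: (closed_set_val (@N_closed i)).
  apply: (preimage_closed (D := @F i.+1)) => // a _.
  by apply: continuous_comp; [exact: hc|exact: sc].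
have c2 k : closed [set x : W k | exists j (y : W j), [/\ j.+1 = k, L y = L x & @F j y]].
  case: k => [|j].
    by rewrite (_ : [set _ | _] = set0); [exact: closed0|apply/seteqP; split=> x // [j [y []]]].
  have ic : continuous (@hinv j).
    by rewrite /hinv; case: cid => g p /=; have [_ _ _ []] := p.
  rewrite (_ : [set _ | _] = set_val @` [set b : pl_sub (@M j.+1) | @F j (set_val (hinv b))]).
    apply: (closed_set_val (@M_closed j.+1)).
    apply: (preimage_closed (D := @F j)) => // a _.
    by apply: continuous_comp; [exact: ic|exact: sc].
  apply/seteqP; split=> x; last first.
    move=> [b Fb <-]; exists j, (set_val (hinv b)); split=> //.
    by rewrite adj_step_eq hK.
  move=> [j' [y [[e]]]]; subst j' => /adj_meet[a [ya xa]] Fy.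
  by exists (h a) => //=; rewrite hinvK -ya.
rewrite [X in closed X](_ : _ = @F i `|` (set_val @` [set a : pl_sub (@N i) | @F i.+1 (set_val (h a))] `|`
    [set x : W i | exists j (y : W j), [/\ j.+1 = i, L y = L x & @F j y]])).
  by apply: closedU => //; exact: closedU.
apply/seteqP; split=> x.
  move=> [j [y [yx Fy]]]; case: (ltngtP i j) => ij.
  - have := adj_next (esym yx) ij => e; subst j.
    have [a [xa ya]] := adj_meet (esym yx).
    by right; left; exists a => //=; rewrite -ya.
  - by right; right; exists j, y; rewrite -(adj_next yx ij).
  - by subst j; left; rewrite -(adj_lift_inj yx).
move=> [Fx|[[a Fa <-]|[j [y [_ yx Fy]]]]].
- by exists i, x.
- by exists i.+1, (set_val (h a)); rewrite -adj_step_eq.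
- by exists j, y.
Qed.

Lemma adj_saturated (O : forall i, set (W i)) : (forall i, open (O i)) ->
  open [set y | forall i x, L x = y -> @O i x].
Proof.
move=> oO; rewrite (_ : mkset _ = ~` [set y | exists i x, L x = y /\ (~` @O i) x]).
  by apply: closed_openC; apply: adj_closed => i; exact: open_closedC.
apply/seteqP; split=> y.
  by move=> Oy [i [x [xy nO]]]; apply: nO; exact: Oy.
by move=> nO i x xy; apply: contrapT => nOx; apply: nO; exists i, x.
Qed.

(** Saturation makes the set of points all of whose lifts are well inside the preimage of [P] open;
    so neighbourhoods can be tested piece by piece. *)
Lemma adj_near (z : T) (P : set T) :
  (forall i (x : W i), L x = z -> \forall w \near x, P (L w)) -> nbhs z P.
Proof.
move=> H; pose O i := [set w : W i | (exists x : W i, L x = z) /\ \forall w \near w, P (L w)].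
have oO i : open (O i).
  by rewrite openE => w [ex /nbhs_interior Ow]; apply: filterS Ow.
have Oz : [set y | forall i x, L x = y -> O i x] z by move=> i x xz; split; [exists x|exact: H].
apply: filterS (open_near (adj_saturated oO) Oz) => y Oy.
by have [i [x xy]] := adj_surj y; have [_ /nbhs_singleton] := Oy i x xy; rewrite xy.
Qed.

Lemma adj_lift_closed i (F : set (W i)) : closed F -> closed (@adj_lift R W M N h i @` F).
Proof.
move=> cF; pose G j := [set w : W j | exists2 x, F x & existT WT i x = existT WT j w].
rewrite (_ : _ @` _ = [set y | exists j x, L x = y /\ @G j x]).
  apply: adj_closed => j; have [ij|ij] := pselect (i = j).
    subst j; rewrite (_ : G i = F) //; apply/seteqP; split=> x; last by exists x.
    by move=> [x' Fx' /(@existT_inj WT) <-].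
  rewrite (_ : G j = set0); first exact: closed0.
  by apply/seteqP; split=> x // [x' _ /(congr1 (@projT1 _ _))].
apply/seteqP; split=> y.
  by move=> [x Fx <-]; exists i, x; split=> //; exists x.
move=> [j [w [<- [x Fx e]]]]; exists x => //.
have ij := congr1 (@projT1 _ _) e; rewrite /= in ij; subst j.
by rewrite (@existT_inj WT _ _ _ e).
Qed.

Lemma adj_lift_emb i : emb_on setT (@adj_lift R W M N h i).
Proof.
split.
- by apply: continuous_cont_on; exact: adj_lift_continuous.
- by move=> x y _ _; exact: adj_lift_inj.
move=> x _ V Vx.
have cV : closed (~` V°) by apply: open_closedC; exact: open_interior.
have nx : ~ (@adj_lift R W M N h i @` (~` V°)) (L x).
  by move=> [w nw /adj_lift_inj wx]; apply: nw; rewrite wx.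
apply: filterS (open_near (closed_openC (adj_lift_closed cV)) nx) => y Hy w _ wy.
by apply: contrapT => nV; apply: Hy; exists w => // /interior_subset.
Qed.

Lemma adj_two (z : T) : exists k, [set y | range (@adj_lift R W M N h k) y] z /\
  forall i x, @adj_lift R W M N h i x = z -> i = k \/ i = k.+1.
Proof.
have ex : exists k, `[< range (@adj_lift R W M N h k) z >].
  by have [i [x xz]] := adj_surj z; exists i; apply/asboolP; exists x.
case: (ex_minnP ex) => k /asboolP zk kmin; exists k; split=> // i x xz.
have : (k <= i)%N by apply: kmin; apply/asboolP; exists x.
rewrite leq_eqVlt => /orP[/eqP->|ki]; first by left.
by case: zk => w _ wz; right; apply: (@adj_next _ _ w x) => //; rewrite wz xz.
Qed.

Lemma adj_local (z : T) : exists k, \forall y \near z,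
  exists i (x : W i), (i <= k)%N /\ L x = y.
Proof.
have [k [_ Hk]] := adj_two z; exists k.+1; apply: adj_near => i x /Hk ik.
by apply: nbhs_all => w; exists i, w; split=> //; case: ik => ->.
Qed.

Hypothesis W_pl : forall i, is_pl_space (W i).

(** Lifts of the two points are separated in each piece and the results saturated. The saturated
    sets are disjoint because every point of the quotient has a lift. *)
Lemma adj_hausdorff : hausdorff_space T.
Proof.
rewrite open_hausdorff => z z' zz'.
have HO0 i : exists O : set (W i) * set (W i),
    [/\ open O.1, open O.2, O.1 `&` O.2 = set0, forall x, L x = z -> O.1 x & forall x, L x = z' -> O.2 x].
  have [[x xz]|nz] := pselect (exists x : W i, L x = z); last first.
    exists (set0, setT); split=> //=; [exact: open0|exact: openT|by rewrite set0I|].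
    by move=> x xz; apply: nz; exists x.
  have [[x' xz']|nz] := pselect (exists x : W i, L x = z'); last first.
    exists (setT, set0); split=> //=; [exact: openT|exact: open0|by rewrite setI0|].
    by move=> x' xz'; apply: nz; exists x'.
  have [H _ _ _ _] := W_pl i; move: H; rewrite open_hausdorff => H.
  have /H [[A B] [/= Ax Bx] [oA oB AB]] : x != x'.
    by apply: contra_neq zz' => xx'; rewrite -xz -xz' xx'.
  exists (A, B); split=> //=; first by apply/eqP.
    by move=> w wz; move: Ax; rewrite inE -(@adj_lift_inj i w x) // xz.
  by move=> w wz; move: Bx; rewrite inE -(@adj_lift_inj i w x') // xz'.
pose O i := sval (cid (HO0 i)); have HO i : [/\ open (O i).1, open (O i).2, (O i).1 `&` (O i).2 = set0,
    forall x, L x = z -> (O i).1 x & forall x, L x = z' -> (O i).2 x] := svalP (cid (HO0 i)).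
exists ([set y | forall i x, L x = y -> (O i).1 x], [set y | forall i x, L x = y -> (O i).2 x]).
  by split; rewrite inE /= => i x; have [_ _ _ h1 h2] := HO i; [exact: h1|exact: h2].
split; try by apply: adj_saturated => i; case: (HO i).
rewrite /=; apply/eqP; apply/seteqP; split=> y // [H1 H2].
have [i [x xy]] := adj_surj y; have [_ _ e _ _] := HO i.
have : ((O i).1 `&` (O i).2) x by split; [exact: H1|exact: H2].
by rewrite e.
Qed.

(** The lifts of a point lie in at most two consecutive pieces, so the saturated sets given by a
    pair of basic open sets in pieces [k] and [k.+1], and by nothing elsewhere, form a base. *)
Lemma adj_second_countable : @second_countable T.
Proof.
have HB0 i : exists B : set (set (W i)), countable B /\ basis B.
  by have [_ [B cB bB] _ _ _] := W_pl i; exists B.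
pose B i := sval (cid (HB0 i)); have HB i : countable (B i) /\ basis (B i) := svalP (cid (HB0 i)).
(* The empty set is added for the points without a lift in the second piece. *)
pose B' i := B i `|` [set set0].
have cB' i : countable (B' i).
  rewrite (_ : B' i = \bigcup_(b : bool) (if b then B i else [set set0])).
    by apply: bigcup_countable => // -[] _; [case: (HB i)|exact: countable1].
  by apply/seteqP; split=> A; [case=> ?; [exists true|exists false]|case=> -[] _; [left|right]].
pose O k (p : set (W k) * set (W k.+1)) i := [set w : W i |
  (exists2 x, p.1 x & existT WT k x = existT WT i w) \/ exists2 x, p.2 x & existT WT k.+1 x = existT WT i w].
have oE k (A : set (W k)) i : open A -> open [set w : W i | exists2 x, A x & existT WT k x = existT WT i w].
  move=> oA; have [ki|ki] := pselect (k = i).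
    subst i; rewrite (_ : mkset _ = A) //; apply/seteqP; split=> x; last by exists x.
    by move=> [x' Ax' /(@existT_inj WT) <-].
  rewrite (_ : mkset _ = set0); first exact: open0.
  by apply/seteqP; split=> x // [x' _ /(congr1 (@projT1 _ _))].
pose G k p := [set y : T | forall i x, L x = y -> @O k p i x].
have oB' i A : B' i A -> open A.
  by case=> [|->]; [case: (HB i) => _ [H _]; exact: H|exact: open0].
have oO k p i : (B' k `*` B' k.+1) p -> open (@O k p i).
  by move=> [h1 h2]; apply: openU; apply: oE; [exact: oB' h1|exact: oB' h2].
exists (\bigcup_k (@G k @` (B' k `*` B' k.+1))).
  apply: bigcup_countable => // k _.
  apply: card_le_trans (card_image_le _ _) _.
  exact: countableX.
split.
  by move=> _ [k _ [p Bp <-]]; apply: adj_saturated => i; exact: oO.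
move=> z P Pz; have [k [[x _ xz] Hk]] := adj_two z.
have pull i (w : W i) : L w = z -> exists2 A, B' i A /\ A w & forall u, A u -> P (L u).
  move=> wz; have Pw : nbhs w (@adj_lift R W M N h i @^-1` P).
    by apply: (@adj_lift_continuous i w); rewrite wz.
  have [_ [_ bB]] := HB i; have [A [BA Aw] AP] := bB w _ Pw.
  by exists A => //; split=> //; left.
have [A [BA Ax] AP] := pull _ _ xz.
have [C BC [Cz CP]] : exists2 C, B' k.+1 C & (forall w, L w = z -> C w) /\ forall u, C u -> P (L u).
  have [[w wz]|nw] := pselect (exists w : W k.+1, L w = z).
    have [C [BC Cw] CP] := pull _ _ wz; exists C => //; split=> // u uz.
    by rewrite (@adj_lift_inj k.+1 u w) // wz.
  exists set0; first by right.
  by split=> // w wz; apply: nw; exists w.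
exists (@G k (A, C)).
  split; first by exists k => //; exists (A, C).
  move=> i w wz; case: (Hk i w wz) => e; subst i.
    by left; exists w => //; rewrite (@adj_lift_inj k w x) // wz.
  by right; exists w => //; exact: Cz.
move=> y Gy; have [i [w wy]] := adj_surj y.
by case: (Gy i w wy) => -[u Hu e]; have ij := congr1 (@projT1 _ _) e; rewrite /= in ij; subst i;
  rewrite -wy -(@existT_inj WT _ _ _ e); [exact: AP|exact: CP].
Qed.

End AdjSpace.

(** * The PL structure of the adjunction space *)

Section AdjPL.
Variables (R : realType) (W : nat -> plSpace R) (M N : forall i, set (W i)).
Variable h : forall i, pl_sub (@N i) -> pl_sub (@M i.+1).
Hypothesis MN0 : forall i, @M i `&` @N i = set0.
Hypothesis h_homeo : forall i, pl_homeo (@h i).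
Hypotheses (M_closed : forall i, closed (@M i)) (N_closed : forall i, closed (@N i)).
Hypothesis W_pl : forall i, is_pl_space (W i).

Local Notation L := (@adj_lift R W M N h).
Local Notation T := (adj_space h).
Local Notation X := (adjunction h).

(* Piecewise PL functions on the adjunction space. *)
Definition ppl (A : set T) k (psi : T -> 'rV[R]_k) : Prop :=
  forall i l (d : chart R (W i) l) w, pl_atlas (W i) l d -> A (L w) -> chart_dom d w ->
    plg (@adj_lift R W M N h i @^-1` A `&` chart_dom d) (chart_map d) (psi \o @adj_lift R W M N h i) w.

(** A neighbourhood of [x] is made of its traces on at most two pieces, so the germs over the
    corresponding sets [S] and [S'] unite to one over [A]. *)
Lemma adj_plg (A : set T) k l (phi : T -> 'rV[R]_k) (psi : T -> 'rV[R]_l) x :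
  inj_on A phi ->
  (forall i (w : W i), L w = x -> exists S, [/\ S `<=` A, plg S phi psi x &
     \forall w' \near w, A (@adj_lift R W M N h i w') -> S (L w')]) ->
  plg A phi psi x.
Proof.
move=> iA H; have [k' [[w _ wx] Hk]] := adj_two MN0 h_homeo x.
have [S [SA pS nS]] := H _ _ wx.
have [[v vx]|nv] := pselect (exists v : W k'.+1, L v = x); last first.
  apply: (plg_enlarge iA SA _ pS); apply: (adj_near MN0 h_homeo M_closed N_closed) => i u ux.
  case: (Hk i u ux) => e; subst i; last by case: nv; exists u.
  by rewrite (@adj_lift_inj _ _ _ _ _ MN0 h_homeo k' u w) // wx.
have [S' [SA' pS' nS']] := H _ _ vx.
have SSA : S `|` S' `<=` A by move=> y [/SA|/SA'].
apply: (@plg_enlarge _ _ _ _ (S `|` S')) => //; last by apply: plg_union => //; exact: inj_on_sub iA.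
apply: (adj_near MN0 h_homeo M_closed N_closed) => i u ux.
case: (Hk i u ux) => e; subst i.
  rewrite (@adj_lift_inj _ _ _ _ _ MN0 h_homeo k' u w) ?wx //.
  by apply: filterS nS => y Hy Ay; left; exact: Hy.
rewrite (@adj_lift_inj _ _ _ _ _ MN0 h_homeo k'.+1 u v) ?vx //.
by apply: filterS nS' => y Hy Ay; right; exact: Hy.
Qed.

(** Within a piece [phi] can be inverted by [plg_inv], which makes [psi] a PL function of [phi]
    there; [adj_plg] unites the pieces. *)
Lemma ppl_plg (A : set T) k l (phi : T -> 'rV[R]_k) (psi : T -> 'rV[R]_l) x :
  A x -> inj_on A phi -> ppl A phi -> ppl A psi -> plg A phi psi x.
Proof.
move=> Ax iA hphi hpsi; apply: adj_plg => // i w wx.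
have [m [d [ad dw]]] := atlas_cover (W_pl i) w; have [od [cd id' vd]] := atlas_emb (W_pl i) ad.
set E := @adj_lift R W M N h i @^-1` A `&` chart_dom d.
exists (@adj_lift R W M N h i @` E); split.
- by move=> _ [u [Au _] <-].
- rewrite -wx; apply: (@plg_push _ _ _ _ _ (@adj_lift R W M N h i) _ E) => //.
  + have [_ _ v] := adj_lift_emb MN0 h_homeo M_closed N_closed i.
    by apply: (@inv_at_sub _ _ setT) => //; exact: v.
  have Aw : A (L w) by rewrite wx.
  apply: (@plg_comp _ _ _ _ _ E E _ (chart_map d)) => //; last exact: hpsi.
  apply: plg_inv; last exact: hphi.
  by move=> u v [Au _] [Av _] /= /iA uv; apply: (@adj_lift_inj _ _ _ _ _ MN0 h_homeo i); exact: uv.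
by apply: filterS (open_near od dw) => u du Au; exists u.
Qed.

Lemma ppl_cont (A : set T) k (psi : T -> 'rV[R]_k) : ppl A psi -> cont_on A psi.
Proof.
move=> hpsi x Ax V Vx; apply: (adj_near MN0 h_homeo M_closed N_closed) => i w wx.
have [m [d [ad dw]]] := atlas_cover (W_pl i) w; have [od [cd id' vd]] := atlas_emb (W_pl i) ad.
have Aw : A (L w) by rewrite wx.
have E := hpsi i m d w ad Aw dw.
have /(_ V) := plg_cont (conj Aw dw) (cont_at_sub (@subIsetr _ _ _) (cd _ dw)) E.
rewrite /= wx => /(_ Vx).
by apply: filterS2 (open_near od dw) => u du Hu Au; apply: Hu.
Qed.

Lemma ppl_sub (A B : set T) k (psi : T -> 'rV[R]_k) : B `<=` A -> open B -> ppl A psi -> ppl B psi.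
Proof.
move=> BA oB hpsi i l d w ad Bw dw.
have [od [cd id' vd]] := atlas_emb (W_pl i) ad.
apply: plg_shrink (hpsi i l d w ad (BA _ Bw) dw).
- by apply: cont_at_sub (cd _ dw); exact: subIsetr.
- by apply: inv_at_sub (vd _ dw); exact: subIsetr.
- by move=> u [/BA].
have H : \forall u \near w, B (@adj_lift R W M N h i u).
  exact: (@adj_lift_continuous R W M N h i w _ (open_near oB Bw)).
by apply: (@filterS _ (nbhs w) _ _ _ _ H) => u Bu [].
Qed.

Lemma adj_atlas_ppl k (c : chart R T k) : pl_atlas X k c -> ppl (chart_dom c) (chart_map c).
Proof.
move=> [_ H] i l d w ad cw dw; have [od [cd id' vd]] := atlas_emb (W_pl i) ad.
rewrite setIC; apply: pl_factor_plg; last exact: H.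
  by apply: cont_at_sub (cd _ dw); exact: subIsetl.
by split.
Qed.

Lemma adj_atlas_emb k (c : chart R T k) : pl_atlas X k c ->
  open (chart_dom c) /\ emb_on (chart_dom c) (chart_map c).
Proof. by case=> /is_chart_emb. Qed.

Lemma adj_atlasI k (D : set T) (phi : T -> 'rV[R]_k) :
  open D -> emb_on D phi -> ppl D phi -> pl_atlas X k (Chart D phi).
Proof.
move=> oD eD pD; split; first exact: emb_is_chart.
move=> i l d ad; have [od [cd id' vd]] := atlas_emb (W_pl i) ad.
apply: plg_pl_factor.
- by apply: inj_on_sub id'; exact: subIsetl.
- by move=> w [dw _]; apply: inv_at_sub (vd _ dw); exact: subIsetl.
by move=> w [dw Dw]; rewrite setIC; exact: pD.
Qed.

Lemma adj_pl_space :
  (forall x : T, exists k (c : chart R T k), pl_atlas X k c /\ chart_dom c x) -> is_pl_space X.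
Proof.
move=> cover; split => //.
- exact: (adj_hausdorff MN0 h_homeo M_closed N_closed W_pl).
- exact: (adj_second_countable MN0 h_homeo M_closed N_closed W_pl).
- by move=> k c [].
move=> k l c d ac ad.
have [oc [cc ic vc]] := adj_atlas_emb ac; have [od [cd ii vd]] := adj_atlas_emb ad.
have oI := openI oc od.
have pc : ppl (chart_dom c `&` chart_dom d) (chart_map c).
  by apply: ppl_sub (adj_atlas_ppl ac) => //; exact: subIsetl.
have pd : ppl (chart_dom c `&` chart_dom d) (chart_map d).
  by apply: ppl_sub (adj_atlas_ppl ad) => //; exact: subIsetr.
have jc := inj_on_sub (@subIsetl _ (chart_dom c) (chart_dom d)) ic.
have jd := inj_on_sub (@subIsetr _ (chart_dom c) (chart_dom d)) ii.
split; apply: plg_pl_factor => //.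
- by move=> x [cx dx]; apply: inv_at_sub (vc x cx); exact: subIsetl.
- by move=> x Ix; apply: ppl_plg.
- by move=> x [cx dx]; apply: inv_at_sub (vd x dx); exact: subIsetr.
by move=> x Ix; apply: ppl_plg.
Qed.

Lemma adj_pl_emb i : @pl_emb R (W i) X (@adj_lift R W M N h i).
Proof.
split; first exact: (adj_lift_emb MN0 h_homeo M_closed N_closed).
move=> k l c d ac ad x cx dx; rewrite setIC.
exact: (adj_atlas_ppl ad).
Qed.

End AdjPL.

(** * Bicollars of the seams *)

Section Bicollar.
Variables (R : realType) (n : nat) (W : nat -> plSpace R) (M N : forall i, set (W i)).
Variable h : forall i, pl_sub (@N i) -> pl_sub (@M i.+1).
Hypothesis h_homeo : forall i, pl_homeo (@h i).
Hypothesis W_cob : forall i, cobordism n (@M i) (@N i).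

Local Notation L := (@adj_lift R W M N h).
Local Notation T := (adj_space h).
Local Notation X := (adjunction h).
Local Notation WT := (fun i => W i : Type).

Lemma cob_MN0 i : @M i `&` @N i = set0. Proof. by have [_ _ _ _ []] := W_cob i. Qed.
Lemma cob_man i : pl_manifold n (W i). Proof. by have [] := W_cob i. Qed.
Lemma cob_pl i : is_pl_space (W i). Proof. by have [] := cob_man i. Qed.
Lemma cob_closedM i : closed (@M i). Proof. by have [] := W_cob i. Qed.
Lemma cob_closedN i : closed (@N i). Proof. by have [] := W_cob i. Qed.
Lemma cob_bd i : boundary n (X := W i) = @M i `|` @N i.
Proof. by have [_ _ _ _ []] := W_cob i. Qed.
Lemma cob_compact_bd i : compact (boundary n (X := W i)).
Proof.
have [_ cW _ _ _] := W_cob i; rewrite cob_bd.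
apply: (subclosed_compact _ cW) => //.
by apply: closedU; [exact: cob_closedM|exact: cob_closedN].
Qed.

Let S i : set (pl_prod (W i) (pl_line R)) := half_open R (boundary n (X := W i)).

Variable col : forall i, pl_prod (W i) (pl_line R) -> W i.
Hypothesis col0 : forall i (y : W i), boundary n y -> col (y, 0) = y.
Hypothesis col_inj : forall i, inj_on (@S i) (@col i).
Hypothesis col_pl : forall i p, @S i p -> plat (@S i) (@col i) p.
Hypothesis col_open : forall i O, open O -> open (@col i @` (O `&` @S i)).

Let MN0 := cob_MN0.
Let cM := cob_closedM.
Let cN := cob_closedN.

Let bdM i (a : W i) : M a -> boundary n a. Proof. by rewrite cob_bd; left. Qed.
Let bdN i (a : W i) : N a -> boundary n a. Proof. by rewrite cob_bd; right. Qed.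
Let notMN i (a : W i) : M a -> N a -> False.
Proof. by move=> Ma Na; have : (@M i `&` @N i) a by []; rewrite MN0. Qed.

Let Linj i := @adj_lift_inj R W M N h MN0 h_homeo i.
Let Lemb i := adj_lift_emb MN0 h_homeo cM cN i.

Lemma col_cont i : cont_on (@S i) (@col i).
Proof. by move=> p Sp; case: (col_pl Sp). Qed.

Let LR i (p : W i * R) : T * R := (L p.1, p.2).

Definition acol i : T * R -> T :=
  extend (@S i) (@LR i) (@adj_lift R W M N h i \o @col i) fst.

Let LR_emb i : emb_on (@S i) (@LR i).
Proof. exact: (emb_prodR _ (emb_on_sub (@subsetT _ _) (Lemb i))). Qed.

Lemma acolE i (a : W i) (s : R) : @S i (a, s) -> acol i (L a, s) = L (@col i (a, s)).
Proof.
by move=> Sas; rewrite /acol (_ : (L a, s) = @LR i (a, s)) // extendE //; case: (LR_emb i).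
Qed.

Lemma acol_cont i : cont_on (@LR i @` @S i) (acol i).
Proof.
apply: extend_cont; first exact: LR_emb.
by apply: (cont_on_comp (B := setT) (@col_cont i)) => //; case: (Lemb i).
Qed.

Definition seam i : set T := @adj_lift R W M N h i @` @N i.

Lemma seamM i : seam i = @adj_lift R W M N h i.+1 @` @M i.+1.
Proof.
apply/seteqP; split=> _ [a Ha <-].
  exists (set_val (h (toset Ha : pl_sub (@N i)))); first exact: set_valE'.
  by rewrite -adj_step_eq set_val_toset.
have [g [_ gK _ _]] := h_homeo i.
exists (set_val (g (toset Ha : pl_sub (@M i.+1)))); first exact: set_valE'.
by rewrite adj_step_eq gK set_val_toset.
Qed.

(** Negative times run back into the [i]-th piece from its end [N], positive ones forward into the
    next piece from its end [M]. *)
Definition bcol i (p : T * R) : T := if p.2 <= 0 then acol i (p.1, - p.2) else acol i.+1 p.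
Definition seam_nbd i : set (T * R) := seam i `*` [set t | -1 < t < 1].

Lemma bcol_le i (a : W i) (t : R) : N a -> -1 < t <= 0 -> bcol i (L a, t) = L (@col i (a, - t)).
Proof.
move=> Na /andP[t1 t0]; rewrite /bcol /= t0 acolE //; split; first exact: bdN.
by apply/andP; split=> /=; lra.
Qed.

Lemma bcol_ge i (b : W i.+1) (t : R) : M b -> 0 <= t < 1 -> bcol i (L b, t) = L (@col i.+1 (b, t)).
Proof.
move=> Mb /andP[t0 t1]; rewrite /bcol /=; case: leP => t0'; last first.
  by rewrite acolE //; split; [exact: bdM|apply/andP; split].
have -> : t = 0 by lra.
have : seam i (L b) by rewrite seamM; exists b.
move=> [a Na ab]; rewrite -ab oppr0 acolE; last by split; [exact: bdN|rewrite /= lexx ltr01].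
by rewrite !col0 //; [exact: bdM|exact: bdN].
Qed.

Lemma seam_points i x : seam i x -> exists (a : W i) (b : W i.+1), [/\ N a, M b, L a = x & L b = x].
Proof. by move=> Bx; have := Bx; rewrite seamM => -[b Mb bx]; case: Bx => a Na ax; exists a, b. Qed.

Lemma bcol0 i x : seam i x -> bcol i (x, 0) = x.
Proof.
move=> [a Na <-]; rewrite bcol_le //; last by apply/andP; split; lra.
by rewrite oppr0 col0 //; exact: bdN.
Qed.

Lemma col_base i (a m : W i) s : @S i (a, s) -> boundary n m -> @col i (a, s) = m -> a = m /\ s = 0.
Proof.
move=> Sas Bm; rewrite -{1}(col0 Bm) => /col_inj E.
have [] // : (a, s) = (m, 0) by apply: E => //; split=> //=; rewrite lexx ltr01.
Qed.

(** A lift outside the expected piece exists only if the point lies on an end of that piece. By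
    [col_base] a collar point on the boundary is a base point, and since [M] and [N] are disjoint
    only seam points at time 0 remain. *)
Lemma bcol_pieces i x t j (w : W j) : seam_nbd i (x, t) -> L w = bcol i (x, t) ->
  (exists a : W i, [/\ N a, L a = x, t <= 0 & existT WT j w = existT WT i (@col i (a, - t))]) \/
  (exists b : W i.+1, [/\ M b, L b = x, 0 <= t & existT WT j w = existT WT i.+1 (@col i.+1 (b, t))]).
Proof.
move=> [/= Bx /andP[t1 t2]]; have [a [b [Na Mb ax bx]]] := seam_points Bx.
case: (leP t 0) => t0.
  have Sat : @S i (a, - t) by split; [exact: bdN|apply/andP; split=> /=; lra].
  rewrite -{1}ax bcol_le ?t1 // => Lw; case: (ltngtP i j) => ij.
  - have e := adj_next MN0 h_homeo (esym Lw) ij; subst j.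
    have [a' [va wa]] := adj_meet MN0 h_homeo (esym Lw).
    have Na' := set_valE' a'.
    have [aa tt] := col_base Sat (bdN Na') va.
    right; exists b; split=> //; first by lra.
    have -> : t = 0 by lra.
    rewrite col0; last exact: bdM.
    congr existT; apply: (@Linj i.+1); rewrite bx -ax Lw va.
    by rewrite aa.
  - have e := adj_next MN0 h_homeo Lw ij; subst i.
    have [a' [va wa]] := adj_meet MN0 h_homeo Lw.
    have Mh := set_valE' (h a').
    by have [aa tt] := col_base Sat (bdM Mh) wa; case: (@notMN _ a) => //; rewrite aa.
  by subst j; left; exists a; split=> //; congr existT; exact: Linj.
have Sbt : @S i.+1 (b, t) by split; [exact: bdM|apply/andP; split=> //; exact: ltW].
rewrite -{1}bx bcol_ge ?t2 ?ltW // => Lw; case: (ltngtP i.+1 j) => ij.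
- have e := adj_next MN0 h_homeo (esym Lw) ij; subst j.
  have [a' [va wa]] := adj_meet MN0 h_homeo (esym Lw).
  have Na' := set_valE' a'.
  by have [aa tt] := col_base Sbt (bdN Na') va; case: (@notMN _ b) => //; rewrite aa.
- have e := adj_next MN0 h_homeo Lw ij; have e' : i = j by lia.
  subst j; have [a' [va wa]] := adj_meet MN0 h_homeo Lw.
  have Mh := set_valE' (h a').
  by have [aa tt] := col_base Sbt (bdM Mh) wa; move: t0; rewrite tt ltxx.
by subst j; right; exists b; split; rewrite ?ltW //; congr existT; exact: Linj.
Qed.

Lemma bcol_inj i : inj_on (seam_nbd i) (bcol i).
Proof.
move=> [x t] [x' t'] Q Q' E; have [a [b [Na Mb ax bx]]] := seam_points (proj1 Q : seam i x).
have [t1 t2] := andP (proj2 Q); have [t1' t2'] := andP (proj2 Q'); rewrite /= in t1 t2 t1' t2'.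
have SN (u : W i) s : N u -> -1 < s -> s <= 0 -> @S i (u, - s).
  by move=> Nu s1 s0; split; [exact: bdN|apply/andP; split=> /=; lra].
have SM (u : W i.+1) s : M u -> s < 1 -> 0 <= s -> @S i.+1 (u, s).
  by move=> Mu s1 s0; split; [exact: bdM|apply/andP; split=> /=; lra].
case: (leP t 0) => t0.
  have Ew : L (@col i (a, - t)) = bcol i (x', t') by rewrite -E -ax bcol_le // t1.
  have [[a' [Na' ax' t0' e]]|[b' [_ _ _ /(congr1 (@projT1 _ _))/= e]]] := bcol_pieces Q' Ew; last by lia.
  have [aa tt] : (a, - t) = (a', - t').
    by apply: col_inj (@existT_inj WT _ _ _ e); apply: SN.
  by rewrite -ax -ax' aa; congr pair; lra.
have Ew : L (@col i.+1 (b, t)) = bcol i (x', t') by rewrite -E -bx bcol_ge // t2 ltW.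
have [[b' [_ _ _ /(congr1 (@projT1 _ _))/= e]]|[b' [Mb' bx' t0' e]]] := bcol_pieces Q' Ew; first by lia.
have [aa tt] : (b, t) = (b', t').
  by apply: col_inj (@existT_inj WT _ _ _ e); apply: SM => //; exact: ltW.
by rewrite -bx -bx' aa tt.
Qed.

Lemma bcol_cont i : cont_on (seam_nbd i) (bcol i).
Proof.
have k1 : closed [set p : T * R | p.2 <= 0].
  by apply: (preimage_closed (D := [set t : R | t <= 0])) => [p _|]; [exact: cvg_snd|exact: closed_le].
have k2 : closed [set p : T * R | 0 <= p.2].
  by apply: (preimage_closed (D := [set t : R | 0 <= t])) => [p _|]; [exact: cvg_snd|exact: closed_ge].
apply: (cont_paste k1 k2).
- by move=> p _; case/orP: (le_total p.2 0); [left|right].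
- apply: (@cont_on_ext _ _ _ (acol i \o (fun p => (p.1, - p.2)))).
    by move=> p [_ /= p0]; rewrite /bcol p0.
  apply: (cont_on_comp _ _ (@acol_cont i)).
    by apply: cont_on_pair; [exact: cont_on_fst|apply: cont_on_opp; exact: cont_on_snd].
  move=> [x t] [[/= [a Na <-] /andP[t1 t2]] t0]; exists (a, - t) => //.
  by split; [exact: bdN|apply/andP; split=> /=; lra].
apply: (@cont_on_ext _ _ _ (acol i.+1)).
  move=> [x t] [[/= Bx /andP[_ t2]] /= t0]; have [a [b [Na Mb ax bx]]] := seam_points Bx.
  rewrite -bx bcol_ge ?t0 // acolE //.
  by split; [exact: bdM|apply/andP; split].
apply: (cont_on_sub _ (@acol_cont i.+1)) => -[x t] [[/= Bx /andP[t1 t2]] t0].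
have [a [b [Na Mb ax bx]]] := seam_points Bx; exists (b, t); last by rewrite /LR /= bx.
by split; [exact: bdM|apply/andP; split].
Qed.

Lemma bcol_open i (O : set (T * R)) : open O -> open (bcol i @` (O `&` seam_nbd i)).
Proof.
move=> oO; rewrite openE => _ [[x t] [Oxt Q] <-].
apply: (adj_near MN0 h_homeo cM cN) => j w Lw.
have L1 k : cont_on setT (fun p : W k * R => L p.1).
  apply: (cont_on_comp (B := setT) (f := fst) (g := @adj_lift R W M N h k)) => //; first exact: cont_on_fst.
  by apply/cont_onT; exact: adj_lift_continuous.
have LRc k : continuous (@LR k).
  by apply/cont_onT; apply: cont_on_pair; [exact: L1|exact: cont_on_snd].
have LRc' k : continuous (fun p : W k * R => (L p.1, - p.2)).
  by apply/cont_onT; apply: cont_on_pair; [exact: L1|apply: cont_on_opp; exact: cont_on_snd].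
have [[a [Na ax t0 e]]|[b [Mb bx t0 e]]] := bcol_pieces Q Lw;
  have ij := congr1 (@projT1 _ _) e; rewrite /= in ij; subst j; rewrite (@existT_inj WT _ _ _ e).
  (* Removing the opposite end from the base leaves an open part of the domain on which only the
     collar of the seam survives, so [col_open] applies. *)
  pose G : set (W i * R) := [set p | O (L p.1, - p.2)] `&` (~` @M i `*` setT).
  have oG : open G.
    apply: openI; last by apply: open_prod; [apply: closed_openC; exact: cM|exact: openT].
    by apply: (@open_comp _ _ (fun p : W i * R => (L p.1, - p.2))) => // p _; exact: LRc'.
  have Hw : (@col i @` (G `&` @S i)) (@col i (a, - t)).
    exists (a, - t) => //; split; last first.
      case: Q => _ /= /andP[? ?]; split; [exact: bdN|by apply/andP; split=> /=; lra].
    by split; [rewrite /= opprK ax|split=> // Ma; exact: (notMN Ma Na)].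
  apply: filterS (open_near (@col_open i _ oG) Hw) => _ [[a' s] [[Oa [nM _]] [Ba /andP[s0 s1]]] <-].
  have Na' : N a' by move: Ba; rewrite /= cob_bd => -[].
  exists (L a', - s).
    by split=> //; split; [exists a'|apply/andP; split=> /=; rewrite /= in s0 s1; lra].
  rewrite bcol_le ?opprK //; apply/andP; split; rewrite /= in s0 s1; lra.
pose G : set (W i.+1 * R) := [set p | O (L p.1, p.2)] `&` (~` @N i.+1 `*` setT).
have oG : open G.
  apply: openI; last by apply: open_prod; [apply: closed_openC; exact: cN|exact: openT].
  by apply: (@open_comp _ _ (@LR i.+1)) => // p _; exact: LRc.
have Hw : (@col i.+1 @` (G `&` @S i.+1)) (@col i.+1 (b, t)).
  exists (b, t) => //; split; last first.
    by case: Q => _ /andP[? ?]; split; [exact: bdM|apply/andP; split].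
  by split; [rewrite /= bx|split=> // Nb; exact: (notMN Mb Nb)].
apply: filterS (open_near (@col_open i.+1 _ oG) Hw) => _ [[b' s] [[Ob [nN _]] [Bb /andP[s0 s1]]] <-].
have Mb' : M b' by move: Bb; rewrite /= cob_bd => -[].
exists (L b', s).
  split=> //; split; first by rewrite seamM; exists b'.
  by apply/andP; split=> //=; rewrite /= in s0 s1; lra.
by rewrite bcol_ge //; apply/andP.
Qed.

End Bicollar.

(** * Charts along the seams *)

Section CollarGerm.
Variables (R : realType) (n : nat) (W : plSpace R) (B : set W).
Hypothesis W_pl : is_pl_space W.
Let WR := pl_prod W (pl_line R).
Let WR_pl : pl_axioms WR := prod_axioms W_pl (line_axioms R).
Let S : set WR := half_open R B.
Variable col : WR -> W.
Hypotheses (col_inj : inj_on S col) (col_pl : forall p, S p -> plat S col p)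
  (col_open : forall O, open O -> open (col @` (O `&` S))).

Lemma collar_inv_at (S' : set WR) p : S' `<=` S -> S p -> inv_at S' col p.
Proof.
move=> SS Sp V Vp.
have H : (col @` (V° `&` S)) (col p) by exists p => //; split=> //; exact: nbhs_interior.
apply: filterS (open_near (col_open (open_interior V)) H) => _ [q [Vq Sq] <-] z Sz zq.
by rewrite (col_inj (SS _ Sz) Sq zq); exact: interior_subset.
Qed.

(** In the product chart both [col] and the formula for [Psi] after [col] are PL, and [col] is
    injective, hence can be inverted. The sign [eps] distinguishes the two sides of a seam and 2 is
    the height of the seam. *)
Lemma collar_plg (P : set W) (chi Psi : W -> 'rV[R]_n.+1) (eps : R) a s k l
    (e : chart R W k) (d : chart R W l) :
  P `<=` B -> pl_atlas W k e -> pl_atlas W l d -> P a -> 0 <= s < 1 -> chart_dom e a ->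
  chart_dom d (col (a, s)) -> plg (P `&` chart_dom e) (chart_map e) chi a ->
  (forall b t, P b -> 0 <= t < 1 -> Psi (col (b, t)) = setc (2 + eps * t) (chi b)) ->
  plg (col @` (half_open R P) `&` chart_dom d) (chart_map d) Psi (col (a, s)).
Proof.
move=> PB ae ad Pa s01 ea dw hchi PsiE.
have [oe [ce ie ve]] := atlas_emb W_pl ae; have [od [cd id' vd]] := atlas_emb W_pl ad.
have SP : half_open R P `<=` S by move=> p [/PB].
have Sas : S (a, s) by apply: SP.
pose Phi (p : WR) := row_mx (chart_map e p.1) (const_mx p.2 : 'rV[R]_1).
have rP := rchart_prod (atlas_rchart W_pl ae) (rchart_line R).
pose P0 : set WR := chart_dom e `*` setT; rewrite -/P0 in rP.
have [_ iPhi _] := proj1 rP.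
pose S1 := S `&` P0 `&` col @^-1` chart_dom d.
have h1 : plg S1 Phi (chart_map d \o col) (a, s).
  exact: (plat_rchart WR_pl W_pl (col_pl Sas) rP (atlas_rchart W_pl ad) Sas (conj ea I) dw).
pose B1 : set WR := (P `&` chart_dom e) `*` setT.
pose Th (q : WR) := setc (2 + eps * q.2) (chi q.1).
have h2 : plg B1 Phi Th (a, s).
  have hs : plg setT (fun t : R => const_mx t : 'rV[R]_1) (fun t => const_mx t : 'rV[R]_1) s.
    exact: (rchart_self (line_axioms R) (rchart_line R) I).
  have := plg_prod hchi hs.
  pose f (y : 'rV[R]_(n.+1 + 1)) : 'rV[R]_n.+1 := setc (2 + eps * y ord0 (rshift _ ord0)) (lsubmx y).
  have af : affine f.
    apply: affine_setc.
      by apply: affine_funD; [exact: affine_fun_cst|apply: affine_funZ; exact: affine_fun_coord].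
    apply/affine_coord => i; have [u [b E]] := @affine_fun_coord R _ (lshift 1 i : 'I_(n.+1 + 1)).
    by exists u, b => y; rewrite mxE E.
  move=> /(plg_post af); apply: plg_ext => // -[b t] _ /=.
  by rewrite /Th /f /= row_mxEr mxE row_mxKl.
have S1P : S1 `<=` P0 by move=> p [[]].
have B1P : B1 `<=` P0 by move=> p [[]].
have iU : inj_on (S1 `|` B1) Phi by apply: inj_on_sub iPhi => p [/S1P|/B1P].
have iU' : inj_on (B1 `|` S1) Phi by rewrite setUC.
pose S2 := S1 `&` B1.
have g1 : plg S2 Phi (chart_map d \o col) (a, s).
  by apply: plg_inter => //; exact: plg_refl h2.
have g2 : plg S2 Phi Th (a, s).
  by rewrite /S2 setIC; apply: plg_inter => //; exact: plg_refl h1.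
have S2S : S2 `<=` S by move=> p [[[]]].
have S2d q : S2 q -> chart_dom d (col q) by move=> [[]].
have g3 : plg S2 (chart_map d \o col) Th (a, s).
  apply: (plg_comp (B := S2) (psi := Phi)) => //; apply: plg_inv => // p q Sp Sq /= E.
  by apply: col_inj; [exact: S2S|exact: S2S|apply: id' E; exact: S2d].
have S2P q : S2 q -> half_open R P q.
  by case: q => b t [[[[_ ?] _] _] [[Pb _] _]].
have g4 : plg (col @` S2) (chart_map d) Psi (col (a, s)).
  apply: (plg_push (B := S2)) => //.
  - exact: collar_inv_at.
  apply: plg_ext g3 => // -[b t] Sq /=; have [Pb t01] := S2P _ Sq.
  by rewrite PsiE.
apply: plg_enlarge g4.
- by apply: inj_on_sub id'; exact: subIsetr.
- by move=> _ [q Sq <-]; split; [exists q => //; exact: S2P|exact: S2d].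
have oP0 : open P0 by exact: (open_prod oe (@openT R)).
have H : (col @` (P0 `&` S)) (col (a, s)) by exists (a, s).
apply: filterS (open_near (col_open oP0) H) => _ [q [Pq Sq] <-] [[q' Pq' /col_inj qq] dq].
have e' : q' = q by apply: qq => //; exact: SP.
subst q'; exists q => //; split; first by split.
by case: q {Sq dq qq} Pq' Pq => b t [/= Pb _] [/= eb _].
Qed.

End CollarGerm.

Lemma emb_of_inverse (S T : topologicalType) (D : set S) (f : S -> T) (g : T -> S) :
  cont_on D f -> cont_on (f @` D) g -> (forall x, D x -> g (f x) = x) -> emb_on D f.
Proof.
move=> cf cg gf; split=> //.
  by move=> x y Dx Dy fxy; rewrite -(gf _ Dx) fxy gf.
move=> x Dx V Vx; have Dfx : (f @` D) (f x) by exists x.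
have := cg _ Dfx V; rewrite gf // => /(_ Vx); apply: filterS => y Hy z Dz zy.
by rewrite -(gf z Dz) zy; apply: Hy; exists z.
Qed.

Section SeamChart.
Variables (R : realType) (n : nat) (W : nat -> plSpace R) (M N : forall i, set (W i)).
Variable h : forall i, pl_sub (@N i) -> pl_sub (@M i.+1).
Hypothesis h_homeo : forall i, pl_homeo (@h i).
Hypothesis W_cob : forall i, cobordism n (@M i) (@N i).

Local Notation L := (@adj_lift R W M N h).
Local Notation T := (adj_space h).
Local Notation X := (adjunction h).
Local Notation WT := (fun i => W i : Type).
Let S i : set (pl_prod (W i) (pl_line R)) := half_open R (boundary n (X := W i)).
Variable col : forall i, pl_prod (W i) (pl_line R) -> W i.
Hypothesis col0 : forall i (y : W i), boundary n y -> col (y, 0) = y.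
Hypothesis col_inj : forall i, inj_on (@S i) (@col i).
Hypothesis col_pl : forall i p, @S i p -> plat (@S i) (@col i) p.
Hypothesis col_open : forall i O, open O -> open (@col i @` (O `&` @S i)).

Let W_pl i : is_pl_space (W i) := cob_pl W_cob i.
Let MN0 := cob_MN0 W_cob.
Let cM := cob_closedM W_cob.
Let cN := cob_closedN W_cob.
Let Linj i := @adj_lift_inj R W M N h MN0 h_homeo i.
Let Lemb i := adj_lift_emb MN0 h_homeo cM cN i.
Local Notation bcol := (@bcol R n W M N h col).
Local Notation seam_nbd := (@seam_nbd R W M N h).

Variables (i : nat) (A : set (W i)) (phi : W i -> 'rV[R]_n.+1) (x0 : T).
Hypotheses (oA : open A) (rA : rchart A phi)
  (imA : exists2 O, open O & phi @` A = O `&` @half_space R n)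
  (NA : forall a, A a -> (N a <-> c0 (phi a) = 0)).

Let chiT : T -> 'rV[R]_n.+1 := extend A (@adj_lift R W M N h i) phi (fun=> 0).

Let chiL a : A a -> chiT (L a) = phi a.
Proof. by move=> Aa; rewrite /chiT extendE // => x y _ _; exact: Linj. Qed.

Let iA : inj_on A phi. Proof. by case: rA => -[]. Qed.

Definition seam_patch : set (T * R) :=
  (@adj_lift R W M N h i @` (A `&` @N i)) `*` [set t | -1 < t < 1].

Let G := seam_patch.

Let GQ : G `<=` seam_nbd i.
Proof. by move=> [x t] [/= [a [Aa Na] <-] t1]; split=> //; exists a. Qed.

Let G_open : exists2 O, open O & G = O `&` seam_nbd i.
Proof.
exists (~` (@adj_lift R W M N h i @` (~` A)) `*` setT).
  apply: open_prod; last exact: openT.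
  by apply: closed_openC; apply: (adj_lift_closed MN0 h_homeo cM cN); exact: open_closedC.
apply/seteqP; split=> [[x t] Gp|[x t] [[/= nx _] [[a Na ax] t1]]].
  split; last exact: GQ.
  case: Gp => /= -[a [Aa Na] ax] _; split=> //= -[b nb bx].
  by apply: nb; rewrite (@Linj i b a) // ax bx.
split=> //=; exists a => //; split=> //; apply: contrapT => nAa; apply: nx.
by exists a.
Qed.

Definition seam_dom : set T := bcol i @` seam_patch.
(** The bicollar parameter, shifted by 2, replaces the vanishing first coordinate of the base point.
    The image lies in 1 < [c0] < 3, so it is open, inside the half-space, and away from the wall
    that marks boundary points. *)
Definition seam_map : T -> 'rV[R]_n.+1 :=
  extend seam_patch (bcol i) (fun p => setc (2 + p.2) (chiT p.1)) (fun=> 0).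

Let iG : inj_on G (bcol i).
Proof. by apply: inj_on_sub GQ (bcol_inj h_homeo W_cob col0 col_inj (i:=i)). Qed.

Let mapE x t : G (x, t) -> seam_map (bcol i (x, t)) = setc (2 + t) (chiT x).
Proof. by move=> Gp; rewrite /seam_map extendE. Qed.

Let setc0_phi a t : A a -> N a -> setc 0 (setc t (phi a)) = phi a.
Proof.
move=> Aa Na; rewrite setc_setc; have := (NA Aa).1 Na => E.
by rewrite -{1}E setc_id.
Qed.

Lemma seam_open : open seam_dom.
Proof.
have [ O oO E] := G_open; rewrite /seam_dom -/G E.
exact: (bcol_open h_homeo W_cob col0 col_inj col_open).
Qed.

Let Om : set 'rV[R]_n.+1 := [set z | (phi @` A) (setc 0 z) /\ 1 < c0 z < 3].

Lemma seam_image : seam_map @` seam_dom = Om.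
Proof.
apply/seteqP; split=> z.
  move=> [_ [[x t] Gp <-] <-]; rewrite mapE //.
  case: Gp => /= -[a [Aa Na] <-] /andP[t1 t2]; rewrite chiL //.
  split; first by rewrite setc0_phi //; exists a.
  by rewrite c0_setc; apply/andP; split; lra.
move=> [[a Aa az] /andP[z1 z3]].
have Na : N a by apply/(NA Aa); rewrite az c0_setc.
have Gp : G (L a, c0 z - 2) by split; [exists a|apply/andP; split=> /=; lra].
exists (bcol i (L a, c0 z - 2)); first by exists (L a, c0 z - 2).
rewrite mapE // chiL // az setc_setc.
have -> : 2 + (c0 z - 2) = c0 z by ring.
exact: setc_id.
Qed.

Lemma seam_image_open : exists2 O, open O & seam_map @` seam_dom = O `&` @half_space R n.
Proof.
have [ O oO E] := imA; exists [set z | O (setc 0 z) /\ 1 < c0 z < 3].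
  have a0 : affine (setc 0 : 'rV[R]_n.+1 -> 'rV[R]_n.+1).
    by apply: affine_setc; [exact: affine_fun_cst|exact: affine_id].
  have cc : continuous (@c0 R n) by apply: affine_fun_continuous; exact: affine_fun_c0.
  apply: openI; first by apply: open_comp => // z _; exact: affine_continuous.
  rewrite [X in open X](_ : _ = [set z | 1 < c0 z] `&` [set z | c0 z < 3]).
    by apply: openI; [apply: (@open_comp _ _ (@c0 R n) [set t | 1 < t]) => [z _|]; [exact: cc|exact: open_gt]
      |apply: (@open_comp _ _ (@c0 R n) [set t | t < 3]) => [z _|]; [exact: cc|exact: open_lt]].
  by apply/seteqP; split=> z /=; [move/andP|move=> [-> ->]].
rewrite seam_image /Om E; apply/seteqP; split=> z.
  move=> [[Oz _] /andP[z1 z3]]; split; first by split=> //; apply/andP.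
  by rewrite /half_space /=; move: z1; rewrite /c0; lra.
move=> [[Oz z13] _]; split=> //; split=> //.
by rewrite /half_space /= -/(c0 _) c0_setc.
Qed.

Lemma seam_c0 z : seam_dom z -> 0 < c0 (seam_map z).
Proof.
move=> Dz; have : (seam_map @` seam_dom) (seam_map z) by exists z.
by rewrite seam_image => -[_ /andP[? ?]]; lra.
Qed.

Let c0_ge0 a : A a -> 0 <= c0 (phi a).
Proof.
move=> Aa; have [ O _ E] := imA; have : (phi @` A) (phi a) by exists a.
by rewrite E => -[].
Qed.

Lemma patch_plg a k (e : chart R (W i) k) : A a -> N a -> pl_atlas (W i) k e -> chart_dom e a ->
  plg (A `&` @N i `&` chart_dom e) (chart_map e) phi a.
Proof.
move=> Aa Na ae ea; have [_ h1] := rA.2 _ _ ae _ Aa ea.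
have [h2 _] := rA.2 _ _ ae _ Aa ea.
have pQ : polyhedron [set z : 'rV[R]_n.+1 | c0 z <= 0] by apply: polyhedron_le0; exact: affine_fun_c0.
have := plg_level pQ h2 h2; rewrite (_ : _ `&` _ = A `&` @N i `&` chart_dom e) //.
apply/seteqP; split=> [b [[Ab eb] /= b0]|b [[Ab Nb] eb]].
  split=> //; split=> //; apply/(NA Ab)/eqP.
  by rewrite eq_le b0 c0_ge0.
by split=> //=; rewrite (NA Ab).1.
Qed.

Let P' : set (W i.+1) := @M i.+1 `&` [set b | (@adj_lift R W M N h i @` (A `&` @N i)) (L b)].

(** Seen from the next piece, the coordinates along the seam are [phi] after the inverse of [h i];
    here it matters that this inverse is PL. *)
Lemma patch_plg_next b k (e : chart R (W i.+1) k) : P' b -> pl_atlas (W i.+1) k e -> chart_dom e b ->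
  plg (P' `&` chart_dom e) (chart_map e) (chiT \o @adj_lift R W M N h i.+1) b.
Proof.
move=> [Mb [a [Aa Na] ab]] ae eb.
have [g [hg gh _ [gc gp]]] := h_homeo i.
pose f (y : pl_sub (@M i.+1)) : W i := set_val (g y).
have fL y : L (f y) = L (set_val y : W i.+1) by rewrite adj_step_eq gh.
pose b0 : pl_sub (@M i.+1) := toset Mb.
have fb : f b0 = a by apply: (@Linj i); rewrite fL set_val_toset.
have fc : continuous f.
  apply/cont_onT; apply: (cont_on_comp (B := setT) (f := g)) => //; first by apply: continuous_cont_on.
  by case: (set_val_emb (@N i)).
have [l [d [ad da]]] := atlas_cover (W_pl i) a; have [od [cd id' vd]] := atlas_emb (W_pl i) ad.
have [oe [ce ie ve]] := atlas_emb (W_pl i.+1) ae.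
have [cM' iM vM] := set_val_emb (@M i.+1).
have := gp k l _ _ (ex_intro2 _ _ e ae erefl) (ex_intro2 _ _ d ad erefl).
set E0 := _ `&` _ => H.
have Eb : E0 b0 by split=> /=; rewrite ?set_val_toset // -/(f b0) fb.
have p1 : plg E0 (chart_map e \o set_val) (chart_map d \o f) b0.
  apply: pl_factor_plg => //.
  apply: (@cont_at_comp _ _ _ E0 (chart_dom e) set_val) => //.
  - by apply: cont_at_sub (cM' _ I).
  - by move=> y [].
  by rewrite set_val_toset; exact: ce.
have p2 : plg (A `&` @N i `&` chart_dom d) (chart_map d) phi (f b0).
  by rewrite fb; exact: patch_plg.
have p3 : plg (E0 `&` f @^-1` (A `&` @N i `&` chart_dom d)) (chart_map e \o set_val) (phi \o f) b0.
  apply: plg_comp_map p1 p2.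
  - apply: (@cont_at_sub _ _ setT) => //; exact: (continuous_cont_on (A := setT) fc).
  by apply: inj_on_sub id' => y [[z [_ dz] <-]|[_ dy]].
set E1 := _ `&` _ in p3.
have p4 : plg (set_val @` E1) (chart_map e) (chiT \o @adj_lift R W M N h i.+1) b.
  have := @plg_push R _ _ _ _ (set_val : pl_sub (@M i.+1) -> W i.+1) (set_val @` E1) E1
    (chart_map e) (chiT \o @adj_lift R W M N h i.+1) b0.
  rewrite set_val_toset; apply=> //.
  - by apply: (@inv_at_sub _ _ setT) => //; exact: vM.
  apply: plg_ext p3 => // y [_ [[Afy _] _]] /=.
  by rewrite -fL chiL.
apply: plg_enlarge p4.
- by apply: inj_on_sub ie; exact: subIsetr.
- move=> _ [y [[/= ey dy] [[Afy Nfy] _]] <-]; split=> //; split; first exact: set_valE'.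
  by exists (f y); rewrite ?fL.
have near_d : \forall y \near b0, chart_dom d (f y).
  by apply: (fc b0); rewrite fb; exact: open_near.
have := vM b0 I _ near_d; rewrite set_val_toset.
apply: filterS => y Hy [[My [a' [Aa' Na'] ay]] ey].
have dfy := Hy (toset My) I (set_val_toset My).
have fy : f (toset My) = a' by apply: (@Linj i); rewrite fL set_val_toset.
exists (toset My); last exact: set_val_toset.
by split; [split; rewrite /= ?set_val_toset|split; rewrite ?fy // -fy].
Qed.

Lemma seam_ppl : ppl seam_dom seam_map.
Proof.
move=> j l d w ad [[x t] Gp bw] dw.
have [[a [Na ax t0 e]]|[b [Mb bx t0 e]]] := bcol_pieces h_homeo W_cob col0 col_inj (GQ Gp) (esym bw);
  have ij := congr1 (@projT1 _ _) e; rewrite /= in ij; subst j; rewrite (@existT_inj WT _ _ _ e) in dw *.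
  have Aa : A a by case: Gp => /= -[a' [Aa' _] a'x] _; rewrite (@Linj i a a') // ax a'x.
  have t1 : 0 <= - t < 1 by case: Gp => _ /= /andP[? ?]; apply/andP; split; lra.
  rewrite (_ : _ @^-1` _ = @col i @` (half_open R (A `&` @N i))); last first.
    apply/seteqP; split=> w'.
      move=> [[x' t'] Gp' bw'].
      have [[a' [Na' ax' t0' e']]|[b' [_ _ _ /(congr1 (@projT1 _ _))/= e']]] :=
        bcol_pieces h_homeo W_cob col0 col_inj (GQ Gp') (esym bw'); last by lia.
      rewrite (@existT_inj WT _ _ _ e').
      have Aa' : A a' by case: Gp' => /= -[a2 [Aa2 _] a2x] _; rewrite (@Linj i a' a2) // ax' a2x.
      exists (a', - t') => //; split=> //.
      by case: Gp' => _ /= /andP[? ?]; apply/andP; split; lra.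
    move=> [[a' s] [[Aa' Na'] /= /andP[s0 s1]] <-]; exists (L a', - s).
      by split; [exists a'|apply/andP; split=> /=; lra].
    by rewrite (bcol_le h_homeo W_cob) ?opprK //; apply/andP; split; lra.
  have [k [c [ac ca]]] := atlas_cover (W_pl i) a.
  apply: (collar_plg (eps := -1) (chi := phi) (W_pl i) (@col_inj i) (@col_pl i) (@col_open i) _ ac) => //.
  - by move=> y [_ Ny]; rewrite (cob_bd W_cob); right.
  - exact: patch_plg.
  move=> y s [Ay Ny] /andP[s0 s1] /=.
  have -> : L (@col i (y, s)) = bcol i (L y, - s).
    by rewrite (bcol_le h_homeo W_cob) ?opprK //; apply/andP; split; lra.
  rewrite mapE ?chiL ?mulN1r //.
  by split; [exists y|apply/andP; split=> /=; lra].
have Pb : P' b by split=> //=; rewrite bx; case: Gp.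
have t1 : 0 <= t < 1 by case: Gp => _ /= /andP[? ?]; apply/andP; split; lra.
rewrite (_ : _ @^-1` _ = @col i.+1 @` (half_open R P')); last first.
  apply/seteqP; split=> w'.
    move=> [[x' t'] Gp' bw'].
    have [[a' [_ _ _ /(congr1 (@projT1 _ _))/= e']]|[b' [Mb' bx' t0' e']]] :=
      bcol_pieces h_homeo W_cob col0 col_inj (GQ Gp') (esym bw'); first by lia.
    rewrite (@existT_inj WT _ _ _ e').
    exists (b', t') => //; split=> /=; first by split=> //=; rewrite bx'; case: Gp'.
    by case: Gp' => _ /= /andP[? ?]; apply/andP; split; lra.
  move=> [[b' s] [[Mb' Lb'] /= /andP[s0 s1]] <-]; exists (L b', s).
    by split=> //; apply/andP; split=> /=; lra.
  by rewrite (bcol_ge h_homeo W_cob col0) //; apply/andP; split; lra.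
have [k [c [ac ca]]] := atlas_cover (W_pl i.+1) b.
apply: (collar_plg (eps := 1) (chi := chiT \o @adj_lift R W M N h i.+1) (W_pl i.+1)
  (@col_inj i.+1) (@col_pl i.+1) (@col_open i.+1) _ ac) => //.
- by move=> y [My _]; rewrite (cob_bd W_cob); left.
- exact: patch_plg_next.
move=> y s [My Ly] /andP[s0 s1] /=.
have -> : L (@col i.+1 (y, s)) = bcol i (L y, s).
  by rewrite (bcol_ge h_homeo W_cob col0) //; apply/andP; split; lra.
rewrite mapE ?mul1r //.
by split=> //; apply/andP; split=> /=; lra.
Qed.

Lemma seam_atlas : pl_atlas X n.+1 (Chart seam_dom seam_map).
Proof.
apply: (adj_atlasI W_pl seam_open _ seam_ppl).
(* The inverse of [phi], with values in the adjunction space; [x0] is a default off the image. It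
   enters an explicit inverse of [seam_map], from which continuity of the inverse follows. *)
pose la : 'rV[R]_n.+1 -> T := extend A phi (@adj_lift R W M N h i) (fun=> x0).
have laE a : A a -> la (phi a) = L a by move=> Aa; rewrite /la extendE.
have cla : cont_on (phi @` A) la.
  apply: extend_cont; first by case: rA.
  by apply: continuous_cont_on; exact: adj_lift_continuous.
apply: (emb_of_inverse (g := fun z => bcol i (la (setc 0 z), c0 z - 2))).
- exact: (ppl_cont MN0 h_homeo cM cN W_pl seam_ppl).
- rewrite seam_image.
  apply: (cont_on_comp (B := seam_nbd i) (f := fun z => (la (setc 0 z), c0 z - 2))).
  + apply: cont_on_pair.
      apply: (cont_on_comp (B := phi @` A) (f := setc 0)) => //; last by move=> z [].
      apply: continuous_cont_on; apply: affine_continuous.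
      by apply: affine_setc; [exact: affine_fun_cst|exact: affine_id].
    apply: cont_on_add; last exact: cont_on_cst.
    by apply: continuous_cont_on; apply: affine_fun_continuous; exact: affine_fun_c0.
  + move=> z [[a Aa az] /andP[z1 z2]]; split=> /=; last by apply/andP; split; lra.
    by rewrite -az laE //; exists a => //; apply/(NA Aa); rewrite az c0_setc.
  exact: (bcol_cont h_homeo W_cob col0 col_pl).
move=> _ [[x t] Gp <-]; rewrite mapE //.
case: (Gp) => /= -[a [Aa Na] <-] _; rewrite chiL // setc0_phi // laE // c0_setc.
by congr (bcol i (_, _)); ring.
Qed.

Lemma seam_patchE z t : seam_dom z -> @seam R W M N h i z -> -1 < t < 1 -> seam_patch (z, t).
Proof.
move=> [[y s] Gp yz] Bz t1; have Q0 : seam_nbd i (z, 0) by split=> //; apply/andP; split=> /=; lra.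
have [yz' _] : (y, s) = (z, 0).
  apply: (bcol_inj h_homeo W_cob col0 col_inj (GQ Gp) Q0).
  by rewrite (bcol0 h_homeo W_cob col0 Bz).
by split=> //=; case: Gp; rewrite /= yz'.
Qed.

Lemma seam_shift z t : seam_dom z -> @seam R W M N h i z -> -1 < t < 1 ->
  seam_dom (bcol i (z, t)) /\ seam_map (bcol i (z, t)) = setc (2 + t) (seam_map z).
Proof.
move=> Dz Bz t1; have Gt := seam_patchE Dz Bz t1; split; first by exists (z, t).
have G0 : G (z, 0) by apply: seam_patchE => //; apply/andP; split; lra.
by rewrite mapE // -[in RHS](bcol0 h_homeo W_cob col0 Bz) mapE // setc_setc.
Qed.

Lemma seam_c0E z : seam_dom z -> (@seam R W M N h i z <-> c0 (seam_map z) = 2).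
Proof.
move=> Dz; split=> [Bz|].
  have G0 : G (z, 0) by apply: seam_patchE => //; apply/andP; split; lra.
  by rewrite -(bcol0 h_homeo W_cob col0 Bz) mapE // c0_setc addr0.
case: Dz => -[y s] Gp <-; rewrite mapE // c0_setc => s0.
have -> : s = 0 by lra.
have [By _] := GQ Gp.
by rewrite (bcol0 h_homeo W_cob col0).
Qed.

End SeamChart.

(** * The adjunction space and its tails as manifolds *)

Section AdjManifold.
Variables (R : realType) (n : nat) (W : nat -> plSpace R) (M N : forall i, set (W i)).
Variable h : forall i, pl_sub (@N i) -> pl_sub (@M i.+1).
Hypothesis h_homeo : forall i, pl_homeo (@h i).
Hypothesis W_cob : forall i, cobordism n (@M i) (@N i).

Local Notation L := (@adj_lift R W M N h).
Local Notation T := (adj_space h).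
Local Notation X := (adjunction h).
Local Notation WT := (fun i => W i : Type).
Let S i : set (pl_prod (W i) (pl_line R)) := half_open R (boundary n (X := W i)).

Let W_pl i : is_pl_space (W i) := cob_pl W_cob i.
Let MN0 := cob_MN0 W_cob.
Let cM := cob_closedM W_cob.
Let cN := cob_closedN W_cob.
Let Linj i := @adj_lift_inj R W M N h MN0 h_homeo i.
Let Lemb i := adj_lift_emb MN0 h_homeo cM cN i.

Definition tail m : set T := [set y | exists i (x : W i), (m <= i)%N /\ L x = y].

Lemma tail_closed m : closed (tail m).
Proof.
rewrite (_ : tail m = [set y | exists i (x : W i), L x = y /\ (m <= i)%N]).
  apply: (adj_closed MN0 h_homeo cM cN (F := fun i => [set x | (m <= i)%N])) => i.
  case: (leqP m i) => mi; last first.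
    by rewrite (_ : mkset _ = set0); [exact: closed0|apply/seteqP; split].
  by rewrite (_ : mkset _ = setT); [exact: closedT|apply/seteqP; split].
by apply/seteqP; split=> y [i [x [? ?]]]; exists i, x.
Qed.

Lemma tail0 : tail 0 = setT.
Proof. by apply/seteqP; split=> // y _; have [i [x xy]] := adj_surj y; exists i, x. Qed.

Lemma meetM i j (x : W i) (y : W j) : L x = L y -> (i < j)%N -> j = i.+1 /\ N x /\ M y.
Proof.
move=> E ij; have e := adj_next MN0 h_homeo E ij; subst j.
have [a [-> ->]] := adj_meet MN0 h_homeo E.
by split=> //; split; exact: set_valE'.
Qed.

Let M_image j l (g : W l) : j = l ->
  ((@adj_lift R W M N h j @` @M j) (L g) <-> M g).
Proof. by move=> ->; split=> [[b Mb /Linj <-]|Mg] //; exists g. Qed.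

Section PieceChart.
Variables (m k : nat) (c : chart R (W k) n.+1).
Hypotheses (mk : (m <= k)%N) (mc : manifold_chart c).

(** The end [N k] is left to the seam charts, and so is [M k] unless [k = m], when it is the
    boundary of the tail. *)
Definition piece_dom : set (W k) :=
  chart_dom c `&` (~` @N k) `&` [set x | (m < k)%N -> ~ M x].

Let G := piece_dom.

Let c_emb := is_chart_emb (let: And3 H _ _ := mc in H).
Let c_r := manifold_chart_rchart (W_pl k) mc.

Let oE : open ((~` @N k) `&` [set x : W k | (m < k)%N -> ~ M x]).
Proof.
apply: openI; first by apply: closed_openC; exact: cN.
case: (ltnP m k) => H; last by rewrite (_ : mkset _ = setT); [exact: openT|apply/seteqP].
rewrite (_ : mkset _ = ~` @M k); first by apply: closed_openC; exact: cM.
by apply/seteqP; split=> x nM; [exact: nM|].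
Qed.

Let oG : open G.
Proof. by rewrite /G /piece_dom -setIA; apply: openI => //; case: c_emb. Qed.

(** An open set whose trace on the tail is the image of [piece_dom]. The image itself may fail to be
    open, since for [m > 0] the end [M m] is also glued to the piece before the tail. *)
Definition piece_nbd : set T :=
  ~` [set y | exists i (x : W i), L x = y /\
      ((m <= i)%N /\ ~ exists2 g, G g & existT WT k g = existT WT i x)].

Definition piece_map : T -> 'rV[R]_n.+1 :=
  extend (chart_dom c) (@adj_lift R W M N h k) (chart_map c) (fun=> 0).

Lemma piece_mapE x : chart_dom c x -> piece_map (L x) = chart_map c x.
Proof. by move=> cx; rewrite /piece_map extendE // => y z _ _; exact: Linj. Qed.

Lemma piece_nbd_open : open piece_nbd.
Proof.
apply: closed_openC; apply: (adj_closed MN0 h_homeo cM cN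
  (F := fun i => [set x : W i | (m <= i)%N /\ ~ exists2 g, G g & existT WT k g = existT WT i x])) => i.
case: (leqP m i) => mi; last first.
  by rewrite (_ : mkset _ = set0); [exact: closed0|apply/seteqP; split=> x // []].
have [ki|ki] := pselect (k = i); last first.
  rewrite (_ : mkset _ = setT); first exact: closedT.
  by apply/seteqP; split=> x // _; split=> // -[g _ /(congr1 (@projT1 _ _))].
subst i; rewrite (_ : mkset _ = ~` G); first exact: open_closedC.
apply/seteqP; split=> x; first by move=> [_ nG] Gx; apply: nG; exists x.
by move=> nG; split=> // -[g Gg /(@existT_inj WT) gx]; apply: nG; rewrite -gx.
Qed.

Lemma piece_nbdE : tail m `&` piece_nbd = @adj_lift R W M N h k @` G.
Proof.
apply/seteqP; split=> y.
  move=> [[i [x [mi xy]]] H]; apply: contrapT => nG; apply: H; exists i, x; split=> //; split=> //.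
  move=> [g Gg e]; apply: nG; have ki := congr1 (@projT1 _ _) e; rewrite /= in ki; subst i.
  by rewrite -xy -(@existT_inj WT _ _ _ e); exists g.
move=> [g Gg <-]; split; first by exists k, g.
move=> [i [x [xg [mi nE]]]]; have [[cg nN] nM] := Gg.
case: (ltngtP i k) => ik.
- have [e [_ Mg]] := meetM xg ik; apply: nM => //; lia.
- by have [_ [Ng _]] := meetM (esym xg) ik; apply: nN.
by subst i; apply: nE; exists g => //; rewrite (@Linj k x g).
Qed.

Lemma piece_map_emb : emb_on (@adj_lift R W M N h k @` G) piece_map.
Proof.
apply: (emb_push (f := chart_map c)); first exact: (emb_on_sub (@subsetT _ _) (Lemb k)).
  by apply: emb_on_sub (c_r.1) => x [[]].
by move=> x [[cx _] _]; exact: piece_mapE.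
Qed.

Lemma piece_atlas : m = 0%N -> pl_atlas X n.+1 (Chart (@adj_lift R W M N h k @` G) piece_map).
Proof.
move=> m0; apply: (adj_atlasI W_pl).
- by rewrite -piece_nbdE {1}m0 tail0 setTI; exact: piece_nbd_open.
- exact: piece_map_emb.
move=> j l d w ad [g Gg gw] dw.
have e : j = k.
  have [[cg nN] nM] := Gg; case: (ltngtP j k) => // jk.
  + by have [? [_ /nM]] := meetM (esym gw) jk; case; lia.
  + by have [_ [/nN]] := meetM gw jk.
subst j; have gw' := Linj gw; subst w.
rewrite (_ : _ @^-1` _ = G); last by apply/seteqP; split=> x; [move=> [y Gy /Linj <-]|exists x].
have rG := rchart_open (W_pl k) c_r oE; rewrite setIA -/piece_dom -/G in rG.
have [h1 _] := rG.2 l d ad g Gg dw.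
by apply: plg_ext h1 => // x [[[cx _] _] _]; rewrite /= piece_mapE.
Qed.

Hypothesis X_pl : is_pl_space X.

Lemma piece_smf : [/\ open piece_nbd, rchart (tail m `&` piece_nbd : set X) piece_map,
   exists2 O, open O & piece_map @` (tail m `&` piece_nbd) = O `&` @half_space R n
   & forall z, tail m z -> piece_nbd z ->
       ((@adj_lift R W M N h m @` @M m) z <-> c0 (piece_map z) = 0)].
Proof.
split.
- exact: piece_nbd_open.
- rewrite piece_nbdE.
  have rG := rchart_open (W_pl k) c_r oE; rewrite setIA -/piece_dom -/G in rG.
  apply: (rchart_push (W_pl k) X_pl (adj_pl_emb MN0 h_homeo cM cN W_pl k) rG).
  by move=> x [[cx _] _]; exact: piece_mapE.
- rewrite piece_nbdE; have [ic _ [ O [ oO E]]] := mc; have [_ _ _ oc] := ic.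
  have GD : G `<=` chart_dom c by move=> x [[]].
  have [ O' [ oO' E']] := oc _ oG GD.
  exists (O' `&` O); first exact: openI.
  rewrite -setIA -E -E'; apply/seteqP; split=> z.
    by move=> [_ [x Gx <-] <-]; exists x => //; rewrite piece_mapE //; case: Gx => -[].
  by move=> [x Gx <-]; exists (L x); [exists x|rewrite piece_mapE //; case: Gx => -[]].
move=> z Vz Dz; have : (tail m `&` piece_nbd) z by [].
rewrite piece_nbdE => -[g Gg <-]; have [[cg nN] nM] := Gg.
rewrite piece_mapE // -(boundary_c0 (W_pl k) mc cg).
rewrite (_ : boundary n g <-> (@M k `|` @N k) g); last by rewrite -(cob_bd W_cob).
case: (ltngtP m k) => km; [|lia|]; last first.
  by rewrite M_image //; split=> [|[]//]; left.
split; last by move=> [Mg|/nN //]; case: nM.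
by move=> [b Mb bg]; have [_ [_ /nM]] := meetM bg km; case.
Qed.

End PieceChart.

Lemma collars_exist : exists col : forall i, pl_prod (W i) (pl_line R) -> W i,
  [/\ forall i (y : W i), boundary n y -> @col i (y, 0) = y, forall i, inj_on (@S i) (@col i),
      forall i p, @S i p -> plat (@S i) (@col i) p
    & forall i O, open O -> open (@col i @` (O `&` @S i))].
Proof.
pose C i := cid (collar_theorem (cob_man W_cob i) (cob_compact_bd W_cob (i := i))).
exists (fun i => sval (C i)).
by split=> i; have [] := svalP (C i).
Qed.

Variable col : forall i, pl_prod (W i) (pl_line R) -> W i.
Hypothesis col0 : forall i (y : W i), boundary n y -> col (y, 0) = y.
Hypothesis col_inj : forall i, inj_on (@S i) (@col i).
Hypothesis col_pl : forall i p, @S i p -> plat (@S i) (@col i) p.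
Hypothesis col_open : forall i O, open O -> open (@col i @` (O `&` @S i)).

Lemma seam_chart k (x : W k) : N x -> exists (A : set (W k)) (phi : W k -> 'rV[R]_n.+1),
  [/\ open A, A x, rchart A phi, exists2 O, open O & phi @` A = O `&` @half_space R n
    & forall a, A a -> (N a <-> c0 (phi a) = 0)].
Proof.
move=> Nx; have [_ /(_ x)[c [mc cx]]] := cob_man W_cob k.
have [oc ec] := is_chart_emb (let: And3 H _ _ := mc in H).
have oM : open (~` @M k) by apply: closed_openC; exact: cM.
have nMx : ~ M x by move=> Mx; have : (@M k `&` @N k) x by []; rewrite MN0.
exists (chart_dom c `&` ~` @M k), (chart_map c); split.
- exact: openI.
- by [].
- exact: (rchart_open (W_pl k) (manifold_chart_rchart (W_pl k) mc)).
- have [ic _ [ O [ oO E]]] := mc; have [_ _ _ oc'] := ic.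
  have [ O' [ oO' E']] := oc' (chart_dom c `&` ~` @M k) (openI oc oM) (@subIsetl _ _ _).
  by exists (O' `&` O); [exact: openI|rewrite -setIA -E].
move=> a [ca nM]; rewrite -(boundary_c0 (W_pl k) mc ca).
by rewrite (_ : boundary n a <-> (@M k `|` @N k) a) ?(cob_bd W_cob) //; split=> [|[]//]; right.
Qed.

Lemma adj_is_pl_space : is_pl_space X.
Proof.
apply: (adj_pl_space MN0 h_homeo cM cN W_pl) => z.
have [k [[x _ xz] Hk]] := adj_two MN0 h_homeo z.
have [Nx|nNx] := pselect (N x).
  have [A [phi [oA Ax rA iA NA]]] := seam_chart Nx.
  exists n.+1, (Chart (@seam_dom R n W M N h col k A) (@seam_map R n W M N h col k A phi)); split.
    exact: (seam_atlas h_homeo W_cob col0 col_inj col_pl col_open z oA rA iA NA).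
  exists (z, 0); last by apply: (bcol0 h_homeo W_cob col0); exists x.
  by split=> /=; [exists x|apply/andP; split; lra].
have [_ /(_ x)[c [mc cx]]] := cob_man W_cob k.
exists n.+1, (Chart (@adj_lift R W M N h k @` piece_dom 0 c) (piece_map c)); split.
  exact: piece_atlas.
exists x => //; split=> // k0 Mx.
case: k x xz Hk {nNx c mc cx} k0 Mx => // k x xz Hk _ Mx.
have [g [_ gK _ _]] := h_homeo k.
have E : L (set_val (g (toset Mx)) : W k) = z by rewrite adj_step_eq gK set_val_toset.
by case: (Hk _ _ E); lia.
Qed.

Lemma tail_smf m : smf n (tail m : set X) (@adj_lift R W M N h m @` @M m).
Proof.
move=> z Vz.
have ex : exists k, (m <= k)%N && `[< exists x : W k, L x = z >].
  by have [i [x [mi xz]]] := Vz; exists i; rewrite mi; apply/asboolP; exists x.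
(* In the first piece of the tail containing [z], the point is not on [M k] unless [k = m], for
   otherwise it would have a lift in the piece before. *)
case: (ex_minnP ex) => k /andP[mk /asboolP[x xz]] kmin.
have [Nx|nNx] := pselect (N x).
  have [A [phi [oA Ax rA iA NA]]] := seam_chart Nx.
  exists (@seam_dom R n W M N h col k A), (@seam_map R n W M N h col k A phi).
  have D : @seam_dom R n W M N h col k A `<=` tail m.
    move=> y [[x' t] [[a [Aa Na] ax] /= t1] <-].
    have Q : @seam_nbd R W M N h k (x', t) by split=> //; exists a.
    have [j [w E]] := adj_surj (@bcol R n W M N h col k (x', t)); rewrite -E.
    have [[a' [_ _ _ e]]|[b [_ _ _ e]]] := bcol_pieces h_homeo W_cob col0 col_inj Q E;
      have ij := congr1 (@projT1 _ _) e; rewrite /= in ij; exists j, w; split=> //; lia.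
  split.
  - split; first exact: (seam_open h_homeo W_cob col0 col_inj col_open oA).
    exists (z, 0); last by apply: (bcol0 h_homeo W_cob col0); exists x.
    by split=> /=; [exists x|apply/andP; split; lra].
  - rewrite setIC setIidl //.
    have aS := seam_atlas h_homeo W_cob col0 col_inj col_pl col_open z oA rA iA NA.
    exact: (atlas_rchart adj_is_pl_space aS).
  - rewrite setIC setIidl //.
    exact: (seam_image_open h_homeo W_cob col0 col_inj iA NA).
  move=> y _ Dy; have c1 := seam_c0 h_homeo W_cob col0 col_inj NA Dy.
  split; last by move=> c0'; move: c1; rewrite c0' ltxx.
  (* A point of [M m] in the seam chart would be a collar point over [N k] with [k = m], hence by
     [col_base] a common point of [M m] and [N m]. *)
  move=> [b Mb bm]; exfalso; case: Dy => -[x' t] [[a [Aa Na] ax] /= t1] E.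
  have Q : @seam_nbd R W M N h k (x', t) by split=> //; exists a.
  have bE : L b = @bcol R n W M N h col k (x', t) by rewrite E.
  have [[a' [Na' _ t0 e]]|[b' [Mb' _ _ e]]] := bcol_pieces h_homeo W_cob col0 col_inj Q bE;
    have ij := congr1 (@projT1 _ _) e; rewrite /= in ij; last by lia.
  subst k; have bd := esym (@existT_inj WT _ _ _ e).
  have [] // := col_base col0 col_inj _ _ bd.
  - split; first by rewrite (cob_bd W_cob); right.
    by case/andP: t1 => ? ?; apply/andP; split=> /=; lra.
  - by rewrite (cob_bd W_cob); left.
  move=> ab _; have : (@M m `&` @N m) b by split=> //; rewrite -ab.
  by rewrite MN0.
have [_ /(_ x)[c [mc cx]]] := cob_man W_cob k.
have [h1 h2 h3 h4] := piece_smf mk mc adj_is_pl_space.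
have Gx : piece_dom m c x.
  split=> // k0 Mx.
  case: k x xz {c mc cx h1 h2 h3 h4} nNx kmin mk k0 Mx => // k x xz _ kmin _ k0 Mx.
  have [g [_ gK _ _]] := h_homeo k.
  have /kmin : (m <= k)%N && `[< exists x : W k, L x = z >].
    apply/andP; split; first by lia.
    by apply/asboolP; exists (set_val (g (toset Mx))); rewrite adj_step_eq gK set_val_toset.
  by lia.
exists (piece_nbd m c), (piece_map c); split=> //; split=> //.
have : (@adj_lift R W M N h k @` piece_dom m c) z by exists x.
by rewrite -(piece_nbdE c mk) => -[].
Qed.

End AdjManifold.

(** * Transport along embeddings *)

Section General.
Variable R : realType.

Lemma emb_pair (X X' Y Y' : topologicalType) (f : X -> X') (g : Y -> Y') :
  emb_on setT f -> emb_on setT g -> emb_on setT (fun p : X * Y => (f p.1, g p.2)).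
Proof.
move=> [cf jf vf] [cg jg vg]; split.
- apply: cont_on_pair.
    by apply: (cont_on_comp (B := setT) (f := fst)) => //; exact: cont_on_fst.
  by apply: (cont_on_comp (B := setT) (f := snd)) => //; exact: cont_on_snd.
- by move=> [x y] [x' y'] _ _ [/jf -> // /jg ->].
move=> [x y] _ V [[V1 V2] /= [n1 n2] HV].
exists ([set u | forall z, setT z -> f z = u -> V1 z], [set u | forall z, setT z -> g z = u -> V2 z]) => /=.
  by split; [exact: vf|exact: vg].
move=> [u v] [/= H1 H2] [z w] _ [zu wv]; apply: HV; split=> /=; [exact: H1|exact: H2].
Qed.

Lemma emb_image_open (X Y : topologicalType) (j : X -> Y) (O : set X) :
  emb_on setT j -> open O -> exists2 O', open O' & j @` O = O' `&` range j.
Proof.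
move=> [cj ij vj] oO; exists ([set y | forall z, setT z -> j z = y -> O z]°); first exact: open_interior.
apply/seteqP; split=> y.
  by move=> [x Ox <-]; split; [exact: (vj x I _ (open_near oO Ox))|exists x].
by move=> [/interior_subset H [x _ xy]]; exists x => //; exact: H.
Qed.

Lemma emb_preimage_compact (X Y : topologicalType) (j : X -> Y) (B : set Y) :
  emb_on setT j -> B `<=` range j -> compact B -> compact (j @^-1` B).
Proof.
move=> ej BV cB; have [cj ij vj] := ej.
have [[x0 _]|nB] := pselect (exists x, B (j x)); last first.
  rewrite (_ : _ @^-1` _ = set0); first exact: compact0.
  by apply/seteqP; split=> x // Bx; apply: nB; exists x.
pose g := extend setT j id (fun=> x0).
have gj x : g (j x) = x by rewrite /g extendE.
rewrite (_ : _ @^-1` _ = g @` B); last first.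
  apply/seteqP; split=> x; first by move=> Bx; exists (j x).
  by move=> [y By <-]; have [z _ zy] := BV _ By; rewrite -zy gj /= zy.
apply: cont_on_compact cB; apply: cont_on_sub BV _.
by apply: extend_cont => //; exact: cont_on_id.
Qed.

Lemma sdr_push (X Y : topologicalType) (j : X -> Y) (A : set X) :
  emb_on setT j -> sdr R setT A -> sdr R (range j) (j @` A).
Proof.
move=> ej [Q [cQ _ QE QA]]; have ejI := emb_prodR (@I01 R) ej.
have [_ ijI _] := ejI.
pose Q' := extend (setT `*` @I01 R) (fun p : X * R => (j p.1, p.2)) (j \o Q) fst.
have Q'E x t : I01 t -> Q' (j x, t) = j (Q (x, t)).
  move=> It; have -> : (j x, t) = (fun p : X * R => (j p.1, p.2)) (x, t) by [].
  by rewrite /Q' extendE.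
exists Q'; split.
- rewrite (_ : range j `*` _ = (fun p : X * R => (j p.1, p.2)) @` (setT `*` @I01 R)).
    apply: extend_cont => //; apply: (cont_on_comp (B := setT)) => //.
    by case: ej.
  apply/seteqP; split=> [[y t] [/= [x _ <-] It]|_ [[x t] [_ It] <-]]; first by exists (x, t).
  by split=> //=; exists x.
- by move=> [y t] [/= [x _ <-] It]; rewrite Q'E //; exists (Q (x, t)).
- move=> _ [x _ <-]; have [q0 q1] := QE x I.
  by rewrite (Q'E _ _ (I01_0 R)) (Q'E _ _ (I01_1 R)) q0; split=> //; exists (Q (x, 1)).
by move=> _ t [a Aa <-] It; rewrite Q'E // QA.
Qed.

Lemma smf_homotopy_collar n (X T : plSpace R) (j : X -> T) (B : set T) :
  is_pl_space X -> is_pl_space T -> pl_emb j -> smf n (range j) B -> B `<=` range j ->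
  compact B -> sheq R (range j) B ->
  homotopy_collar n X /\ boundary n (X := X) = j @^-1` B.
Proof.
move=> X_pl T_pl je sB BV cB hB; have [mX E] := smf_manifold X_pl T_pl je sB.
split=> //; split=> //; rewrite E; have [ej _] := je.
  exact: emb_preimage_compact.
exact: sheq_inclusion_heq.
Qed.

(** The charts of [Z] are charts of [Y] pulled back along [j], so that [f] can be tested on the
    image of [j]. In the application that image is the seam times ]-1, 1[ and [F] is the
    bicollar. *)
Lemma pull_pl_map (Z Y T : plSpace R) (j : Z -> Y) (f : Z -> T) (F : Y -> T) :
  pl_axioms Y -> pl_axioms T -> emb_on setT j ->
  (forall k (c : chart R Z k), pl_atlas Z k c ->
     exists2 d, pl_atlas Y k d & c = Chart (j @^-1` chart_dom d) (chart_map d \o j)) ->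
  (forall z, F (j z) = f z) -> (forall z, plat (range j) F (j z)) -> pl_map f.
Proof.
move=> Y_pl T_pl ej atl Ff H; have [cj ij vj] := ej; split.
  apply/cont_onT; apply: (@cont_on_ext _ _ _ (F \o j)); first by move=> z _; exact: Ff.
  apply: (cont_on_comp (B := range j) (f := j) (g := F)) => // _ [z _ <-].
  by case: (H z).
move=> k l _ d /atl[c ac ->] ad.
have [oc [cc ic vc]] := atlas_emb Y_pl ac; have [od [cd _ vd]] := atlas_emb T_pl ad.
apply: plg_pl_factor.
- by move=> a b [/= ca _] [/= cb _] /(ic _ _ ca cb) /ij; exact.
- move=> a [/= ca _] V Va; have := vc _ ca _ (vj a I V Va).
  by apply: filterS => y Hy b [/= cb _] by_; exact: (Hy _ cb by_ b I erefl).
move=> a [/= ca da]; have [_ /(_ k l c d ac ad ca)] := H a.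
rewrite Ff => /(_ da) Hp.
apply: (@plg_ext _ _ _ _ _ (chart_map c \o j) _ ((chart_map d \o F) \o j)) => //.
  by move=> b _ /=; rewrite Ff.
apply: plg_pull Hp.
- exact: (cont_atT (cj _ I)).
- by move=> b [/= cb db]; split; [split=> //; exists b|rewrite /= Ff].
by move=> y [[[b _ <-] cy] dy]; exists b => //; split=> //=; rewrite -Ff.
Qed.

End General.

(** * Unions of cobordisms are pseudo-collars *)

Section DirectOne.
Variables (R : realType) (n : nat) (W : nat -> plSpace R) (M N : forall i, set (W i)).
Variable h : forall i, pl_sub (@N i) -> pl_sub (@M i.+1).
Hypothesis h_homeo : forall i, pl_homeo (@h i).
Hypothesis W_cob : forall i, cobordism n (@M i) (@N i).

Local Notation L := (@adj_lift R W M N h).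
Local Notation T := (adj_space h).
Local Notation X := (adjunction h).
Let S i : set (pl_prod (W i) (pl_line R)) := half_open R (boundary n (X := W i)).

Let W_pl i : is_pl_space (W i) := cob_pl W_cob i.
Let MN0 := cob_MN0 W_cob.
Let cM := cob_closedM W_cob.
Let cN := cob_closedN W_cob.
Let Linj i := @adj_lift_inj R W M N h MN0 h_homeo i.
Let Lemb i := adj_lift_emb MN0 h_homeo cM cN i.

Variable col : forall i, pl_prod (W i) (pl_line R) -> W i.
Hypothesis col0 : forall i (y : W i), boundary n y -> col (y, 0) = y.
Hypothesis col_inj : forall i, inj_on (@S i) (@col i).
Hypothesis col_pl : forall i p, @S i p -> plat (@S i) (@col i) p.
Hypothesis col_open : forall i O, open O -> open (@col i @` (O `&` @S i)).

Local Notation bcol := (@bcol R n W M N h col).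
Local Notation seam_nbd := (@seam_nbd R W M N h).
Local Notation seam := (@seam R W M N h).

Let X_pl : is_pl_space X := adj_is_pl_space h_homeo W_cob col0 col_inj col_pl col_open.

(* In the chart of [seam_atlas] the bicollar is a translation of the first coordinate. *)
Lemma seam_plat k p : seam_nbd k p -> @plat R (pl_prod X (pl_line R)) X (seam_nbd k) (bcol k) p.
Proof.
case: p => x t [[a Na ax] /= t1].
have [A [phi [oA Aa rA iA NA]]] := seam_chart W_cob Na.
set D := @seam_dom R n W M N h col k A; set psi := @seam_map R n W M N h col k A phi.
have aD : pl_atlas X n.+1 (Chart D psi) := seam_atlas h_homeo W_cob col0 col_inj col_pl col_open x oA rA iA NA.
have oD : open D := seam_open h_homeo W_cob col0 col_inj col_open oA.
have rD : @rchart R X _ D psi := atlas_rchart X_pl aD.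
have Bx : seam k x by exists a.
have Dx : D x.
  exists (x, 0); last exact: (bcol0 h_homeo W_cob col0 Bx).
  by split=> /=; [exists a|apply/andP; split; lra].
have shift z s := @seam_shift _ _ _ _ _ _ h_homeo W_cob _ col0 col_inj k A phi z s.
have lev z := @seam_c0E _ _ _ _ _ _ h_homeo W_cob _ col0 col_inj k A phi z.
apply: (plat_intro (prod_axioms X_pl (line_axioms R)) X_pl (rchart_prod rD (rchart_line R)) rD).
- by split=> //; exists a.
- by apply: open_nbhs_nbhs; split; [exact: (open_prod oD (@openT R))|].
- by apply: open_nbhs_nbhs; split=> //; case: (shift x t Dx Bx t1).
- have oP : open (D `*` [set: R]) by exact: (open_prod oD (@openT R)).
  apply: filterS (open_near oP (conj Dx I : (D `*` [set: R]) (x, t))) => -[z s] [/= Dz _] [/= Bz s1].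
  by case: (shift z s Dz Bz s1).
set Q := [set z : 'rV[R]_n.+1 | c0 z - 2 <= 0] `&` [set z | - c0 z + 2 <= 0].
have pQ : polyhedron Q.
  apply: polyhedronI; apply: polyhedron_le0.
    by apply: affine_funD; [exact: affine_fun_c0|exact: affine_fun_cst].
  by apply: affine_funD; [apply: affine_funN; exact: affine_fun_c0|exact: affine_fun_cst].
have h0 := rchart_self X_pl rD Dx.
have h1 : plg (D `&` psi @^-1` Q) psi psi x by exact: (plg_level pQ h0 h0).
have h2 : plg [set s : R | -1 < s < 1] (fun s => const_mx s : 'rV[R]_1) (fun s => const_mx s : 'rV[R]_1) t.
  have oI : open [set s : R | -1 < s < 1].
    rewrite (_ : mkset _ = `]-1, 1[%classic); first exact: interval_open.
    by apply/seteqP; split=> s; rewrite /= in_itv.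
  have := rchart_open (line_axioms R) (rchart_line R) oI; rewrite setTI => rI.
  exact: (rchart_self (line_axioms R) rI t1).
have := plg_prod h1 h2.
pose f (y : 'rV[R]_(n.+1 + 1)) : 'rV[R]_n.+1 := setc (2 + 1 * y ord0 (rshift _ ord0)) (lsubmx y).
have af : affine f.
  apply: affine_setc.
    by apply: affine_funD; [exact: affine_fun_cst|apply: affine_funZ; exact: affine_fun_coord].
  apply/affine_coord => i; have [u [b E]] := @affine_fun_coord R _ (lshift 1 i : 'I_(n.+1 + 1)).
  by exists u, b => y; rewrite mxE E.
move=> /(plg_post af).
rewrite (_ : (D `&` psi @^-1` Q) `*` _ = seam_nbd k `&` (D `*` [set: R]) `&` bcol k @^-1` D); last first.
  apply/seteqP; split=> -[z s].
    move=> [/= [Dz [z1 z2]] s1]; have [y1 y2] : c0 (psi z) - 2 <= 0 /\ - c0 (psi z) + 2 <= 0 by [].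
    have Bz : seam k z by apply/lev => //; rewrite -/psi; lra.
    by split; [split|case: (shift z s Dz Bz s1)].
  move=> [[[/= Bz s1] [/= Dz _]] _]; split=> //=; split=> //.
  have E : c0 (psi z) = 2 := (lev z Dz).1 Bz.
  by rewrite /Q /= E; split; lra.
apply: plg_ext => // -[z s] [[[/= Bz s1] [/= Dz _]] _] /=.
have [_ E] := shift z s Dz Bz s1; rewrite /psi E.
by rewrite /f row_mxEr mxE row_mxKl mul1r.
Qed.

Lemma seam_bicollared k : @bicollared R X (seam k).
Proof.
pose I1 : set (pl_line R) := `]-1, 1[%classic.
pose Z := pl_prod (pl_sub (X := X) (seam k)) (pl_sub I1).
pose j (p : Z) : pl_prod X (pl_line R) := (set_val p.1, set_val p.2).
have ej : emb_on [set: Z] j.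
  exact: (emb_pair (set_val_emb (seam k)) (set_val_emb I1)).
have jE : range j = seam_nbd k.
  apply/seteqP; split=> [_ [[b s] _ <-]|[b s] [/= Bb s1]].
    split; first exact: (set_valE' b).
    by have := set_valE' s; rewrite /I1 /= in_itv.
  have Is : I1 s by rewrite /I1 /= in_itv.
  by exists (toset Bb, toset Is) => //; rewrite /j /= !set_val_toset.
have jQ p : seam_nbd k (j p) by rewrite -jE; exists p.
exists (fun p => bcol k (j p)); split.
- apply: (@pull_pl_map _ Z (pl_prod X (pl_line R)) X j _ (bcol k)) => //.
  + exact: (prod_axioms X_pl (line_axioms R)).
  + exact: X_pl.
  + move=> m _ [m1 m2 _ _ [c ac <-] [d ad <-]].
    by exists (Chart (chart_dom c `*` chart_dom d)
                 (fun p => row_mx (chart_map c p.1) (chart_map d p.2))).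
  + by move=> p; rewrite jE; exact: seam_plat.
- move=> p q /(bcol_inj h_homeo W_cob col0 col_inj (jQ p) (jQ q)).
  by case: ej => _ ij _; exact: ij.
- move=> O oO; have [ O' oO' E] := emb_image_open ej oO.
  rewrite -(image_comp j (bcol k)) E jE.
  exact: (bcol_open h_homeo W_cob col0 col_inj col_open).
move=> b t t0; rewrite /j /= t0 (bcol0 h_homeo W_cob col0) //.
exact: (set_valE' b).
Qed.

Hypothesis M_heq : forall i, inclusion_heq R (@M i).

Lemma piece_sdr i : sdr R [set: W i] (@M i).
Proof.
apply: heq_sdr; last first.
  have e : emb_on [set: W i] id by split=> // [x _ V Vx|x _ V Vx]; apply: filterS Vx => // y Vy z _ ->.
  by have := inclusion_heq_sheq e (@M_heq i); rewrite !image_id.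
have [_ cW _ _ _] := W_cob i.
have SM : half_open R (@M i) `<=` @S i by move=> p [Mp ?]; split=> //; rewrite (cob_bd W_cob); left.
apply: (@collar_ndr _ _ _ (@col i)).
- by have [] := W_pl i.
- by apply: (subclosed_compact _ cW) => //; exact: cM.
- by move=> y My; apply: col0; rewrite (cob_bd W_cob); left.
- exact: inj_on_sub (@col_inj i).
- by apply: (cont_on_sub SM) => p Sp; case: (col_pl Sp).
(* Removing the end [N] from the base cuts the collar of the whole boundary down to that of [M] by
   an open condition. *)
move=> O oO; rewrite (_ : O `&` _ = (O `&` (~` @N i `*` [set: R])) `&` @S i).
  apply: col_open; apply: openI => //; apply: open_prod; last exact: openT.
  by apply: closed_openC; exact: cN.
apply/seteqP; split=> -[y s].
  move=> [Oy [/= My s1]]; split; last by apply: SM.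
  by split=> //; split=> // Ny; have : (@M i `&` @N i) y by []; rewrite MN0.
move=> [[Oy [/= nN _]] [By s1]]; split=> //; split=> //=.
by move: By; rewrite /= (cob_bd W_cob) => -[].
Qed.

Lemma tail_sheq m : sheq R (@tail R W M N h m) (@adj_lift R W M N h m @` @M m).
Proof.
have step i : @adj_lift R W M N h i.+1 @` @M i.+1 `<=` range (@adj_lift R W M N h i).
  by rewrite -seamM // => _ [a _ <-]; exists a.
apply: sdr_sheq; first by move=> _ [a _ <-]; exists m, a.
pose Z i := range (@adj_lift R W M N h (i + m)).
pose B i := @adj_lift R W M N h (i + m) @` @M (i + m).
have /choice[D HD] i : exists Q : T * R -> T,
  [/\ cont_on (Z i `*` @I01 R) Q, forall p, (Z i `*` @I01 R) p -> Z i (Q p),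
      forall x, Z i x -> Q (x, 0) = x /\ B i (Q (x, 1))
    & forall b t, B i b -> I01 t -> Q (b, t) = b].
  exact: (sdr_push (Lemb (i + m)) (@piece_sdr (i + m))).
have E : @tail R W M N h m = [set x | exists i, Z i x].
  apply/seteqP; split=> y.
    move=> [i [x [mi xy]]]; exists (i - m)%N; rewrite /Z subnK //; exists x => //.
  by move=> [i [x _ xy]]; exists (i + m)%N, x; split=> //; exact: leq_addl.
rewrite E; apply: (@tele_sdr _ _ Z B D); try by move=> i; case: (HD i).
- move=> i; rewrite /Z; apply: (adj_lift_closed MN0 h_homeo cM cN); exact: closedT.
- move=> i _ [[x _ <-] [j ji [y _ yx]]].
  have lt : (j + m < i.+1 + m)%N by rewrite ltn_add2r.
  have [_ [_ Mx]] := meetM h_homeo W_cob yx lt.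
  by exists x.
- by move=> _ [a _ <-]; exists a.
- by move=> i; exact: step.
move=> x _; have [k Hk] := adj_local MN0 h_homeo cM cN x.
exists ([set y | exists i (w : W i), (i <= k)%N /\ L w = y]°), k; split.
- exact: open_interior.
- exact: Hk.
move=> y [/interior_subset Oy [i [w _ wy]]].
have [i' [w' [ik w'y]]] := Oy.
case: (leqP m i') => mi'.
  by exists (i' - m)%N; [lia|rewrite /Z subnK //; exists w'].
case: (leqP (i + m) k) => imk; first by exists i; [lia|exists w].
have [e _] := meetM h_homeo W_cob (etrans w'y (esym wy)) (leq_ltn_trans ik imk).
by exists i; [lia|exists w].
Qed.

Lemma adj_pseudo_collar : pseudo_collar n X.
Proof.
have [_ cW0 _ _ _] := W_cob 0.
have cLM m : compact (@adj_lift R W M N h m @` @M m).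
  apply: cont_on_compact.
    by apply: continuous_cont_on; exact: adj_lift_continuous.
  have [_ cW _ _ _] := W_cob m.
  by apply: (subclosed_compact _ cW) => //; exact: cM.
have LMt m : @adj_lift R W M N h m @` @M m `<=` @tail R W M N h m.
  by move=> _ [a _ <-]; exists m, a.
have sm m := tail_smf h_homeo W_cob col0 col_inj col_pl col_open m.
split.
  have rE : range (@id X) = @tail R W M N h 0.
    by rewrite tail0; apply/seteqP; split=> x // _; exists x.
  have H := @smf_homotopy_collar R n X X id (@adj_lift R W M N h 0 @` @M 0) X_pl X_pl (pl_emb_id X_pl).
  rewrite rE in H.
  by have [] := H (sm 0) (@LMt 0) (cLM 0) (@tail_sheq 0).
move=> V; rewrite /neighborhood_of_infinity => cV.
(* By compactness the closure of the complement of [V] lies in the pieces up to [k]. The tail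
   starting at [k.+2] is disjoint from these, whereas the piece [k.+1] still shares a seam with the
   piece [k]. *)
have [k Hk] : exists k, closure (~` V) `<=` [set y | exists i (x : W i), (i <= k)%N /\ L x = y].
  have HN (y : T) : exists k, \forall z \near y, exists i (x : W i), (i <= k)%N /\ L x = z.
    exact: (adj_local MN0 h_homeo cM cN).
  have /choice[kk Hkk] := HN.
  have [s [_ Hs]] := compact_finite_cover cV (fun x _ => Hkk x).
  exists (\max_(x <- s) kk x) => y /Hs[x xs [i [w [ik wy]]]].
  exists i, w; split=> //; apply: leq_trans ik _.
  exact: (@leq_bigmax_seq _ _ xpredT kk x xs isT).
exists (@tail R W M N h k.+2).
have oT : is_pl_space (pl_sub (X := X) (@tail R W M N h k.+2)).
  exact: (sub_is_pl_space X_pl (smf_poly X_pl (sm k.+2))).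
have jT : @pl_emb R (pl_sub (X := X) (@tail R W M N h k.+2)) X set_val by exact: (sub_pl_emb X_pl oT).
have [] := @smf_homotopy_collar R n (pl_sub (X := X) (@tail R W M N h k.+2)) X set_val (@adj_lift R W M N h k.+2 @` @M k.+2) oT X_pl jT.
- by rewrite set_val_image; exact: sm.
- by rewrite set_val_image; exact: LMt.
- exact: cLM.
- by rewrite set_val_image; exact: tail_sheq.
move=> hc bE; split=> //.
- move=> y [i [x [ki xy]]]; apply: contrapT => nVy.
  have [i' [x' [ik x'y]]] := Hk y (subset_closure nVy).
  have [e _] := meetM h_homeo W_cob (etrans x'y (esym xy)) (leq_ltn_trans ik (ltnW ki)).
  lia.
- have cE : compact (\bigcup_(i in `I_k.+2) range (@adj_lift R W M N h i)).
    rewrite bigcup_mkord; apply: big_ind => //; [exact: compact0|exact: compactU|].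
    move=> i _; apply: cont_on_compact; last by have [] := W_cob i.
    by apply: continuous_cont_on; exact: adj_lift_continuous.
  have sE : ~` @tail R W M N h k.+2 `<=` \bigcup_(i in `I_k.+2) range (@adj_lift R W M N h i).
    move=> y ny; have [i [x xy]] := adj_surj y; exists i; last by exists x.
    by rewrite /= ltnNge; apply/negP => ki; apply: ny; exists i, x.
  apply: (subclosed_compact _ cE); first exact: closed_closure.
  have hX : hausdorff_space X by have [] := X_pl.
  have /closure_id -> := compact_closed hX cE.
  exact: closureS.
- split; first exact: (tail_closed h_homeo W_cob).
    by have [] := hc.
  rewrite bE (_ : set_val @` _ = seam k.+1); first exact: seam_bicollared.
  rewrite seamM //; apply/seteqP; split=> y; first by move=> [z Bz <-].
  by move=> By; exists (toset (LMt _ _ By)); rewrite /= set_val_toset.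
Qed.

End DirectOne.

(** * The two sides of a bicollared boundary *)

Section Affine.
Variable R : realType.

(** Along a segment of [C], the function that is 0 on the part in [G1] and 1 on the part in [G2] is
    continuous, so by the intermediate value theorem it does not take both values. *)
Lemma convex_side k (Y : topologicalType) (C : set 'rV[R]_k) (rho : 'rV[R]_k -> Y) (G1 G2 : set Y) :
  (forall x y t, C x -> C y -> 0 <= t <= 1 -> C ((1 - t) *: x + t *: y)) ->
  cont_on C rho -> open G1 -> open G2 -> G1 `&` G2 = set0 ->
  (forall z, C z -> G1 (rho z) \/ G2 (rho z)) ->
  forall x y, C x -> C y -> G1 (rho x) -> G1 (rho y).
Proof.
move=> Cc cr o1 o2 G12 GC x y Cx Cy Gx; apply: contrapT => nGy.
pose f t := rho ((1 - t) *: x + t *: y).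
have Cf t : 0 <= t <= 1 -> C ((1 - t) *: x + t *: y) by exact: Cc.
have cf : cont_on (@I01 R) f.
  apply: (cont_on_comp (B := C)) => //.
  apply: continuous_cont_on => t; apply: (mx_continuous (nbhs_filter t)) => i.
  rewrite (_ : (fun _ => _) = fun t => (1 - t) * x ord0 i + t * y ord0 i); last first.
    by apply/funext => u; rewrite !mxE.
  have H : cont_on setT (fun t : R => (1 - t) * x ord0 i + t * y ord0 i).
    apply: cont_on_add; apply: cont_on_mul; try exact: cont_on_cst; last exact: cont_on_id.
    by apply: cont_on_add; [exact: cont_on_cst|apply: cont_on_opp; exact: cont_on_id].
  by rewrite !mxE; exact: (cont_atT (H t I)).
pose g t : R := if `[< G1 (f t) >] then 0 else 1.
have cg : {within `[0, 1], continuous g}.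
  rewrite -I01E; apply/cont_on_within => t It V Vt.
  case: (GC _ (Cf _ It)) => Gt.
    apply: filterS (cf t It _ (open_near o1 Gt)) => u Gu Iu.
    by rewrite /g asboolT; [move: Vt; rewrite /g asboolT // => /nbhs_singleton|exact: Gu].
  have n2 u : G2 (f u) -> ~ G1 (f u).
    by move=> h2 h1; have : (G1 `&` G2) (f u) by []; rewrite G12.
  apply: filterS (cf t It _ (open_near o2 Gt)) => u Gu Iu.
  rewrite /g asboolF; last by apply: n2; exact: Gu.
  by move: Vt; rewrite /g asboolF; [move/nbhs_singleton|exact: n2].
have g0 : g 0 = 0 by rewrite /g asboolT // /f subr0 scale1r scale0r addr0.
have g1 : g 1 = 1 by rewrite /g asboolF // /f subrr scale0r scale1r add0r.
have [] := @IVT R g 0 1 (1 / 2) ler01 cg.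
  by rewrite g0 g1 ge_min le_max; apply/andP; split; apply/orP; [left|right]; lra.
by move=> t _; rewrite /g; case: asboolP => _; lra.
Qed.

Lemma rchart_affine (X : plSpace R) k l (A : set X) (phi : X -> 'rV[R]_k)
    (f : 'rV[R]_k -> 'rV[R]_l) (g : 'rV[R]_l -> 'rV[R]_k) :
  affine f -> affine g -> (forall x, A x -> g (f (phi x)) = phi x) ->
  rchart A phi -> rchart A (f \o phi).
Proof.
move=> af ag gf [[cp ip vp] hp].
have jp : inj_on A (f \o phi).
  by move=> x y Ax Ay /= E; apply: ip => //; rewrite -(gf _ Ax) E gf.
split.
  split=> //.
    by apply: (cont_on_comp (B := setT)) => //; apply: continuous_cont_on; exact: affine_continuous.
  move=> x Ax V Vx; have Vg := vp x Ax V Vx; rewrite -(gf _ Ax) in Vg.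
  have H : \forall y \near f (phi x), forall z, A z -> phi z = g y -> V z.
    exact: (affine_continuous ag Vg).
  apply: (@filterS _ (nbhs (f (phi x))) _ _ _ _ H) => y Hy z Az zy.
  by apply: (Hy z Az); rewrite -zy /= gf.
move=> m c ac x Ax cx; have [h1 h2] := hp m c ac x Ax cx.
have h3 := plg_post af h1; split=> //; apply: plg_inv => //.
by apply: inj_on_sub jp; exact: subIsetl.
Qed.

Definition obox k (a : 'rV[R]_k) (r : R) : set 'rV[R]_k :=
  [set z | forall j, `|z ord0 j - a ord0 j| < r].

Lemma obox_open k (a : 'rV[R]_k) r : open (obox a r).
Proof.
rewrite (_ : obox a r = ~` [set z | exists j, r <= `|z ord0 j - a ord0 j|]); last first.
  apply/seteqP; split=> z.
    by move=> H [j]; rewrite leNgt (H j).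
  by move=> H j; rewrite ltNge; apply/negP => h; apply: H; exists j.
apply: closed_openC; apply: (closed_finU (F := fun j : 'I_k => [set z : 'rV[R]_k | r <= `|z ord0 j - a ord0 j|])) => j.
apply: closed_le_on; first by move=> z; exact: cst_continuous.
move=> z; apply: (continuous_comp (f := fun z : 'rV[R]_k => z ord0 j - a ord0 j)); last exact: norm_continuous.
apply: affine_fun_continuous; apply: affine_funD; first exact: affine_fun_coord.
exact: affine_fun_cst.
Qed.

(* In [slab a r], the coordinate [c0] plays the role of a bicollar parameter, shifted to [1, 3]. *)
Definition slab n (a : 'rV[R]_n.+1) r : set 'rV[R]_n.+1 :=
  [set z | obox a r (setc 0 z) /\ 1 < c0 z < 3].

Lemma c0_continuous n : continuous (@c0 R n).
Proof. by apply: affine_fun_continuous; exact: affine_fun_c0. Qed.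

Lemma slab_open n (a : 'rV[R]_n.+1) r : open (slab a r).
Proof.
have a0 : affine (setc 0 : 'rV[R]_n.+1 -> 'rV[R]_n.+1).
  by apply: affine_setc; [exact: affine_fun_cst|exact: affine_id].
apply: openI.
  by apply: open_comp; [move=> z _; exact: affine_continuous|exact: obox_open].
rewrite [X in open X](_ : _ = [set z | 1 < c0 z] `&` [set z | c0 z < 3]).
  by apply: openI; [apply: (@open_comp _ _ (@c0 R n) [set t | 1 < t]) => [z _|]; [exact: c0_continuous|exact: open_gt]
    |apply: (@open_comp _ _ (@c0 R n) [set t | t < 3]) => [z _|]; [exact: c0_continuous|exact: open_lt]].
by apply/seteqP; split=> z /=; [move/andP|move=> [-> ->]].
Qed.

Lemma conv_gt (u x y t : R) : u < x -> u < y -> 0 <= t <= 1 -> u < (1 - t) * x + t * y.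
Proof.
move=> ux uy /andP[t0 t1]; case: (leP t (1 / 2)) => h.
  have : 0 < (1 - t) * (x - u) by apply: mulr_gt0; lra.
  have : 0 <= t * (y - u) by apply: mulr_ge0; lra.
  by lra.
have : 0 <= (1 - t) * (x - u) by apply: mulr_ge0; lra.
have : 0 < t * (y - u) by apply: mulr_gt0; lra.
by lra.
Qed.

Lemma conv_lt (u x y t : R) : x < u -> y < u -> 0 <= t <= 1 -> (1 - t) * x + t * y < u.
Proof.
rewrite -(ltrN2 u x) -(ltrN2 u y) => xu yu t01; rewrite -ltrN2.
by have := conv_gt xu yu t01; lra.
Qed.

Lemma slab_convex n (a : 'rV[R]_n.+1) r x y t : slab a r x -> slab a r y -> 0 <= t <= 1 ->
  slab a r ((1 - t) *: x + t *: y).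
Proof.
move=> [ox /andP[x1 x3]] [oy /andP[y1 y3]] t01; split.
  move=> j; have := ox j; have := oy j; rewrite !mxE; case: ifP => // _.
  rewrite !ltr_norml => /andP[y4 y5] /andP[x4 x5].
  have := conv_gt x4 y4 t01; have := conv_lt x5 y5 t01 => h1 h2.
  by apply/andP; split; lra.
rewrite /c0 !mxE -/(c0 x) -/(c0 y); apply/andP; split; [exact: conv_gt|exact: conv_lt].
Qed.

Lemma nbhs_setc n (a : 'rV[R]_n.+1) (P : set 'rV[R]_n.+1) : nbhs a P ->
  exists2 e, 0 < e & P (setc (c0 a + e) a) /\ P (setc (c0 a - e) a).
Proof.
move=> /nbhs_cube[r r0 H]; exists r => //.
split; apply: H => j; rewrite !mxE; case: eqP => [->|_]; try by rewrite subrr normr0 ltW.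
  by rewrite /c0 ler_norml; apply/andP; split; lra.
by rewrite /c0 ler_norml; apply/andP; split; lra.
Qed.

End Affine.

Section Sides.
Variables (R : realType) (n : nat) (U : plSpace R) (V B : set U).
Hypotheses (U_man : pl_manifold n U) (V_smf : smf n V B) (BV : B `<=` V) (V_closed : closed V).

Let U_pl : is_pl_space U := proj1 U_man.

Let smf_ge0 D (phi : U -> 'rV[R]_n.+1) z :
  (exists2 O, open O & phi @` (V `&` D) = O `&` @half_space R n) -> V z -> D z -> 0 <= c0 (phi z).
Proof.
move=> [ O _ E] Vz Dz; have : (phi @` (V `&` D)) (phi z) by exists z.
by rewrite E => -[].
Qed.

(* By invariance of domain, [V] minus its boundary is open in [U]. *)
Lemma smf_interior z : V z -> ~ B z -> nbhs z V.
Proof.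
move=> Vz nB; have [D [phi [[oD Dz] rD imD BE]]] := V_smf Vz.
have c1 : 0 < c0 (phi z).
  rewrite lt_neqAle (smf_ge0 imD Vz Dz) andbT eq_sym; apply/eqP => e.
  by apply: nB; apply/BE.
have [_ /(_ z)[c [mc cz]]] := U_man.
have rc := manifold_chart_rchart U_pl mc.
have [oc [cc ic vc]] := is_chart_emb (let: And3 H _ _ := mc in H).
have [[cp ip vp] _] := rD.
set A := V `&` D `&` chart_dom c.
have Az : A z by [].
have AD : A `<=` V `&` D by move=> y [].
have pA := rchart_plg U_pl rD rc (conj Vz Dz) cz.
have [ O oO E] := imD.
have Oz : nbhs (phi z) (O `&` [set y | 0 < c0 y]).
  apply: filterI; last first.
    apply: (@open_near _ [set y : 'rV[R]_n.+1 | 0 < c0 y] _ _ c1); apply: (@open_comp _ _ (@c0 R n) [set t | 0 < t]) => [y _|].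
      exact: c0_continuous.
    exact: open_gt.
  have : (phi @` (V `&` D)) (phi z) by exists z.
  by rewrite E => -[Oz _]; exact: (open_near oO Oz).
have nA : nbhs (phi z) (phi @` A).
  have Gz : nbhs z (chart_dom c) by exact: (open_near oc cz).
  apply: filterS2 Oz (vp z (conj Vz Dz) _ Gz) => y [Oy y0] Hy.
  have : (phi @` (V `&` D)) y by rewrite E; split=> //; exact: ltW.
  by move=> [w VDw wy]; exists w => //; split=> //; exact: Hy wy.
have := plg_open Az (inj_on_sub AD ip) (inv_at_sub AD (vp z (conj Vz Dz)))
  (inj_on_sub (@subIsetr _ _ _) ic) nA pA (nbhs_all z (fun=> I)).
rewrite setIT => H.
have H' := cc z cz _ H.
apply: filterS2 (open_near oc cz) H' => y cy /(_ cy)[w [[Vw Dw] cw] wy].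
by rewrite -(ic _ _ cw cy wy).
Qed.

(** The image is cut down to a box so that the two halves of the bicollar chart built over it are
    convex, hence connected. *)
Lemma smf_box b : B b -> exists D (phi : U -> 'rV[R]_n.+1) r,
  [/\ open D /\ D b, 0 < r /\ rchart (V `&` D) phi,
      phi @` (V `&` D) = obox (phi b) r `&` @half_space R n
    & forall z, V z -> D z -> (B z <-> c0 (phi z) = 0)].
Proof.
move=> Bb; have Vb := BV Bb; have [D [phi [[oD Db] rD [ O oO E] BE]]] := V_smf Vb.
have [[cp ip vp] _] := rD.
have : (phi @` (V `&` D)) (phi b) by exists b.
rewrite E => -[Ob hb]; have [r r0 HO] := nbhs_cube (open_near oO Ob).
have bO : obox (phi b) r `<=` O by move=> y Hy; apply: HO => j; exact: ltW.
pose D1 := [set z | V z -> D z -> obox (phi b) r (phi z)]° `&` D.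
have D1E : V `&` D1 = V `&` D `&` [set z | obox (phi b) r (phi z)].
  apply/seteqP; split=> z; first by move=> [Vz [/interior_subset H Dz]]; split=> //; exact: H.
  move=> [[Vz Dz] oz]; split=> //; split=> //.
  apply: filterS (cp z (conj Vz Dz) _ (open_near (@obox_open R _ (phi b) r) oz)) => y Hy Vy Dy.
  exact: Hy.
have oD1 : open D1 by apply: openI => //; exact: open_interior.
have D1b : (V `&` D1) b.
  by rewrite D1E; split=> // j; rewrite subrr normr0.
exists D1, phi, r; split.
- by split=> //; case: D1b.
- split=> //; have -> : V `&` D1 = V `&` D `&` D1.
    by apply/seteqP; split=> z; [move=> [Vz [? Dz]]|move=> [[]]].
  exact: (rchart_open U_pl).
- rewrite D1E; apply/seteqP; split=> y.
    move=> [z [[Vz Dz] oz] <-]; split=> //.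
    have : (phi @` (V `&` D)) (phi z) by exists z.
    by rewrite E => -[].
  move=> [oy hy]; have : (phi @` (V `&` D)) y by rewrite E; split=> //; exact: bO.
  by move=> [z VDz zy]; exists z => //; split=> //=; rewrite zy.
by move=> z Vz [_ Dz]; exact: BE.
Qed.

Let polyc0 (t : R) : polyhedron [set z : 'rV[R]_n.+1 | c0 z <= t].
Proof.
rewrite (_ : mkset _ = [set z : 'rV[R]_n.+1 | c0 z + - t <= 0]).
  apply: polyhedron_le0; apply: affine_funD; [exact: affine_fun_c0|exact: affine_fun_cst].
by apply/seteqP; split=> z /=; lra.
Qed.

Lemma boundary_rchart D (phi : U -> 'rV[R]_n.+1) : rchart (V `&` D) phi ->
  (exists2 O, open O & phi @` (V `&` D) = O `&` @half_space R n) ->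
  (forall z, V z -> D z -> (B z <-> c0 (phi z) = 0)) -> rchart (B `&` D) phi.
Proof.
move=> rD imD BE; apply: (rchart_sub U_pl rD); first by move=> z [/BV].
move=> x [Bx Dx]; have h0 := rchart_self U_pl rD (conj (BV Bx) Dx).
rewrite (_ : B `&` D = V `&` D `&` phi @^-1` [set z | c0 z <= 0]).
  exact: plg_level.
apply/seteqP; split=> z.
  move=> [Bz Dz]; split; first by split=> //; exact: BV.
  by rewrite /= (BE _ (BV Bz) Dz).1.
move=> [[Vz Dz] /= z0]; split=> //; apply/(BE _ Vz Dz)/eqP.
by rewrite eq_le z0 (smf_ge0 imD).
Qed.

Lemma boundary_poly k (c : chart R U k) : pl_atlas U k c ->
  forall x, B x -> chart_dom c x -> plg (B `&` chart_dom c) (chart_map c) (chart_map c) x.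
Proof.
move=> ac x Bx cx; have [D [phi [[oD Dx] rD imD BE]]] := V_smf (BV Bx).
have rB := boundary_rchart rD imD BE; have [_ HD] := rB.
have [h1 h2] := HD _ _ ac _ (conj Bx Dx) cx.
have [_ [_ ic _]] := atlas_emb U_pl ac.
apply: plg_enlarge (plg_refl h1).
- by apply: inj_on_sub ic => z [].
- by move=> z [[? ?] ?].
by apply: filterS (open_near oD Dx) => z Dz [? ?].
Qed.

Hypothesis B_bic : bicollared B.

Let I1 : set (pl_line R) := `]-1, 1[%classic.

Let I1_open : open I1. Proof. exact: interval_open. Qed.

Let lineI_axioms : pl_axioms (pl_sub I1).
Proof.
apply: (sub_axioms (line_axioms R)) => k _ [] x Ix _.
have := rchart_open (line_axioms R) (rchart_line R) I1_open; rewrite setTI => rI.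
by rewrite setIT; exact: (rchart_self (line_axioms R) rI Ix).
Qed.

(** On [B] the coordinate [c0] of a chart of [V] vanishes and is free to carry the bicollar
    parameter, shifted by 2 as in [seam_map]. The chart is pushed forward along the bicollar, which
    is an open PL embedding. *)
Lemma bicollar_chart b : B b -> exists D (psi : U -> 'rV[R]_n.+1) a r,
  [/\ open D /\ D b, rchart D psi, psi @` D = slab a r & forall z, D z -> (B z <-> c0 (psi z) = 2)].
Proof.
move=> Bb; have [D1 [phi [r [[oD1 D1b] [r0 rD1] imD BE]]]] := smf_box Bb.
have imD' : exists2 O, open O & phi @` (V `&` D1) = O `&` @half_space R n.
  by exists (obox (phi b) r) => //; exact: obox_open.
have rB := boundary_rchart rD1 imD' BE.
pose YB := pl_sub B; have YB_pl : pl_axioms YB := sub_axioms U_pl boundary_poly.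
pose YI := pl_sub I1; pose Z := pl_prod YB YI.
have Z_pl : pl_axioms Z := prod_axioms YB_pl lineI_axioms.
have rB' : @rchart R YB _ (set_val @^-1` (B `&` D1)) (phi \o set_val).
  apply: (rchart_pull YB_pl U_pl (sub_pl_emb U_pl YB_pl) rB).
  by move=> x [Bx _]; exists (toset Bx); rewrite ?set_val_toset.
have rI' : @rchart R YI _ (set_val @^-1` I1) ((fun t : R => const_mx t : 'rV[R]_1) \o set_val).
  have := rchart_open (line_axioms R) (rchart_line R) I1_open; rewrite setTI => rI.
  apply: (rchart_pull lineI_axioms (line_axioms R) (sub_pl_emb (line_axioms R) lineI_axioms) rI).
  by move=> x Ix; exists (toset Ix); rewrite ?set_val_toset.
have rZ := rchart_prod rB' rI'.
set P := _ `*` _ in rZ; set Phi := (fun p : YB * YI => _) in rZ.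
have [c [[cc cp] ic oc cb]] := B_bic.
pose f (y : 'rV[R]_(n.+1 + 1)) : 'rV[R]_n.+1 := setc (2 + 1 * y ord0 (rshift _ ord0)) (lsubmx y).
pose g (z : 'rV[R]_n.+1) : 'rV[R]_(n.+1 + 1) := row_mx (setc 0 z) (const_mx (c0 z - 2)).
have af : affine f.
  apply: affine_setc.
    by apply: affine_funD; [exact: affine_fun_cst|apply: affine_funZ; exact: affine_fun_coord].
  apply/affine_coord => i; have [u [v E]] := @affine_fun_coord R _ (lshift 1 i : 'I_(n.+1 + 1)).
  by exists u, v => y; rewrite mxE E.
have ag : affine g.
  apply/affine_coord => i; case: (split_ordP i) => j ->.
    have /affine_coord H : affine (setc 0 : 'rV[R]_n.+1 -> 'rV[R]_n.+1).
      by apply: affine_setc; [exact: affine_fun_cst|exact: affine_id].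
    have [u [v E]] := H j.
    by exists u, v => z; rewrite /g row_mxEl E.
  have [u [v E]] : affine_fun (fun z : 'rV[R]_n.+1 => c0 z + - 2).
    by apply: affine_funD; [exact: affine_fun_c0|exact: affine_fun_cst].
  by exists u, v => z; rewrite /g row_mxEr mxE E.
have fPhi p : f (Phi p) = setc (2 + set_val p.2) (phi (set_val p.1)).
  by rewrite /f /Phi row_mxEr mxE row_mxKl mul1r.
have Bc0 (y : YB) : D1 (set_val y) -> c0 (phi (set_val y)) = 0.
  by move=> Dy; apply/BE => //; [apply: BV|]; exact: set_valE'.
have phi0 (y : YB) s : D1 (set_val y) -> setc 0 (setc s (phi (set_val y))) = phi (set_val y).
  by move=> Dy; rewrite setc_setc -{1}(Bc0 _ Dy) setc_id.
have rf : @rchart R Z _ P (f \o Phi).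
  apply: (rchart_affine (g := g) af ag _ rZ) => -[y s] [/= [_ Dy] _].
  rewrite fPhi /g /= phi0 // c0_setc /Phi /=; congr row_mx.
  by apply/matrixP => i j; rewrite !mxE; ring.
have ec : emb_on [set: Z] c.
  split.
  - exact: continuous_cont_on.
  - by move=> x y _ _; exact: ic.
  move=> x _ G Gx; have Gi : (c @` G°) (c x) by exists x.
  apply: filterS (open_near (oc _ (open_interior G)) Gi) => _ [y Gy <-] z _ /ic ->.
  exact: interior_subset.
have pc : @pl_emb R Z U c.
  split=> // k l e d ae ad x ex dx; have [oe [ce ie ve]] := atlas_emb Z_pl ae.
  apply: pl_factor_plg => //; last exact: cp.
  by apply: cont_at_sub (ce _ ex); exact: subIsetl.
pose psi := extend setT c (f \o Phi) (fun=> 0).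
have psiE p : psi (c p) = f (Phi p) by rewrite /psi extendE //; case: ec.
have rD := rchart_push Z_pl U_pl pc rf (fun p _ => psiE p).
have I0 : I1 0 by rewrite /I1 /= in_itv /=; apply/andP; split; lra.
pose z0 : YI := toset I0; have z00 : set_val z0 = 0 by rewrite set_val_toset.
exists (c @` P), psi, (phi b), r; split=> //.
- split; last first.
    exists (toset Bb : YB, z0); last by rewrite cb // set_val_toset.
    by split; rewrite /P /= set_val_toset.
  apply: oc; apply: open_prod.
    rewrite preimage_setI; apply: openI.
      by rewrite (_ : _ @^-1` B = setT); [exact: openT|apply/seteqP; split=> y // _; exact: set_valE'].
    by apply: open_comp => // y _; have [cv _ _] := set_val_emb B; exact: (cont_atT (cv y I)).
  by rewrite (_ : _ @^-1` I1 = setT); [exact: openT|apply/seteqP; split=> y // _; exact: set_valE'].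
- apply/seteqP; split=> z.
    move=> [_ [[y s] [[By Dy] Is] <-] <-]; rewrite psiE fPhi /=.
    have : (phi @` (V `&` D1)) (phi (set_val y)) by exists (set_val y) => //; split=> //; exact: BV.
    rewrite imD => -[oy _]; split; first by rewrite phi0.
    by rewrite c0_setc; move: Is; rewrite /I1 /= in_itv /= => /andP[? ?]; apply/andP; split; lra.
  move=> [oz /andP[z1 z3]].
  have : (phi @` (V `&` D1)) (setc 0 z).
    by rewrite imD; split=> //; rewrite /half_space /= -/(c0 _) c0_setc.
  move=> [x [Vx Dx] xz]; have Bx : B x by apply/BE => //; rewrite xz c0_setc.
  have Is : I1 (c0 z - 2) by rewrite /I1 /= in_itv /=; apply/andP; split; lra.
  exists (c (toset Bx : YB, toset Is : YI)).
    by exists (toset Bx : YB, toset Is : YI) => //; split; rewrite /P /= set_val_toset.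
  rewrite psiE fPhi /= !set_val_toset xz setc_setc.
  have -> : 2 + (c0 z - 2) = c0 z by ring.
  exact: setc_id.
move=> _ [[y s] [[By Dy] Is] <-]; rewrite psiE fPhi c0_setc /=; split.
  move=> Bc; have E : c (toset Bc : YB, z0) = c (y, s).
    by have := cb (toset Bc) z0 z00; rewrite set_val_toset.
  by have [_ <-] := ic _ _ E; rewrite z00 addr0.
by move=> s2; rewrite cb //; lra.
Qed.

End Sides.

Section TwoSides.
Variables (R : realType) (n : nat) (U : plSpace R) (V B : set U).
Hypotheses (U_man : pl_manifold n U) (V_smf : smf n V B) (BV : B `<=` V) (V_closed : closed V)
  (B_bic : bicollared B).

Let U_pl : is_pl_space U := proj1 U_man.

Lemma slab_half (a : 'rV[R]_n.+1) r : slab a r = slab a r `&` @half_space R n.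
Proof.
apply/seteqP; split=> z; last by case.
move=> H; split=> //; case: H => _ /andP[z1 _].
by rewrite /half_space /= -/(c0 z); lra.
Qed.

Lemma both_in b D (psi : U -> 'rV[R]_n.+1) a r : B b -> open D -> D b -> rchart D psi ->
  psi @` D = slab a r -> D `<=` V -> False.
Proof.
move=> Bb oD Db rD imD DV.
have [D' [phi [[oD' Db'] rD' [ O oO E] BE]]] := V_smf (BV Bb).
have nb : nbhs b (V `&` D').
  by apply: filterS2 (open_near oD Db) (open_near oD' Db') => z /DV.
have ge0 z : (V `&` D') z -> 0 <= c0 (phi z).
  move=> VDz; have : (phi @` (V `&` D')) (phi z) by exists z.
  by rewrite E => -[].
have im : exists2 O, open O & psi @` D = O `&` @half_space R n.
  by exists (slab a r); [exact: slab_open|rewrite imD -slab_half].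
have := half_chart_boundary U_pl rD' rD nb (open_near oD Db) ge0 im ((BE b (BV Bb) Db').1 Bb).
have : (psi @` D) (psi b) by exists b.
by rewrite imD => -[_ /andP[? ?]]; lra.
Qed.

Lemma both_out b D : B b -> open D -> D b -> exists z, [/\ V z, D z & ~ B z].
Proof.
move=> Bb oD Db; have [D' [phi [[oD' Db'] [[cp ip vp] _] [ O oO E] BE]]] := V_smf (BV Bb).
have b0 : c0 (phi b) = 0 by apply/(BE b (BV Bb) Db').
have VDb : (V `&` D') b by split=> //; exact: BV.
have : (phi @` (V `&` D')) (phi b) by exists b.
rewrite E => -[Ob _].
have [e e0 [[Oy Hy] _]] := nbhs_setc (filterI (open_near oO Ob) (vp b VDb _ (open_near oD Db))).
have : (phi @` (V `&` D')) (setc (c0 (phi b) + e) (phi b)).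
  by rewrite E; split=> //; rewrite /half_space /= -/(c0 _) c0_setc b0; lra.
move=> [z [Vz Dz] zy]; exists z; split=> //; first exact: (Hy z _ zy).
by move=> /(BE z Vz Dz); rewrite zy c0_setc b0; lra.
Qed.

(* The two halves of a bicollar chart are connected and miss [B], so each of them lies
   in [V] or outside of [V]; exactly one does the former, by [both_in] and [both_out]. *)
Lemma two_sided b : B b -> exists D (psi : U -> 'rV[R]_n.+1) a r,
  [/\ open D /\ D b, rchart D psi, psi @` D = slab a r
    & forall z, D z -> (V z <-> 2 <= c0 (psi z)) /\ (B z <-> c0 (psi z) = 2)].
Proof.
move=> Bb; have [D [psi [a [r [[oD Db] rD imD BE]]]]] := bicollar_chart U_man V_smf BV B_bic Bb.
have [[cp ip vp] _] := rD.
pose rho := extend D psi id (fun=> b).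
have rhoE z : D z -> rho (psi z) = z by move=> Dz; rewrite /rho extendE.
have crho : cont_on (slab a r) rho.
  by rewrite -imD; apply: extend_cont => //; exact: cont_on_id.
(* A convex part of the slab off height 2 misses [B], so each of its points is interior to [V] or
   outside [V]; [convex_side] then decides for the whole part at once. *)
have side (C : set 'rV[R]_n.+1) : C `<=` slab a r -> (forall z, C z -> c0 z != 2) ->
    (forall x y t, C x -> C y -> 0 <= t <= 1 -> C ((1 - t) *: x + t *: y)) ->
    (forall z, C z -> V (rho z)) \/ (forall z, C z -> ~ V (rho z)).
  move=> CO C2 Cc.
  have dich z : C z -> (V°) (rho z) \/ (~` V) (rho z).
    move=> Cz; have [Vz|nVz] := pselect (V (rho z)); [left|by right].
    apply: (smf_interior U_man V_smf Vz) => Bz.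
    have : (psi @` D) z by rewrite imD; exact: CO.
    move=> [w Dw wz]; move: Bz; rewrite -wz rhoE // => /(BE _ Dw) /eqP.
    by rewrite wz; apply/negP; exact: C2.
  have disj : V° `&` ~` V = set0.
    by apply/seteqP; split=> z // [/interior_subset].
  have [[z [Cz Vz]]|nz] := pselect (exists z, C z /\ V (rho z)).
    left=> y Cy; apply: interior_subset.
    have Iz : (V°) (rho z) by case: (dich z Cz) => // /(_ Vz).
    apply: (convex_side Cc (cont_on_sub CO crho) (open_interior V) (closed_openC V_closed) disj dich Cz Cy Iz).
  by right=> z Cz Vz; apply: nz; exists z.
have lin (x y : 'rV[R]_n.+1) t : c0 ((1 - t) *: x + t *: y) = (1 - t) * c0 x + t * c0 y.
  by rewrite /c0 !mxE.
have [up|up] : (forall z, slab a r z /\ 2 < c0 z -> V (rho z)) \/ (forall z, slab a r z /\ 2 < c0 z -> ~ V (rho z)).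
  apply: (side [set z | slab a r z /\ 2 < c0 z]) => [z []//|z [_ ?]|x y t [Hx x2] [Hy y2] t01].
    by apply/eqP; lra.
  by split; [exact: slab_convex|rewrite lin; exact: conv_gt].
- have [dn|dn] : (forall z, slab a r z /\ c0 z < 2 -> V (rho z)) \/ (forall z, slab a r z /\ c0 z < 2 -> ~ V (rho z)).
    apply: (side [set z | slab a r z /\ c0 z < 2]) => [z []//|z [_ ?]|x y t [Hx x2] [Hy y2] t01].
      by apply/eqP; lra.
    by split; [exact: slab_convex|rewrite lin; exact: conv_lt].
  + case: (both_in Bb oD Db rD imD) => z Dz.
    have Oz : slab a r (psi z) by rewrite -imD; exists z.
    by rewrite -(rhoE _ Dz); case: (ltgtP (c0 (psi z)) 2) => h;
      [exact: dn|exact: up|rewrite rhoE //; apply: BV; apply/BE].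
  exists D, psi, a, r; split=> // z Dz; split; last exact: BE.
  have Oz : slab a r (psi z) by rewrite -imD; exists z.
  rewrite -{1}(rhoE _ Dz); case: (ltgtP (c0 (psi z)) 2) => h.
  + by split=> // Vz; case: (dn (psi z)).
  + by split=> // _; exact: up.
  + by split=> // _; rewrite rhoE //; apply: BV; apply/BE.
have [dn|dn] : (forall z, slab a r z /\ c0 z < 2 -> V (rho z)) \/ (forall z, slab a r z /\ c0 z < 2 -> ~ V (rho z)).
  apply: (side [set z | slab a r z /\ c0 z < 2]) => [z []//|z [_ ?]|x y t [Hx x2] [Hy y2] t01].
    by apply/eqP; lra.
  by split; [exact: slab_convex|rewrite lin; exact: conv_lt].
(* Here [V] is the lower half. The reflection of [c0] at 2 preserves the slab and turns the chart
   upside down. *)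
- pose f (y : 'rV[R]_n.+1) : 'rV[R]_n.+1 := setc (4 + -1 * c0 y) y.
  have af : affine f.
    apply: affine_setc; last exact: affine_id.
    by apply: affine_funD; [exact: affine_fun_cst|apply: affine_funZ; exact: affine_fun_c0].
  have ff y : f (f y) = y.
    rewrite /f c0_setc setc_setc.
    have -> : 4 + -1 * (4 + -1 * c0 y) = c0 y by ring.
    exact: setc_id.
  have fO y : slab a r y -> slab a r (f y).
    move=> [oy /andP[y1 y3]]; split; first by rewrite /f setc_setc.
    by rewrite /f c0_setc; apply/andP; split; lra.
  exists D, (f \o psi), a, r; split=> //.
  + exact: (rchart_affine af af (fun x _ => ff (psi x)) rD).
  + apply/seteqP; split=> y; first by move=> [z Dz <-]; apply: fO; rewrite -imD; exists z.
    move=> Oy; have : (psi @` D) (f y) by rewrite imD; exact: fO.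
    by move=> [z Dz zy]; exists z => //=; rewrite zy ff.
  move=> z Dz; rewrite /= /f c0_setc.
  have Oz : slab a r (psi z) by rewrite -imD; exists z.
  split; last by rewrite (BE _ Dz); split=> h; lra.
  rewrite -{1}(rhoE _ Dz); case: (ltgtP (c0 (psi z)) 2) => h.
  + by split=> [_|_]; [lra|exact: dn].
  + by split=> [Vz|?]; [case: (up (psi z))|move: h; rewrite ltNge => /negP[]; lra].
  + by split=> [_|_]; [lra|rewrite rhoE //; apply: BV; apply/BE].
have [z [Vz Dz nB]] := both_out Bb oD Db.
have Oz : slab a r (psi z) by rewrite -imD; exists z.
case: (ltgtP (c0 (psi z)) 2) => h.
- by case: (dn (psi z)) => //; rewrite rhoE.
- by case: (up (psi z)) => //; rewrite rhoE.
by case: nB; apply/BE.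
Qed.

Lemma boundary_closure : B `<=` closure (~` V).
Proof.
move=> b Bb G Gb; have [D [psi [a [r [[oD Db] [[cp ip vp] _] imD VE]]]]] := two_sided Bb.
have b2 : c0 (psi b) = 2 by apply/(VE b Db).2.
have Ob : slab a r (psi b) by rewrite -imD; exists b.
have [e e0 [_ [Oy Hy]]] := nbhs_setc (filterI (open_near (@slab_open _ _ a r) Ob) (vp b Db _ Gb)).
have : (psi @` D) (setc (c0 (psi b) - e) (psi b)) by rewrite imD.
move=> [z Dz zy]; exists z; split; last exact: Hy zy.
by move=> /(VE z Dz).1; rewrite zy c0_setc b2; lra.
Qed.

Lemma closure_boundary : V `&` closure (~` V) = B.
Proof.
apply/seteqP; split=> z; last by move=> Bz; split; [exact: BV|exact: boundary_closure].
move=> [Vz cz]; apply: contrapT => nB.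
by have [w [nVw Vw]] := cz _ (smf_interior U_man V_smf Vz nB).
Qed.

Variables (Vo Bo : set U).
Hypotheses (Vo_smf : smf n Vo Bo) (V_in : V `<=` Vo°) (VBo : V `&` Bo = set0) (Bo_closed : closed Bo).

(** Off [V] the charts of [Vo] serve. On [B] a two-sided chart shows the region as [c0 <= 2], and
    the reflection [2 - c0] turns this into a half-space chart with [B] on the wall. As [V] is
    inside the interior of [Vo] and misses [Bo], such a chart can be shrunk away from the frontier
    of [Vo] and from [Bo]. *)
Lemma between_smf : smf n (Vo `&` closure (~` V)) (Bo `|` B).
Proof.
move=> z [Voz cz]; have [Vz|nVz] := pselect (V z); last first.
  have [D [phi [[oD Dz] rD [ O oO E] BE]]] := Vo_smf Voz.
  have oV := closed_openC V_closed.
  have WE : (Vo `&` closure (~` V)) `&` (D `&` ~` V) = Vo `&` D `&` ~` V.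
    apply/seteqP; split=> y; first by move=> [[? ?] [? ?]].
    by move=> [[? ?] nV]; split=> //; split=> //; exact: subset_closure.
  have [[cp ip vp] _] := rD.
  exists (D `&` ~` V), phi; split.
  - by split=> //; exact: openI.
  - by rewrite WE; exact: (rchart_open U_pl).
  - rewrite WE.
    exists (O `&` [set y | forall w, (Vo `&` D) w -> phi w = y -> ~ V w]°).
      by apply: openI => //; exact: open_interior.
    apply/seteqP; split=> y.
      move=> [w [VDw nVw] <-].
      have : (phi @` (Vo `&` D)) (phi w) by exists w.
      rewrite E => -[Ow hw]; split=> //; split=> //.
      exact: (vp w VDw _ (open_near oV nVw)).
    move=> [[Oy /interior_subset Hy] hy]; have : (phi @` (Vo `&` D)) y by rewrite E.
    by move=> [w VDw wy]; exists w => //; split=> //; exact: Hy wy.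
  move=> y [Voy _] [Dy nVy]; rewrite -BE //; split; last by left.
  by move=> [//|/BV].
have Bz : B z by rewrite -closure_boundary.
have [D [psi [a [r [[oD Dz] rD imD VE]]]]] := two_sided Bz.
have [[cp ip vp] _] := rD.
pose D1 := D `&` (Vo° `&` ~` Bo).
have oG : open (Vo° `&` ~` Bo) by apply: openI; [exact: open_interior|exact: closed_openC].
have Gz : (Vo° `&` ~` Bo) z.
  by split; [exact: V_in|move=> Boz; have : (V `&` Bo) z by []; rewrite VBo].
have WE : (Vo `&` closure (~` V)) `&` D1 = D1 `&` psi @^-1` [set y | c0 y <= 2].
  apply/seteqP; split=> y.
    move=> [[Voy cy] D1y]; split=> //=; rewrite leNgt; apply/negP => h.
    have [Dy _] := D1y; have Vy : V y by apply/(VE y Dy).1; exact: ltW.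
    have By : B y by rewrite -closure_boundary.
    by have := (VE y Dy).2.1 By; move: h; lra.
  move=> [D1y /= y2]; split=> //; have [Dy [Voy _]] := D1y; split; first exact: interior_subset.
  have [Vy|nVy] := pselect (V y); last exact: subset_closure.
  apply: boundary_closure; apply/(VE y Dy).2.
  by have := (VE y Dy).1.1 Vy; lra.
pose f (y : 'rV[R]_n.+1) : 'rV[R]_n.+1 := setc (2 + -1 * c0 y) y.
have af : affine f.
  apply: affine_setc; last exact: affine_id.
  by apply: affine_funD; [exact: affine_fun_cst|apply: affine_funZ; exact: affine_fun_c0].
have ff y : f (f y) = y.
  rewrite /f c0_setc setc_setc.
  have -> : 2 + -1 * (2 + -1 * c0 y) = c0 y by ring.
  exact: setc_id.
have r1 : rchart D1 psi by exact: (rchart_open U_pl rD oG).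
exists D1, (f \o psi); split.
- by split=> //; exact: openI.
- apply: (rchart_affine af af (fun x _ => ff (psi x))).
  rewrite WE; apply: (rchart_sub U_pl r1) => // x [D1x x2].
  have h0 := rchart_self U_pl r1 D1x.
  apply: (plg_level _ h0 h0).
  rewrite (_ : mkset _ = [set y : 'rV[R]_n.+1 | c0 y + - 2 <= 0]).
    by apply: polyhedron_le0; apply: affine_funD; [exact: affine_fun_c0|exact: affine_fun_cst].
  by apply/seteqP; split=> y /=; lra.
- exists (f @^-1` (slab a r `&` [set y | forall w, D w -> psi w = y -> (Vo° `&` ~` Bo) w]°)).
    apply: open_comp; first by move=> y _; exact: affine_continuous.
    by apply: openI; [exact: slab_open|exact: open_interior].
  rewrite WE; apply/seteqP; split=> y.
    move=> [w [[Dw Gw] /= w2] <-]; split; last first.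
      by rewrite /half_space /= -/(c0 _) /f c0_setc; lra.
    rewrite /= ff; split; first by rewrite -imD; exists w.
    exact: (vp w Dw _ (open_near oG Gw)).
  move=> [[Oy /interior_subset Hy] hy].
  have : (psi @` D) (f y) by rewrite imD.
  move=> [w Dw wy]; exists w; last by rewrite /= wy ff.
  split; first by split=> //; exact: Hy wy.
  by rewrite /= wy /f c0_setc; move: hy; rewrite /half_space /= -/(c0 y); lra.
move=> y _ [Dy [_ nBo]]; rewrite /= /f c0_setc.
split; first by move=> [//|By]; have := (VE y Dy).2.1 By; lra.
by move=> y2; right; apply/(VE y Dy).2; lra.
Qed.

End TwoSides.

(** * Pseudo-collars are unions of cobordisms *)

Section Retraction.
Variables (R : realType) (n : nat).

Lemma collar_sheq_ndr (X : plSpace R) : homotopy_collar n X ->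
  ndr R (boundary n (X := X)) /\ sheq R setT (boundary n (X := X)).
Proof.
move=> [X_man cB hB]; have [c [c0' ci cp co]] := collar_theorem X_man cB.
split; last first.
  have e : emb_on [set: X] id by split=> // [x _ V Vx|x _ V Vx]; apply: filterS Vx => // y Vy z _ ->.
  by have := inclusion_heq_sheq e hB; rewrite !image_id.
apply: (@collar_ndr _ _ _ c) => //; first by case: X_man => -[].
by move=> p Sp; case: (cp p Sp).
Qed.

Lemma sub_retraction (U : plSpace R) (V : set U) : homotopy_collar n (pl_sub V) ->
  exists r : U -> U, [/\ cont_on V r,
    forall x, V x -> (set_val @` boundary n (X := pl_sub V)) (r x)
    & forall b, (set_val @` boundary n (X := pl_sub V)) b -> r b = b].
Proof.
move=> /collar_sheq_ndr[nd sh].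
have [r [_ [cr rB r_id _ _]]] := heq_retraction nd sh.
have eV := set_val_emb V; have [_ iV _] := eV.
exists (extend setT (set_val : V -> U) (set_val \o r) id); split.
- rewrite -{1}(set_val_image V); apply: extend_cont => //.
  apply: (cont_on_comp (B := setT)) => //; first exact: continuous_cont_on.
  by case: eV.
- move=> x Vx; rewrite -(set_val_toset Vx) extendE //.
  by exists (r (toset Vx)).
by move=> _ [b Bb <-]; rewrite extendE //= r_id.
Qed.

(* The region beyond [V] is retracted to its boundary, so deformations in [Vo] can be
   pushed into the region between [Bo] and [B]. *)
Lemma sheq_between (U : plSpace R) (Vo Bo V : set U) (B := set_val @` boundary n (X := pl_sub V)) :
  homotopy_collar n (pl_sub V) -> closed V -> V `&` closure (~` V) = B -> V `<=` Vo -> V `&` Bo = set0 ->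
  Bo `<=` Vo -> sheq R Vo Bo -> sheq R (Vo `&` closure (~` V)) Bo.
Proof.
move=> hV cV VB VVo VBo BVo [g [G [F [[cg gB] [cG GB] GE [cF FV] FE]]]].
have [r [cr rB r_id]] := sub_retraction hV.
set W := Vo `&` closure (~` V).
have BW : B `<=` W by move=> b; rewrite -VB => -[Vb cb]; split=> //; exact: VVo.
pose q x := if `[< V x >] then r x else x.
have qW x : Vo x -> W (q x).
  move=> Vx; rewrite /q; case: asboolP => [/rB/BW//|nVx]; split=> //.
  exact: subset_closure.
have q_id x : W x -> q x = x.
  move=> [_ cx]; rewrite /q; case: asboolP => // Vx; apply: r_id.
  by rewrite -/B -VB.
have cq : cont_on Vo q.
  apply: (cont_paste cV (@closed_closure _ (~` V))).
  - by move=> x _; have [Vx|nVx] := pselect (V x); [left|right; exact: subset_closure].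
  - apply: (@cont_on_ext _ _ _ r); first by move=> x [_ Vx]; rewrite /q asboolT.
    by apply: cont_on_sub cr => x [].
  by apply: (@cont_on_ext _ _ _ id); [move=> x Wx; rewrite q_id|exact: cont_on_id].
have BoW : Bo `<=` W.
  move=> x Bx; split; first exact: BVo.
  by apply: subset_closure => Vx; have : (V `&` Bo) x by []; rewrite VBo.
have WVo : W `<=` Vo by move=> x [].
exists g, G, (q \o F); split=> //.
- by split=> [|x /WVo]; [exact: cont_on_sub cg|exact: gB].
- split; last by move=> p [/WVo Vp Ip]; apply: qW; apply: FV.
  apply: (cont_on_comp (B := Vo)) => //; last by move=> p [/WVo Vp Ip]; apply: FV.
  by apply: cont_on_sub cF => p [/WVo].
move=> x Wx; have [F0 F1] := FE x (WVo _ Wx); rewrite /= F0 F1 !q_id //.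
by apply: BoW; apply: gB; exact: WVo.
Qed.

End Retraction.

(** * Countable families of compact sets *)

Section Exhaustion.
Variables (R : realType) (n : nat) (U : plSpace R).
Hypothesis U_man : pl_manifold n U.

Lemma compact_nbhs (x : U) : exists2 K, compact K & nbhs x K.
Proof.
have [U_pl /(_ x)[c [mc cx]]] := U_man; have [ic _ [ O [ oO E]]] := mc.
have [oc [cc jc vc]] := is_chart_emb ic.
have : (chart_map c @` chart_dom c) (chart_map c x) by exists x.
rewrite E => -[Ox hx]; have [r r0 HO] := nbhs_cube (open_near oO Ox).
pose g := extend (chart_dom c) (chart_map c) id (fun=> x).
have cg : cont_on (chart_map c @` chart_dom c) g by apply: extend_cont => //; exact: cont_on_id.
have sub : cube (chart_map c x) r `&` [set z | 0 <= c0 z] `<=` chart_map c @` chart_dom c.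
  by rewrite E => y [/HO Oy y0].
exists (g @` (cube (chart_map c x) r `&` [set z | 0 <= c0 z])).
  by apply: cont_on_compact; [exact: cont_on_sub cg|exact: compact_cube_half].
have nx := cc x cx _ (@cube_nbhs R _ (chart_map c x) r r0).
apply: filterS2 (open_near oc cx) nx => z cz /(_ cz) Hz.
exists (chart_map c z); last by rewrite /g extendE.
split=> //; have : (chart_map c @` chart_dom c) (chart_map c z) by exists z.
by rewrite E => -[].
Qed.

(** The sets are the compact ones among the closures of a countable base, numbered by an injection
    of the base into the naturals. They are not nested; what the construction uses is that their
    interiors cover [U]. *)
Lemma exhaustion : exists C : nat -> set U, (forall i, compact (C i)) /\ forall x : U, exists i, nbhs x (C i).
Proof.
have [U_pl _] := U_man; have [hU [Bs cBs [oBs bBs]] _ _ _] := U_pl.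
have [e e_inj] : exists e : set U -> nat, {in Bs &, injective e} by apply/countable_injP.
pose C j := [set x | exists b, [/\ Bs b, e b = j, compact (closure b) & closure b x]].
exists C; split=> [j|x].
  have [[b [Bb eb cb]]|nb] := pselect (exists b, [/\ Bs b, e b = j & compact (closure b)]); last first.
    rewrite (_ : C j = set0); first exact: compact0.
    by apply/seteqP; split=> x // [b [? ? ? _]]; apply: nb; exists b.
  rewrite (_ : C j = closure b) //; apply/seteqP; split=> x; last by exists b.
  by move=> [b' [Bb' eb' _ ]]; rewrite (e_inj b' b) ?inE // eb' eb.
have [K cK nK] := compact_nbhs x; have [b [Bb bx] bK] := bBs x _ nK.
exists (e b); apply: filterS (open_near (oBs _ Bb) bx) => y yb; exists b; split=> //.
  apply: (subclosed_compact _ cK); first exact: closed_closure.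
  rewrite (closure_id K).1; last exact: compact_closed.
  exact: closureS.
exact: subset_closure.
Qed.

End Exhaustion.

Section Pulled.
Variable R : realType.

(** Every chart of [Z] is a chart of [Y] pulled back along [j], as for subspaces of subspaces. Maps
    between two such spaces over [Y] can be compared inside [Y], where the gluing homeomorphisms
    become identities. *)
Definition pulled (Z Y : plSpace R) (j : Z -> Y) : Prop :=
  emb_on setT j /\ forall k (c : chart R Z k), pl_atlas Z k c ->
     exists2 d, pl_atlas Y k d & c = Chart (j @^-1` chart_dom d) (chart_map d \o j).

Lemma pulled_sub (Y : plSpace R) (A : set Y) : pulled (set_val : pl_sub A -> Y).
Proof. by split; [exact: set_val_emb|move=> k _ [d ad <-]; exists d]. Qed.

Lemma pulled_comp (Z Y T : plSpace R) (j : Z -> Y) (j' : Y -> T) :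
  pulled j -> pulled j' -> pulled (j' \o j).
Proof.
move=> [ej aj] [ej' aj']; split; first by apply: (emb_comp ej _ ej').
by move=> k c /aj[d /aj'[d' ad' ->] ->]; exists d'.
Qed.

Lemma pulled_pl_map (Z Z' Y : plSpace R) (j : Z -> Y) (j' : Z' -> Y) (f : Z -> Z') :
  pl_axioms Y -> pulled j -> pulled j' -> (forall z, j' (f z) = j z) ->
  (forall y, range j y -> plat (range j) id y) -> pl_map f.
Proof.
move=> Y_pl [ej aj] [ej' aj'] jf Hp; have [cj ij vj] := ej; split.
  by apply/cont_onT; apply: (@lift_cont _ _ _ _ j' _ j).
move=> k l _ _ /aj[c ac ->] /aj'[d ad ->].
have [oc [cc ic vc]] := atlas_emb Y_pl ac.
apply: plg_pl_factor.
- by move=> a b [/= ca _] [/= cb _] /(ic _ _ ca cb) /ij; exact.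
- move=> a [/= ca _] V Va; have := vc _ ca _ (vj a I V Va).
  by apply: filterS => y Hy b [/= cb _] by_; exact: (Hy _ cb by_ b I erefl).
move=> a [/= ca da]; rewrite jf in da.
have [_ /(_ k l c d ac ad ca da) H] := Hp _ (imageP j I : range j (j a)).
apply: (@plg_ext _ _ _ _ _ (chart_map c \o j) _ (chart_map d \o j)) => //.
  by move=> b _ /=; rewrite jf.
apply: plg_pull H.
- exact: (cont_atT (cj _ I)).
- by move=> b [/= cb db]; split; [split=> //; exists b|rewrite /= -jf].
by move=> y [[[b _ <-] cy] dy]; exists b => //; split=> //=; rewrite jf.
Qed.

End Pulled.

Lemma boundary_plat (R : realType) n (U : plSpace R) (V B : set U) x :
  pl_manifold n U -> smf n V B -> B `<=` V -> B x -> plat B id x.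
Proof.
move=> U_man V_smf BV Bx; have U_pl : is_pl_space U := proj1 U_man.
have [D [phi [[oD Dx] rD imD BE]]] := V_smf x (BV _ Bx).
have rB := boundary_rchart U_man BV rD imD BE.
apply: (plat_near U_pl (A := B `&` D) (f := id)) => //; last exact: (rchart_plat U_pl rB).
by apply: filterS (open_near oD Dx) => z Dz; split=> //; split=> [[]|].
Qed.

Lemma pl_factor_image (R : realType) (S T : Type) k l (A : set S) (A' : set T) (f : S -> T)
    (phi : S -> 'rV[R]_k) (psi : S -> 'rV[R]_l) (phi' : T -> 'rV[R]_k) (psi' : T -> 'rV[R]_l) :
  f @` A = A' -> (forall x, phi' (f x) = phi x) -> (forall x, psi' (f x) = psi x) ->
  pl_factor A' phi' psi' -> pl_factor A phi psi.
Proof.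
move=> AA' E1 E2 [g [hg Hg]]; exists g; split.
  rewrite (_ : phi @` A = phi' @` A') // -AA' image_comp; apply: eq_imagel => x _ /=.
  by rewrite E1.
by move=> x Ax; rewrite -E1 -E2 Hg // -AA'; exists x.
Qed.

(** * Layers between nested neighbourhoods of infinity *)

Section Chain.
Variables (R : realType) (n : nat) (U : plSpace R).
Hypothesis U_man : pl_manifold n U.
Variables (V B : nat -> set U).
Hypotheses (V0 : V 0 = setT) (V_closed : forall i, closed (V i))
  (V_cpt : forall i, compact (closure (~` V i))) (BV : forall i, B i `<=` V i)
  (B_cpt : forall i, compact (B i)) (V_smf : forall i, smf n (V i) (B i))
  (V_sheq : forall i, sheq R (V i) (B i)).
Hypotheses (B_bic : forall i, bicollared (B i.+1)) (V_col : forall i, homotopy_collar n (pl_sub (V i.+1)))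
  (B_bd : forall i, B i.+1 = set_val @` boundary n (X := pl_sub (V i.+1))).
Hypotheses (V_deep : forall i, V i.+1 `&` closure (~` V i) = set0)
  (VB0 : forall i, V i.+1 `&` B i = set0)
  (V_far : forall x : U, exists i, \forall y \near x, ~ V i.+1 y).

Let U_pl : is_pl_space U := proj1 U_man.
Let U_hd : hausdorff_space U. Proof. by case: U_pl. Qed.
Let B_closed i : closed (B i). Proof. exact: compact_closed. Qed.

Let V_out i x : V i.+1 x -> ~ closure (~` V i) x.
Proof. by move=> Vx cx; have : (V i.+1 `&` closure (~` V i)) x by []; rewrite V_deep. Qed.

Let V_notB i x : V i.+1 x -> ~ B i x.
Proof. by move=> Vx Bx; have : (V i.+1 `&` B i) x by []; rewrite VB0. Qed.

Let V_in i : V i.+1 `<=` (V i)°.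
Proof.
move=> x Vx; apply: filterS (open_near (closed_openC (@closed_closure _ (~` V i))) (V_out Vx)) => y nc.
by apply: contrapT => nV; apply: nc; exact: subset_closure.
Qed.

Let VS i : V i.+1 `<=` V i. Proof. by move=> x /V_in /interior_subset. Qed.

Let V_mono i j : (i <= j)%N -> V j `<=` V i.
Proof. by move=> /subnK <-; elim: (j - i)%N => // k IH x /VS; exact: IH. Qed.

Definition layer i : set U := V i `&` closure (~` V i.+1).

Let VBc i : V i.+1 `&` closure (~` V i.+1) = B i.+1.
Proof. exact: (closure_boundary U_man (@V_smf i.+1) (@BV i.+1) (@V_closed i.+1) (@B_bic i)). Qed.

Let layer_smf i : smf n (layer i) (B i `|` B i.+1).
Proof.
exact: (@between_smf _ _ _ _ _ U_man (@V_smf i.+1) (@BV i.+1) (@V_closed i.+1) (@B_bic i) _ _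
  (@V_smf i) (@V_in i) (VB0 i) (@B_closed i)).
Qed.

Let layer_compact i : compact (layer i).
Proof.
have cc : compact (closure (~` V i.+1)) by exact: V_cpt.
have kc : closed (layer i) by apply: closedI => //; exact: closed_closure.
by apply: (subclosed_compact kc cc) => x [].
Qed.

Let layer_closed i : closed (layer i). Proof. exact: compact_closed. Qed.

Let layerB i : B i `<=` layer i.
Proof. by move=> x Bx; split; [exact: BV|apply: subset_closure => /V_notB]. Qed.

Let layerBS i : B i.+1 `<=` layer i.
Proof. by move=> x; rewrite -VBc => -[Vx cx]; split=> //; exact: VS. Qed.

(** A common point lies in [V i.+1] and in the closure of its complement, hence on [B i.+1], which
    [V i.+2] misses; so the layers are adjacent. *)
Let layer_meet i j x : (i < j)%N -> layer i x -> layer j x -> j = i.+1 /\ B i.+1 x.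
Proof.
move=> ij [_ cx] [Vx _]; have Bx : B i.+1 x by rewrite -VBc; split=> //; exact: V_mono Vx.
split=> //; apply/eqP; rewrite eqn_leq ij andbT leqNgt; apply/negP => ij'.
exact: (V_notB (V_mono ij' Vx) Bx).
Qed.

Let layer_cover x : exists i, layer i x.
Proof.
have ex : exists k, `[< ~ V k.+1 x >].
  by have [i /nbhs_singleton Hi] := V_far x; exists i; apply/asboolP.
case: (ex_minnP ex) => k /asboolP nV kmin; exists k; split; last exact: subset_closure.
case: k nV kmin => [|k] _ kmin; first by rewrite V0.
apply: contrapT => nV; have /kmin : `[< ~ V k.+1 x >] by apply/asboolP.
by rewrite ltnn.
Qed.

Let layer_near (x : U) : exists k, \forall y \near x, forall i, layer i y -> (i <= k)%N.
Proof.
have [k Hk] := V_far x; exists k; apply: filterS Hk => y nV i [Vy _].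
by rewrite leqNgt; apply/negP => ki; apply: nV; exact: V_mono Vy.
Qed.

Let W i : plSpace R := pl_sub (layer i).
Let M i : set (W i) := set_val @^-1` B i.
Let N i : set (W i) := set_val @^-1` B i.+1.
Let v i (w : W i) : U := set_val w.

Let v_emb i : emb_on setT (@v i). Proof. exact: set_val_emb. Qed.
Let v_inj i : injective (@v i). Proof. exact: set_val_inj. Qed.
Let v_in i (w : W i) : layer i (v w). Proof. exact: (set_valE' w). Qed.
Let v_range i : range (@v i) = layer i. Proof. exact: set_val_image. Qed.
Let v_cont i : continuous (@v i). Proof. by apply/cont_onT; case: (v_emb i). Qed.

Let W_pl i : is_pl_space (W i).
Proof. by apply: sub_is_pl_space => // k c ac; exact: (smf_poly U_pl (@layer_smf i)). Qed.

Let v_pl i : @pl_emb R (W i) U (@v i).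
Proof. exact: (sub_pl_emb U_pl (W_pl i)). Qed.

Let W_bd i : pl_manifold n (W i) /\ boundary n (X := W i) = @M i `|` @N i.
Proof.
have S : smf n (range (@v i)) (B i `|` B i.+1) by rewrite v_range.
exact: (smf_manifold (W_pl i) U_pl (v_pl i) S).
Qed.

Let W_cob i : cobordism n (@M i) (@N i).
Proof.
have [Wm bE] := W_bd i; split=> //.
- have -> : [set: W i] = @v i @^-1` layer i by apply/seteqP; split=> w // _; exact: v_in.
  by apply: emb_preimage_compact; [exact: v_emb|rewrite v_range|exact: layer_compact].
- by apply: (preimage_closed (D := B i)) => // w _; exact: v_cont.
- by apply: (preimage_closed (D := B i.+1)) => // w _; exact: v_cont.
split=> //; apply/seteqP; split=> w // [Mw Nw].
exact: (V_notB (BV Nw) Mw).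
Qed.

Let M_heq i : inclusion_heq R (@M i).
Proof.
apply: (sheq_inclusion_heq (v_emb i)); first by rewrite v_range.
rewrite v_range; apply: (sheq_between (V_col i)) => //; first by rewrite -B_bd.
Qed.

Let NM i (a : pl_sub (@N i)) : exists b : pl_sub (@M i.+1), v (set_val b : W i.+1) = v (set_val a : W i).
Proof.
have Ba : B i.+1 (v (set_val a : W i)) by exact: (set_valE' a).
pose w : W i.+1 := toset (layerB Ba).
have Mw : @M i.+1 w by rewrite /M /= set_val_toset.
by exists (toset Mw); rewrite /v !set_val_toset.
Qed.

Let MN i (b : pl_sub (@M i.+1)) : exists a : pl_sub (@N i), v (set_val a : W i) = v (set_val b : W i.+1).
Proof.
have Bb : B i.+1 (v (set_val b : W i.+1)) by exact: (set_valE' b).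
pose w : W i := toset (layerBS Bb).
have Nw : @N i w by rewrite /N /= set_val_toset.
by exists (toset Nw); rewrite /v !set_val_toset.
Qed.

Let h i (a : pl_sub (@N i)) : pl_sub (@M i.+1) := sval (cid (NM a)).
Let hE i (a : pl_sub (@N i)) : v (set_val (h a) : W i.+1) = v (set_val a : W i).
Proof. exact: svalP (cid (NM a)). Qed.

Let h_homeo i : pl_homeo (@h i).
Proof.
pose g (b : pl_sub (@M i.+1)) : pl_sub (@N i) := sval (cid (MN b)).
have gE b : v (set_val (g b) : W i) = v (set_val b : W i.+1) := svalP (cid (MN b)).
have pN : pulled (@v i \o (set_val : pl_sub (@N i) -> W i)).
  by apply: pulled_comp; exact: pulled_sub.
have pM : pulled (@v i.+1 \o (set_val : pl_sub (@M i.+1) -> W i.+1)).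
  by apply: pulled_comp; exact: pulled_sub.
have rN : range (@v i \o (set_val : pl_sub (@N i) -> W i)) = B i.+1.
  apply/seteqP; split=> [_ [a _ <-]|x Bx]; first exact: (set_valE' a).
  have Nw : @N i (toset (layerBS Bx)) by rewrite /N /= set_val_toset.
  by exists (toset Nw) => //=; rewrite /v !set_val_toset.
have rM : range (@v i.+1 \o (set_val : pl_sub (@M i.+1) -> W i.+1)) = B i.+1.
  apply/seteqP; split=> [_ [a _ <-]|x Bx]; first exact: (set_valE' a).
  have Mw : @M i.+1 (toset (layerB Bx)) by rewrite /M /= set_val_toset.
  by exists (toset Mw) => //=; rewrite /v !set_val_toset.
have Bp y : B i.+1 y -> plat (B i.+1) id y by exact: (boundary_plat U_man (@V_smf i.+1) (@BV i.+1)).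
exists g; split.
- by move=> a; apply: set_val_inj; apply: v_inj; rewrite gE hE.
- by move=> b; apply: set_val_inj; apply: v_inj; rewrite hE gE.
- apply: (pulled_pl_map U_pl pN pM) => [a|y]; first exact: hE.
  by rewrite rN; exact: Bp.
apply: (pulled_pl_map U_pl pM pN) => [b|y]; first exact: gE.
by rewrite rM; exact: Bp.
Qed.

Local Notation L := (@adj_lift R W (@M) (@N) (@h)).
Local Notation T := (adj_space (@h)).
Local Notation X := (adjunction (@h)).

Let MN0 := cob_MN0 W_cob.
Let cM := cob_closedM W_cob.
Let cN := cob_closedN W_cob.

Let glue i j (w : W i) (w' : W j) : v w = v w' -> L w = L w'.
Proof.
have step k l (u : W k) (u' : W l) : (k < l)%N -> v u = v u' -> L u = L u'.
  move=> kl uu'; have := v_in u'; rewrite -uu' => h2.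
  have [e Bu] := layer_meet kl (v_in u) h2; subst l.
  rewrite -(set_val_toset (Bu : @N k u)) (adj_step_eq (@h)); congr adj_lift.
  by apply: v_inj; rewrite hE set_val_toset.
move=> ww'; case: (ltngtP i j) => ij; first exact: step.
  by symmetry; exact: step.
by subst j; rewrite (v_inj ww').
Qed.

Let unglue i j (w : W i) (w' : W j) : L w = L w' -> v w = v w'.
Proof.
have step k l (u : W k) (u' : W l) : (k < l)%N -> L u = L u' -> v u = v u'.
  move=> kl uu'; have e := adj_next MN0 h_homeo uu' kl; subst l.
  by have [a [-> ->]] := adj_meet MN0 h_homeo uu'; rewrite hE.
move=> ww'; case: (ltngtP i j) => ij; first exact: step.
  by symmetry; exact: step.
by subst j; rewrite (adj_lift_inj MN0 h_homeo ww').
Qed.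

Let f_ex (x : U) : exists y : T, forall i (w : W i), v w = x -> L w = y.
Proof.
have [k kx] := layer_cover x; exists (L (toset kx : W k)) => i w wx.
by apply: glue; rewrite wx /v set_val_toset.
Qed.

Let f (x : U) : X := sval (cid (f_ex x)).
Let fE i (w : W i) : f (v w) = L w.
Proof. by have H := svalP (cid (f_ex (v w))); rewrite /f (H i w). Qed.

Let k_ex (y : T) : exists x : U, f x = y.
Proof. by have [i [w <-]] := adj_surj y; exists (v w); rewrite fE. Qed.

Let k (y : X) : U := sval (cid (k_ex y)).
Let fk y : f (k y) = y. Proof. exact: svalP (cid (k_ex y)). Qed.

Let f_inj : injective f.
Proof.
move=> x x'; have [i ix] := layer_cover x; have [j jx] := layer_cover x'.
rewrite -(set_val_toset ix) -(set_val_toset jx) -/(v (toset ix : W i)) -/(v (toset jx : W j)).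
by rewrite !fE; exact: unglue.
Qed.

Let kf x : k (f x) = x. Proof. by apply: f_inj; rewrite fk. Qed.
Let kL i (w : W i) : k (L w) = v w. Proof. by rewrite -fE kf. Qed.

Let k_cont : continuous k.
Proof.
apply/continuousP => O oO; apply/adj_openP => i.
rewrite (_ : _ @^-1` _ = @v i @^-1` O); last by apply/seteqP; split=> w; rewrite /= kL.
by apply: open_comp => // w _; exact: v_cont.
Qed.

(** Near [x] only the finitely many layers up to [m] occur; they are closed, and [f] is continuous
    on each of them. *)
Let f_cont : continuous f.
Proof.
move=> x G Gf; have [m Hm] := layer_near x.
have H (i : 'I_m.+1) : \forall y \near x, layer i y -> G (f y).
  have [ix|nix] := pselect (layer i x); last first.
    by apply: filterS (open_near (closed_openC (@layer_closed i)) nix) => y ny /ny.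
  have Gw : nbhs (toset ix : W i) [set w : W i | G (L w)].
    apply: (@adj_lift_continuous R W (@M) (@N) (@h) i (toset ix)).
    by rewrite -fE /v set_val_toset.
  have [_ _ vi] := v_emb i; have := vi _ I _ Gw; rewrite {1}/v set_val_toset.
  apply: filterS => y Hy iy; rewrite -(set_val_toset iy) -/(v (toset iy : W i)) fE.
  by apply: (Hy (toset iy : W i)) => //; rewrite /v set_val_toset.
have H' := @filter_forall _ _ _ _ (nbhs_filter x) H.
apply: filterS2 Hm H' => y Hy Hy'; have [i iy] := layer_cover y.
have im : (i < m.+1)%N by rewrite ltnS; exact: Hy.
exact: (Hy' (Ordinal im) iy).
Qed.

(** The atlas of the adjunction space contains every open embedding that is PL on the pieces, in
    particular the charts of [U] read through [k]. They cover the space, and since they belong to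
    its atlas, compatibility alone makes [f] and [k] PL. *)
Let kc_atlas l (c : chart R U l) : pl_atlas U l c ->
  pl_atlas X l (Chart (k @^-1` chart_dom c) (chart_map c \o k)).
Proof.
move=> ac; have [oc [cc ic vc]] := atlas_emb U_pl ac.
apply: (adj_atlasI W_pl).
- by apply: open_comp => // y _; exact: k_cont.
- split.
  + apply: (cont_on_comp (B := chart_dom c)) => //; apply: continuous_cont_on.
    exact: k_cont.
  + by move=> y z cy cz /= /(ic _ _ cy cz) kyz; rewrite -(fk y) kyz fk.
  move=> y cy G Gy; have Gk : nbhs (k y) [set x | G (f x)].
    by apply: f_cont; rewrite fk.
  apply: filterS (vc _ cy _ Gk) => u Hu z cz zu.
  by have := Hu (k z) cz zu; rewrite /= fk.
move=> i m d w ad cw dw; rewrite /= kL in cw.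
have [_ H] := v_pl i; have := H m l d c ad ac w dw cw.
rewrite setIC (_ : @v i @^-1` chart_dom c = @adj_lift R W (@M) (@N) (@h) i @^-1` (k @^-1` chart_dom c)).
  by apply: plg_ext => // u _; rewrite /= kL.
by apply/seteqP; split=> u; rewrite /= kL.
Qed.

Let X_pl : is_pl_space X.
Proof.
apply: (adj_pl_space MN0 h_homeo cM cN W_pl) => y.
have [l [c [ac cy]]] := atlas_cover U_pl (k y).
by exists l, (Chart (k @^-1` chart_dom c) (chart_map c \o k)); split=> //; exact: kc_atlas.
Qed.

Let f_homeo : pl_homeo f.
Proof.
have [_ _ _ _ compat] := X_pl.
exists k; split=> //; split=> // l m.
- move=> c d ac ad; have [H _] := compat _ _ _ _ (kc_atlas ac) ad.
  apply: (pl_factor_image (f := f) _ _ _ H) => [|x|//]; last by rewrite /= kf.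
  apply/seteqP; split=> y; first by move=> [x [cx dx] <-]; split=> //; rewrite /= kf.
  by move=> [cy dy]; exists (k y); rewrite ?fk //; split=> //=; rewrite fk.
move=> d c ad ac; have [_ H] := compat _ _ _ _ (kc_atlas ac) ad.
by rewrite setIC.
Qed.

Lemma chain_adjunction :
  exists (W : nat -> plSpace R) (M N : forall i, set (W i))
         (h : forall i, pl_sub (N i) -> pl_sub (M i.+1)),
  [/\ forall i, one_sided_h_cobordism n (M i) (N i), forall i, inclusion_heq R (M i),
      forall i, pl_homeo (h i) & exists f : U -> adjunction h, pl_homeo f].
Proof.
exists W, (@M), (@N), (@h); split=> //; last by exists f.
by move=> i; split; [exact: W_cob|left; exact: M_heq].
Qed.

End Chain.

(** * Choice of the nested neighbourhoods *)

Section Descent.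
Variables (R : realType) (n : nat) (U : plSpace R).
Hypothesis U_pc : pseudo_collar n U.

Let U_man : pl_manifold n U. Proof. by case: U_pc => -[]. Qed.
Let U_pl : is_pl_space U := proj1 U_man.
Let U_hd : hausdorff_space U. Proof. by case: U_pl. Qed.

Let bd (V : set U) : set U := set_val @` boundary n (X := pl_sub V).

(** The invariant of the pairs [V i], [B i]. Bicollaredness is kept out of it, because the first
    pair is [U] with its boundary, which need not be bicollared. *)
Let good (p : set U * set U) : Prop :=
  [/\ closed p.1, compact (closure (~` p.1)), compact p.2 /\ p.2 `<=` p.1,
      smf n p.1 p.2 & sheq R p.1 p.2].

Let good_bd (V : set U) : closed V -> compact (closure (~` V)) -> homotopy_collar n (pl_sub V) ->
  good (V, bd V).
Proof.
move=> cV kV [mV cB hB]; have V_pl : is_pl_space (pl_sub V) := proj1 mV.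
split=> //=.
- split; last by move=> _ [x _ <-]; exact: set_valE'.
  by apply: cont_on_compact => //; apply: cont_on_sub (@subsetT _ _) _; case: (set_val_emb V).
- have := manifold_smf V_pl U_pl (sub_pl_emb U_pl V_pl) mV.
  by rewrite set_val_image.
by have := inclusion_heq_sheq (set_val_emb V) hB; rewrite set_val_image.
Qed.

Lemma pseudo_collar_chain :
  exists (W : nat -> plSpace R) (M N : forall i, set (W i))
         (h : forall i, pl_sub (N i) -> pl_sub (M i.+1)),
  [/\ forall i, one_sided_h_cobordism n (M i) (N i), forall i, inclusion_heq R (M i),
      forall i, pl_homeo (h i) & exists f : U -> adjunction h, pl_homeo f].
Proof.
have [[_ cbU hU] nbd] := U_pc.
have /choice[F HF] (V : set U) : exists V', neighborhood_of_infinity V ->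
    [/\ V' `<=` V, neighborhood_of_infinity V', clean n V' & homotopy_collar n (pl_sub V')].
  have [/nbd[V' HV]|nV] := pselect (neighborhood_of_infinity V); first by exists V'.
  by exists V.
have [C [cC nC]] := exhaustion U_man.
(* Removing [p.2] matters for the first pair: the closure of the complement is then empty, and the
   boundary of [U] has to be avoided separately. *)
pose next i (p : set U * set U) := F (~` (closure (~` p.1) `|` C i `|` p.2)).
pose st := fix st i := if i is j.+1 then (next j (st j), bd (next j (st j))) else (setT, boundary n (X := U)).
have g0 : good (st 0).
  split=> /=.
  - exact: closedT.
  - by rewrite setCT closure0; exact: compact0.
  - by split.
  - have := manifold_smf U_pl U_pl (pl_emb_id U_pl) U_man.
    by rewrite !image_id.
  have [e _] := pl_emb_id U_pl.
  by have := inclusion_heq_sheq e hU; rewrite !image_id.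
have gS i : good (st i) -> [/\ good (st i.+1), clean n (st i.+1).1, homotopy_collar n (pl_sub (st i.+1).1)
    & (st i.+1).1 `<=` ~` (closure (~` (st i).1) `|` C i `|` (st i).2)].
  move=> [cV kV [cB BV] _ _].
  have cX : compact (closure (~` (st i).1) `|` C i `|` (st i).2) by do 2?apply: compactU.
  have [] // := HF (~` (closure (~` (st i).1) `|` C i `|` (st i).2)).
    by rewrite /neighborhood_of_infinity setCK -(closure_id _).1 //; exact: compact_closed.
  move=> sub noi cl hc; split=> //; apply: good_bd => //.
  by case: cl.
have gi i : good (st i) by elim: i => // i /gS[].
have sub i : (st i.+1).1 `<=` ~` (closure (~` (st i).1) `|` C i `|` (st i).2) by case: (gS i (gi i)).
apply: (@chain_adjunction R n U U_man (fun i => (st i).1) (fun i => (st i).2)) => //; try by move=> i; case: (gi i) => // ? ? [].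
- by move=> i; have [_ [_ _ ?] _ _] := gS i (gi i).
- by move=> i; have [_ _ ? _] := gS i (gi i).
- by move=> i; apply/seteqP; split=> x // [/sub nx cx]; apply: nx; left; left.
- by move=> i; apply/seteqP; split=> x // [/sub nx cx]; apply: nx; right.
move=> x; have [i Hi] := nC x; exists i; apply: filterS Hi => y Cy /sub ny.
by apply: ny; left; right.
Qed.

End Descent.

Theorem proposition2 (R : realType) (n : nat) :
  (forall (W : nat -> plSpace R) (M N : forall i, set (W i))
          (h : forall i, pl_sub (N i) -> pl_sub (M i.+1)),
     (forall i, one_sided_h_cobordism n (M i) (N i)) ->
     (forall i, inclusion_heq R (M i)) ->
     (forall i, pl_homeo (h i)) ->
     pseudo_collar n (adjunction h))
  /\
  (forall U : plSpace R, pseudo_collar n U ->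
     exists (W : nat -> plSpace R) (M N : forall i, set (W i))
            (h : forall i, pl_sub (N i) -> pl_sub (M i.+1)),
       [/\ forall i, one_sided_h_cobordism n (M i) (N i),
           forall i, inclusion_heq R (M i),
           forall i, pl_homeo (h i)
         & exists f : U -> adjunction h, pl_homeo f]).
Proof.
split; last exact: pseudo_collar_chain.
move=> W M N h W_os M_heq h_homeo.
have W_cob i : cobordism n (M i) (N i) by case: (W_os i).
have [col [col0 col_inj col_pl col_open]] := collars_exist W_cob.
exact: (adj_pseudo_collar h_homeo W_cob col0 col_inj col_pl col_open M_heq).
Qed.
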